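(* Let $j:V_\lambda\to V_\lambda$ be an $\mathrm{I3}_{\mathrm{wf}(0)}$-embedding with critical sequence $\langle\kappa_m:m<\omega\rangle$, let $U_0=\{A\subseteq\kappa_0:\kappa_0\in j(A)\}$ be the normal ultrafilter on $\kappa_0$ induced by $j$, and let $G$ be $\mathbb{P}_{U_0}$-generic over $V$. Then $\kappa_0$ is an exacting cardinal in $V[G]$.
   Context: An $\mathrm{I3}$-embedding is a non-identity elementary embedding $j:V_\lambda\to V_\lambda$ with $\lambda$ a limit ordinal; its critical sequence is $\kappa_0=\mathrm{crit}(j)$, $\kappa_{m+1}=j(\kappa_m)$, and $\lambda=\sup_m\kappa_m$. Define $j^+:V_{\lambda+1}\to V_{\lambda+1}$ by $j^+(A)=\bigcup_{\alpha<\lambda}j(A\cap V_\alpha)$. There is a unique commuting system $\langle j_{m,n}:V_\lambda\to V_\lambda : m\le n<\omega\rangle$ of elementary embeddings with $j_{0,1}=j$, $j_{n,n}=\mathrm{id}$, and $j_{n+1,n+2}=j^+(j_{n,n+1})$. Let $M^j_\omega$ with maps $j_{n,\omega}:V_\lambda\to M^j_\omega$ be its direct limit, and let $W^j_\omega$ be the well-founded part of $M^j_\omega$, identified with its transitive collapse. $j$ is an $\mathrm{I3}_{\mathrm{wf}(n)}$-embedding if $j_{n,\omega}[\kappa_n^+]\subseteq W^j_\omega$. $\mathbb{P}_U$ denotes Prikry forcing with a normal ultrafilter $U$. For $m>0$, $C^{(m)}$ is the class of ordinals $\alpha$ with $V_\alpha\prec_{\Sigma_m}V$. A limit cardinal $\mu$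 is exacting if there exist $m>0$, a cardinal $\eta\in C^{(m)}$ with $\eta>\mu$, $X\prec V_\eta$ with $V_\mu\cup\{\mu\}\subseteq X$, a cardinal $\zeta\in C^{(m+1)}$ with $\zeta>\mu$, and an elementary $i:X\to V_\zeta$ with $i(\mu)=\mu$ and $i\restriction\mu\ne\mathrm{id}_\mu$. *)

(* Defs.v *)
From Stdlib Require Import List Arith.

Set Implicit Arguments.
Unset Strict Implicit.
Unset Printing Implicit Defensive.

(** Structures for the language of set theory.  Both the ground universe [V]
    and its forcing extension are of this type; "the set x belongs to the
    structure" is [x : M]. *)
Record structure := Structure {
  carrier :> Type;
  mem : carrier -> carrier -> Prop }.

Arguments mem {s} _ _.
Notation "x ∈ y" := (mem x y) (at level 70, no associativity).

Inductive form : Type :=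
| Mem (x y : nat)
| Eq (x y : nat)
| Neg (f : form)
| And (f g : form)
| Or (f g : form)
| Imp (f g : form)
| All (x : nat) (f : form)
| Ex (x : nat) (f : form).

Inductive delta0 : form -> Prop :=
| delta0_Mem x y : delta0 (Mem x y)
| delta0_Eq x y : delta0 (Eq x y)
| delta0_Neg f : delta0 f -> delta0 (Neg f)
| delta0_And f g : delta0 f -> delta0 g -> delta0 (And f g)
| delta0_Or f g : delta0 f -> delta0 g -> delta0 (Or f g)
| delta0_Imp f g : delta0 f -> delta0 g -> delta0 (Imp f g)
| delta0_All x y f : x <> y -> delta0 f -> delta0 (All x (Imp (Mem x y) f))
| delta0_Ex x y f : x <> y -> delta0 f -> delta0 (Ex x (And (Mem x y) f)).

Inductive sigma : nat -> form -> Prop :=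
| sigma_0 f : delta0 f -> sigma 0 f
| sigma_pi m f : pi m f -> sigma (S m) f
| sigma_Ex m x f : sigma (S m) f -> sigma (S m) (Ex x f)
with pi : nat -> form -> Prop :=
| pi_0 f : delta0 f -> pi 0 f
| pi_sigma m f : sigma m f -> pi (S m) f
| pi_All m x f : pi (S m) f -> pi (S m) (All x f).

Definition upd (T : Type) (v : nat -> T) (n : nat) (a : T) : nat -> T :=
  fun k => if Nat.eqb k n then a else v k.

(** Satisfaction in the substructure of [M] with domain [D]. *)
Fixpoint sat {M : structure} (D : M -> Prop) (v : nat -> M) (f : form) : Prop :=
  match f with
  | Mem x y => v x ∈ v y
  | Eq x y => v x = v y
  | Neg f => ~ sat D v f
  | And f g => sat D v f /\ sat D v g
  | Or f g => sat D v f \/ sat D v g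
  | Imp f g => sat D v f -> sat D v g
  | All x f => forall a, D a -> sat D (upd v x a) f
  | Ex x f => exists a, D a /\ sat D (upd v x a) f
  end.

Definition whole (M : structure) : M -> Prop := fun _ => True.

Definition subset (M : structure) (x y : M) : Prop :=
  forall z, z ∈ x -> z ∈ y.

Definition is_unordered_pair (M : structure) (x y p : M) : Prop :=
  forall z, z ∈ p <-> z = x \/ z = y.

(** [p] is the Kuratowski pair {{x},{x,y}}. *)
Definition is_pair (M : structure) (x y p : M) : Prop :=
  exists a b, is_unordered_pair x x a /\ is_unordered_pair x y b /\
              is_unordered_pair a b p.

Definition pair_in (M : structure) (x y f : M) : Prop :=
  exists p, is_pair x y p /\ p ∈ f.

(** The set [f] is a function from the class [A] to the class [B]. *)
Definition is_function (M : structure) (f : M) (A B : M -> Prop) : Prop :=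
  (forall p, p ∈ f -> exists x y, is_pair x y p /\ A x /\ B y) /\
  (forall x, A x -> exists! y, pair_in x y f).

Definition is_bijection (M : structure) (f a b : M) : Prop :=
  is_function f (fun x => x ∈ a) (fun y => y ∈ b) /\
  (forall y, y ∈ b -> exists! x, pair_in x y f).

Definition transitive_set (M : structure) (x : M) : Prop :=
  forall y, y ∈ x -> subset y x.

Definition ordinal (M : structure) (x : M) : Prop :=
  transitive_set x /\ forall y, y ∈ x -> transitive_set y.

Definition limit_ordinal (M : structure) (x : M) : Prop :=
  ordinal x /\ (exists a, a ∈ x) /\
  (forall a, a ∈ x -> exists b, b ∈ x /\ a ∈ b).

Definition cardinal (M : structure) (x : M) : Prop :=
  ordinal x /\ forall a, a ∈ x -> ~ exists f, is_bijection f a x.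

Definition limit_cardinal (M : structure) (x : M) : Prop :=
  cardinal x /\ (exists a, a ∈ x) /\
  (forall a, a ∈ x -> exists b, b ∈ x /\ a ∈ b /\ cardinal b).

Definition is_successor_cardinal (M : structure) (k d : M) : Prop :=
  cardinal d /\ k ∈ d /\ forall c, cardinal c -> k ∈ c -> subset d c.

(** [in_V a x] is x ∈ V_a, through V_a = ⋃_(b ∈ a) P(V_b). *)
Inductive in_V (M : structure) (a : M) (x : M) : Prop :=
| in_V_intro b : b ∈ a -> (forall y, y ∈ x -> in_V b y) -> in_V a x.

Record ZFC (M : structure) : Prop := {
  zfc_extensionality : forall x y : M, (forall z, z ∈ x <-> z ∈ y) -> x = y;
  zfc_foundation : forall x : M, (exists y, y ∈ x) ->
    exists y, y ∈ x /\ forall z, z ∈ y -> ~ z ∈ x;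
  zfc_pairing : forall x y : M, exists p, is_unordered_pair x y p;
  zfc_union : forall x : M, exists u,
    forall z, z ∈ u <-> exists y, y ∈ x /\ z ∈ y;
  zfc_powerset : forall x : M, exists p, forall z, z ∈ p <-> subset z x;
  zfc_infinity : exists w : M,
    (exists e, e ∈ w /\ forall z, ~ z ∈ e) /\
    (forall x, x ∈ w ->
       exists s, s ∈ w /\ forall z, z ∈ s <-> z ∈ x \/ z = x);
  zfc_separation : forall (f : form) (v : nat -> M) (a : M), exists b,
    forall x, x ∈ b <-> x ∈ a /\ sat (@whole M) (upd v 0 x) f;
  zfc_replacement : forall (f : form) (v : nat -> M) (a : M),
    (forall x, x ∈ a ->
       exists! y, sat (@whole M) (upd (upd v 0 x) 1 y) f) ->
    exists b, forall y, y ∈ b <->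
      exists x, x ∈ a /\ sat (@whole M) (upd (upd v 0 x) 1 y) f;
  zfc_choice : forall a : M,
    (forall x, x ∈ a -> exists z, z ∈ x) ->
    (forall x y z, x ∈ a -> y ∈ a -> z ∈ x -> z ∈ y -> x = y) ->
    exists c, forall x, x ∈ a -> exists! z, z ∈ x /\ z ∈ c }.

(** [r] preserves and reflects the formulas in [K] between the substructures
    of [M] with (nonempty) domains [A] and [B]. *)
Definition preserves (M : structure) (K : form -> Prop) (A B : M -> Prop)
    (r : M -> M -> Prop) : Prop :=
  forall f, K f -> forall v w : nat -> M,
    (forall n, A (v n)) -> (forall n, B (w n)) -> (forall n, r (v n) (w n)) ->
    (sat A v f <-> sat B w f).

Definition elementary_submodel (M : structure) (K : form -> Prop)
    (A B : M -> Prop) : Prop :=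
  (forall x, A x -> B x) /\ preserves K A B eq.

Definition elementary_embedding (M : structure) (i : M) (A B : M -> Prop) :
    Prop :=
  is_function i A B /\
  preserves (fun _ => True) A B (fun x y => pair_in x y i).

Definition I3_embedding (V : structure) (lam j : V) : Prop :=
  limit_ordinal lam /\
  elementary_embedding j (in_V lam) (in_V lam) /\
  (exists x y, pair_in x y j /\ x <> y).

Definition is_critical_point (V : structure) (j k : V) : Prop :=
  ordinal k /\ (exists k', pair_in k k' j /\ k' <> k) /\
  (forall a, a ∈ k -> pair_in a a j).

Definition is_critical_sequence (V : structure) (j : V) (kappa : nat -> V) :
    Prop :=
  is_critical_point j (kappa 0) /\
  (forall m, pair_in (kappa m) (kappa (S m)) j).

(** B = j^+(A) = ⋃_(a < lam) j(A ∩ V_a). *)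
Definition is_plus (V : structure) (lam j A B : V) : Prop :=
  forall z, z ∈ B <->
    exists a c d, a ∈ lam /\ (forall x, x ∈ c <-> x ∈ A /\ in_V a x) /\
                  pair_in c d j /\ z ∈ d.

(** [J m n], for m <= n, is the map j_{m,n}. *)
Definition is_iteration (V : structure) (lam j : V) (J : nat -> nat -> V) :
    Prop :=
  (forall m n, m <= n ->
     elementary_embedding (J m n) (in_V lam) (in_V lam)) /\
  (forall k m n, k <= m -> m <= n -> forall x z,
     pair_in x z (J k n) <->
     exists y, pair_in x y (J k m) /\ pair_in y z (J m n)) /\
  J 0 1 = j /\
  (forall n x y, pair_in x y (J n n) <-> in_V lam x /\ x = y) /\
  (forall n, is_plus lam j (J n (S n)) (J (S n) (S (S n)))).

(** Membership of the direct limit M_ω, on representatives: (m, x) stands for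
    j_{m,ω}(x).  Representatives of the same point of M_ω have the same
    predecessors, so accessibility of (m, x) for this relation says that
    j_{m,ω}(x) is in the well-founded part of M_ω. *)
Definition limit_mem (V : structure) (J : nat -> nat -> V) (a b : nat * V) :
    Prop :=
  exists k x y, fst a <= k /\ fst b <= k /\
    pair_in (snd a) x (J (fst a) k) /\ pair_in (snd b) y (J (fst b) k) /\
    x ∈ y.

Definition I3_wf (V : structure) (n : nat) (lam j : V) : Prop :=
  I3_embedding lam j /\
  exists (kappa : nat -> V) (J : nat -> nat -> V) (d : V),
    is_critical_sequence j kappa /\ is_iteration lam j J /\
    is_successor_cardinal (kappa n) d /\
    (forall a, a ∈ d -> Acc (limit_mem J) (n, a)).

Definition is_induced_ultrafilter (V : structure) (j k U : V) : Prop :=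
  forall A, A ∈ U <-> subset A k /\ exists B, pair_in A B j /\ k ∈ B.

(** Prikry conditions (s, A): s a finite set of ordinals below k, A ∈ U. *)
Definition prikry_condition (V : structure) (k U p : V) : Prop :=
  exists s A, is_pair s A p /\ subset s k /\
    (exists l : list V, forall x, x ∈ s <-> In x l) /\ A ∈ U.

(** [prikry_le k q p]: q = (t, B) extends p = (s, A), i.e. s = t ∩ a for some
    ordinal a <= k, t \ s ⊆ A and B ⊆ A. *)
Definition prikry_le (V : structure) (k q p : V) : Prop :=
  exists t B s A, is_pair t B q /\ is_pair s A p /\
    (exists a, (a ∈ k \/ a = k) /\ forall x, x ∈ s <-> x ∈ t /\ x ∈ a) /\
    (forall x, x ∈ t -> ~ x ∈ s -> x ∈ A) /\
    subset B A.

(** [G] is a filter on the poset ([P], [le]) meeting every dense subset of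
    [P] that is an element of [V]. *)
Definition generic (V : structure) (P : V -> Prop) (le : V -> V -> Prop)
    (G : V -> Prop) : Prop :=
  (forall p, G p -> P p) /\
  (exists p, G p) /\
  (forall p q, G p -> P q -> le p q -> G q) /\
  (forall p q, G p -> G q -> exists r, G r /\ le r p /\ le r q) /\
  (forall D : V, (forall x, x ∈ D -> P x) ->
     (forall p, P p -> exists d, d ∈ D /\ le d p) ->
     exists d, d ∈ D /\ G d).

(** [N] is the generic extension V[G], with evaluation of names
    val(σ) = {val(τ) : (τ, p) ∈ σ for some p ∈ G}.  Every set is used as a
    name: its elements that are not pairs (τ, p) with p ∈ G do not matter.
    For well-founded [V] this determines ([N], [val]) up to isomorphism. *)
Definition generic_extension (V : structure) (G : V -> Prop) (N : structure)
    (val : V -> N) : Prop :=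
  (forall a b : N, (forall z, z ∈ a <-> z ∈ b) -> a = b) /\
  (forall a : N, exists s, a = val s) /\
  (forall s z, z ∈ val s <->
     exists t p, pair_in t p s /\ G p /\ z = val t).

(** The inclusion of V in V[G]: [a] is the element of [N] identified with the
    element [x] of [V], that is, a = {b : b is identified with some y ∈ x}. *)
Inductive identified (V N : structure) (x : V) (a : N) : Prop :=
| identified_intro :
    (forall y, y ∈ x -> exists b, b ∈ a /\ identified y b) ->
    (forall b, b ∈ a -> exists y, y ∈ x /\ identified y b) ->
    identified x a.

(** C^(m), for m > 0.  Nonemptiness of V_a is asked for because [preserves]
    says nothing about empty domains. *)
Definition C_class (M : structure) (m : nat) (a : M) : Prop :=
  ordinal a /\ (exists b, b ∈ a) /\
  elementary_submodel (sigma m) (in_V a) (@whole M).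

Definition exacting (M : structure) (mu : M) : Prop :=
  limit_cardinal mu /\
  exists (m : nat) (eta X zeta i : M),
    0 < m /\
    cardinal eta /\ C_class m eta /\ mu ∈ eta /\
    elementary_submodel (fun _ => True) (fun x => x ∈ X) (in_V eta) /\
    (forall x, in_V mu x -> x ∈ X) /\ mu ∈ X /\
    cardinal zeta /\ C_class (S m) zeta /\ mu ∈ zeta /\
    elementary_embedding i (fun x => x ∈ X) (in_V zeta) /\
    pair_in mu mu i /\
    (exists a b, a ∈ mu /\ pair_in a b i /\ b <> a).

(* Main.v *)
Require Import Defs.
From Stdlib Require Import List Arith Lia Classical ClassicalEpsilon
  FunctionalExtensionality PropExtensionality.

(** Write [k] for the critical point and [c] for the Prikry sequence of [G].
    In V[G] choose [zeta] in C^(2) and code an elementary submodel X of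
    V_zeta containing V_k and k by a set A of pairs (x, t), where x is a tuple of
    elements of V_k naming elements of X and t is the type of the named tuple.
    A condition (s, B) forces that the name of A denotes such a code, and by
    the Prikry property a finite stem u decides A up to the next element of [c];
    this gives a function F from stems to subsets of V_k in V.  Removing the
    first element of [c] after s yields another generic filter with the same
    extension, hence another code A'', and an embedding of X into V_zeta
    amounts to a map e of V_k to itself that carries A to A''.  Finite
    approximations of e form a tree of nodes (t, e') in V, where t is a finite
    increasing sequence.  If it had no subtree with U-many successors at every
    node, its nodes would have ranks below k^+; but the restrictions of [j]
    form a branch of the iterated images of the tree, along which the images of
    these ranks are a descending sequence in the direct limit M_omega below
    j_{0,omega}[k^+], contradicting the well-foundedness assumption.  So
    there is such a subtree, and [c] determines a branch of it, which is e. *)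

Set Implicit Arguments.
Unset Strict Implicit.
Unset Printing Implicit Defensive.

(** * Definability *)

(** The obstacle is that V_zeta is far too large to be compared with [j] directly. Types repair
    this: for a fixed length and depth, the type of a tuple over V_zeta has rank below omega +
    omega, whatever the tuple. So A is a subset of V_k, Prikry forcing adds no elements to V_k, and
    the types lie where e is the identity.

    Removing a point of the sequence is modelled on [j], which sends the set of kappa_0, ...,
    kappa_(n-1) to that of kappa_1, ..., kappa_n, that is, to the first n+1 critical points without
    the first one. Hence the restrictions of [j] satisfy in the iterated trees what e must satisfy
    for G and the filter of the shortened sequence. The bound k^+ arises because V_k does not map
    onto k^+: the values of a minimal ranking stop below k^+ and leave room for one more.

    Since [V] is an arbitrary well-founded model of first-order axioms, separation, recursion and
    forcing apply to definable classes only; hence the definability calculus that comes first. *)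

Section Renaming.
Context {M : structure} (D : M -> Prop).

(** Bound variables are renamed along with the free ones, so an injective [r] causes no capture. *)
Fixpoint ren (r : nat -> nat) (f : form) : form :=
  match f with
  | Mem x y => Mem (r x) (r y)
  | Eq x y => Eq (r x) (r y)
  | Neg f => Neg (ren r f)
  | And f g => And (ren r f) (ren r g)
  | Or f g => Or (ren r f) (ren r g)
  | Imp f g => Imp (ren r f) (ren r g)
  | All x f => All (r x) (ren r f)
  | Ex x f => Ex (r x) (ren r f)
  end.

Lemma upd_same (v : nat -> M) n a : upd v n a n = a.
Proof. unfold upd. now rewrite Nat.eqb_refl. Qed.

Lemma upd_other (v : nat -> M) n m a : m <> n -> upd v n a m = v m.
Proof. intro H. unfold upd. destruct (Nat.eqb_spec m n); congruence. Qed.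

Lemma upd_ren (r : nat -> nat) (rinj : forall m n, r m = r n -> m = n)
    (v : nat -> M) x a :
  (fun n => upd v (r x) a (r n)) = upd (fun n => v (r n)) x a.
Proof.
  apply functional_extensionality; intro n. unfold upd.
  destruct (Nat.eqb_spec (r n) (r x)), (Nat.eqb_spec n x); subst; auto.
  - apply rinj in e. congruence.
  - congruence.
Qed.

Lemma sat_ren (r : nat -> nat) (rinj : forall m n, r m = r n -> m = n) f :
  forall v : nat -> M, sat D v (ren r f) <-> sat D (fun n => v (r n)) f.
Proof.
  induction f; intro v; simpl;
    try (rewrite ?IHf, ?IHf1, ?IHf2; reflexivity).
  - split; intros H a Ha; specialize (H a Ha); rewrite IHf, upd_ren in *; auto.
  - split; intros (a & Ha & H); exists a; split; auto;
      rewrite IHf, upd_ren in *; auto.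
Qed.

End Renaming.

(** Environments are left-nested tuples; the component of level [n] is held by
    the variable [2 n], and parameters are held by the odd variables. *)
Class Env (M : structure) (E : Type) := {
  depth : nat;
  rep : E -> (nat -> M) -> Prop;
  envD : (M -> Prop) -> E -> Prop;
  rep_upd : forall e v k a, depth <= k -> rep e v -> rep e (upd v (2 * k) a);
  rep_even : forall e v v', (forall n, n < depth -> v (2 * n) = v' (2 * n)) ->
    rep e v -> rep e v';
  rep_exists : forall (D : M -> Prop) e v, envD D e -> (forall n, D (v n)) ->
    exists v', (forall n, D (v' n)) /\ rep e v' /\
      (forall k, v' (2 * k + 1) = v (2 * k + 1));
  envD_all : forall (D : M -> Prop) e, (forall x, D x) -> envD D e }.

#[global, refine] Instance Env_unit (M : structure) : Env M unit := {
  depth := 0; rep := fun _ _ => True; envD := fun _ _ => True }.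
Proof. all: auto. intros D e v _ HD. exists v; auto. Defined.

#[global, refine] Instance Env_prod (M : structure) (E : Type) (HE : Env M E) :
  Env M (E * M) := {
  depth := S depth;
  rep := fun e v => rep (fst e) v /\ v (2 * depth) = snd e;
  envD := fun D e => envD D (fst e) /\ D (snd e) }.
Proof.
  - intros [e x] v k a Hk [H1 H2]; split; simpl in *.
    + apply rep_upd; auto; lia.
    + rewrite upd_other; auto; lia.
  - intros [e x] v v' Hv [H1 H2]; split; simpl in *.
    + apply (rep_even (v := v)); auto. intros n Hn. apply Hv. lia.
    + rewrite <- Hv; auto.
  - intros D [e x] v [H1 H2] Hv; simpl in *.
    destruct (rep_exists H1 Hv) as (v' & A & B & C).
    exists (upd v' (2 * depth) x); repeat split.
    + intro n. unfold upd. destruct (Nat.eqb_spec n (2 * depth)); auto.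
    + apply rep_upd; auto.
    + apply upd_same.
    + intro k. rewrite upd_other; [apply C | lia].
  - intros D [e x] H; split; simpl; auto. apply envD_all; auto.
Defined.

Section Definable.
Context {M : structure}.

(** [Par] controls the parameters: [whole] allows all of them, [NoPar] is what the elementarity of
    an embedding requires, and the class of the checks of ground model sets allows a property to be
    forced. The list [l] is read through the odd variables. *)
Definition Dfn (D Par : M -> Prop) {E : Type} {HE : Env M E} (P : E -> Prop) :
    Prop :=
  exists (f : form) (l : list M), Forall (fun a => Par a /\ D a) l /\
    forall e v, envD D e -> (forall n, D (v n)) -> rep e v ->
      (forall k a, nth_error l k = Some a -> v (2 * k + 1) = a) ->
      (P e <-> sat D v f).

(** A term is treated through its graph. The second clause keeps its values in [D], so that a
    quantifier relativised to [D] can range over them. *)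
Definition DF (D Par : M -> Prop) {E : Type} {HE : Env M E} (t : E -> M) :
    Prop :=
  Dfn D Par (fun e : E * M => snd e = t (fst e)) /\
  forall e, envD D e -> D (t e).

Context {D Par : M -> Prop} {E : Type} {HE : Env M E}.

Lemma dfn_iff (P Q : E -> Prop) :
  Dfn D Par Q -> (forall e, envD D e -> (P e <-> Q e)) -> Dfn D Par P.
Proof.
  intros (f & l & Hl & Hf) HPQ. exists f, l; split; auto.
  intros e v He Hv Hr Hk. rewrite HPQ; auto.
Qed.

Lemma dfn_not (P : E -> Prop) :
  Dfn D Par P -> Dfn D Par (fun e => ~ P e).
Proof.
  intros (f & l & Hl & Hf). exists (Neg f), l; split; auto.
  intros e v He Hv Hr Hk. simpl. now rewrite (Hf e v).
Qed.

Definition shift_par (n k : nat) : nat := if Nat.odd k then k + 2 * n else k.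

Lemma shift_par_even n k : shift_par n (2 * k) = 2 * k.
Proof.
  unfold shift_par. replace (Nat.odd (2 * k)) with false; auto.
  symmetry. rewrite <- Nat.negb_even, Nat.even_mul. reflexivity.
Qed.

Lemma shift_par_odd n k : shift_par n (2 * k + 1) = 2 * (n + k) + 1.
Proof.
  unfold shift_par. replace (Nat.odd (2 * k + 1)) with true; [lia |].
  symmetry. apply Nat.odd_spec. now exists k.
Qed.

Lemma shift_par_inj n a b : shift_par n a = shift_par n b -> a = b.
Proof.
  destruct (Nat.Even_or_Odd a) as [[i ->] | [i ->]],
    (Nat.Even_or_Odd b) as [[k ->] | [k ->]];
  rewrite ?shift_par_even, ?shift_par_odd; lia.
Qed.

(** The two parameter lists are concatenated, and [shift_par] moves the odd variables of the second
    formula past those of the first. *)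
Lemma dfn_op2 (op : Prop -> Prop -> Prop) (fop : form -> form -> form)
    (Hop : forall (v : nat -> M) f g,
       sat D v (fop f g) <-> op (sat D v f) (sat D v g))
    (Hop_iff : forall A B A' B', (A <-> A') -> (B <-> B') ->
       (op A B <-> op A' B'))
    (P Q : E -> Prop) :
  Dfn D Par P -> Dfn D Par Q -> Dfn D Par (fun e => op (P e) (Q e)).
Proof.
  intros (f & l & Hl & Hf) (g & m & Hm & Hg).
  exists (fop f (ren (shift_par (length l)) g)), (l ++ m). split.
  { apply Forall_app; auto. }
  intros e v He Hv Hr Hk. rewrite Hop. apply Hop_iff.
  - apply Hf; auto. intros k a Ha. apply Hk.
    rewrite nth_error_app1; auto. apply nth_error_Some. congruence.
  - rewrite sat_ren by apply shift_par_inj. apply Hg; auto.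
    + apply (rep_even (v := v)); auto. intros n _. now rewrite shift_par_even.
    + intros k a Ha. rewrite shift_par_odd. apply Hk.
      rewrite nth_error_app2 by lia. rewrite <- Ha. f_equal. lia.
Qed.

Lemma dfn_and (P Q : E -> Prop) :
  Dfn D Par P -> Dfn D Par Q -> Dfn D Par (fun e => P e /\ Q e).
Proof. apply (@dfn_op2 and And); simpl; tauto. Qed.

Lemma dfn_or (P Q : E -> Prop) :
  Dfn D Par P -> Dfn D Par Q -> Dfn D Par (fun e => P e \/ Q e).
Proof. apply (@dfn_op2 or Or); simpl; tauto. Qed.

Lemma dfn_imp (P Q : E -> Prop) :
  Dfn D Par P -> Dfn D Par Q -> Dfn D Par (fun e => P e -> Q e).
Proof. apply (@dfn_op2 (fun A B => A -> B) Imp); simpl; tauto. Qed.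

Lemma dfn_equiv (P Q : E -> Prop) :
  Dfn D Par P -> Dfn D Par Q -> Dfn D Par (fun e => P e <-> Q e).
Proof.
  intros. apply (dfn_and (P := fun e => P e -> Q e)); apply dfn_imp; auto.
Qed.

Lemma dfn_exD (P : E -> M -> Prop) :
  Dfn D Par (fun e : E * M => P (fst e) (snd e)) ->
  Dfn D Par (fun e => exists x, D x /\ P e x).
Proof.
  intros (f & l & Hl & Hf). exists (Ex (2 * depth) f), l; split; auto.
  intros e v He Hv Hr Hk. simpl.
  split; intros (x & Hx & H); exists x; split; auto; revert H;
  (apply (Hf (e, x));
   [split; auto
   | intro n; unfold upd; destruct (Nat.eqb n _); auto
   | split; [now apply rep_upd | apply upd_same]
   | intros k a Ha; rewrite upd_other; [now apply Hk | lia]]).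
Qed.

End Definable.

Section DefinableTerms.
Context {M : structure} {D Par : M -> Prop}.

Lemma dfn_allD {E : Type} {HE : Env M E} (P : E -> M -> Prop) :
  Dfn D Par (fun e : E * M => P (fst e) (snd e)) ->
  Dfn D Par (fun e => forall x, D x -> P e x).
Proof.
  intro H. apply dfn_iff with (Q := fun e => ~ exists x, D x /\ ~ P e x).
  - apply dfn_not, (dfn_exD (P := fun e x => ~ P e x)), dfn_not, H.
  - intros e _. split; [firstorder |]. intros H' x Hx. apply NNPP. eauto.
Qed.

Definition IsVar {E : Type} {HE : Env M E} (i : nat) (t : E -> M) : Prop :=
  forall e v, rep e v -> v (2 * i) = t e.

Lemma isvar_snd {E : Type} {HE : Env M E} :
  IsVar depth (fun e : E * M => snd e).
Proof. intros e v [_ H]. exact H. Qed.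

Lemma isvar_fst {E : Type} {HE : Env M E} i (t : E -> M) :
  IsVar i t -> IsVar i (fun e : E * M => t (fst e)).
Proof. intros H e v [Hr _]. now apply H. Qed.

Lemma dfn_eq_var {E : Type} {HE : Env M E} i k (s t : E -> M) :
  IsVar i s -> IsVar k t -> Dfn D Par (fun e => s e = t e).
Proof.
  intros Hs Ht. exists (Eq (2 * i) (2 * k)), nil; split; auto.
  intros e v He Hv Hr _. cbn [sat]. now rewrite (Hs e v Hr), (Ht e v Hr).
Qed.

Lemma dfn_mem_var {E : Type} {HE : Env M E} i k (s t : E -> M) :
  IsVar i s -> IsVar k t -> Dfn D Par (fun e => s e ∈ t e).
Proof.
  intros Hs Ht. exists (Mem (2 * i) (2 * k)), nil; split; auto.
  intros e v He Hv Hr _. cbn [sat]. now rewrite (Hs e v Hr), (Ht e v Hr).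
Qed.

Definition swap (i k n : nat) : nat :=
  if Nat.eqb n i then k else if Nat.eqb n k then i else n.

Lemma swap_inj i k m n : swap i k m = swap i k n -> m = n.
Proof.
  unfold swap. destruct (Nat.eqb_spec m i), (Nat.eqb_spec m k),
    (Nat.eqb_spec n i), (Nat.eqb_spec n k); lia.
Qed.

Lemma swap_l i k : swap i k i = k.
Proof. unfold swap. now rewrite Nat.eqb_refl. Qed.

Lemma swap_other i k n : n <> i -> n <> k -> swap i k n = n.
Proof.
  unfold swap. intros. destruct (Nat.eqb_spec n i), (Nat.eqb_spec n k); lia.
Qed.

Lemma dfn_ren {E E' : Type} {HE : Env M E} {HE' : Env M E'} (r : nat -> nat)
    (rinj : forall m n, r m = r n -> m = n)
    (rodd : forall k, r (2 * k + 1) = 2 * k + 1) (g : E' -> E)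
    (grep : forall e v, rep e v -> rep (g e) (fun n => v (r n)))
    (gD : forall e, envD D e -> envD D (g e)) (P : E -> Prop) :
  Dfn D Par P -> Dfn D Par (fun e => P (g e)).
Proof.
  intros (f & l & Hl & Hf). exists (ren r f), l; split; auto.
  intros e v He Hv Hr Hk. rewrite sat_ren by auto. apply Hf; auto.
  intros k a Ha. rewrite rodd. auto.
Qed.

(** Opens a gap at level [d]: the even variables from that level on move up by one level and the
    parameters stay. Weakening an environment below its last components is this renaming. *)
Definition ins (d n : nat) : nat :=
  if Nat.odd n then n else if Nat.ltb n (2 * d) then n else n + 2.

Lemma ins_odd d k : ins d (2 * k + 1) = 2 * k + 1.
Proof.
  unfold ins. replace (2 * k + 1) with (S (2 * k)) by lia.
  now rewrite Nat.odd_succ, Nat.even_even.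
Qed.

Lemma ins_low d k : k < d -> ins d (2 * k) = 2 * k.
Proof.
  unfold ins. rewrite Nat.odd_even. destruct (Nat.ltb_spec (2 * k) (2 * d)); lia.
Qed.

Lemma ins_high d k : d <= k -> ins d (2 * k) = 2 * S k.
Proof.
  unfold ins. rewrite Nat.odd_even. destruct (Nat.ltb_spec (2 * k) (2 * d)); lia.
Qed.

Lemma ins_inj d m n : ins d m = ins d n -> m = n.
Proof.
  destruct (Nat.Even_or_Odd m) as [[i ->] | [i ->]],
    (Nat.Even_or_Odd n) as [[k ->] | [k ->]];
  rewrite ?ins_odd; try destruct (le_lt_dec d i); try destruct (le_lt_dec d k);
  repeat first [rewrite ins_low by lia | rewrite ins_high by lia]; lia.
Qed.

Lemma rep_ins {E : Type} {HE : Env M E} (e : E) v :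
  rep e v -> rep e (fun n => v (ins depth n)).
Proof.
  intro H. apply (rep_even (v := v)); auto. intros n Hn. now rewrite ins_low.
Qed.

Lemma dfn_ins1 {E : Type} {HE : Env M E} (Q : E * M -> Prop) :
  Dfn D Par Q -> Dfn D Par (fun e : E * M * M => Q (fst (fst e), snd e)).
Proof.
  apply dfn_ren with (r := ins depth); [apply ins_inj | apply ins_odd | |].
  - intros [[e x] y] v [[H1 H2] H3]; cbn [fst snd] in *.
    split; cbn [fst snd]; [now apply rep_ins |].
    rewrite ins_high; auto.
  - intros [[e x] y] [[H1 H2] H3]. split; auto.
Qed.

Lemma dfn_ins2 {E : Type} {HE : Env M E} (Q : E * M * M -> Prop) :
  Dfn D Par Q -> Dfn D Par
    (fun e : E * M * M * M => Q (fst (fst (fst e)), snd (fst e), snd e)).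
Proof.
  apply dfn_ren with (r := ins depth); [apply ins_inj | apply ins_odd | |].
  - intros [[[e x] y] z] v [[[H1 H2] H3] H4]; cbn [fst snd depth Env_prod] in *.
    repeat split; cbn [fst snd depth Env_prod]; [now apply rep_ins | |];
    rewrite ins_high; auto.
  - intros [[[e x] y] z] [[[H1 H2] H3] H4]. repeat split; auto.
Qed.

Lemma dfn_ins3 {E : Type} {HE : Env M E} (Q : E * M * M * M -> Prop) :
  Dfn D Par Q -> Dfn D Par (fun e : E * M * M * M * M =>
    Q (fst (fst (fst (fst e))), snd (fst (fst e)), snd (fst e), snd e)).
Proof.
  apply dfn_ren with (r := ins depth); [apply ins_inj | apply ins_odd | |].
  - intros [[[[e x] y] z] w] v [[[[H1 H2] H3] H4] H5];
    cbn [fst snd depth Env_prod] in *.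
    repeat split; cbn [fst snd depth Env_prod]; [now apply rep_ins | | |];
    rewrite ins_high; auto.
  - intros [[[[e x] y] z] w] [[[[H1 H2] H3] H4] H5]. repeat split; auto.
Qed.

Lemma df_ins1 {E : Type} {HE : Env M E} (t : E * M -> M) :
  DF D Par t -> DF D Par (fun e : E * M * M => t (fst (fst e), snd e)).
Proof.
  intros [H1 H2]; split.
  - apply (dfn_ins2 (Q := fun e => snd e = t (fst e))), H1.
  - intros [[e x] y] [[H3 _] H4]. apply H2. split; auto.
Qed.

Lemma df_ins2 {E : Type} {HE : Env M E} (t : E * M * M -> M) :
  DF D Par t -> DF D Par
    (fun e : E * M * M * M => t (fst (fst (fst e)), snd (fst e), snd e)).
Proof.
  intros [H1 H2]; split.
  - apply (dfn_ins3 (Q := fun e => snd e = t (fst e))), H1.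
  - intros [[[e x] y] z] [[[H3 _] H4] H5]. apply H2. repeat split; auto.
Qed.

Lemma df_weak {E : Type} {HE : Env M E} (t : E -> M) :
  DF D Par t -> DF D Par (fun e : E * M => t (fst e)).
Proof.
  intros [H1 H2]; split.
  - apply (dfn_ins1 (Q := fun e => snd e = t (fst e))), H1.
  - intros [e x] [He _]. now apply H2.
Qed.

(** Quantifying existentially over the value of [t] takes the place of a syntactic substitution. *)
Lemma dfn_subst {E : Type} {HE : Env M E} (P : E * M -> Prop) (t : E -> M) :
  Dfn D Par P -> DF D Par t -> Dfn D Par (fun e => P (e, t e)).
Proof.
  intros HP [Ht HD].
  apply dfn_iff with (Q := fun e => exists y, D y /\ (y = t e /\ P (e, y))).
  - apply dfn_exD with (P := fun e y => y = t e /\ P (e, y)).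
    apply dfn_and; auto.
    eapply dfn_iff; [exact HP |]. intros [e x] _. reflexivity.
  - intros e He. split.
    + intro H. exists (t e). auto.
    + intros (y & _ & -> & H). exact H.
Qed.

(** The terms are replaced one at a time by fresh last variables, which reduces the claim to the
    relation between two variables. *)
Lemma dfn_term2 (R : M -> M -> Prop)
    (HR : forall (E : Type) (HE : Env M E) i k (s t : E -> M),
       IsVar i s -> IsVar k t -> Dfn D Par (fun e => R (s e) (t e)))
    {E : Type} {HE : Env M E} (s t : E -> M) :
  DF D Par s -> DF D Par t -> Dfn D Par (fun e => R (s e) (t e)).
Proof.
  intros Hs Ht.
  apply (dfn_subst (P := fun e => R (s (fst e)) (snd e))); auto.
  apply (dfn_subst (P := fun e => R (snd e) (snd (fst e)))
                   (t := fun e => s (fst e))).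
  - eapply HR; [apply isvar_snd | apply isvar_fst, isvar_snd].
  - apply (df_weak Hs).
Qed.

Lemma dfn_mem {E : Type} {HE : Env M E} (s t : E -> M) :
  DF D Par s -> DF D Par t -> Dfn D Par (fun e => s e ∈ t e).
Proof. apply dfn_term2. intros. eapply dfn_mem_var; eauto. Qed.

Lemma dfn_eq {E : Type} {HE : Env M E} (s t : E -> M) :
  DF D Par s -> DF D Par t -> Dfn D Par (fun e => s e = t e).
Proof. apply dfn_term2. intros. eapply dfn_eq_var; eauto. Qed.

Lemma df_isvar {E : Type} {HE : Env M E} i (t : E -> M) :
  IsVar i t -> (forall e, envD D e -> D (t e)) -> DF D Par t.
Proof.
  intros Ht HD; split; auto.
  apply (dfn_eq_var (s := fun e => snd e) (t := fun e => t (fst e))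
    isvar_snd (isvar_fst Ht)).
Qed.

Lemma df_snd {E : Type} {HE : Env M E} : DF D Par (fun e : E * M => snd e).
Proof.
  eapply df_isvar; [apply isvar_snd |]. intros e [_ H]. exact H.
Qed.

Lemma df_const {E : Type} {HE : Env M E} (a : M) :
  Par a -> D a -> DF D Par (fun _ : E => a).
Proof.
  intros HP Ha; split; auto.
  exists (Eq (2 * depth) 1), (a :: nil); split; auto.
  intros [e x] v He Hv [_ Hx] Hk. cbn [sat]. rewrite Hx.
  now rewrite (Hk 0 a eq_refl : v 1 = a).
Qed.

Lemma df_subst {E : Type} {HE : Env M E} (s : E * M -> M) (t : E -> M) :
  DF D Par s -> DF D Par t -> DF D Par (fun e => s (e, t e)).
Proof.
  intros [Hs HsD] Ht; split.
  - apply dfn_iff with (Q := fun e : E * M => exists y, D y /\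
      (y = t (fst e) /\ snd e = s (fst e, y))).
    + apply dfn_exD with
        (P := fun (e : E * M) y => y = t (fst e) /\ snd e = s (fst e, y)).
      apply dfn_and; [apply (df_weak Ht) |].
      destruct Hs as (f & l & Hl & Hf).
      (* The environment lists the result [x] before the argument [y], whereas the graph of [s]
         expects the argument first. *)
      exists (ren (swap (2 * depth) (2 * S depth)) f), l; split; auto.
      intros [[e x] y] v [[He Hx] Hy] Hv [[Hr Hrx] Hry] Hk.
      rewrite sat_ren by apply swap_inj.
      apply (Hf (e, y, x)).
      * repeat split; auto.
      * auto.
      * repeat split; cbn [fst snd] in *.
        -- apply (rep_even (v := v)); auto. intros n Hn.
           rewrite swap_other; auto; lia.
        -- rewrite swap_l. exact Hry.
        -- unfold swap. cbn [depth Env_prod].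
           destruct (Nat.eqb_spec (2 * S depth) (2 * depth)); [lia |].
           now rewrite Nat.eqb_refl.
      * intros k a Ha. rewrite swap_other by lia. auto.
    + intros [e x] [He Hx]. simpl. split.
      * intros ->. exists (t e). split; auto. now apply Ht.
      * now intros (y & _ & -> & ->).
  - intros e He. apply HsD. split; auto. now apply Ht.
Qed.

End DefinableTerms.

Lemma dfn_ex {M : structure} {Par : M -> Prop} {E : Type} {HE : Env M E}
    (P : E -> M -> Prop) :
  Dfn (@whole M) Par (fun e : E * M => P (fst e) (snd e)) ->
  Dfn (@whole M) Par (fun e => exists x, P e x).
Proof.
  intro H. eapply dfn_iff; [apply dfn_exD, H |].
  intros e _. split; [intros [x Hx]; exists x; split; [exact I | auto]
    | intros (x & _ & Hx); eauto].
Qed.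

Lemma dfn_all {M : structure} {Par : M -> Prop} {E : Type} {HE : Env M E}
    (P : E -> M -> Prop) :
  Dfn (@whole M) Par (fun e : E * M => P (fst e) (snd e)) ->
  Dfn (@whole M) Par (fun e => forall x, P e x).
Proof.
  intro H. eapply dfn_iff; [apply dfn_allD, H |].
  intros e _. split; [auto | intros H' x; exact (H' x I)].
Qed.

(** These hooks are redefined each time new operations have been shown definable; [df] and [dfn]
    then follow the shape of the expression. *)
Ltac dfn_user := fail.
Ltac df_user := fail.

Ltac df_weaken H n :=
  first [ exact H
        | lazymatch n with
          | S ?m => let H' := uconstr:(df_weak H) in df_weaken H' m
          end ].

Ltac df_hyp :=
  match goal with
  | H : DF _ _ _ |- DF _ _ _ => df_weaken H 12
  end.

Ltac df_var :=
  lazymatch goal with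
  | |- DF _ _ (@snd _ _) => exact df_snd
  | |- DF _ _ (fun e => snd _) => let H := uconstr:(df_snd) in df_weaken H 16
  end.

Ltac df :=
  cbv beta;
  first
  [ df_var
  | df_hyp
  | apply df_const; [exact I | exact I]
  | apply df_const; [assumption | exact I]
  | df_user ].

Ltac dfn :=
  cbv beta;
  lazymatch goal with
  | |- DF _ _ _ => df
  | |- Dfn _ _ (fun e => _ /\ _) => apply dfn_and; dfn
  | |- Dfn _ _ (fun e => _ \/ _) => apply dfn_or; dfn
  | |- Dfn _ _ (fun e => ~ _) => apply dfn_not; dfn
  | |- Dfn _ _ (fun e => _ <-> _) => apply dfn_equiv; dfn
  | |- Dfn _ _ (fun e => exists x, _) => apply dfn_ex; dfn
  | |- Dfn _ _ (fun e => _ = _) => apply dfn_eq; dfn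
  | |- Dfn _ _ (fun e => _ ∈ _) => apply dfn_mem; dfn
  | |- Dfn _ _ (fun e => _ -> _) =>
    first [ apply dfn_imp; dfn | apply dfn_all; dfn ]
  | |- Dfn _ _ (fun e => forall x : _, _) => apply dfn_all; dfn
  | |- Dfn _ _ _ => first [ assumption | dfn_user ]
  end.


(** * Turning the components of an environment into parameters *)

Section FixEnvironment.
Context {M : structure} {Par : M -> Prop} {E : Type} {HE : Env M E}.

(** Even variables of level below [depth] become parameters placed after the first [n] ones, the
    higher even variables start again at level 0, and the remaining odd variables move out of the
    way. *)
Definition fix_ren (n k : nat) : nat :=
  if Nat.odd k then
    if Nat.ltb (Nat.div2 k) n then k else k + 2 * depth
  else if Nat.ltb (Nat.div2 k) depth then 2 * (n + Nat.div2 k) + 1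
  else k - 2 * depth.

Lemma fix_ren_odd n k : k < n -> fix_ren n (2 * k + 1) = 2 * k + 1.
Proof.
  unfold fix_ren. intro H. replace (2 * k + 1) with (S (2 * k)) by lia.
  rewrite Nat.odd_succ, Nat.div2_succ_double, Nat.even_even.
  destruct (Nat.ltb_spec k n); lia.
Qed.

Lemma fix_ren_odd' n k :
  n <= k -> fix_ren n (2 * k + 1) = 2 * (k + depth) + 1.
Proof.
  unfold fix_ren. intro H. replace (2 * k + 1) with (S (2 * k)) by lia.
  rewrite Nat.odd_succ, Nat.div2_succ_double, Nat.even_even.
  destruct (Nat.ltb_spec k n); lia.
Qed.

Lemma fix_ren_low n k :
  k < depth -> fix_ren n (2 * k) = 2 * (n + k) + 1.
Proof.
  unfold fix_ren. intro H. rewrite Nat.odd_even, Nat.div2_double.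
  destruct (Nat.ltb_spec k depth); lia.
Qed.

Lemma fix_ren_high n k : fix_ren n (2 * (depth + k)) = 2 * k.
Proof.
  unfold fix_ren. rewrite Nat.odd_even, Nat.div2_double.
  destruct (Nat.ltb_spec (depth + k) depth); lia.
Qed.

Lemma fix_ren_inj n a b : fix_ren n a = fix_ren n b -> a = b.
Proof.
  assert (C : forall k, (exists i, i < n /\ k = 2 * i + 1) \/
    (exists i, n <= i /\ k = 2 * i + 1) \/ (exists i, i < depth /\ k = 2 * i) \/
    (exists i, k = 2 * (depth + i))).
  { intro k. destruct (Nat.Even_or_Odd k) as [[i ->] | [i ->]].
    - destruct (le_lt_dec depth i); [| eauto 6].
      right; right; right. exists (i - depth). lia.
    - destruct (le_lt_dec n i); eauto 6. }
  destruct (C a) as [(i & Hi & ->) | [(i & Hi & ->) | [(i & Hi & ->) |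
    (i & ->)]]], (C b) as [(k & Hk & ->) | [(k & Hk & ->) | [(k & Hk & ->) |
    (k & ->)]]];
  repeat first [ rewrite fix_ren_high | rewrite fix_ren_low by lia
    | rewrite fix_ren_odd by lia | rewrite fix_ren_odd' by lia ]; lia.
Qed.

(** The components of [e] are values and can be appended to the parameters. Thus separation and
    replacement, formulated for classes of one or two variables, apply inside an arbitrary
    environment. *)
Lemma fix_env (e : E) (f : form) (l : list M) :
  exists (f' : form) (l' : list M), forall v',
    (forall k a, nth_error l' k = Some a -> v' (2 * k + 1) = a) ->
    exists v, rep e v /\
      (forall k a, nth_error l k = Some a -> v (2 * k + 1) = a) /\
      (forall k, v (2 * (depth + k)) = v' (2 * k)) /\
      (sat (@whole M) v' f' <-> sat (@whole M) v f).
Proof.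
  destruct (classic (inhabited M)) as [[m] | HM].
  2:{ exists f, nil. intros v'. destruct (HM (inhabits (v' 0))). }
  destruct (rep_exists (D := @whole M) (e := e) (v := fun _ => m))
    as (v0 & _ & Hr & _).
  { apply envD_all. intro; exact I. } { intro; exact I. }
  exists (ren (fix_ren (length l)) f),
    (l ++ map (fun i => v0 (2 * i)) (seq 0 depth)).
  intros v' Hv'. exists (fun n => v' (fix_ren (length l) n)).
  split; [| split; [| split]].
  - apply (rep_even (v := v0)); auto. intros n Hn.
    rewrite fix_ren_low by auto. symmetry. apply Hv'.
    rewrite nth_error_app2 by lia.
    replace (length l + n - length l) with n by lia.
    rewrite nth_error_map, (nth_error_nth' _ 0), seq_nth; auto.
    now rewrite length_seq.
  - intros k a Ha. assert (k < length l) by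
      (apply nth_error_Some; congruence).
    rewrite fix_ren_odd by auto. apply Hv'. now rewrite nth_error_app1.
  - intro k. now rewrite fix_ren_high.
  - apply sat_ren, fix_ren_inj.
Qed.

Lemma dfn_fix (P : E * M -> Prop) (e : E) :
  Dfn (@whole M) Par P ->
  Dfn (@whole M) (@whole M) (fun x : unit * M => P (e, snd x)).
Proof.
  intros (f & l & _ & Hf). destruct (fix_env e f l) as (f' & l' & H).
  exists f', l'; split. { apply Forall_forall. repeat split. }
  intros [[] x] v' _ _ [_ Hx] Hk. destruct (H v' Hk) as (v & Hr & Hl & Hd & Hs).
  rewrite Hs. apply Hf; auto; try (intros; exact I).
  - apply envD_all. intro; exact I.
  - split; auto. cbn [fst snd]. etransitivity; [| exact Hx].
    refine (eq_trans _ (Hd 0)). f_equal. lia.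
Qed.

Lemma dfn_fix2 (P : E * M * M -> Prop) (e : E) :
  Dfn (@whole M) Par P ->
  Dfn (@whole M) (@whole M)
    (fun x : unit * M * M => P (e, snd (fst x), snd x)).
Proof.
  intros (f & l & _ & Hf). destruct (fix_env e f l) as (f' & l' & H).
  exists f', l'; split. { apply Forall_forall. repeat split. }
  intros [[[] x] y] v' _ _ [[_ Hx] Hy] Hk.
  destruct (H v' Hk) as (v & Hr & Hl & Hd & Hs).
  rewrite Hs. apply Hf; auto; try (intros; exact I).
  - apply envD_all. intro; exact I.
  - cbn [fst snd] in *. repeat split; auto; cbn [fst snd].
    + etransitivity; [| exact Hx].
      refine (eq_trans _ (Hd 0)). f_equal. lia.
    + etransitivity; [| exact Hy].
      refine (eq_trans _ (Hd 1)). f_equal. cbn [depth Env_prod]. lia.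
Qed.

Lemma dfn_fix3 (P : E * M * M * M -> Prop) (e : E) :
  Dfn (@whole M) Par P ->
  Dfn (@whole M) (@whole M)
    (fun x : unit * M * M * M => P (e, snd (fst (fst x)), snd (fst x), snd x)).
Proof.
  intros (f & l & _ & Hf). destruct (fix_env e f l) as (f' & l' & H).
  exists f', l'; split. { apply Forall_forall. repeat split. }
  intros [[[[] x] y] z] v' _ _ [[[_ Hx] Hy] Hz] Hk.
  destruct (H v' Hk) as (v & Hr & Hl & Hd & Hs).
  rewrite Hs. apply Hf; auto; try (intros; exact I).
  - apply envD_all. intro; exact I.
  - cbn [fst snd] in *. repeat split; auto; cbn [fst snd].
    + etransitivity; [| exact Hx].
      refine (eq_trans _ (Hd 0)). f_equal. lia.
    + etransitivity; [| exact Hy].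
      refine (eq_trans _ (Hd 1)). f_equal. cbn [depth Env_prod]. lia.
    + etransitivity; [| exact Hz].
      refine (eq_trans _ (Hd 2)). f_equal. cbn [depth Env_prod]. lia.
Qed.

End FixEnvironment.

Lemma df_fix {M : structure} {Par : M -> Prop} {E : Type} {HE : Env M E}
    (t : E * M -> M) (e : E) :
  DF (@whole M) Par t ->
  DF (@whole M) (@whole M) (fun x : unit * M => t (e, snd x)).
Proof.
  intros [H _]; split; [| intros; exact I].
  apply (dfn_fix2 (P := fun x => snd x = t (fst x)) e H).
Qed.

Lemma df_fix2 {M : structure} {Par : M -> Prop} {E : Type} {HE : Env M E}
    (t : E * M * M -> M) (e : E) :
  DF (@whole M) Par t ->
  DF (@whole M) (@whole M) (fun x : unit * M * M => t (e, snd (fst x), snd x)).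
Proof.
  intros [H _]; split; [| intros; exact I].
  apply (dfn_fix3 (P := fun x => snd x = t (fst x)) e H).
Qed.

(** * Set theory inside a well-founded model *)

(** Foundation appears as external well-foundedness, so that inductions can be made from outside.
    Choice is kept apart, in the form [WO]. Both [V] and its extension are shown to be instances. *)
Class ZF (M : structure) : Prop := {
  zf_ext : forall x y : M, (forall z, z ∈ x <-> z ∈ y) -> x = y;
  zf_wf : well_founded (@mem M);
  zf_pairing : forall x y : M, exists p, is_unordered_pair x y p;
  zf_union : forall x : M, exists u,
    forall z, z ∈ u <-> exists y, y ∈ x /\ z ∈ y;
  zf_powerset : forall x : M, exists p, forall z, z ∈ p <-> subset z x;
  zf_infinity : exists w : M,
    (exists e, e ∈ w /\ forall z, ~ z ∈ e) /\
    (forall x, x ∈ w ->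
       exists s, s ∈ w /\ forall z, z ∈ s <-> z ∈ x \/ z = x);
  zf_separation : forall (f : form) (v : nat -> M) (a : M), exists b,
    forall x, x ∈ b <-> x ∈ a /\ sat (@whole M) (upd v 0 x) f;
  zf_replacement : forall (f : form) (v : nat -> M) (a : M),
    (forall x, x ∈ a ->
       exists! y, sat (@whole M) (upd (upd v 0 x) 1 y) f) ->
    exists b, forall y, y ∈ b <->
      exists x, x ∈ a /\ sat (@whole M) (upd (upd v 0 x) 1 y) f }.

Lemma ZF_of_ZFC (M : structure) :
  ZFC M -> well_founded (@mem M) -> ZF M.
Proof. intros [] H. split; auto. Qed.

Notation DW := (Dfn (@whole _)).
Notation FW := (DF (@whole _)).

Definition Cls {M : structure} (P : M -> Prop) : Prop :=
  Dfn (@whole M) (@whole M) (fun e : unit * M => P (snd e)).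
Definition Rel2 {M : structure} (R : M -> M -> Prop) : Prop :=
  Dfn (@whole M) (@whole M) (fun e : unit * M * M => R (snd (fst e)) (snd e)).
Definition Fun1 {M : structure} (f : M -> M) : Prop :=
  DF (@whole M) (@whole M) (fun e : unit * M => f (snd e)).
Definition Fun2 {M : structure} (f : M -> M -> M) : Prop :=
  DF (@whole M) (@whole M) (fun e : unit * M * M => f (snd (fst e)) (snd e)).

(** * Classes, relations and functions of the model inside larger environments *)

Section Lift.
Context {M : structure} {E : Type} {HE : Env M E}.

Definition lift_ren (n : nat) : nat :=
  if Nat.odd n then n else n + 2 * depth.

Lemma lift_ren_even k : lift_ren (2 * k) = 2 * (k + depth).
Proof. unfold lift_ren. rewrite Nat.odd_even. lia. Qed.

Lemma lift_ren_odd k : lift_ren (2 * k + 1) = 2 * k + 1.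
Proof. unfold lift_ren. now rewrite Nat.odd_odd. Qed.

Lemma lift_ren_inj m n : lift_ren m = lift_ren n -> m = n.
Proof.
  destruct (Nat.Even_or_Odd m) as [[i ->] | [i ->]],
    (Nat.Even_or_Odd n) as [[k ->] | [k ->]];
  rewrite ?lift_ren_even, ?lift_ren_odd; lia.
Qed.

Context {Par : M -> Prop}.

Lemma dfn_lift1 (P : unit * M -> Prop) :
  DW Par P -> DW Par (fun e : E * M => P (tt, snd e)).
Proof.
  apply dfn_ren with (r := lift_ren);
    [apply lift_ren_inj | apply lift_ren_odd | | repeat split].
  intros [e x] v [_ Hx]. split; [exact I |].
  exact (eq_trans (f_equal v (lift_ren_even 0)) Hx).
Qed.

Lemma dfn_lift2 (P : unit * M * M -> Prop) :
  DW Par P -> DW Par (fun e : E * M * M => P (tt, snd (fst e), snd e)).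
Proof.
  apply dfn_ren with (r := lift_ren);
    [apply lift_ren_inj | apply lift_ren_odd | | repeat split].
  intros [[e x] y] v [[_ Hx] Hy]. split; [split; [exact I |] |].
  - exact (eq_trans (f_equal v (lift_ren_even 0)) Hx).
  - exact (eq_trans (f_equal v (lift_ren_even 1)) Hy).
Qed.

Lemma dfn_lift3 (P : unit * M * M * M -> Prop) :
  DW Par P -> DW Par (fun e : E * M * M * M =>
    P (tt, snd (fst (fst e)), snd (fst e), snd e)).
Proof.
  apply dfn_ren with (r := lift_ren);
    [apply lift_ren_inj | apply lift_ren_odd | | repeat split].
  intros [[[e x] y] z] v [[[_ Hx] Hy] Hz].
  split; [split; [split; [exact I |] |] |].
  - exact (eq_trans (f_equal v (lift_ren_even 0)) Hx).
  - exact (eq_trans (f_equal v (lift_ren_even 1)) Hy).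
  - exact (eq_trans (f_equal v (lift_ren_even 2)) Hz).
Qed.

Lemma df_lift1 (t : unit * M -> M) :
  FW Par t -> FW Par (fun e : E * M => t (tt, snd e)).
Proof.
  intros [H _]; split; [| intros; exact I].
  exact (dfn_lift2 (P := fun e => snd e = t (fst e)) H).
Qed.

Lemma df_lift2 (t : unit * M * M -> M) :
  FW Par t -> FW Par (fun e : E * M * M => t (tt, snd (fst e), snd e)).
Proof.
  intros [H _]; split; [| intros; exact I].
  exact (dfn_lift3 (P := fun e => snd e = t (fst e)) H).
Qed.

End Lift.

Section LiftTerms.
Context {M : structure} {E : Type} {HE : Env M E}.
Local Notation W := (@whole M).

Lemma dfn_cls (P : M -> Prop) (t : E -> M) :
  Cls P -> FW W t -> DW W (fun e => P (t e)).
Proof.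
  intros HP Ht. apply (dfn_subst (P := fun x => P (snd x))); auto.
  exact (dfn_lift1 HP).
Qed.

Lemma df_fun1 (f : M -> M) (t : E -> M) :
  Fun1 f -> FW W t -> FW W (fun e => f (t e)).
Proof.
  intros HP Ht. apply (df_subst (s := fun x => f (snd x))); auto.
  exact (df_lift1 HP).
Qed.

Lemma dfn_rel2 (R : M -> M -> Prop) (s t : E -> M) :
  Rel2 R -> FW W s -> FW W t -> DW W (fun e => R (s e) (t e)).
Proof.
  intros HP Hs Ht.
  apply (dfn_subst (P := fun x => R (s (fst x)) (snd x))); auto.
  apply (dfn_iff (Q := fun x : E * M => exists y, y = snd x /\
    exists z, z = s (fst x) /\ R z y)).
  - apply dfn_ex. apply dfn_and; [dfn |]. apply dfn_ex.
    apply dfn_and; [dfn |]. cbv beta.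
    apply (dfn_subst (P := fun x => R (snd (fst x)) (snd x))
      (t := fun x => snd (fst x))); [| dfn].
    exact (dfn_lift2 HP).
  - intros [e y] _. simpl. split.
    + intro H. eauto.
    + intros (y' & -> & z & -> & H). exact H.
Qed.

Lemma df_fun2 (f : M -> M -> M) (s t : E -> M) :
  Fun2 f -> FW W s -> FW W t -> FW W (fun e => f (s e) (t e)).
Proof.
  intros HP Hs Ht.
  apply (df_subst (s := fun x => f (s (fst x)) (snd x))); auto.
  split; [| intros; exact I].
  apply (dfn_iff (Q := fun x : E * M * M => exists y, y = snd (fst x) /\
    exists z, z = s (fst (fst x)) /\ exists w, w = snd x /\
      exists y', y' = y /\ w = f z y')).
  - apply dfn_ex. apply dfn_and; [dfn |]. apply dfn_ex.
    apply dfn_and; [dfn |]. apply dfn_ex. apply dfn_and; [dfn |].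
    apply dfn_ex. apply dfn_and; [dfn |]. cbv beta.
    apply dfn_eq; [dfn |].
    apply (df_subst (s := fun x => f (snd (fst (fst (fst x)))) (snd x))
      (t := fun x => snd x)); [| dfn].
    apply (df_ins1 (t := fun x => f (snd (fst (fst x))) (snd x))).
    apply (df_ins1 (t := fun x => f (snd (fst x)) (snd x))).
    exact (df_lift2 HP).
  - intros [[e y] w] _. simpl. split.
    + intros ->. eauto 10.
    + intros (y' & -> & z & -> & w' & -> & y'' & -> & ->). reflexivity.
Qed.

End LiftTerms.

Ltac cls :=
  match goal with
  | |- Cls _ => unfold Cls at 1
  | |- Rel2 _ => unfold Rel2 at 1
  | |- Fun1 _ => unfold Fun1 at 1
  | |- Fun2 _ => unfold Fun2 at 1
  end; dfn.

(** * Basic set operations and their definability *)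

Section Basic.
Context {M : structure} {HM : ZF M}.

Lemma zf_inh : inhabited M.
Proof. destruct zf_infinity as [w _]. exact (inhabits w). Qed.

(** Hilbert's choice operator makes all set operations total; their values have a meaning whenever a
    witness exists. *)
Definition the (P : M -> Prop) : M := epsilon zf_inh P.

Lemma the_spec (P : M -> Prop) : (exists x, P x) -> P (the P).
Proof. apply epsilon_spec. Qed.

Lemma df_char {Par : M -> Prop} {E : Type} {HE : Env M E} (t : E -> M)
    (Q : E -> M -> Prop) :
  DW Par (fun e : E * M => Q (fst e) (snd e)) ->
  (forall e, Q e (t e)) -> (forall e y, Q e y -> y = t e) -> FW Par t.
Proof.
  intros H1 H2 H3; split; [| intros; exact I].
  eapply dfn_iff; [exact H1 |]. intros [e y] _; simpl; split.
  - intros ->; auto.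
  - apply H3.
Qed.

Lemma the_set_spec (P : M -> Prop) :
  (exists b, forall x, x ∈ b <-> P x) ->
  forall x, x ∈ the (fun b => forall x, x ∈ b <-> P x) <-> P x.
Proof. intro H. exact (the_spec (P := fun b => forall x, x ∈ b <-> P x) H). Qed.

(** By extensionality a set is the only one with its elements, so a definition of its elements
    defines its graph. *)
Lemma df_set {Par : M -> Prop} {E : Type} {HE : Env M E} (t : E -> M)
    (Q : E -> M -> Prop) :
  DW Par (fun e : E * M => Q (fst e) (snd e)) ->
  (forall e z, z ∈ t e <-> Q e z) -> FW Par t.
Proof.
  intros H1 H2. apply df_char with (Q := fun e y => forall z, z ∈ y <-> Q e z).
  - apply dfn_all. cbv beta. apply dfn_equiv.
    + apply dfn_mem; [apply df_snd | apply df_weak, df_snd].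
    + apply (dfn_ins1 (Q := fun e => Q (fst e) (snd e))), H1.
  - auto.
  - intros e y H. apply zf_ext. intro z. now rewrite H, H2.
Qed.

Definition emp : M := the (fun b => forall x, x ∈ b <-> False).
Definition upair (a b : M) : M := the (fun p => forall x, x ∈ p <-> x = a \/ x = b).
Definition bigU (a : M) : M :=
  the (fun u => forall z, z ∈ u <-> exists y, y ∈ a /\ z ∈ y).
Definition pow (a : M) : M := the (fun p => forall z, z ∈ p <-> subset z a).
Definition sep (a : M) (P : M -> Prop) : M :=
  the (fun b => forall x, x ∈ b <-> x ∈ a /\ P x).
Definition img (a : M) (f : M -> M) : M :=
  the (fun b => forall y, y ∈ b <-> exists x, x ∈ a /\ y = f x).
Definition cup (a b : M) : M := bigU (upair a b).
Definition pr (a b : M) : M := upair (upair a a) (upair a b).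
Definition osucc (a : M) : M := cup a (upair a a).

Lemma sep_exists (P : M -> Prop) (a : M) :
  Cls P -> exists b, forall x, x ∈ b <-> x ∈ a /\ P x.
Proof.
  intros (f & l & _ & H).
  destruct (zf_separation f
    (fun n => nth (Nat.div2 n) l a) a) as [b Hb].
  exists b. intro x. rewrite Hb.
  rewrite (H (tt, x) (upd (fun n => nth (Nat.div2 n) l a) 0 x)).
  - reflexivity.
  - repeat split.
  - intro; exact I.
  - repeat split.
  - intros k c Hk. rewrite upd_other by lia.
    replace (2 * k + 1) with (S (2 * k)) by lia.
    rewrite Nat.div2_succ_double. now apply nth_error_nth.
Qed.

Lemma repl_exists (R : M -> M -> Prop) (a : M) :
  Rel2 R -> (forall x, x ∈ a -> exists! y, R x y) ->
  exists b, forall y, y ∈ b <-> exists x, x ∈ a /\ R x y.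
Proof.
  intros (f & l & _ & H) Ha.
  (* Replacement puts the value in variable 1, a parameter slot in the present convention, while [f]
     expects it in variable 2. The swap of the two moves the first parameter to variable 2. *)
  set (v := fun n => nth (if Nat.eqb n 2 then 0 else Nat.div2 n) l a).
  assert (K : forall x y, sat (@whole M) (upd (upd v 0 x) 1 y)
    (ren (swap 1 2) f) <-> R x y).
  { intros x y. rewrite sat_ren by apply swap_inj.
    rewrite (H (tt, x, y) (fun n => upd (upd v 0 x) 1 y (swap 1 2 n)));
      [reflexivity | repeat split | intro; exact I | repeat split |].
    intros k c Hk. destruct k as [| k].
    - change (v 2 = c). unfold v. simpl. now apply (nth_error_nth l 0).
    - rewrite swap_other by lia. rewrite !upd_other by lia. unfold v.
      destruct (Nat.eqb_spec (2 * S k + 1) 2); [lia |].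
      replace (2 * S k + 1) with (S (2 * S k)) by lia.
      rewrite Nat.div2_succ_double. now apply nth_error_nth. }
  destruct (zf_replacement (f := ren (swap 1 2) f) (v := v) (a := a))
    as [b Hb].
  - intros x Hx. destruct (Ha x Hx) as (y & Hy & Hu).
    exists y; split; [now apply K |]. intros y' Hy'. apply Hu, K, Hy'.
  - exists b. intro y. rewrite Hb. split; intros (x & Hx & HR); exists x;
      split; auto; now apply K.
Qed.

Lemma mem_upair a b x : x ∈ upair a b <-> x = a \/ x = b.
Proof. revert x. apply the_set_spec, zf_pairing. Qed.

Lemma mem_bigU a x : x ∈ bigU a <-> exists y, y ∈ a /\ x ∈ y.
Proof. revert x. apply the_set_spec, zf_union. Qed.

Lemma mem_pow a x : x ∈ pow a <-> subset x a.
Proof. revert x. apply the_set_spec, zf_powerset. Qed.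

Lemma mem_sep a (P : M -> Prop) x : Cls P -> x ∈ sep a P <-> x ∈ a /\ P x.
Proof. intro H. revert x. now apply the_set_spec, sep_exists. Qed.

Lemma mem_img a (f : M -> M) x :
  Fun1 f -> x ∈ img a f <-> exists y, y ∈ a /\ x = f y.
Proof.
  intro H. revert x. apply the_set_spec.
  apply (repl_exists (R := fun x y => y = f x) (a := a)).
  - apply H.
  - intros x _. exists (f x); split; auto.
Qed.

Lemma mem_emp x : ~ x ∈ emp.
Proof.
  assert (H : forall x, x ∈ emp <-> False); [| intro; now apply (H x)].
  apply the_set_spec with (P := fun _ => False).
  destruct (sep_exists (P := fun x => ~ x = x) emp) as [b Hb]; [cls |].
  exists b. intro y. rewrite Hb. tauto.
Qed.

Lemma mem_cup a b x : x ∈ cup a b <-> x ∈ a \/ x ∈ b.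
Proof.
  unfold cup. rewrite mem_bigU. split.
  - intros (y & Hy & H). apply mem_upair in Hy as [-> | ->]; auto.
  - intros [H | H]; [exists a | exists b]; split; auto; apply mem_upair; auto.
Qed.

Lemma mem_osucc a x : x ∈ osucc a <-> x ∈ a \/ x = a.
Proof. unfold osucc. rewrite mem_cup, mem_upair. tauto. Qed.

Section Terms.
Context {Par : M -> Prop} {E : Type} {HE : Env M E}.
Implicit Types s t a b : E -> M.

Lemma df_emp : FW Par (fun _ : E => emp).
Proof.
  apply df_char with (Q := fun (_ : E) y => forall z, ~ z ∈ y).
  - dfn.
  - intros _. apply mem_emp.
  - intros _ y H. apply zf_ext. intro z. split; intro Hz.
    + destruct (H z Hz).
    + destruct (mem_emp Hz).
Qed.

Lemma df_upair s t :
  FW Par s -> FW Par t -> FW Par (fun e => upair (s e) (t e)).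
Proof.
  intros. apply df_set with (Q := fun e z => z = s e \/ z = t e); [dfn |].
  intros. apply mem_upair.
Qed.

Lemma df_bigU s : FW Par s -> FW Par (fun e => bigU (s e)).
Proof.
  intros. apply df_set with (Q := fun e z => exists y, y ∈ s e /\ z ∈ y);
    [dfn |]. intros. apply mem_bigU.
Qed.

Lemma dfn_subset s t :
  FW Par s -> FW Par t -> DW Par (fun e => subset (s e) (t e)).
Proof. intros. unfold subset. dfn. Qed.

Lemma df_sep a (P : E -> M -> Prop) :
  FW Par a -> DW Par (fun e : E * M => P (fst e) (snd e)) ->
  FW Par (fun e => sep (a e) (P e)).
Proof.
  intros Ha HP. apply df_set with (Q := fun e z => z ∈ a e /\ P e z).
  - apply dfn_and; auto. dfn.
  - intros e z. apply mem_sep.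
    exact (dfn_fix (P := fun x => P (fst x) (snd x)) e HP).
Qed.

Lemma df_img a (f : E -> M -> M) :
  FW Par a -> FW Par (fun e : E * M => f (fst e) (snd e)) ->
  FW Par (fun e => img (a e) (f e)).
Proof.
  intros Ha Hf.
  apply df_set with (Q := fun e z => exists y, y ∈ a e /\ z = f e y).
  - apply dfn_ex. cbv beta. apply dfn_and; [dfn |].
    apply dfn_eq; [df |].
    exact (df_ins1 (t := fun e => f (fst e) (snd e)) Hf).
  - intros e z. apply mem_img.
    exact (df_fix (t := fun x => f (fst x) (snd x)) e Hf).
Qed.

Lemma df_pow s : FW Par s -> FW Par (fun e => pow (s e)).
Proof.
  intros. apply df_set with (Q := fun e z => subset z (s e)).
  - unfold subset. dfn.
  - intros. apply mem_pow.
Qed.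

End Terms.
End Basic.

Ltac df_fun :=
  match goal with
  | H : Fun1 _ |- _ => apply (df_fun1 H); df
  | H : Fun2 _ |- _ => apply (df_fun2 H); df
  end.
Ltac dfn_rel :=
  match goal with
  | H : Cls _ |- _ => apply (dfn_cls H); df
  | H : Rel2 _ |- _ => apply (dfn_rel2 H); df
  end.
Ltac df_more := df_fun.
Ltac dfn_more := dfn_rel.
Ltac df_user ::=
  lazymatch goal with
  | |- DF _ _ (fun e => emp) => apply df_emp
  | |- DF _ _ (fun e => upair _ _) => apply df_upair; df
  | |- DF _ _ (fun e => bigU _) => apply df_bigU; df
  | |- DF _ _ (fun e => pow _) => apply df_pow; df
  | |- DF _ _ (fun e => img _ _) => apply df_img; df
  | |- DF _ _ (fun e => sep _ _) => apply df_sep; [df | dfn]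
  | |- DF _ _ (fun e => cup _ _) => unfold cup; df
  | |- DF _ _ (fun e => pr _ _) => unfold pr; df
  | |- DF _ _ (fun e => osucc _) => unfold osucc; df
  | |- _ => df_more
  end.
Ltac dfn_user ::=
  lazymatch goal with
  | |- Dfn _ _ (fun e => subset _ _) => apply dfn_subset; df
  | |- _ => dfn_more
  end.

Section Pairs.
Context {M : structure} {HM : ZF M}.
Implicit Types x y z a b f g p : M.

Lemma pr_inj a b c d : pr a b = pr c d -> a = c /\ b = d.
Proof.
  intro H. assert (Hac : a = c).
  { assert (K : upair a a ∈ pr c d) by (rewrite <- H; apply mem_upair; auto).
    apply mem_upair in K as [K | K].
    - assert (L : c ∈ upair a a) by (rewrite K; apply mem_upair; auto).
      apply mem_upair in L; intuition congruence.
    - assert (L : c ∈ upair a a) by (rewrite K; apply mem_upair; auto).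
      apply mem_upair in L; intuition congruence. }
  subst c. split; auto.
  assert (K : upair a b ∈ pr a d) by (rewrite <- H; apply mem_upair; auto).
  assert (K' : upair a d ∈ pr a b) by (rewrite H; apply mem_upair; auto).
  apply mem_upair in K as [K | K], K' as [K' | K'].
  - assert (L : b ∈ upair a a) by (rewrite <- K; apply mem_upair; auto).
    assert (L' : d ∈ upair a a) by (rewrite <- K'; apply mem_upair; auto).
    apply mem_upair in L, L'. intuition congruence.
  - assert (L : b ∈ upair a a) by (rewrite <- K; apply mem_upair; auto).
    assert (L' : d ∈ upair a b) by (rewrite <- K'; apply mem_upair; auto).
    apply mem_upair in L, L'. intuition congruence.
  - assert (L : b ∈ upair a d) by (rewrite <- K; apply mem_upair; auto).
    assert (L' : d ∈ upair a a) by (rewrite <- K'; apply mem_upair; auto).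
    apply mem_upair in L, L'. intuition congruence.
  - assert (L : b ∈ upair a d) by (rewrite <- K; apply mem_upair; auto).
    assert (L' : d ∈ upair a b) by (rewrite <- K'; apply mem_upair; auto).
    apply mem_upair in L, L'. intuition congruence.
Qed.

Lemma is_unordered_pairE x y p : is_unordered_pair x y p <-> p = upair x y.
Proof.
  split.
  - intro H. apply zf_ext. intro z. rewrite mem_upair. apply H.
  - intros -> z. apply mem_upair.
Qed.

Lemma is_pairE x y p : is_pair x y p <-> p = pr x y.
Proof.
  unfold is_pair. split.
  - intros (a & b & Ha & Hb & Hp).
    apply is_unordered_pairE in Ha, Hb, Hp. subst. reflexivity.
  - intros ->. exists (upair x x), (upair x y).
    rewrite !is_unordered_pairE. auto.
Qed.

Lemma pair_inE x y f : pair_in x y f <-> pr x y ∈ f.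
Proof.
  unfold pair_in. split.
  - intros (p & Hp & H). apply is_pairE in Hp. now subst.
  - intro H. exists (pr x y). now rewrite is_pairE.
Qed.

Lemma subset_refl a : subset a a.
Proof. intro; auto. Qed.

Lemma subset_antisym a b : subset a b -> subset b a -> a = b.
Proof. intros H K. apply zf_ext. split; auto. Qed.

Lemma fst_mem a b f : pr a b ∈ f -> a ∈ bigU (bigU f).
Proof.
  intro H. apply mem_bigU. exists (upair a a). rewrite mem_upair; split; auto.
  apply mem_bigU. exists (pr a b). split; auto. apply mem_upair; auto.
Qed.

Lemma snd_mem a b f : pr a b ∈ f -> b ∈ bigU (bigU f).
Proof.
  intro H. apply mem_bigU. exists (upair a b). rewrite mem_upair; split; auto.
  apply mem_bigU. exists (pr a b). split; auto. apply mem_upair; auto.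
Qed.

(* The union of a singleton is its element, so these are the projections and
   the value of a function; the junk value is [emp]. *)
Definition fstp p : M := bigU (sep (bigU p) (fun x => exists y, p = pr x y)).
Definition sndp p : M := bigU (sep (bigU p) (fun y => exists x, p = pr x y)).
Definition app f x : M := bigU (sep (bigU (bigU f)) (fun y => pr x y ∈ f)).
Definition dom f : M := sep (bigU (bigU f)) (fun x => exists y, pr x y ∈ f).
Definition ran f : M := sep (bigU (bigU f)) (fun y => exists x, pr x y ∈ f).
Definition lam a (t : M -> M) : M := img a (fun x => pr x (t x)).
Definition prod a b : M := bigU (img a (fun x => img b (fun y => pr x y))).

Lemma bigU_sep_unique a (P : M -> Prop) x :
  Cls P -> x ∈ a -> P x -> (forall y, P y -> y = x) -> bigU (sep a P) = x.
Proof.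
  intros HP Hx Px U. apply zf_ext. intro z. rewrite mem_bigU. split.
  - intros (y & Hy & Hz). apply mem_sep in Hy as [_ Hy]; auto.
    now rewrite <- (U y Hy).
  - intro Hz. exists x. split; auto. apply mem_sep; auto.
Qed.

Lemma fstp_pr a b : fstp (pr a b) = a.
Proof.
  unfold fstp. apply bigU_sep_unique; [cls | | eauto |].
  - apply mem_bigU. exists (upair a a). unfold pr. rewrite !mem_upair; auto.
  - intros y (x & H). now apply pr_inj in H.
Qed.

Lemma sndp_pr a b : sndp (pr a b) = b.
Proof.
  unfold sndp. apply bigU_sep_unique; [cls | | eauto |].
  - apply mem_bigU. exists (upair a b). unfold pr. rewrite !mem_upair; auto.
  - intros y (x & H). now apply pr_inj in H.
Qed.

Lemma mem_dom f x : x ∈ dom f <-> exists y, pr x y ∈ f.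
Proof.
  unfold dom. rewrite mem_sep by cls. split; [tauto |].
  intros [y H]. split; eauto. eapply fst_mem; eauto.
Qed.

Lemma mem_ran f y : y ∈ ran f <-> exists x, pr x y ∈ f.
Proof.
  unfold ran. rewrite mem_sep by cls. split; [tauto |].
  intros [x H]. split; eauto. eapply snd_mem; eauto.
Qed.

Lemma mem_lam a (t : M -> M) p :
  Fun1 t -> p ∈ lam a t <-> exists x, x ∈ a /\ p = pr x (t x).
Proof.
  intro H. unfold lam. rewrite mem_img; [reflexivity |].
  cls.
Qed.

Lemma pr_lam a (t : M -> M) x y :
  Fun1 t -> pr x y ∈ lam a t <-> x ∈ a /\ y = t x.
Proof.
  intro H. rewrite mem_lam by auto. split.
  - intros (z & Hz & E). apply pr_inj in E as [-> ->]. auto.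
  - intros [Hx ->]. eauto.
Qed.

Lemma mem_prod a b p :
  p ∈ prod a b <-> exists x y, x ∈ a /\ y ∈ b /\ p = pr x y.
Proof.
  unfold prod. rewrite mem_bigU. split.
  - intros (u & Hu & Hp). apply mem_img in Hu as (x & Hx & ->); [| cls].
    apply mem_img in Hp as (y & Hy & ->); [eauto 6 | cls].
  - intros (x & y & Hx & Hy & ->). exists (img b (fun y => pr x y)).
    rewrite !mem_img by cls. split; [exists x | exists y]; auto.
Qed.

Lemma pr_prod a b x y : pr x y ∈ prod a b <-> x ∈ a /\ y ∈ b.
Proof.
  rewrite mem_prod. split.
  - intros (x' & y' & Hx & Hy & E). apply pr_inj in E as [-> ->]. auto.
  - intros []. eauto 6.
Qed.

Definition isfun f : Prop :=
  (forall p, p ∈ f -> exists x y, p = pr x y) /\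
  (forall x y y', pr x y ∈ f -> pr x y' ∈ f -> y = y').

Lemma app_eq f x y : isfun f -> pr x y ∈ f -> app f x = y.
Proof.
  intros [_ Hf] H. unfold app. apply bigU_sep_unique; [cls | | auto |].
  - eapply snd_mem; eauto.
  - intros z Hz. eapply Hf; eauto.
Qed.

Lemma app_mem f x : isfun f -> x ∈ dom f -> pr x (app f x) ∈ f.
Proof.
  intros Hf Hx. apply mem_dom in Hx as [y Hy]. now rewrite (app_eq Hf Hy).
Qed.

Lemma isfun_lam a (t : M -> M) : Fun1 t -> isfun (lam a t).
Proof.
  intro H. split.
  - intros p Hp. apply mem_lam in Hp as (x & _ & ->); eauto.
  - intros x y y'. rewrite !pr_lam by auto. intros [_ ->] [_ ->]. auto.
Qed.

Lemma app_lam a (t : M -> M) x : Fun1 t -> x ∈ a -> app (lam a t) x = t x.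
Proof.
  intros H Hx. apply app_eq; [now apply isfun_lam |]. now apply pr_lam.
Qed.

Lemma dom_lam a (t : M -> M) : Fun1 t -> dom (lam a t) = a.
Proof.
  intro H. apply zf_ext. intro x. rewrite mem_dom. split.
  - intros [y Hy]. apply pr_lam in Hy; tauto.
  - intro Hx. exists (t x). now apply pr_lam.
Qed.

Lemma fun_ext f g : isfun f -> isfun g -> dom f = dom g ->
  (forall x, x ∈ dom f -> app f x = app g x) -> f = g.
Proof.
  assert (K : forall f g, isfun f -> isfun g -> dom f = dom g ->
    (forall x, x ∈ dom f -> app f x = app g x) -> subset f g).
  { intros f' g' Hf Hg Hd Ha p Hp.
    destruct (proj1 Hf p Hp) as (x & y & ->).
    assert (Hx : x ∈ dom f') by (apply mem_dom; eauto).
    rewrite <- (app_eq Hf Hp), Ha by auto. apply app_mem; auto. congruence. }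
  intros Hf Hg Hd Ha. apply subset_antisym; apply K; auto.
  intros x Hx. symmetry. apply Ha. congruence.
Qed.

Section Terms.
Context {Par : M -> Prop} {E : Type} {HE : Env M E}.
Implicit Types s t : E -> M.

Lemma df_fstp s : FW Par s -> FW Par (fun e => fstp (s e)).
Proof. intro. unfold fstp. df. Qed.
Lemma df_sndp s : FW Par s -> FW Par (fun e => sndp (s e)).
Proof. intro. unfold sndp. df. Qed.
Lemma df_app s t : FW Par s -> FW Par t -> FW Par (fun e => app (s e) (t e)).
Proof. intros. unfold app. df. Qed.
Lemma df_dom s : FW Par s -> FW Par (fun e => dom (s e)).
Proof. intros. unfold dom. df. Qed.
Lemma df_ran s : FW Par s -> FW Par (fun e => ran (s e)).
Proof. intros. unfold ran. df. Qed.
Lemma df_prod s t : FW Par s -> FW Par t -> FW Par (fun e => prod (s e) (t e)).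
Proof. intros. unfold prod. df. Qed.
Lemma df_pr s t : FW Par s -> FW Par t -> FW Par (fun e => pr (s e) (t e)).
Proof. intros. unfold pr. df. Qed.
Lemma df_cup s t : FW Par s -> FW Par t -> FW Par (fun e => cup (s e) (t e)).
Proof. intros. unfold cup. df. Qed.
Lemma df_osucc s : FW Par s -> FW Par (fun e => osucc (s e)).
Proof. intros. unfold osucc. df. Qed.
Lemma dfn_isfun s : FW Par s -> DW Par (fun e => isfun (s e)).
Proof. intros. unfold isfun. dfn. Qed.

End Terms.

Lemma df_lam {Par : M -> Prop} {E : Type} {HE : Env M E} (s : E -> M)
    (f : E -> M -> M) :
  FW Par s -> FW Par (fun e : E * M => f (fst e) (snd e)) ->
  FW Par (fun e => lam (s e) (f e)).
Proof.
  intros Hs Hf. unfold lam. apply df_img; auto. apply df_pr; auto. df.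
Qed.

End Pairs.

Ltac df_more1 := df_fun.
Ltac dfn_more1 := dfn_rel.
Ltac df_user ::=
  lazymatch goal with
  | |- DF _ _ (fun e => emp) => apply df_emp
  | |- DF _ _ (fun e => upair _ _) => apply df_upair; df
  | |- DF _ _ (fun e => bigU _) => apply df_bigU; df
  | |- DF _ _ (fun e => pow _) => apply df_pow; df
  | |- DF _ _ (fun e => img _ _) => apply df_img; df
  | |- DF _ _ (fun e => sep _ _) => apply df_sep; [df | dfn]
  | |- DF _ _ (fun e => cup _ _) => apply df_cup; df
  | |- DF _ _ (fun e => pr _ _) => apply df_pr; df
  | |- DF _ _ (fun e => osucc _) => apply df_osucc; df
  | |- DF _ _ (fun e => fstp _) => apply df_fstp; df
  | |- DF _ _ (fun e => sndp _) => apply df_sndp; df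
  | |- DF _ _ (fun e => app _ _) => apply df_app; df
  | |- DF _ _ (fun e => dom _) => apply df_dom; df
  | |- DF _ _ (fun e => ran _) => apply df_ran; df
  | |- DF _ _ (fun e => prod _ _) => apply df_prod; df
  | |- DF _ _ (fun e => lam _ _) => apply df_lam; df
  | |- _ => df_more
  end.
Ltac df_more ::= df_more1.
Ltac dfn_more ::=
  lazymatch goal with
  | |- Dfn _ _ (fun e => isfun _) => apply dfn_isfun; df
  | |- _ => dfn_more1
  end.

Section Restriction.
Context {M : structure} {HM : ZF M}.
Implicit Types x y z a b f g p : M.

Definition restr f a : M :=
  sep f (fun p => exists x y, x ∈ a /\ p = pr x y).

Lemma mem_restr f a p :
  p ∈ restr f a <-> p ∈ f /\ exists x y, x ∈ a /\ p = pr x y.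
Proof. unfold restr. now rewrite mem_sep by cls. Qed.

Lemma df_restr {Par : M -> Prop} {E : Type} {HE : Env M E} (s t : E -> M) :
  FW Par s -> FW Par t -> FW Par (fun e => restr (s e) (t e)).
Proof. intros. unfold restr. df. Qed.

Lemma restr_sub f g a : isfun g -> subset f g ->
  (forall z, z ∈ a -> exists w, pr z w ∈ f) -> restr g a = restr f a.
Proof.
  intros Hg Hfg Ha. apply zf_ext. intro p. rewrite !mem_restr.
  split; intros (Hp & x & y & Hx & ->); split; eauto.
  destruct (Ha x Hx) as [w Hw]. now rewrite (proj2 Hg x y w Hp (Hfg _ Hw)).
Qed.

End Restriction.

Ltac df_more ::=
  lazymatch goal with
  | |- DF _ _ (fun e => restr _ _) => apply df_restr; df
  | |- _ => df_more1
  end.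

(** * Definable recursion along set-like well-founded relations *)

Section Recursion.
Context {M : structure} {HM : ZF M}.
Implicit Types x y z a b f g p : M.

Definition approx (preds : M -> M) (step : M -> M -> M) f : Prop :=
  isfun f /\ forall x y, pr x y ∈ f ->
    (forall z, z ∈ preds x -> exists w, pr z w ∈ f) /\
    y = step x (restr f (preds x)).

Definition rec (preds : M -> M) (step : M -> M -> M) x : M :=
  the (fun y => exists f, approx preds step f /\ pr x y ∈ f).

Section Fixed.
Variables (preds : M -> M) (step : M -> M -> M).
Hypotheses (Hp : Fun1 preds) (Hs : Fun2 step).
Hypothesis Hwf : well_founded (fun z x => z ∈ preds x).
Local Notation apx := (approx preds step).

Lemma approx_agree f g x y y' :
  apx f -> apx g -> pr x y ∈ f -> pr x y' ∈ g -> y = y'.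
Proof.
  intros Hf Hg. revert y y'. induction x as [x IH] using (well_founded_ind Hwf).
  intros y y' Hy Hy'.
  destruct (proj2 Hf _ _ Hy) as [Hfx ->], (proj2 Hg _ _ Hy') as [Hgx ->].
  f_equal. apply zf_ext. intro p. rewrite !mem_restr.
  split; intros (Hpf & z & w & Hz & ->); split; eauto.
  - destruct (Hgx z Hz) as [w' Hw']. now rewrite (IH z Hz w w').
  - destruct (Hfx z Hz) as [w' Hw']. now rewrite <- (IH z Hz w' w).
Qed.

(** Membership in the intersection of all partial solutions defined at [z]. This solution is unique,
    so replacement can collect one for every predecessor in [approx_exists], with no choice among
    solutions. *)
Definition in_min_approx z p : Prop :=
  (exists f, apx f /\ z ∈ dom f) /\
  forall f, apx f -> z ∈ dom f -> p ∈ f.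

Lemma approx_sub f g : apx f -> subset g f ->
  (forall x y z, pr x y ∈ g -> z ∈ preds x -> exists w, pr z w ∈ g) ->
  apx g.
Proof.
  intros Hf Hgf Hg. assert (Ig : isfun g).
  { destruct Hf as [[F1 F2] _]. split; eauto. }
  split; auto. intros x y Hxy. split; [eauto |].
  destruct (proj2 Hf x y (Hgf _ Hxy)) as [_ ->].
  f_equal. apply restr_sub; eauto. apply Hf.
Qed.

Lemma min_approx z f : apx f -> z ∈ dom f ->
  exists g, apx g /\ z ∈ dom g /\ forall p, p ∈ g <-> in_min_approx z p.
Proof.
  intros Hf Hz. exists (sep f (in_min_approx z)).
  assert (HC : Cls (in_min_approx z)) by
    (unfold in_min_approx, approx; cls).
  assert (HE : forall p, p ∈ sep f (in_min_approx z) <-> in_min_approx z p).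
  { intro p. rewrite mem_sep by auto. split; [tauto |]. intros [H1 H2].
    split; [auto | split; auto]. }
  split; [| split; auto].
  - apply approx_sub with (f := f); auto.
    + intros p Hp'. rewrite mem_sep in Hp' by auto. tauto.
    + intros x y w Hxy Hw. rewrite HE in Hxy.
      destruct (proj2 Hf x y (proj2 Hxy f Hf Hz)) as [Hc _].
      destruct (Hc w Hw) as [u Hu]. exists u. rewrite HE. split; [eauto |].
      intros g Hg Hzg.
      destruct (proj2 Hg x y (proj2 Hxy g Hg Hzg)) as [Hc' _].
      destruct (Hc' w Hw) as [u' Hu'].
      now rewrite (approx_agree Hf Hg Hu Hu').
  - apply mem_dom in Hz as [y Hy]. apply mem_dom. exists y. rewrite HE.
    split; [exists f; split; auto; apply mem_dom; eauto |].
    intros g Hg Hzg. apply mem_dom in Hzg as [y' Hy'].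
    now rewrite (approx_agree Hf Hg Hy Hy').
Qed.

Lemma approx_exists x : exists f, apx f /\ x ∈ dom f.
Proof.
  induction x as [x IH] using (well_founded_ind Hwf).
  destruct (repl_exists (R := fun z g => forall p, p ∈ g <-> in_min_approx z p)
    (a := preds x)) as [S HS].
  { unfold in_min_approx, approx. cls. }
  { intros z Hz. destruct (IH z Hz) as (f & Hf & Hzf).
    destruct (min_approx Hf Hzf) as (g & _ & _ & Hg).
    exists g; split; auto. intros g' Hg'. apply zf_ext. intro p.
    now rewrite Hg, Hg'. }
  assert (HSa : forall g, g ∈ S -> apx g).
  { intros g Hg. apply HS in Hg as (z & Hz & Hg).
    destruct (IH z Hz) as (f & Hf & Hzf).
    destruct (min_approx Hf Hzf) as (g' & Hg' & _ & Hgg').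
    replace g with g'; auto. apply zf_ext. intro p. now rewrite Hg, Hgg'. }
  assert (HSd : forall z, z ∈ preds x -> exists w, pr z w ∈ bigU S).
  { intros z Hz. destruct (IH z Hz) as (f & Hf & Hzf).
    destruct (min_approx Hf Hzf) as (g' & Hg' & Hzg & Hgg').
    apply mem_dom in Hzg as [w Hw]. exists w. apply mem_bigU. exists g'.
    split; auto. apply HS. eauto. }
  set (u := bigU S).
  assert (Hu : apx u).
  { assert (Iu : isfun u).
    { split.
      - intros p Hp'. apply mem_bigU in Hp' as (g & Hg & Hpg).
        apply HSa in Hg. now apply Hg.
      - intros a b b' Hb Hb'. apply mem_bigU in Hb as (g & Hg & Hpg).
        apply mem_bigU in Hb' as (g' & Hg' & Hpg').
        eapply approx_agree; [apply HSa, Hg | apply HSa, Hg' | |]; eauto. }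
    split; auto. intros a b Hab. apply mem_bigU in Hab as (g & Hg & Hpg).
    destruct (proj2 (HSa g Hg) a b Hpg) as [Hc ->].
    assert (Hgu : subset g u) by (intros q Hq; apply mem_bigU; eauto).
    split.
    - intros z Hz. destruct (Hc z Hz) as [w Hw]. eauto.
    - f_equal. symmetry. apply restr_sub; auto. }
  (* The union [u] of the minimal solutions at the predecessors lacks at most the point [x] itself,
     whose value is forced by the recursion equation. *)
  set (y := step x (restr u (preds x))).
  set (h := cup u (upair (pr x y) (pr x y))).
  assert (Huh : subset u h) by (intros q Hq; apply mem_cup; auto).
  assert (Hh : forall p, p ∈ h <-> p ∈ u \/ p = pr x y).
  { intro p. unfold h. rewrite mem_cup, mem_upair. tauto. }
  assert (Hxu : forall b, pr x b ∈ u -> b = y).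
  { intros b Hb. apply (proj2 Hu) in Hb as [_ ->]. reflexivity. }
  assert (Ih : isfun h).
  { split.
    - intros p Hp'. apply Hh in Hp' as [Hp' | ->]; [now apply Hu | eauto].
    - intros a b b' Hb Hb'. apply Hh in Hb, Hb'.
      destruct Hb as [Hb | Hb], Hb' as [Hb' | Hb'].
      + eapply Hu; eauto.
      + apply pr_inj in Hb' as [-> ->]. auto.
      + apply pr_inj in Hb as [-> ->]. symmetry. auto.
      + apply pr_inj in Hb as [-> ->], Hb' as [_ ->]. auto. }
  exists h. split.
  - split; auto. intros a b Hab. apply Hh in Hab as [Hab | Hab].
    + destruct (proj2 Hu a b Hab) as [Hc ->]. split.
      * intros z Hz. destruct (Hc z Hz) as [w Hw]. eauto.
      * f_equal. symmetry. apply restr_sub; auto.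
    + apply pr_inj in Hab as [-> ->]. split.
      * intros z Hz. destruct (HSd z Hz) as [w Hw]. eauto.
      * unfold y. f_equal. symmetry. apply restr_sub; auto.
  - apply mem_dom. exists y. apply Hh. auto.
Qed.

Lemma rec_char x y :
  y = rec preds step x <-> exists f, apx f /\ pr x y ∈ f.
Proof.
  assert (K : exists f, apx f /\ pr x (rec preds step x) ∈ f).
  { unfold rec. apply the_spec with
      (P := fun y => exists f, apx f /\ pr x y ∈ f).
    destruct (approx_exists x) as (f & Hf & Hx).
    apply mem_dom in Hx as [w Hw]. eauto. }
  split; [intros ->; auto |]. intros (f & Hf & Hxy).
  destruct K as (g & Hg & Hxg). exact (approx_agree Hf Hg Hxy Hxg).
Qed.

Lemma Fun1_rec : Fun1 (rec preds step).
Proof.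
  apply df_char with (Q := fun (e : unit * M) y =>
    exists f, apx f /\ pr (snd e) y ∈ f).
  - unfold approx. dfn.
  - intros e. now apply rec_char.
  - intros e y H. now apply rec_char.
Qed.

Lemma rec_eq x :
  rec preds step x = step x (lam (preds x) (rec preds step)).
Proof.
  destruct (proj1 (rec_char x _) eq_refl) as (f & Hf & Hx).
  destruct (proj2 Hf _ _ Hx) as [Hc ->]. f_equal.
  apply zf_ext. intro p. rewrite mem_restr, mem_lam by apply Fun1_rec. split.
  - intros (Hpf & z & w & Hz & ->). exists z. split; auto. f_equal.
    apply rec_char. eauto.
  - intros (z & Hz & ->). split; [| eauto].
    destruct (Hc z Hz) as [w Hw]. replace (rec preds step z) with w; auto.
    apply rec_char. eauto.
Qed.

End Fixed.

Lemma df_rec {Par : M -> Prop} {E : Type} {HE : Env M E}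
    (preds : E -> M -> M) (step : E -> M -> M -> M) (t : E -> M) :
  (forall e, well_founded (fun z x => z ∈ preds e x)) ->
  FW Par (fun e : E * M => preds (fst e) (snd e)) ->
  FW Par (fun e : E * M * M => step (fst (fst e)) (snd (fst e)) (snd e)) ->
  FW Par t -> FW Par (fun e => rec (preds e) (step e) (t e)).
Proof.
  intros Hwf Hp Hs Ht.
  apply df_char with (Q := fun e y =>
    exists f, approx (preds e) (step e) f /\ pr (t e) y ∈ f).
  - apply dfn_ex. apply dfn_and; [| dfn]. unfold approx. cbv beta.
    apply dfn_and; [dfn |]. apply dfn_all. apply dfn_all. cbv beta.
    apply dfn_imp; [dfn |].
    assert (Hp' : FW Par (fun e : E * M * M * M * M =>
      preds (fst (fst (fst (fst e)))) (snd (fst e)))).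
    { apply (df_weak (t := fun e : E * M * M * M =>
        preds (fst (fst (fst e))) (snd e))).
      apply (df_ins1 (t := fun e => preds (fst (fst e)) (snd e))).
      apply (df_ins1 (t := fun e => preds (fst e) (snd e))). exact Hp. }
    apply dfn_and.
    + apply dfn_all. cbv beta. apply dfn_imp; [| dfn].
      apply dfn_mem; [df | exact (df_weak Hp')].
    + apply dfn_eq; [df |].
      (* Each [df_subst] turns one argument of [step] into a fresh last variable; the [df_ins2]
         steps then discard the variables in between. *)
      apply (df_subst (s := fun x : E * M * M * M * M * M =>
         step (fst (fst (fst (fst (fst x))))) (snd (fst (fst x))) (snd x))
        (t := fun e => restr (snd (fst (fst e)))
           (preds (fst (fst (fst (fst e)))) (snd (fst e))))).
      * apply (df_subst (s := fun q : E * M * M * M * M * M * M =>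
           step (fst (fst (fst (fst (fst (fst q)))))) (snd q) (snd (fst q)))
          (t := fun q => snd (fst (fst q)))); [| df].
        apply (df_subst (s := fun q : E * M * M * M * M * M * M * M =>
           step (fst (fst (fst (fst (fst (fst (fst q))))))) (snd (fst q))
             (snd q)) (t := fun q => snd (fst q))); [| df].
        apply (df_ins2 (t := fun q => step (fst (fst (fst (fst (fst (fst q))))))
          (snd (fst q)) (snd q))).
        apply (df_ins2 (t := fun q => step (fst (fst (fst (fst (fst q)))))
          (snd (fst q)) (snd q))).
        apply (df_ins2 (t := fun q => step (fst (fst (fst (fst q))))
          (snd (fst q)) (snd q))).
        apply (df_ins2 (t := fun q => step (fst (fst (fst q)))
          (snd (fst q)) (snd q))).
        apply (df_ins2 (t := fun q => step (fst (fst q))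
          (snd (fst q)) (snd q))).
        exact Hs.
      * apply df_restr; [df | exact Hp'].
  - intros e. apply rec_char; auto.
    + exact (df_fix (t := fun q => preds (fst q) (snd q)) e Hp).
    + exact (df_fix2 (t := fun q => step (fst (fst q)) (snd (fst q)) (snd q))
        e Hs).
  - intros e y H. apply rec_char; auto.
    + exact (df_fix (t := fun q => preds (fst q) (snd q)) e Hp).
    + exact (df_fix2 (t := fun q => step (fst (fst q)) (snd (fst q)) (snd q))
        e Hs).
Qed.

End Recursion.

(** * Ordinals and natural numbers *)

Section Ordinals.
Context {M : structure} {HM : ZF M}.
Implicit Types x y z a b c d f g p : M.

Lemma mem_irrefl x : ~ x ∈ x.
Proof.
  induction x as [x IH] using (well_founded_ind zf_wf). intro H. exact (IH x H H).
Qed.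

Lemma mem_asym x y : x ∈ y -> ~ y ∈ x.
Proof.
  revert y. induction x as [x IH] using (well_founded_ind zf_wf).
  intros y H K. exact (IH y K x K H).
Qed.

Lemma ord_mem a b : ordinal a -> b ∈ a -> ordinal b.
Proof.
  intros [Ht Hm] Hb. split; auto. intros y Hy. apply Hm. eapply Ht; eauto.
Qed.

Lemma ord_trans a b c : ordinal c -> a ∈ b -> b ∈ c -> a ∈ c.
Proof. intros [Ht _] H K. eapply Ht; eauto. Qed.

Lemma ord_total a b : ordinal a -> ordinal b -> a ∈ b \/ a = b \/ b ∈ a.
Proof.
  revert b. induction a as [a IHa] using (well_founded_ind zf_wf).
  intro b. induction b as [b IHb] using (well_founded_ind zf_wf).
  intros Ha Hb.
  destruct (classic (exists c, c ∈ a /\ (b ∈ c \/ b = c))) as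
    [(c & Hc & [H | ->]) | N1]; [right; right; eapply ord_trans; eauto | auto |].
  destruct (classic (exists d, d ∈ b /\ (a ∈ d \/ a = d))) as
    [(d & Hd & [H | ->]) | N2]; [left; eapply ord_trans; eauto | auto |].
  right; left. apply zf_ext. intro z. split; intro Hz.
  - destruct (IHa z Hz b) as [H | [H | H]]; eauto using ord_mem.
    + destruct N1. eauto.
    + destruct N1. eauto.
  - destruct (IHb z Hz) as [H | [H | H]]; eauto using ord_mem.
    + destruct N2. eauto.
    + destruct N2. eauto.
Qed.

Lemma ord_subset a b : ordinal a -> ordinal b ->
  subset a b -> a ∈ b \/ a = b.
Proof.
  intros Ha Hb H. destruct (ord_total Ha Hb) as [K | [K | K]]; auto.
  destruct (mem_irrefl (H b K)).
Qed.

Lemma ord_le_subset a b : ordinal b -> a ∈ b \/ a = b -> subset a b.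
Proof. intros [Ht _] [H | ->]; [now apply Ht | apply subset_refl]. Qed.

Lemma ord_osucc a : ordinal a -> ordinal (osucc a).
Proof.
  intros [Ht Hm]. split.
  - intros y Hy z Hz. apply mem_osucc. apply mem_osucc in Hy as [Hy | ->]; auto.
    left. eapply Ht; eauto.
  - intros y Hy. apply mem_osucc in Hy as [Hy | ->]; auto.
Qed.

Lemma ord_bigU a : (forall b, b ∈ a -> ordinal b) -> ordinal (bigU a).
Proof.
  intro H. split.
  - intros y Hy z Hz. apply mem_bigU in Hy as (b & Hb & Hy).
    apply mem_bigU. exists b. split; auto. eapply ord_trans; eauto.
  - intros y Hy. apply mem_bigU in Hy as (b & Hb & Hy). now apply (H b Hb).
Qed.

Lemma ord_set a : (forall b, b ∈ a -> ordinal b) ->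
  (forall b c, b ∈ a -> c ∈ b -> c ∈ a) -> ordinal a.
Proof. intros H K. split; [intros y Hy z Hz; eauto | intros y Hy; now apply H]. Qed.

Lemma ord_least (P : M -> Prop) a : ordinal a -> P a ->
  exists b, ordinal b /\ P b /\ forall c, c ∈ b -> ~ P c.
Proof.
  induction a as [a IH] using (well_founded_ind zf_wf). intros Ha Pa.
  destruct (classic (exists c, c ∈ a /\ P c)) as [(c & Hc & Pc) | N].
  - apply (IH c); auto. eapply ord_mem; eauto.
  - exists a. split; [| split]; auto. intros c Hc Pc. eauto.
Qed.

Lemma ord_emp : ordinal emp.
Proof. split; intros y Hy; destruct (mem_emp Hy). Qed.

Lemma no_set_of_ordinals a : ~ forall b, ordinal b -> b ∈ a.
Proof.
  intro H. set (o := sep a (fun b => ordinal b)).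
  assert (Ho : forall b, b ∈ o <-> ordinal b).
  { intro b. unfold o. rewrite mem_sep; [split; [tauto |]; auto |].
    unfold ordinal, transitive_set. cls. }
  apply (@mem_irrefl o). apply Ho. apply ord_set.
  - intro b. apply Ho.
  - intros b c Hb Hc. apply Ho. apply Ho in Hb. eapply ord_mem; eauto.
Qed.

Definition omega : M :=
  the (fun b => forall x, x ∈ b <-> forall w, emp ∈ w ->
    (forall y, y ∈ w -> osucc y ∈ w) -> x ∈ w).

Lemma mem_omega_def x : x ∈ omega <->
  forall w, emp ∈ w -> (forall y, y ∈ w -> osucc y ∈ w) -> x ∈ w.
Proof.
  revert x. apply the_set_spec.
  destruct zf_infinity as (w & (e & He & He') & Hs).
  exists (sep w (fun x => forall w, emp ∈ w ->
    (forall y, y ∈ w -> osucc y ∈ w) -> x ∈ w)).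
  intro x. rewrite mem_sep by cls. split; [tauto |].
  intro H. split; auto. apply H.
  - replace emp with e; auto. apply zf_ext. intro z. split; intro Hz.
    + destruct (He' z Hz).
    + destruct (mem_emp Hz).
  - intros y Hy. destruct (Hs y Hy) as (s & Hsw & Hss).
    replace (osucc y) with s; auto. apply zf_ext. intro z.
    rewrite mem_osucc. apply Hss.
Qed.

Fixpoint num (n : nat) : M :=
  match n with 0 => emp | S n => osucc (num n) end.

Lemma num_omega n : num n ∈ omega.
Proof.
  apply mem_omega_def. intros w H0 HS. induction n; simpl; auto.
Qed.

(** A nonzero element of [omega] is a successor, since otherwise deleting it would leave a smaller
    inductive set. Descending along the external well-foundedness therefore ends at [emp], and
    [omega] has standard elements only. *)
Lemma mem_omega x : x ∈ omega <-> exists n, x = num n.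
Proof.
  split; [| intros [n ->]; apply num_omega].
  induction x as [x IH] using (well_founded_ind zf_wf). intro Hx.
  destruct (classic (x = emp)) as [-> | N0]; [now exists 0 |].
  destruct (classic (exists y, y ∈ omega /\ x = osucc y)) as
    [(y & Hy & ->) | NS].
  - destruct (IH y) as [n ->]; auto; [apply mem_osucc; auto |].
    now exists (S n).
  - exfalso. assert (K : x ∈ sep omega (fun z => z <> x)).
    { rewrite mem_omega_def in Hx. apply Hx.
      - apply mem_sep; [cls | split; [apply (num_omega 0) | congruence]].
      - intros y Hy. rewrite mem_sep in * by cls. destruct Hy as [Hy Hyx].
        split.
        + rewrite mem_omega_def in *. intros w H0 HS. apply HS. apply Hy; auto.
        + intro E. apply NS. eauto. }
    rewrite mem_sep in K by cls. tauto.
Qed.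

Lemma ord_num n : ordinal (num n).
Proof. induction n; simpl; [apply ord_emp | now apply ord_osucc]. Qed.

Lemma ord_omega : ordinal omega.
Proof.
  apply ord_set.
  - intros b Hb. apply mem_omega in Hb as [n ->]. apply ord_num.
  - intros b c Hb Hc. apply mem_omega in Hb as [n ->].
    induction n; simpl in Hc; [destruct (mem_emp Hc) |].
    apply mem_osucc in Hc as [Hc | ->]; auto. apply num_omega.
Qed.

Lemma mem_num n x : x ∈ num n <-> exists m, m < n /\ x = num m.
Proof.
  induction n; simpl.
  - split; [intro H; destruct (mem_emp H) | intros (m & Hm & _); lia].
  - rewrite mem_osucc, IHn. split.
    + intros [(m & Hm & ->) | ->]; [exists m | exists n]; split; auto.
    + intros (m & Hm & ->). destruct (Nat.eq_dec m n) as [-> | ]; auto.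
      left. exists m. split; auto. lia.
Qed.

Lemma num_inj m n : num m = num n -> m = n.
Proof.
  intro E. destruct (Nat.lt_trichotomy m n) as [H | [H | H]]; auto; exfalso.
  - apply (@mem_irrefl (num n)). rewrite <- E at 1. apply mem_num. eauto.
  - apply (@mem_irrefl (num m)). rewrite E at 1. apply mem_num. eauto.
Qed.

Lemma omega_closed x : x ∈ omega -> osucc x ∈ omega.
Proof. intro H. apply mem_omega in H as [n ->]. apply (num_omega (S n)). Qed.

Section Terms.
Context {Par : M -> Prop} {E : Type} {HE : Env M E}.
Implicit Types s t u : E -> M.

Lemma df_omega : FW Par (fun _ : E => omega).
Proof.
  apply df_set with (Q := fun _ x => forall w, emp ∈ w ->
    (forall y, y ∈ w -> osucc y ∈ w) -> x ∈ w); [dfn |].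
  intros _. apply mem_omega_def.
Qed.

Lemma df_num n : FW Par (fun _ : E => num n).
Proof. induction n; simpl; df. Qed.

Lemma dfn_transitive_set s :
  FW Par s -> DW Par (fun e => transitive_set (s e)).
Proof. intro. unfold transitive_set. dfn. Qed.

Lemma dfn_ordinal s : FW Par s -> DW Par (fun e => ordinal (s e)).
Proof. intro. unfold ordinal, transitive_set. dfn. Qed.

Lemma dfn_is_pair s t u : FW Par s -> FW Par t -> FW Par u ->
  DW Par (fun e => is_pair (s e) (t e) (u e)).
Proof. intros. unfold is_pair, is_unordered_pair. dfn. Qed.

Lemma dfn_pair_in s t u : FW Par s -> FW Par t -> FW Par u ->
  DW Par (fun e => pair_in (s e) (t e) (u e)).
Proof. intros. unfold pair_in, is_pair, is_unordered_pair. dfn. Qed.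

End Terms.
End Ordinals.

Ltac df_more2 := df_fun.
Ltac dfn_more2 := dfn_rel.
Ltac df_more1 ::=
  lazymatch goal with
  | |- DF _ _ (fun e => omega) => apply df_omega
  | |- DF _ _ (fun e => num _) => apply df_num
  | |- _ => df_more2
  end.
Ltac dfn_more1 ::=
  lazymatch goal with
  | |- Dfn _ _ (fun e => transitive_set _) => apply dfn_transitive_set; df
  | |- Dfn _ _ (fun e => ordinal _) => apply dfn_ordinal; df
  | |- Dfn _ _ (fun e => is_pair _ _ _) => apply dfn_is_pair; df
  | |- Dfn _ _ (fun e => pair_in _ _ _) => apply dfn_pair_in; df
  | |- _ => dfn_more2
  end.

(** * The cumulative hierarchy and ranks *)

Section Rank.
Context {M : structure} {HM : ZF M}.
Implicit Types x y z a b c d f g p : M.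

Lemma img_ext a (f g : M -> M) :
  (forall x, x ∈ a -> f x = g x) -> img a f = img a g.
Proof.
  intro H. unfold img. f_equal. apply functional_extensionality. intro b.
  assert (K : forall y, (exists x, x ∈ a /\ y = f x) <->
    (exists x, x ∈ a /\ y = g x)).
  { intro y; split; intros (x & Hx & ->); exists x; split; auto.
    symmetry; auto. }
  apply propositional_extensionality.
  split; intros L y; rewrite L; [apply K | symmetry; apply K].
Qed.

Definition Vs a : M :=
  rec (fun a => a) (fun a g => bigU (img a (fun b => pow (app g b)))) a.
Definition rk a : M :=
  rec (fun a => a) (fun a g => bigU (img a (fun b => osucc (app g b)))) a.

Lemma df_Vs {Par : M -> Prop} {E : Type} {HE : Env M E} (t : E -> M) :
  FW Par t -> FW Par (fun e => Vs (t e)).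
Proof.
  intro H. unfold Vs.
  apply (df_rec (preds := fun _ a => a)
    (step := fun _ a g => bigU (img a (fun b => pow (app g b)))));
    [intros _; apply zf_wf | df | df | df].
Qed.

Lemma df_rk {Par : M -> Prop} {E : Type} {HE : Env M E} (t : E -> M) :
  FW Par t -> FW Par (fun e => rk (t e)).
Proof.
  intro H. unfold rk.
  apply (df_rec (preds := fun _ a => a)
    (step := fun _ a g => bigU (img a (fun b => osucc (app g b)))));
    [intros _; apply zf_wf | df | df | df].
Qed.

Lemma Fun1_Vs : Fun1 Vs.
Proof. apply df_Vs, df_snd. Qed.

Lemma Fun1_rk : Fun1 rk.
Proof. apply df_rk, df_snd. Qed.

Lemma Vs_eq a : Vs a = bigU (img a (fun b => pow (Vs b))).
Proof.
  unfold Vs at 1. rewrite rec_eq; [| cls | cls | apply zf_wf]. fold Vs.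
  f_equal. apply img_ext. intros b Hb. f_equal.
  apply app_lam; auto. apply Fun1_Vs.
Qed.

Lemma rk_eq a : rk a = bigU (img a (fun b => osucc (rk b))).
Proof.
  unfold rk at 1. rewrite rec_eq; [| cls | cls | apply zf_wf]. fold rk.
  f_equal. apply img_ext. intros b Hb. f_equal.
  apply app_lam; auto. apply Fun1_rk.
Qed.

End Rank.

Ltac df_more3 := df_fun.
Ltac dfn_more3 := dfn_rel.
Ltac df_more2 ::=
  lazymatch goal with
  | |- DF _ _ (fun e => Vs _) => apply df_Vs; df
  | |- DF _ _ (fun e => rk _) => apply df_rk; df
  | |- _ => df_more3
  end.
Ltac dfn_more2 ::= dfn_more3.

Section Rank2.
Context {M : structure} {HM : ZF M}.
Implicit Types x y z a b c d f g p : M.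

Lemma mem_Vs a x : x ∈ Vs a <-> exists b, b ∈ a /\ subset x (Vs b).
Proof.
  rewrite Vs_eq, mem_bigU. split.
  - intros (u & Hu & Hx). apply mem_img in Hu as (b & Hb & ->); [| cls].
    apply mem_pow in Hx. eauto.
  - intros (b & Hb & Hx). exists (pow (Vs b)). rewrite mem_pow. split; auto.
    apply mem_img; [cls |]. eauto.
Qed.

Lemma in_V_iff a x : in_V a x <-> x ∈ Vs a.
Proof.
  revert x. induction a as [a IH] using (well_founded_ind zf_wf). intro x.
  rewrite mem_Vs. split.
  - intros [b Hb H]. exists b. split; auto. intros y Hy. apply IH; auto.
  - intros (b & Hb & H). exists b; auto. intros y Hy. apply IH; auto.
Qed.

Lemma mem_rk a x : x ∈ rk a <-> exists b, b ∈ a /\ (x ∈ rk b \/ x = rk b).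
Proof.
  rewrite rk_eq, mem_bigU. split.
  - intros (u & Hu & Hx). apply mem_img in Hu as (b & Hb & ->); [| cls].
    apply mem_osucc in Hx. eauto.
  - intros (b & Hb & Hx). exists (osucc (rk b)). rewrite mem_osucc. split; auto.
    apply mem_img; [cls |]. eauto.
Qed.

Lemma ord_rk a : ordinal (rk a).
Proof.
  induction a as [a IH] using (well_founded_ind zf_wf). apply ord_set.
  - intros b Hb. apply mem_rk in Hb as (c & Hc & [Hb | ->]); auto.
    eapply ord_mem; eauto.
  - intros b c Hb Hc. apply mem_rk in Hb as (d & Hd & Hb). apply mem_rk.
    exists d. split; auto. destruct Hb as [Hb | ->]; auto.
    left. eapply ord_trans; eauto.
Qed.

Lemma Vs_mono a b : subset a b -> subset (Vs a) (Vs b).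
Proof.
  intros H x Hx. apply mem_Vs in Hx as (c & Hc & Hx). apply mem_Vs. eauto.
Qed.

Lemma Vs_subset a x y : subset x y -> y ∈ Vs a -> x ∈ Vs a.
Proof.
  intros H Hy. apply mem_Vs in Hy as (c & Hc & Hy). apply mem_Vs.
  exists c. split; auto. intros z Hz. auto.
Qed.

Lemma Vs_trans a x y : ordinal a -> x ∈ Vs a -> y ∈ x -> y ∈ Vs a.
Proof.
  intros Ha Hx Hy. apply mem_Vs in Hx as (c & Hc & Hx).
  apply Hx in Hy. revert Hy. apply Vs_mono. now apply (proj1 Ha).
Qed.

Lemma rk_in_Vs x : subset x (Vs (rk x)).
Proof.
  induction x as [x IH] using (well_founded_ind zf_wf). intros y Hy.
  apply mem_Vs. exists (rk y). split; auto. apply mem_rk. eauto.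
Qed.

Lemma mem_Vs_rk a x : ordinal a -> x ∈ Vs a <-> rk x ∈ a.
Proof.
  revert x. induction a as [a IH] using (well_founded_ind zf_wf).
  intros x Ha. split.
  - intro Hx. apply mem_Vs in Hx as (b & Hb & Hx).
    assert (Ob : ordinal b) by (eapply ord_mem; eauto).
    assert (K : subset (rk x) b).
    { intros z Hz. apply mem_rk in Hz as (y & Hy & Hz). apply Hx in Hy.
      apply IH in Hy; auto. destruct Hz as [Hz | ->]; auto.
      eapply ord_trans; eauto. }
    apply ord_subset in K as [K | ->]; auto using ord_rk.
    eapply ord_trans; eauto.
  - intro H. apply mem_Vs. exists (rk x). split; auto. apply rk_in_Vs.
Qed.

Lemma in_Vs_osucc_rk x : x ∈ Vs (osucc (rk x)).
Proof. apply mem_Vs_rk; [apply ord_osucc, ord_rk |]. apply mem_osucc; auto. Qed.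

Lemma rk_ord a : ordinal a -> rk a = a.
Proof.
  induction a as [a IH] using (well_founded_ind zf_wf). intro Ha.
  apply zf_ext. intro z. rewrite mem_rk. split.
  - intros (b & Hb & Hz). rewrite (IH b Hb) in Hz by (eapply ord_mem; eauto).
    destruct Hz as [Hz | ->]; auto. eapply ord_trans; eauto.
  - intro Hz. exists z. split; auto. right. symmetry. apply IH; auto.
    eapply ord_mem; eauto.
Qed.

Lemma ord_Vs a b : ordinal a -> ordinal b -> a ∈ Vs b <-> a ∈ b.
Proof. intros Ha Hb. rewrite mem_Vs_rk by auto. now rewrite rk_ord. Qed.

Lemma mem_rk_mem x y : x ∈ y -> rk x ∈ rk y.
Proof. intro H. apply mem_rk. eauto. Qed.

Lemma limit_osucc a b : limit_ordinal a -> b ∈ a -> osucc b ∈ a.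
Proof.
  intros (Ha & _ & Hl) Hb. destruct (Hl b Hb) as (c & Hc & Hbc).
  assert (Oc : ordinal c) by (eapply ord_mem; eauto).
  assert (Ob : ordinal b) by (eapply ord_mem; eauto).
  assert (K : subset (osucc b) c).
  { intros z Hz. apply mem_osucc in Hz as [Hz | ->]; auto.
    eapply ord_trans; eauto. }
  apply ord_subset in K as [K | K]; auto using ord_osucc.
  - eapply ord_trans; eauto.
  - now rewrite K.
Qed.

Lemma Vs_upair a x y : limit_ordinal a -> x ∈ Vs a -> y ∈ Vs a ->
  upair x y ∈ Vs a.
Proof.
  intros Ha Hx Hy. pose proof (proj1 Ha) as Oa.
  rewrite mem_Vs_rk in Hx, Hy by auto.
  assert (K : exists b, b ∈ a /\ subset (upair x y) (Vs b)).
  { destruct (ord_total (ord_rk x) (ord_rk y)) as [H | [H | H]].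
    - exists (osucc (rk y)). split; [now apply limit_osucc |].
      intros z Hz. apply mem_upair in Hz as [-> | ->].
      + apply mem_Vs_rk; [apply ord_osucc, ord_rk |]. apply mem_osucc; auto.
      + apply in_Vs_osucc_rk.
    - exists (osucc (rk y)). split; [now apply limit_osucc |].
      intros z Hz. apply mem_upair in Hz as [-> | ->].
      + rewrite <- H. apply in_Vs_osucc_rk.
      + apply in_Vs_osucc_rk.
    - exists (osucc (rk x)). split; [now apply limit_osucc |].
      intros z Hz. apply mem_upair in Hz as [-> | ->].
      + apply in_Vs_osucc_rk.
      + apply mem_Vs_rk; [apply ord_osucc, ord_rk |]. apply mem_osucc; auto. }
  now apply mem_Vs.
Qed.

Lemma Vs_pr a x y : limit_ordinal a -> x ∈ Vs a -> y ∈ Vs a -> pr x y ∈ Vs a.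
Proof. intros. unfold pr. auto using Vs_upair. Qed.

Lemma Vs_pr_inv a x y : ordinal a -> pr x y ∈ Vs a -> x ∈ Vs a /\ y ∈ Vs a.
Proof.
  intros Ha H. assert (K : upair x y ∈ Vs a).
  { eapply Vs_trans; eauto. apply mem_upair; auto. }
  split; eapply Vs_trans; eauto; apply mem_upair; auto.
Qed.

Lemma Vs_bounded a b x : b ∈ a -> subset x (Vs b) -> x ∈ Vs a.
Proof. intros Hb Hx. apply mem_Vs. eauto. Qed.

(** Scott's trick: the least [o] such that [Vs o] contains a value for [x] is unique, so replacement
    collects these ordinals, and their union is the bound. *)
Lemma collection (R : M -> M -> Prop) a : Rel2 R ->
  exists b, ordinal b /\
    forall x, x ∈ a -> (exists y, R x y) -> exists y, y ∈ Vs b /\ R x y.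
Proof.
  intro HR.
  set (Q := fun x o => ordinal o /\ (exists y, y ∈ Vs o /\ R x y) /\
    forall c, c ∈ o -> ~ exists y, y ∈ Vs c /\ R x y).
  destruct (repl_exists (R := Q) (a := sep a (fun x => exists y, R x y)))
    as [b Hb].
  - unfold Q. cls.
  - intros x Hx. apply mem_sep in Hx as [_ [y Hy]]; [| cls].
    destruct (@ord_least M HM (fun o => exists y, y ∈ Vs o /\ R x y)
      (osucc (rk y))) as (o & Oo & H1 & H2).
    + apply ord_osucc, ord_rk.
    + exists y. split; auto. apply in_Vs_osucc_rk.
    + exists o. split; [split; auto |]. intros o' (Oo' & H1' & H2').
      destruct (ord_total Oo Oo') as [H | [H | H]]; auto; exfalso.
      * exact (H2' o H H1).
      * exact (H2 o' H H1').
  - assert (Ob : forall o, o ∈ b -> ordinal o).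
    { intros o Ho. apply Hb in Ho as (x & _ & Ho). apply Ho. }
    exists (bigU b). split; [now apply ord_bigU |]. intros x Hx He.
    destruct He as [y Hy].
    destruct (@ord_least M HM (fun o => exists y, y ∈ Vs o /\ R x y)
      (osucc (rk y))) as (o & Oo & (w & Hw & Hxw) & H2).
    + apply ord_osucc, ord_rk.
    + exists y. split; auto. apply in_Vs_osucc_rk.
    + exists w. split; auto. apply (Vs_mono (a := o)); auto.
      intros z Hz. apply mem_bigU. exists o. split; auto. apply Hb.
      exists x. split; [apply mem_sep; [cls | split; eauto] |].
      split; [auto | split; [eauto | auto]].
Qed.

End Rank2.

(** * Well-orderings and cardinality *)

Section WellOrder.
Context {M : structure} {HM : ZF M}.
Implicit Types x y z a b c d f g h p : M.

(** [h] maps a subset of [a] onto a superset of [x]. *)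
Definition surj h a x : Prop :=
  isfun h /\ forall y, y ∈ x -> exists b, b ∈ a /\ pr b y ∈ h.

(** Choice is used in this form because an enumeration of names yields one of their values in the
    extension, and because [least] turns an enumeration into a definable selector. *)
Definition WO : Prop := forall x, exists a h, ordinal a /\ surj h a x.

Lemma dfn_surj {Par : M -> Prop} {E : Type} {HE : Env M E} (s t u : E -> M) :
  FW Par s -> FW Par t -> FW Par u ->
  DW Par (fun e => surj (s e) (t e) (u e)).
Proof. intros. unfold surj. dfn. Qed.

Lemma isfun_sub f g : subset f g -> isfun g -> isfun f.
Proof. intros H [H1 H2]. split; eauto. Qed.

(** The member of [x] that [h] enumerates first. *)
Definition least h a x : M :=
  bigU (sep x (fun y => exists b, b ∈ a /\ pr b y ∈ h /\
    forall c z, c ∈ b -> z ∈ x -> ~ pr c z ∈ h)).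

Lemma df_least {Par : M -> Prop} {E : Type} {HE : Env M E} (s t u : E -> M) :
  FW Par s -> FW Par t -> FW Par u ->
  FW Par (fun e => least (s e) (t e) (u e)).
Proof. intros. unfold least. df. Qed.

Lemma least_mem h a x u : ordinal a -> surj h a x -> subset u x ->
  (exists y, y ∈ u) -> least h a u ∈ u.
Proof.
  intros Oa [Hf Hs] Hux [y Hy]. destruct (Hs y (Hux y Hy)) as (b & Hb & Hby).
  destruct (@ord_least M HM (fun b => b ∈ a /\ exists y, y ∈ u /\ pr b y ∈ h) b)
    as (c & Oc & (Hca & w & Hw & Hcw) & Hl).
  { eapply ord_mem; eauto. } { eauto. }
  replace (least h a u) with w; auto. symmetry.
  assert (K : forall d z, d ∈ c -> z ∈ u -> ~ pr d z ∈ h).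
  { intros d z Hd Hz Hdz. apply (Hl d Hd). split; [| eauto].
    eapply ord_trans; eauto. }
  unfold least. apply zf_ext. intro z. rewrite mem_bigU. split.
  - intros (w' & Hw' & Hz).
    apply mem_sep in Hw' as [Hw' (c' & Hc' & Hcw' & K')]; [| cls].
    assert (c = c').
    { destruct (ord_total Oc (ord_mem Oa Hc')) as [L | [L | L]]; auto; exfalso.
      - exact (K' c w L Hw Hcw).
      - exact (K c' w' L Hw' Hcw'). }
    subst c'. now rewrite <- (proj2 Hf c w' w Hcw' Hcw).
  - intro Hz. exists w. split; auto. apply mem_sep; [cls |]. eauto 6.
Qed.

(** The measure [m] may be undefinable, since the induction is external. *)
Lemma wf_measure_ord (S : M) (lt : M -> M -> Prop) (m : M -> M) :
  (forall x y, x ∈ S -> y ∈ S -> lt x y -> m x ∈ m y) ->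
  well_founded (fun x y => x ∈ S /\ y ∈ S /\ lt x y).
Proof.
  intro H.
  assert (K : forall o x, m x = o ->
    Acc (fun x y => x ∈ S /\ y ∈ S /\ lt x y) x).
  { induction o as [o IH] using (well_founded_ind zf_wf). intros x <-.
    constructor. intros y (Hy & Hx & L). apply (IH (m y)); auto. }
  intro x. eapply K; eauto.
Qed.

Section Collapse.
Variables (S : M) (lt : M -> M -> Prop).
Hypotheses (Hlt : Rel2 lt)
  (lt_trans : forall x y z, x ∈ S -> y ∈ S -> z ∈ S ->
     lt x y -> lt y z -> lt x z)
  (lt_total : forall x y, x ∈ S -> y ∈ S -> lt x y \/ x = y \/ lt y x)
  (lt_wf : well_founded (fun x y => x ∈ S /\ y ∈ S /\ lt x y)).

Definition lt_below x : M := sep S (fun y => x ∈ S /\ lt y x).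

Lemma mem_lt_below x y : y ∈ lt_below x <-> y ∈ S /\ x ∈ S /\ lt y x.
Proof. unfold lt_below. rewrite mem_sep by cls. tauto. Qed.

(** The Mostowski collapse: the range of the recursive values is the set of the collapses of the
    predecessors. *)
Definition ot x : M := rec lt_below (fun x f => ran f) x.

Lemma Fun1_lt_below : Fun1 lt_below.
Proof. unfold lt_below. cls. Qed.

Lemma lt_below_wf : well_founded (fun z x => z ∈ lt_below x).
Proof.
  intro x. induction x as [x IH] using (well_founded_ind lt_wf). constructor.
  intros y H. apply IH. apply mem_lt_below in H. tauto.
Qed.

Lemma Fun1_ot : Fun1 ot.
Proof.
  apply Fun1_rec; [apply Fun1_lt_below | cls | apply lt_below_wf].
Qed.

Lemma mem_ot x z :
  z ∈ ot x <-> exists y, y ∈ S /\ x ∈ S /\ lt y x /\ z = ot y.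
Proof.
  unfold ot at 1.
  rewrite rec_eq; [| apply Fun1_lt_below | cls | apply lt_below_wf]. fold ot.
  rewrite mem_ran. split.
  - intros [y Hy]. apply pr_lam in Hy as [Hy ->]; [| apply Fun1_ot].
    apply mem_lt_below in Hy. exists y. tauto.
  - intros (y & Hy & Hx & L & ->). exists y. apply pr_lam; [apply Fun1_ot |].
    rewrite mem_lt_below. auto.
Qed.

Lemma ot_ord x : x ∈ S -> ordinal (ot x).
Proof.
  induction x as [x IH] using (well_founded_ind lt_wf). intro Hx. apply ord_set.
  - intros b Hb. apply mem_ot in Hb as (y & Hy & _ & L & ->). apply IH; auto.
  - intros b c Hb Hc. apply mem_ot in Hb as (y & Hy & _ & L & ->).
    apply mem_ot in Hc as (z & Hz & _ & L' & ->). apply mem_ot.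
    exists z. repeat split; auto. apply (lt_trans (y := y)); auto.
Qed.

Lemma ot_lt x y : x ∈ S -> y ∈ S -> lt x y -> ot x ∈ ot y.
Proof. intros. apply mem_ot. eauto 6. Qed.

Lemma ot_inj x y : x ∈ S -> y ∈ S -> ot x = ot y -> x = y.
Proof.
  intros Hx Hy E. destruct (lt_total Hx Hy) as [L | [L | L]]; auto; exfalso;
  apply ot_lt in L; auto; rewrite E in L; exact (mem_irrefl L).
Qed.

Lemma collapse_exists : exists o f, ordinal o /\ isfun f /\ dom f = S /\
  (forall x, x ∈ S -> app f x ∈ o) /\
  (forall z, z ∈ o -> exists x, x ∈ S /\ app f x = z) /\
  (forall x y, x ∈ S -> y ∈ S -> app f x = app f y -> x = y) /\
  (forall x z, x ∈ S -> z ∈ app f x ->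
     exists y, y ∈ S /\ lt y x /\ z = app f y).
Proof.
  pose proof Fun1_ot as HF.
  assert (Ha : forall x, x ∈ S -> app (lam S ot) x = ot x) by
    (intros; now apply app_lam).
  exists (img S ot), (lam S ot).
  refine (conj _ (conj _ (conj _ (conj _ (conj _ (conj _ _)))))).
  - apply ord_set.
    + intros b Hb. apply mem_img in Hb as (x & Hx & ->); auto. now apply ot_ord.
    + intros b c Hb Hc. apply mem_img in Hb as (x & Hx & ->); auto.
      apply mem_ot in Hc as (y & Hy & _ & _ & ->). apply mem_img; eauto.
  - now apply isfun_lam.
  - now apply dom_lam.
  - intros x Hx. rewrite Ha by auto. apply mem_img; eauto.
  - intros z Hz. apply mem_img in Hz as (x & Hx & ->); auto.
    exists x. auto.
  - intros x y Hx Hy. rewrite !Ha by auto. now apply ot_inj.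
  - intros x z Hx. rewrite Ha by auto. intro Hz.
    apply mem_ot in Hz as (y & Hy & _ & L & ->). exists y.
    rewrite Ha by auto. auto.
Qed.

End Collapse.

(** The axiom speaks of disjoint families, so each nonempty subset [u] of [x] is replaced by the set
    of the pairs [pr u y]. The resulting selector enumerates [x] by recursion; if this never
    stopped, replacement would make a set of all ordinals. *)
Lemma WO_of_choice :
  (forall a : M,
    (forall x, x ∈ a -> exists z, z ∈ x) ->
    (forall x y z, x ∈ a -> y ∈ a -> z ∈ x -> z ∈ y -> x = y) ->
    exists c, forall x, x ∈ a -> exists! z, z ∈ x /\ z ∈ c) -> WO.
Proof.
  intros AC x.
  set (fam := img (sep (pow x) (fun u => exists y, y ∈ u))
                  (fun u => img u (fun y => pr u y))).
  assert (Hfam : forall w, w ∈ fam <-> exists u, subset u x /\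
    (exists y, y ∈ u) /\ w = img u (fun y => pr u y)).
  { intro w. unfold fam. rewrite mem_img by cls. split.
    - intros (u & Hu & ->). apply mem_sep in Hu as [Hu Hy]; [| cls].
      apply mem_pow in Hu. eauto.
    - intros (u & Hu & Hy & ->). exists u. split; auto.
      apply mem_sep; [cls |]. rewrite mem_pow. auto. }
  destruct (AC fam) as [c Hc].
  { intros w Hw. apply Hfam in Hw as (u & _ & [y Hy] & ->).
    exists (pr u y). apply mem_img; [cls |]. eauto. }
  { intros w w' z Hw Hw' Hz Hz'.
    apply Hfam in Hw as (u & _ & _ & ->), Hw' as (u' & _ & _ & ->).
    apply mem_img in Hz as (y & _ & ->); [| cls].
    apply mem_img in Hz' as (y' & _ & E); [| cls].
    apply pr_inj in E as [-> _]. reflexivity. }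
  set (C := fun u => bigU (sep x (fun y => y ∈ u /\ pr u y ∈ c))).
  assert (HC : forall u, subset u x -> (exists y, y ∈ u) -> C u ∈ u).
  { intros u Hu Hy.
    destruct (Hc (img u (fun y => pr u y))) as (z & [Hz Hzc] & Hun).
    { apply Hfam. eauto. }
    apply mem_img in Hz as (w & Hw & ->); [| cls].
    replace (C u) with w; auto. symmetry.
    apply bigU_sep_unique; auto; [cls |]. intros y' [Hy' Hc'].
    assert (E : pr u w = pr u y').
    { apply Hun. split; auto. apply mem_img; [cls | eauto]. }
    now apply pr_inj in E. }
  set (rest := fun f => sep x (fun y => ~ exists b, pr b y ∈ f)).
  set (g := rec (fun a => a) (fun a f => C (rest f))).
  assert (Hg : Fun1 g).
  { apply Fun1_rec; [cls | unfold C, rest; cls | apply zf_wf]. }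
  assert (Eg : forall a, g a = C (rest (lam a g))).
  { intro a. unfold g at 1. rewrite rec_eq;
      [reflexivity | cls | unfold C, rest; cls | apply zf_wf]. }
  assert (Hrest : forall a y, y ∈ rest (lam a g) <->
    y ∈ x /\ forall b, b ∈ a -> y <> g b).
  { intros a y. unfold rest. rewrite mem_sep by cls. split.
    - intros [Hy N]. split; auto. intros b Hb ->. apply N. exists b.
      now apply pr_lam.
    - intros [Hy N]. split; auto. intros [b Hb].
      apply pr_lam in Hb as [Hb ->]; auto. exact (N b Hb eq_refl). }
  assert (Hsub : forall a, subset (rest (lam a g)) x).
  { intros a y Hy. apply Hrest in Hy. tauto. }
  destruct (classic (exists a, ordinal a /\ forall y, ~ y ∈ rest (lam a g)))
    as [(a & Oa & Ha) | N].
  - exists a, (lam a g). split; auto. split; [now apply isfun_lam |].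
    intros y Hy. apply NNPP. intro K. apply (Ha y). apply Hrest. split; auto.
    intros b Hb ->. apply K. exists b. split; auto. now apply pr_lam.
  - exfalso.
    assert (Hm : forall a, ordinal a -> g a ∈ rest (lam a g)).
    { intros a Oa. rewrite Eg. apply HC; auto. apply NNPP. intro K.
      apply N. exists a. split; auto. intros y Hy. eauto. }
    assert (Hinj : forall a b, ordinal a -> ordinal b -> g a = g b -> a = b).
    { intros a b Oa Ob E. destruct (ord_total Oa Ob) as [L | [L | L]]; auto;
        exfalso.
      - pose proof (Hm b Ob) as K. apply Hrest in K as [_ K].
        exact (K a L (eq_sym E)).
      - pose proof (Hm a Oa) as K. apply Hrest in K as [_ K].
        exact (K b L E). }
    destruct (repl_exists (R := fun y a => ordinal a /\ g a = y)
      (a := sep x (fun y => exists a, ordinal a /\ g a = y))) as [b Hb].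
    + cls.
    + intros y Hy. apply mem_sep in Hy as [_ (a & Oa & <-)]; [| cls].
      exists a. split; auto. intros a' [Oa' E]. symmetry. auto.
    + apply (@no_set_of_ordinals M HM b). intros a Oa. apply Hb.
      exists (g a). split; auto. apply mem_sep; [cls |]. split; eauto.
      eapply Hsub, Hm; auto.
Qed.

Lemma cantor h x : ~ surj h x (pow x).
Proof.
  intros [Hf Hs].
  destruct (Hs (sep x (fun y => exists u, pr y u ∈ h /\ ~ y ∈ u)))
    as (b & Hb & Hd).
  { apply mem_pow. intros z Hz. apply mem_sep in Hz as [Hz _]; [auto | cls]. }
  assert (K : b ∈ sep x (fun y => exists u, pr y u ∈ h /\ ~ y ∈ u) <->
    ~ b ∈ sep x (fun y => exists u, pr y u ∈ h /\ ~ y ∈ u)).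
  { rewrite mem_sep at 1 by cls. split.
    - intros (_ & u & Hu & N). now rewrite (proj2 Hf _ _ _ Hd Hu).
    - intro N. split; eauto. }
  tauto.
Qed.

Lemma is_bijection_fun f a b : is_bijection f a b -> isfun f.
Proof.
  intros [[H1 H2] _]. split.
  - intros p Hp. destruct (H1 p Hp) as (x & y & Hxy & _).
    apply is_pairE in Hxy. eauto.
  - intros x y y' Hy Hy'. assert (Hx : x ∈ a).
    { destruct (H1 _ Hy) as (x' & z & E & Hx & _). apply is_pairE in E.
      apply pr_inj in E as [-> _]. auto. }
    destruct (H2 x Hx) as (z & _ & U).
    rewrite <- (U y), <- (U y'); auto; now apply pair_inE.
Qed.

(** Composing the two maps sends a part of [x] onto the power set of [x], against [cantor]. *)
Lemma no_bijection_power f h a b x : is_bijection f x b -> subset a b ->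
  surj h a (pow x) -> False.
Proof.
  intros Hf Hab [Hh Hs].
  set (k := sep (prod x (pow x)) (fun p => exists c, pr (fstp p) c ∈ f /\
    pr c (sndp p) ∈ h)).
  assert (Hk : forall y u, pr y u ∈ k <-> (y ∈ x /\ u ∈ pow x) /\
    exists c, pr y c ∈ f /\ pr c u ∈ h).
  { intros y u. unfold k. rewrite mem_sep by cls.
    now rewrite pr_prod, fstp_pr, sndp_pr. }
  apply (@cantor k x). split; [split |].
  - intros p Hp. apply mem_sep in Hp as [Hp _]; [| cls].
    apply mem_prod in Hp as (y & u & _ & _ & ->). eauto.
  - intros y u u' Hu Hu'. apply Hk in Hu as (_ & c & Hc & Hu),
      Hu' as (_ & c' & Hc' & Hu').
    rewrite (proj2 (is_bijection_fun Hf) _ _ _ Hc' Hc) in Hu'.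
    exact (proj2 Hh _ _ _ Hu Hu').
  - intros u Hu. destruct (Hs u Hu) as (c & Hc & Hcu).
    destruct Hf as [[Hf1 _] Hf]. destruct (Hf c (Hab c Hc)) as (y & Hy & _).
    apply pair_inE in Hy. exists y.
    assert (y ∈ x).
    { destruct (Hf1 _ Hy) as (y' & z & E & Hx & _). apply is_pairE in E.
      apply pr_inj in E as [-> _]. auto. }
    split; auto. apply Hk. eauto.
Qed.

Lemma bijection_inverse f a b : isfun f -> dom f = a ->
  (forall x, x ∈ a -> app f x ∈ b) ->
  (forall z, z ∈ b -> exists x, x ∈ a /\ app f x = z) ->
  (forall x y, x ∈ a -> y ∈ a -> app f x = app f y -> x = y) ->
  exists g, is_bijection g b a.
Proof.
  intros Hf Hd H1 H2 H3.
  exists (img f (fun p => pr (sndp p) (fstp p))).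
  assert (K : forall x y,
    pr y x ∈ img f (fun p => pr (sndp p) (fstp p)) <-> pr x y ∈ f).
  { intros x y. rewrite mem_img by cls. split.
    - intros (p & Hp & E). destruct (proj1 Hf p Hp) as (x' & y' & ->).
      rewrite sndp_pr, fstp_pr in E. apply pr_inj in E as [-> ->]. auto.
    - intro H. exists (pr x y). now rewrite sndp_pr, fstp_pr. }
  assert (L : forall x y, pr x y ∈ f -> x ∈ a /\ y ∈ b /\ app f x = y).
  { intros x y Hxy. assert (x ∈ a) by (rewrite <- Hd; apply mem_dom; eauto).
    split; auto. rewrite <- (app_eq Hf Hxy). auto. }
  split; [split |].
  - intros p Hp. pose proof Hp as Hp'. apply mem_img in Hp as (q & Hq & ->);
      [| cls]. destruct (proj1 Hf q Hq) as (x & y & ->).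
    rewrite sndp_pr, fstp_pr in *. exists y, x. rewrite is_pairE.
    destruct (L x y Hq) as (? & ? & _). auto.
  - intros y Hy. destruct (H2 y Hy) as (x & Hx & <-). exists x.
    split; [apply pair_inE, K, app_mem; congruence |].
    intros x' Hx'. rewrite pair_inE, K in Hx'.
    destruct (L _ _ Hx') as (? & ? & ?). apply H3; auto.
  - intros x Hx. exists (app f x).
    split; [apply pair_inE, K, app_mem; congruence |].
    intros y Hy. rewrite pair_inE, K in Hy. now apply app_eq.
Qed.

End WellOrder.

(** * The forcing theorem *)

Section Forcing.
Context {V : structure} {HV : ZF V}.
Variables (P : V) (le : V -> V -> Prop).
Hypothesis (Hle : Rel2 le).
Implicit Types p q r s t x y : V.

Definition ext q p : Prop := q ∈ P /\ p ∈ P /\ le q p.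

Lemma Rel2_ext : Rel2 ext.
Proof. unfold ext. cls. Qed.
Local Hint Resolve Rel2_ext : core.

(** Forced equality of two names refers to forced equality of the members of their domains, so the
    recursion runs over pairs of names. *)
Definition eq_preds x : V := prod (dom (fstp x)) (dom (sndp x)).
Definition eq_half1 (F : V -> V -> V -> Prop) p s t : Prop :=
  forall a r q, pr a r ∈ s -> ext q p -> ext q r ->
    exists q' b r', ext q' q /\ pr b r' ∈ t /\ ext q' r' /\ F q' a b.
Definition eq_half2 (F : V -> V -> V -> Prop) p s t : Prop :=
  forall b r q, pr b r ∈ t -> ext q p -> ext q r ->
    exists q' a r', ext q' q /\ pr a r' ∈ s /\ ext q' r' /\ F q' a b.
Definition eq_step x g : V :=
  sep P (fun p =>
    eq_half1 (fun q a b => q ∈ app g (pr a b)) p (fstp x) (sndp x) /\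
    eq_half2 (fun q a b => q ∈ app g (pr a b)) p (fstp x) (sndp x)).

Definition feq p s t : Prop := p ∈ rec eq_preds eq_step (pr s t).
Definition fmem p s t : Prop :=
  p ∈ P /\ forall q, ext q p -> exists q' b r,
    ext q' q /\ pr b r ∈ t /\ ext q' r /\ feq q' s b.

Lemma dom_rk x y : x ∈ dom y -> rk x ∈ rk y.
Proof.
  intro H. apply mem_dom in H as [z Hz].
  assert (K : rk x ∈ rk (pr x z)).
  { apply (ord_trans (b := rk (upair x x))); [apply ord_rk | |];
      apply mem_rk_mem; apply mem_upair; auto. }
  eapply ord_trans; [apply ord_rk | apply K |]. now apply mem_rk_mem.
Qed.

Lemma dom_wf : well_founded (fun x y : V => x ∈ dom y).
Proof.
  assert (K : forall o x, rk x = o -> Acc (fun x y : V => x ∈ dom y) x).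
  { induction o as [o IH] using (well_founded_ind zf_wf). intros x <-.
    constructor. intros y Hy. apply (IH (rk y)); auto. now apply dom_rk. }
  intro x. eapply K; eauto.
Qed.

Lemma Fun1_eq_preds : Fun1 eq_preds.
Proof. unfold eq_preds. cls. Qed.

Lemma Fun2_eq_step : Fun2 eq_step.
Proof.
  pose proof Rel2_ext. unfold eq_step, eq_half1, eq_half2. cls.
Qed.

Lemma eq_preds_wf : well_founded (fun z x => z ∈ eq_preds x).
Proof.
  assert (K : forall o x, fstp x = o -> Acc (fun z x => z ∈ eq_preds x) x).
  { induction o as [o IH] using (well_founded_ind dom_wf). intros x <-.
    constructor. intros y Hy. apply mem_prod in Hy as (a & b & Ha & _ & ->).
    apply (IH a); auto. apply fstp_pr. }
  intro x. eapply K; eauto.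
Qed.

Lemma feq_eq p s t :
  feq p s t <-> p ∈ P /\ eq_half1 feq p s t /\ eq_half2 feq p s t.
Proof.
  unfold feq at 1.
  rewrite rec_eq; [| apply Fun1_eq_preds | apply Fun2_eq_step
    | apply eq_preds_wf].
  pose proof Rel2_ext as HR.
  unfold eq_step at 1. rewrite mem_sep by (unfold eq_half1, eq_half2; cls).
  rewrite fstp_pr, sndp_pr.
  assert (K : forall a b r r' q, pr a r ∈ s -> pr b r' ∈ t ->
    q ∈ app (lam (eq_preds (pr s t)) (rec eq_preds eq_step)) (pr a b) <->
    feq q a b).
  { intros a b r r' q Ha Hb. rewrite app_lam; [reflexivity | |].
    - apply Fun1_rec; [apply Fun1_eq_preds | apply Fun2_eq_step
        | apply eq_preds_wf].
    - unfold eq_preds. rewrite fstp_pr, sndp_pr. apply pr_prod.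
      split; apply mem_dom; eauto. }
  unfold eq_half1, eq_half2. split; intros (Hp & H1 & H2); repeat split; auto.
  - intros a r q Ha Hq Hr. destruct (H1 a r q Ha Hq Hr)
      as (q' & b & r' & X1 & X2 & X3 & X4). exists q', b, r'.
    repeat split; try tauto; try apply X1; try apply X3.
    eapply K; eauto.
  - intros b r q Hb Hq Hr. destruct (H2 b r q Hb Hq Hr)
      as (q' & a & r' & X1 & X2 & X3 & X4). exists q', a, r'.
    repeat split; try tauto; try apply X1; try apply X3.
    eapply K; eauto.
  - intros a r q Ha Hq Hr. destruct (H1 a r q Ha Hq Hr)
      as (q' & b & r' & X1 & X2 & X3 & X4). exists q', b, r'.
    repeat split; try tauto; try apply X1; try apply X3.
    eapply K; eauto.
  - intros b r q Hb Hq Hr. destruct (H2 b r q Hb Hq Hr)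
      as (q' & a & r' & X1 & X2 & X3 & X4). exists q', a, r'.
    repeat split; try tauto; try apply X1; try apply X3.
    eapply K; eauto.
Qed.

Section Definability.
Context {E : Type} {HE : Env V E}.
Local Notation W := (@whole V).

Lemma dfn_feq (a b c : E -> V) : FW W a -> FW W b -> FW W c ->
  DW W (fun e => feq (a e) (b e) (c e)).
Proof.
  intros. unfold feq. apply dfn_mem; auto.
  apply (df_rec (preds := fun _ x => eq_preds x) (step := fun _ => eq_step)).
  - intros _. apply eq_preds_wf.
  - unfold eq_preds. df.
  - pose proof Rel2_ext. unfold eq_step, eq_half1, eq_half2. df.
  - df.
Qed.

End Definability.

Lemma dfn_fmem {E : Type} {HE : Env V E} (a b c : E -> V) :
  FW (@whole V) a -> FW (@whole V) b -> FW (@whole V) c ->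
  DW (@whole V) (fun e => fmem (a e) (b e) (c e)).
Proof.
  intros. pose proof Rel2_ext. unfold fmem. apply dfn_and; [dfn |].
  apply dfn_all. apply dfn_imp; [dfn |].
  apply dfn_ex. apply dfn_ex. apply dfn_ex. cbv beta.
  repeat (apply dfn_and; [dfn |]). apply dfn_feq; df.
Qed.

Definition fneg (A : V -> Prop) p : Prop := p ∈ P /\ forall q, ext q p -> ~ A q.

(** [Or], [Imp] and [Ex] are expressed through [fneg], so that the conditions forcing a formula
    always form a regular open set ([Reg_forces]). *)
Fixpoint forces (f : form) (nv : nat -> V) p : Prop :=
  match f with
  | Mem x y => fmem p (nv x) (nv y)
  | Eq x y => feq p (nv x) (nv y)
  | Neg f => fneg (forces f nv) p
  | And f g => forces f nv p /\ forces g nv p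
  | Or f g => fneg (fun p => fneg (forces f nv) p /\ fneg (forces g nv) p) p
  | Imp f g => fneg (fun p => forces f nv p /\ fneg (forces g nv) p) p
  | All x f => p ∈ P /\ forall t, forces f (upd nv x t) p
  | Ex x f => fneg (fun p => p ∈ P /\ forall t, fneg (forces f (upd nv x t)) p) p
  end.

Lemma dfn_fneg {E : Type} {HE : Env V E} (A : E -> V -> Prop) (a : E -> V) :
  FW (@whole V) a -> DW (@whole V) (fun e : E * V => A (fst e) (snd e)) ->
  DW (@whole V) (fun e => fneg (A e) (a e)).
Proof.
  intros Ha HA. pose proof Rel2_ext. unfold fneg. apply dfn_and; [dfn |].
  apply dfn_all. apply dfn_imp; [dfn |]. apply dfn_not. exact HA.
Qed.

Lemma dfn_forces f : forall {E : Type} {HE : Env V E} (nv : E -> nat -> V)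
    (a : E -> V),
  (forall i, FW (@whole V) (fun e => nv e i)) -> FW (@whole V) a ->
  DW (@whole V) (fun e => forces f (nv e) (a e)).
Proof.
  induction f; intros E HE nv a Hn Ha; cbn [forces].
  - now apply dfn_fmem.
  - now apply dfn_feq.
  - apply dfn_fneg; auto. apply IHf; [| df]. intro i. exact (df_weak (Hn i)).
  - apply dfn_and; auto.
  - apply dfn_fneg; auto.
    apply dfn_and;
      (apply (dfn_fneg (A := fun e : E * V => forces _ (nv (fst e)))); [df |]).
    + apply IHf1; [| df]. intro i. exact (df_weak (df_weak (Hn i))).
    + apply IHf2; [| df]. intro i. exact (df_weak (df_weak (Hn i))).
  - apply dfn_fneg; auto. apply dfn_and.
    + apply IHf1; [| df]. intro i. exact (df_weak (Hn i)).
    + apply (dfn_fneg (A := fun e : E * V => forces _ (nv (fst e)))); [df |].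
      apply IHf2; [| df]. intro i. exact (df_weak (df_weak (Hn i))).
  - apply dfn_and; [dfn |]. apply dfn_all. cbv beta. apply IHf.
    + intro i. unfold upd. destruct (Nat.eqb i x); [df |].
      exact (df_weak (Hn i)).
    + exact (df_weak Ha).
  - apply dfn_fneg; auto. apply dfn_and; [dfn |]. apply dfn_all. cbv beta.
    apply (dfn_fneg (A := fun e : E * V * V =>
      forces f (upd (nv (fst (fst e))) x (snd e)))); [df |].
    apply IHf; [| df]. intro i. unfold upd. destruct (Nat.eqb i x); [df |].
    exact (df_weak (df_weak (df_weak (Hn i)))).
Qed.

Hypothesis le_refl : forall p, p ∈ P -> le p p.
Hypothesis le_trans : forall p q r, p ∈ P -> q ∈ P -> r ∈ P ->
  le r q -> le q p -> le r p.

Lemma ext_refl p : p ∈ P -> ext p p.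
Proof. intro. unfold ext. auto. Qed.

Lemma ext_trans r q p : ext r q -> ext q p -> ext r p.
Proof. unfold ext. intros (? & ? & ?) (? & ? & ?). eauto 6. Qed.

Ltac etr :=
  solve [ assumption
        | match goal with
          | H : ext ?a ?b |- ext ?a ?c => apply (ext_trans H); etr
          end ].

(** Regular open subsets of the poset. *)
Record Reg (A : V -> Prop) : Prop := {
  reg_in : forall p, A p -> p ∈ P;
  reg_mono : forall p q, A p -> ext q p -> A q;
  reg_dense : forall p, p ∈ P ->
    (forall q, ext q p -> exists r, ext r q /\ A r) -> A p }.

Lemma Reg_feq s t : Reg (fun p => feq p s t).
Proof.
  split.
  - intros p H. apply feq_eq in H. tauto.
  - intros p q H Hq. apply feq_eq in H as (Hp & H1 & H2). apply feq_eq.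
    split; [apply Hq | split].
    + intros a r q' Ha Hq' Hr. apply (H1 a r q'); auto.
      etr.
    + intros a r q' Ha Hq' Hr. apply (H2 a r q'); auto.
      etr.
  - intros p Hp H. apply feq_eq. split; [auto | split].
    + intros a r q Ha Hq Hr. destruct (H q Hq) as (q1 & Hq1 & Hf).
      apply feq_eq in Hf as (_ & H1 & _).
      destruct (H1 a r q1 Ha) as (q' & b & r' & X1 & X2).
      * apply ext_refl, Hq1.
      * etr.
      * exists q', b, r'. split; auto. etr.
    + intros a r q Ha Hq Hr. destruct (H q Hq) as (q1 & Hq1 & Hf).
      apply feq_eq in Hf as (_ & _ & H1).
      destruct (H1 a r q1 Ha) as (q' & b & r' & X1 & X2).
      * apply ext_refl, Hq1.
      * etr.
      * exists q', b, r'. split; auto. etr.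
Qed.

Lemma Reg_fmem s t : Reg (fun p => fmem p s t).
Proof.
  split.
  - intros p H. apply H.
  - intros p q [Hp H] Hq. split; [apply Hq |]. intros q' Hq'. apply H.
    etr.
  - intros p Hp H. split; auto. intros q Hq. destruct (H q Hq) as (r & Hr & Hm).
    destruct (proj2 Hm r) as (q' & b & r' & X1 & X2).
    + apply ext_refl, Hr.
    + exists q', b, r'. split; auto. etr.
Qed.

Lemma Reg_fneg A : (forall p q, A p -> ext q p -> A q) -> Reg (fneg A).
Proof.
  intro HA. split.
  - intros p H. apply H.
  - intros p q [Hp H] Hq. split; [apply Hq |]. intros q' Hq'. apply H.
    etr.
  - intros p Hp H. split; auto. intros q Hq Aq.
    destruct (H q Hq) as (r & Hr & _ & Hn). apply (Hn r).
    + apply ext_refl, Hr.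
    + eauto.
Qed.

Lemma Reg_and A B : Reg A -> Reg B -> Reg (fun p => A p /\ B p).
Proof.
  intros HA HB. split.
  - intros p [H _]. now apply HA.
  - intros p q [H1 H2] Hq. split; eapply reg_mono; eauto.
  - intros p Hp H. split.
    + apply HA; auto. intros q Hq. destruct (H q Hq) as (r & Hr & X & _). eauto.
    + apply HB; auto. intros q Hq. destruct (H q Hq) as (r & Hr & _ & X). eauto.
Qed.

Lemma Reg_all (A : V -> V -> Prop) : (forall t, Reg (A t)) ->
  Reg (fun p => p ∈ P /\ forall t, A t p).
Proof.
  intro HA. split.
  - tauto.
  - intros p q [Hp H] Hq. split; [apply Hq |]. intro t.
    eapply reg_mono; eauto.
  - intros p Hp H. split; auto. intro t. apply (HA t); auto.
    intros q Hq. destruct (H q Hq) as (r & Hr & _ & X). eauto.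
Qed.

Lemma Reg_forces f : forall nv, Reg (forces f nv).
Proof.
  induction f; intro nv; cbn [forces].
  - apply Reg_fmem.
  - apply Reg_feq.
  - apply Reg_fneg. apply IHf.
  - now apply Reg_and.
  - apply Reg_fneg. apply Reg_and; apply Reg_fneg; [apply IHf1 | apply IHf2].
  - apply Reg_fneg. apply Reg_and; auto. apply Reg_fneg, IHf2.
  - apply Reg_all. auto.
  - apply Reg_fneg. apply (Reg_all (A := fun t => fneg (forces f (upd nv x t)))).
    intro t. apply Reg_fneg, IHf.
Qed.

Lemma reg_decide A p : Reg A -> p ∈ P -> ~ A p -> exists q, ext q p /\ fneg A q.
Proof.
  intros HA Hp N. apply NNPP. intro K. apply N. apply HA; auto.
  intros q Hq. apply NNPP. intro K'. apply K. exists q. split; auto.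
  split; [apply Hq |]. intros r Hr Ar. eauto.
Qed.

Variables (G : V -> Prop) (N : structure) (val : V -> N).
Hypothesis HG : generic (fun p => p ∈ P) le G.
Hypothesis HN : generic_extension G val.

Lemma G_in p : G p -> p ∈ P.
Proof. apply HG. Qed.

Lemma G_common p q : G p -> G q -> exists r, G r /\ ext r p /\ ext r q.
Proof.
  intros Hp Hq. destruct HG as (H1 & _ & _ & H & _).
  destruct (H p q Hp Hq) as (r & Hr & X & Y). exists r. unfold ext. auto 8.
Qed.

Lemma G_up p q : G p -> ext p q -> G q.
Proof. intros Hp (X & Y & Z). destruct HG as (_ & _ & H & _). eauto. Qed.

(** Genericity concerns dense subsets of the whole poset. Below [p] the set [A] is used, and the
    conditions incompatible with [p] are added; none of the latter is in [G]. *)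
Lemma G_dense (A : V -> Prop) p : G p -> Cls A ->
  (forall q, ext q p -> exists r, ext r q /\ A r) ->
  exists r, G r /\ ext r p /\ A r.
Proof.
  intros Hp HA Hd. pose proof Rel2_ext as HR.
  destruct HG as (_ & _ & _ & _ & H).
  destruct (H (sep P (fun r => (ext r p /\ A r) \/
    ~ exists s, ext s r /\ ext s p))) as (d & Hd1 & Hd2).
  - intros x Hx. apply mem_sep in Hx; [tauto | cls].
  - intros q Hq. destruct (classic (exists s, ext s q /\ ext s p))
      as [(s & X & Y) | K].
    + destruct (Hd s Y) as (r & Hr & Ar). exists r.
      assert (ext r q) by (etr).
      rewrite mem_sep by cls. split; [split; [apply Hr |] |].
      * left. split; auto. etr.
      * apply H0.
    + exists q. rewrite mem_sep by cls. split; [tauto |].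
      now apply le_refl.
  - apply mem_sep in Hd1 as [_ [[X Y] | K]]; [| | cls]; [eauto |].
    destruct (G_common Hd2 Hp) as (s & _ & X & Y). destruct K. eauto.
Qed.

Lemma mem_val s z :
  z ∈ val s <-> exists t p, pr t p ∈ s /\ G p /\ z = val t.
Proof.
  destruct HN as (_ & _ & H). rewrite H.
  split; intros (t & p & X & Y); exists t, p; now rewrite pair_inE in *.
Qed.

Definition T (A : V -> Prop) : Prop := exists p, G p /\ A p.

Lemma T_neg A : Reg A -> Cls A -> T (fneg A) <-> ~ T A.
Proof.
  intros HA CA. pose proof Rel2_ext as HR. split.
  - intros (p & Gp & _ & Hn) (q & Gq & Aq).
    destruct (G_common Gp Gq) as (r & _ & X & Y).
    apply (Hn r X). eapply reg_mono; eauto.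
  - intro K. destruct HG as (_ & [p Gp] & _).
    destruct (@G_dense (fun q => A q \/ fneg A q) p Gp) as (r & Gr & _ & [X | X]).
    + unfold fneg. cls.
    + intros q Hq. destruct (classic (A q)) as [X | X].
      * exists q. split; auto. apply ext_refl, Hq.
      * destruct (reg_decide HA (proj1 Hq) X) as (r & Hr & Y). eauto.
    + destruct K. exists r. auto.
    + exists r. auto.
Qed.

Lemma T_and A B : Reg A -> Reg B -> T (fun p => A p /\ B p) <-> T A /\ T B.
Proof.
  intros HA HB. split.
  - intros (p & Gp & X & Y). split; exists p; auto.
  - intros [(p & Gp & X) (q & Gq & Y)].
    destruct (G_common Gp Gq) as (r & Gr & Z & W).
    exists r. repeat split; auto; eapply reg_mono; eauto.
Qed.

Lemma T_all (A : V -> V -> Prop) : (forall t, Reg (A t)) -> Rel2 A ->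
  T (fun p => p ∈ P /\ forall t, A t p) <-> forall t, T (A t).
Proof.
  intros HA CA. pose proof Rel2_ext as HR. split.
  - intros (p & Gp & _ & X) t. exists p. auto.
  - intro K. destruct HG as (_ & [p Gp] & _).
    destruct (@G_dense (fun q => (forall t, A t q) \/ exists t, fneg (A t) q)
      p Gp) as (r & Gr & _ & [X | [t X]]).
    + unfold fneg. cls.
    + intros q Hq. destruct (classic (forall t, A t q)) as [X | X].
      * exists q. split; auto. apply ext_refl, Hq.
      * apply not_all_ex_not in X as [t X].
        destruct (reg_decide (HA t) (proj1 Hq) X) as (r & Hr & Y). eauto.
    + exists r. split; auto. split; auto. now apply G_in.
    + destruct (K t) as (q & Gq & Aq).
      destruct (G_common Gr Gq) as (s & _ & Y & Z).
      destruct (proj2 X s Y). eapply reg_mono; eauto.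
Qed.

(** From left to right: the conditions that force equality together with those that witness the
    failure of one of its halves ([Q1], [Q2]) are dense, and a failure in [G] contradicts the
    equality of the values by the induction hypothesis. *)
Lemma feq_truth s t : val s = val t <-> T (fun p => feq p s t).
Proof.
  revert t. induction s as [s IH] using (well_founded_ind dom_wf). intro t.
  pose proof Rel2_ext as HR.
  assert (D3 : forall a : V, Rel2 (fun q b => feq q a b)).
  { intro a. apply dfn_feq; df. }
  assert (D3' : forall b : V, Rel2 (fun q a => feq q a b)).
  { intro b. apply dfn_feq; df. }
  split.
  - intro Ev. destruct HG as (_ & [p0 Gp0] & _).
    set (Q1 := fun p => exists a r, pr a r ∈ s /\ ext p r /\
      forall q b r', ext q p -> pr b r' ∈ t -> ext q r' -> ~ feq q a b).
    set (Q2 := fun p => exists b r, pr b r ∈ t /\ ext p r /\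
      forall q a r', ext q p -> pr a r' ∈ s -> ext q r' -> ~ feq q a b).
    assert (C1 : Cls Q1 /\ Cls Q2 /\ Cls (fun p => feq p s t)).
    { repeat split; unfold Q1, Q2, Cls.
      - apply dfn_ex, dfn_ex. cbv beta. repeat (apply dfn_and; [dfn |]).
        apply dfn_all, dfn_all, dfn_all. cbv beta.
        repeat (apply dfn_imp; [dfn |]). apply dfn_not, dfn_feq; df.
      - apply dfn_ex, dfn_ex. cbv beta. repeat (apply dfn_and; [dfn |]).
        apply dfn_all, dfn_all, dfn_all. cbv beta.
        repeat (apply dfn_imp; [dfn |]). apply dfn_not, dfn_feq; df.
      - apply dfn_feq; df. }
    destruct C1 as (C1 & C2 & C3).
    destruct (@G_dense (fun p => feq p s t \/ Q1 p \/ Q2 p) p0 Gp0)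
      as (r & Gr & _ & [X | [X | X]]).
    + cls.
    + intros p [Hp _]. destruct (classic (feq p s t)) as [X | X].
      { exists p. split; auto. now apply ext_refl. }
      rewrite feq_eq in X.
      destruct (classic (eq_half1 feq p s t)) as [Y | Y];
        [destruct (classic (eq_half2 feq p s t)) as [Z | Z]; [tauto |] |].
      * apply not_all_ex_not in Z as [b Z]. apply not_all_ex_not in Z as [r Z].
        apply not_all_ex_not in Z as [q Z].
        apply imply_to_and in Z as [Z1 Z]. apply imply_to_and in Z as [Z2 Z].
        apply imply_to_and in Z as [Z3 Z].
        exists q. split; auto. right; right. exists b, r. repeat split; auto;
          try apply Z3.
        intros q' a r' K1 K2 K3 K4. apply Z. exists q', a, r'. auto.
      * apply not_all_ex_not in Y as [b Z]. apply not_all_ex_not in Z as [r Z].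
        apply not_all_ex_not in Z as [q Z].
        apply imply_to_and in Z as [Z1 Z]. apply imply_to_and in Z as [Z2 Z].
        apply imply_to_and in Z as [Z3 Z].
        exists q. split; auto. right; left. exists b, r. repeat split; auto;
          try apply Z3.
        intros q' a r' K1 K2 K3 K4. apply Z. exists q', a, r'. auto.
    + exists r. auto.
    + exfalso. destruct X as (a & r0 & Ha & Hr0 & X).
      assert (Gr0 : G r0) by (eapply G_up; eauto).
      assert (Ha' : val a ∈ val s) by (apply mem_val; eauto).
      rewrite Ev in Ha'. apply mem_val in Ha' as (b & r' & Hb & Gr' & Eb).
      apply IH in Eb as (q & Gq & Hq); [| apply mem_dom; eauto].
      destruct (G_common Gr Gq) as (q1 & Gq1 & Y1 & Y2).
      destruct (G_common Gq1 Gr') as (q2 & Gq2 & Y3 & Y4).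
      apply (X q2 b r'); auto.
      * etr.
      * apply (reg_mono (Reg_feq a b) Hq). etr.
    + exfalso. destruct X as (b & r0 & Hb & Hr0 & X).
      assert (Gr0 : G r0) by (eapply G_up; eauto).
      assert (Ha' : val b ∈ val t) by (apply mem_val; eauto).
      rewrite <- Ev in Ha'. apply mem_val in Ha' as (a & r' & Ha & Gr' & Eb).
      symmetry in Eb.
      apply IH in Eb as (q & Gq & Hq); [| apply mem_dom; eauto].
      destruct (G_common Gr Gq) as (q1 & Gq1 & Y1 & Y2).
      destruct (G_common Gq1 Gr') as (q2 & Gq2 & Y3 & Y4).
      apply (X q2 a r'); auto.
      * etr.
      * apply (reg_mono (Reg_feq a b) Hq). etr.
  - intros (p & Gp & Hp). apply feq_eq in Hp as (_ & H1 & H2).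
    apply HN. intro z. split; intro Hz.
    + apply mem_val in Hz as (a & r & Ha & Gr & ->).
      destruct (G_common Gp Gr) as (q & Gq & X & Y).
      destruct (@G_dense (fun q' => exists b r', pr b r' ∈ t /\ ext q' r' /\
        feq q' a b) q Gq) as (q2 & Gq2 & _ & b & r' & Z1 & Z2 & Z3).
      * specialize (D3 a). cls.
      * intros q1 Hq1. destruct (H1 a r q1 Ha) as
          (q' & b & r' & X1 & X2 & X3 & X4); try (etr).
        eauto 8.
      * apply mem_val. exists b, r'. split; auto. split; [eapply G_up; eauto |].
        apply IH; [apply mem_dom; eauto |]. exists q2. auto.
    + apply mem_val in Hz as (b & r & Hb & Gr & ->).
      destruct (G_common Gp Gr) as (q & Gq & X & Y).
      destruct (@G_dense (fun q' => exists a r', pr a r' ∈ s /\ ext q' r' /\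
        feq q' a b) q Gq) as (q2 & Gq2 & _ & a & r' & Z1 & Z2 & Z3).
      * specialize (D3' b). cls.
      * intros q1 Hq1. destruct (H2 b r q1 Hb) as
          (q' & a & r' & X1 & X2 & X3 & X4); try (etr).
        eauto 8.
      * apply mem_val. exists a, r'. split; auto. split; [eapply G_up; eauto |].
        symmetry. apply IH; [apply mem_dom; eauto |]. exists q2. auto.
Qed.

Lemma fmem_truth s t : val s ∈ val t <-> T (fun p => fmem p s t).
Proof.
  pose proof Rel2_ext as HR. split.
  - intro H. apply mem_val in H as (b & r & Hb & Gr & Eb).
    apply feq_truth in Eb as (q & Gq & Hq).
    destruct (G_common Gr Gq) as (p & Gp & X & Y). exists p. split; auto.
    split; [now apply G_in |]. intros q1 Hq1. exists q1, b, r.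
    split; [apply ext_refl, Hq1 |]. split; auto. split; [etr |].
    apply (reg_mono (Reg_feq s b) Hq). etr.
  - intros (p & Gp & _ & H).
    assert (D3 : Rel2 (fun q b => feq q s b)) by (apply dfn_feq; df).
    destruct (@G_dense (fun q' => exists b r', pr b r' ∈ t /\ ext q' r' /\
        feq q' s b) p Gp) as (q2 & Gq2 & _ & b & r' & Z1 & Z2 & Z3).
    + cls.
    + intros q Hq. destruct (H q Hq) as (q' & b & r' & X1 & X2). eauto 8.
    + apply mem_val. exists b, r'. split; auto. split; [eapply G_up; eauto |].
      apply feq_truth. exists q2. auto.
Qed.

Lemma upd_val (nv : nat -> V) (x : nat) t :
  (fun n => val (upd nv x t n)) = upd (fun n => val (nv n)) x (val t).
Proof.
  apply functional_extensionality. intro n. unfold upd.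
  now destruct (Nat.eqb n x).
Qed.

Theorem forcing_truth f : forall nv,
  sat (@whole N) (fun n => val (nv n)) f <-> T (forces f nv).
Proof.
  assert (CF : forall f nv, Cls (forces f nv)).
  { intros g nv. apply (dfn_forces g (nv := fun _ : unit * V => nv));
      [intro; df | df]. }
  induction f; intro nv; cbn [sat forces].
  - apply fmem_truth.
  - apply feq_truth.
  - rewrite IHf. symmetry. apply T_neg; auto. apply Reg_forces.
  - rewrite IHf1, IHf2. symmetry. apply T_and; apply Reg_forces.
  - rewrite IHf1, IHf2. pose proof (CF f1 nv). pose proof (CF f2 nv).
    pose proof Rel2_ext.
    assert (R1 : Reg (fneg (forces f1 nv))) by apply Reg_fneg, Reg_forces.
    assert (R2 : Reg (fneg (forces f2 nv))) by apply Reg_fneg, Reg_forces.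
    rewrite T_neg, T_and, !T_neg; auto using Reg_forces, Reg_and.
    + tauto.
    + unfold fneg. cls.
  - rewrite IHf1, IHf2. pose proof (CF f1 nv). pose proof (CF f2 nv).
    pose proof Rel2_ext.
    assert (R1 : Reg (forces f1 nv)) by apply Reg_forces.
    assert (R2 : Reg (fneg (forces f2 nv))) by apply Reg_fneg, Reg_forces.
    rewrite T_neg, T_and, T_neg; auto using Reg_forces, Reg_and.
    + tauto.
    + unfold fneg. cls.
  - rewrite T_all.
    + split.
      * intros H t. apply IHf. rewrite upd_val. apply H. exact I.
      * intros H a _. destruct HN as (_ & Hs & _). destruct (Hs a) as [s ->].
        rewrite <- upd_val. now apply IHf.
    + intro t. apply Reg_forces.
    + apply (dfn_forces f (nv := fun e : unit * V * V =>
        upd nv x (snd (fst e)))); [| df].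
      intro i. unfold upd. destruct (Nat.eqb i x); df.
  - assert (DD : Rel2 (fun t p => fneg (forces f (upd nv x t)) p)).
    { apply (dfn_fneg (A := fun e : unit * V * V =>
        forces f (upd nv x (snd (fst e))))); [df |].
      apply (dfn_forces f (nv := fun e : unit * V * V * V =>
        upd nv x (snd (fst (fst e))))); [| df].
      intro i. unfold upd. destruct (Nat.eqb i x); df. }
    rewrite T_neg, (T_all (A := fun t => fneg (forces f (upd nv x t)))).
    + split.
      * intros (a & _ & H) K. destruct HN as (_ & Hs & _).
        destruct (Hs a) as [s ->]. rewrite <- upd_val in H. apply IHf in H.
        specialize (K s). rewrite T_neg in K; auto. apply Reg_forces.
      * intro K. apply not_all_ex_not in K as [t K].
        rewrite T_neg in K; auto using Reg_forces. apply NNPP in K.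
        apply IHf in K. rewrite upd_val in K. exists (val t).
        split; [exact I | auto].
    + intro t. apply Reg_fneg, Reg_forces.
    + exact DD.
    + apply (Reg_all (A := fun t => fneg (forces f (upd nv x t)))).
      intro t. apply Reg_fneg, Reg_forces.
    + cls.
Qed.

End Forcing.

(** * The generic extension *)

Record poset {V : structure} {HV : ZF V} (P : V) (le : V -> V -> Prop) : Prop := {
  po_rel : Rel2 le;
  po_refl : forall p, p ∈ P -> le p p;
  po_trans : forall p q r, p ∈ P -> q ∈ P -> r ∈ P -> le r q -> le q p -> le r p }.

(** * Check names, names of pairs and names of definable sets *)

Section CheckNames.
Context {V : structure} {HV : ZF V} (P : V).

Definition chk (x : V) : V := rec (fun x => x) (fun x g => prod (ran g) P) x.

Lemma Fun1_chk : Fun1 chk.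
Proof. apply Fun1_rec; [cls | cls | apply zf_wf]. Qed.

Lemma pr_chk x t p : pr t p ∈ chk x <-> p ∈ P /\ exists y, y ∈ x /\ t = chk y.
Proof.
  unfold chk at 1. rewrite rec_eq; [| cls | cls | apply zf_wf]. fold chk.
  rewrite pr_prod, mem_ran. split.
  - intros [[y Hy] Hp]. apply pr_lam in Hy as [Hy ->]; [eauto | apply Fun1_chk].
  - intros (Hp & y & Hy & ->). split; auto. exists y.
    apply pr_lam; [apply Fun1_chk | auto].
Qed.

Definition upn (s t : V) : V := prod (upair s t) P.
Definition opn (s t : V) : V := upn (upn s s) (upn s t).
Definition cn (D : V) (A : V -> V -> Prop) : V :=
  sep (prod D P) (fun x => A (fstp x) (sndp x)).

Lemma pr_cn D A t p : Rel2 A ->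
  pr t p ∈ cn D A <-> (t ∈ D /\ p ∈ P) /\ A t p.
Proof.
  intro HA. unfold cn. rewrite mem_sep by cls.
  now rewrite pr_prod, fstp_pr, sndp_pr.
Qed.

End CheckNames.

(** This compares two evaluations of names in the same model [N]: a check name has the same value
    for both. *)
Lemma identified_unique {V N : structure}
    (N_ext : forall a b : N, (forall z, z ∈ a <-> z ∈ b) -> a = b)
    (V_wf : well_founded (@mem V)) (x : V) : forall a b : N,
  identified x a -> identified x b -> a = b.
Proof.
  induction x as [x IH] using (well_founded_ind V_wf).
  intros a b [A1 A2] [B1 B2]. apply N_ext. intro z. split; intro Hz.
  - destruct (A2 z Hz) as (y & Hy & Iy). destruct (B1 y Hy) as (w & Hw & Iw).
    now rewrite (IH y Hy z w).
  - destruct (B2 z Hz) as (y & Hy & Iy). destruct (A1 y Hy) as (w & Hw & Iw).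
    now rewrite (IH y Hy z w).
Qed.

Section Extension.
Context {V : structure} {HV : ZF V} (P : V) (le : V -> V -> Prop).
Hypothesis (PO : poset P le).
Variables (G : V -> Prop) (N : structure) (val : V -> N).
Hypothesis HG : generic (fun p => p ∈ P) le G.
Hypothesis HN : generic_extension G val.
Implicit Types p q r s t : V.

Let Hle := po_rel PO.
Let le_refl := po_refl PO.
Let le_trans := po_trans PO.
Local Notation ext := (ext P le).
Local Notation feq := (feq P le).
Local Notation fmem := (fmem P le).
Local Notation forces := (forces P le).
Local Notation T := (T G).

Lemma truth f nv : sat (@whole N) (fun n => val (nv n)) f <-> T (forces f nv).
Proof. exact (forcing_truth Hle le_refl le_trans HG HN f nv). Qed.

Lemma truth_mem s t : val s ∈ val t <-> T (fun p => fmem p s t).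
Proof. exact (fmem_truth Hle le_refl le_trans HG HN s t). Qed.

Lemma val_surj a : exists s, a = val s.
Proof. apply HN. Qed.

Lemma N_ext (a b : N) : (forall z, z ∈ a <-> z ∈ b) -> a = b.
Proof. apply HN. Qed.

Lemma N_wf : well_founded (@mem N).
Proof.
  assert (K : forall s, Acc (@mem N) (val s)).
  { induction s as [s IH] using (well_founded_ind dom_wf). constructor.
    intros z Hz. apply (mem_val HN) in Hz as (t & p & Ht & _ & ->).
    apply IH, mem_dom. eauto. }
  intro a. destruct (val_surj a) as [s ->]. auto.
Qed.

Lemma val_cn D (A : V -> V -> Prop) z : Rel2 A ->
  z ∈ val (cn P D A) <-> exists t, t ∈ D /\ T (A t) /\ z = val t.
Proof.
  intro HA. rewrite (mem_val HN). split.
  - intros (t & p & H & Gp & ->). apply pr_cn in H as [[H1 H2] H3]; auto.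
    exists t. split; auto. split; auto. exists p. auto.
  - intros (t & Ht & (p & Gp & Ap) & ->). exists t, p. split; auto.
    apply pr_cn; auto. repeat split; auto. now apply (G_in HG).
Qed.

Lemma val_upn s t z : z ∈ val (upn P s t) <-> z = val s \/ z = val t.
Proof.
  rewrite (mem_val HN). unfold upn. split.
  - intros (u & p & H & Gp & ->). apply pr_prod in H as [H _].
    apply mem_upair in H as [-> | ->]; auto.
  - destruct HG as (_ & [p Gp] & _).
    intros [-> | ->]; [exists s, p | exists t, p]; rewrite pr_prod, mem_upair;
      repeat split; auto; now apply (G_in HG).
Qed.

Lemma T_and2 A B : Reg P le A -> Reg P le B ->
  T (fun p => A p /\ B p) <-> T A /\ T B.
Proof. exact (T_and HG (A := A) (B := B)). Qed.

Lemma N_separation f (v : nat -> N) (a : N) : exists b,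
  forall x, x ∈ b <-> x ∈ a /\ sat (@whole N) (upd v 0 x) f.
Proof.
  destruct (choice (fun n s => v n = val s)) as [nv Hnv].
  { intro n. apply val_surj. }
  destruct (val_surj a) as [s ->].
  set (A := fun t p => fmem p t s /\ forces f (upd nv 0 t) p).
  assert (HA : Rel2 A).
  { apply dfn_and; [apply dfn_fmem; [exact Hle | df | df | df] |].
    apply (dfn_forces P Hle f (nv := fun e : unit * V * V =>
      upd nv 0 (snd (fst e)))); [| df].
    intro i. unfold upd. destruct (Nat.eqb i 0); df. }
  assert (TA : forall t, T (A t) <->
    val t ∈ val s /\ sat (@whole N) (upd v 0 (val t)) f).
  { intro t. unfold A. rewrite T_and2.
    - rewrite <- truth_mem, <- truth, upd_val.
      replace (fun n => val (nv n)) with v; [reflexivity |].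
      now apply functional_extensionality.
    - apply (Reg_fmem le_refl le_trans).
    - apply (Reg_forces Hle le_refl le_trans). }
  exists (val (cn P (dom s) A)). intro x. rewrite val_cn by auto. split.
  - intros (t & _ & Ht & ->). now apply TA.
  - intros [Hx Hs]. pose proof Hx as Hx'.
    apply (mem_val HN) in Hx as (t & p & Ht & _ & ->).
    exists t. split; [apply mem_dom; eauto |]. split; auto. apply TA. auto.
Qed.

(** Collection in [V], applied to pairs of a member of [dom s] and a condition, yields one set of
    names that contains a name for the value at every element of [val s]. *)
Lemma N_replacement f (v : nat -> N) (a : N) :
  (forall x, x ∈ a -> exists! y, sat (@whole N) (upd (upd v 0 x) 1 y) f) ->
  exists b, forall y, y ∈ b <->
    exists x, x ∈ a /\ sat (@whole N) (upd (upd v 0 x) 1 y) f.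
Proof.
  intro Hf. destruct (choice (fun n s => v n = val s)) as [nv Hnv].
  { intro n. apply val_surj. }
  assert (Ev : (fun n => val (nv n)) = v) by
    (now apply functional_extensionality).
  destruct (val_surj a) as [s ->].
  destruct (collection (R := fun x t =>
    forces f (upd (upd nv 0 (fstp x)) 1 t) (sndp x)) (prod (dom s) P))
    as (o & _ & Ho).
  { apply (dfn_forces P Hle f (nv := fun e : unit * V * V =>
      upd (upd nv 0 (fstp (snd (fst e)))) 1 (snd e))); [| df].
    intro i. unfold upd. destruct (Nat.eqb i 1); [df |].
    destruct (Nat.eqb i 0); df. }
  set (A := fun t p => exists u, u ∈ dom s /\ fmem p u s /\
    forces f (upd (upd nv 0 u) 1 t) p).
  assert (HA : Rel2 A).
  { apply dfn_ex. apply dfn_and; [dfn |]. apply dfn_and.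
    - apply dfn_fmem; [exact Hle | df | df | df].
    - apply (dfn_forces P Hle f (nv := fun e : unit * V * V * V =>
        upd (upd nv 0 (snd e)) 1 (snd (fst (fst e))))); [| df].
      intro i. unfold upd. destruct (Nat.eqb i 1); [df |].
      destruct (Nat.eqb i 0); df. }
  assert (TF : forall t u, T (forces f (upd (upd nv 0 u) 1 t)) <->
    sat (@whole N) (upd (upd v 0 (val u)) 1 (val t)) f).
  { intros t u. now rewrite <- truth, !upd_val, Ev. }
  exists (val (cn P (Vs o) A)). intro y. rewrite val_cn by auto. split.
  - intros (t & _ & (p & Gp & u & _ & Hu & Hfu) & ->). exists (val u). split.
    + apply truth_mem. exists p. auto.
    + apply TF. exists p. auto.
  - intros (x & Hx & Hy). pose proof Hx as Hx'.
    apply (mem_val HN) in Hx as (u & r & Hu & _ & ->).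
    assert (Hud : u ∈ dom s) by (apply mem_dom; eauto).
    destruct (val_surj y) as [t0 ->]. apply TF in Hy as (p & Gp & Hp).
    destruct (Ho (pr u p)) as (t & Ht & Htf).
    + apply pr_prod. split; auto. now apply (G_in HG).
    + exists t0. now rewrite fstp_pr, sndp_pr.
    + rewrite fstp_pr, sndp_pr in Htf. exists t. split; auto. split.
      * apply truth_mem in Hx' as (q & Gq & Hq).
        destruct (G_common HG Gp Gq) as (q' & Gq' & X & Y). exists q'.
        split; auto. exists u. split; auto. split.
        -- apply (reg_mono (Reg_fmem le_refl le_trans u s) Hq Y).
        -- apply (reg_mono (Reg_forces Hle le_refl le_trans f _) Htf X).
      * destruct (Hf (val u) Hx') as (w & _ & Hu').
        rewrite <- (Hu' (val t0)), <- (Hu' (val t)); auto; apply TF;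
          exists p; auto.
Qed.

Lemma N_pairing (a b : N) : exists c, is_unordered_pair a b c.
Proof.
  destruct (val_surj a) as [s ->], (val_surj b) as [t ->].
  exists (val (upn P s t)). intro z. apply val_upn.
Qed.

Lemma N_union (a : N) : exists u, forall z, z ∈ u <-> exists y, y ∈ a /\ z ∈ y.
Proof.
  destruct (val_surj a) as [s ->]. pose proof (Rel2_ext P Hle) as HR.
  set (A := fun t p => exists u q r, pr u q ∈ s /\ pr t r ∈ u /\
    ext p q /\ ext p r).
  assert (HA : Rel2 A) by (unfold A; cls).
  exists (val (cn P (bigU (img (dom s) dom)) A)). intro z.
  rewrite val_cn by auto. split.
  - intros (t & _ & (p & Gp & u & q & r & X1 & X2 & X3 & X4) & ->).
    exists (val u). rewrite !(mem_val HN). split.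
    + exists u, q. repeat split; auto. apply (G_up HG Gp X3).
    + exists t, r. repeat split; auto. apply (G_up HG Gp X4).
  - intros (y & Hy & Hz). apply (mem_val HN) in Hy as (u & q & Hu & Gq & ->).
    apply (mem_val HN) in Hz as (t & r & Ht & Gr & ->). exists t.
    split; [| split; auto].
    + apply mem_bigU. exists (dom u). rewrite mem_img by cls.
      split; [exists u; split; auto |]; apply mem_dom; eauto.
    + destruct (G_common HG Gq Gr) as (p & Gp & X & Y). exists p.
      split; auto. exists u, q, r. auto.
Qed.

(** Every subset of [val s] has a name included in [prod (dom s) P], so the subsets of this product
    that are forced to be subsets of [s] are enough. *)
Lemma N_powerset (a : N) : exists b, forall z, z ∈ b <-> subset z a.
Proof.
  destruct (val_surj a) as [s ->]. pose proof (Rel2_ext P Hle) as HR.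
  set (A := fun t p => p ∈ P /\ forall u r q, pr u r ∈ t -> ext q p ->
    ext q r -> fmem q u s).
  assert (HA : Rel2 A).
  { apply dfn_and; [dfn |]. apply dfn_all, dfn_all, dfn_all. cbv beta.
    repeat (apply dfn_imp; [dfn |]). apply dfn_fmem; [exact Hle | df..]. }
  exists (val (cn P (pow (prod (dom s) P)) A)). intro z.
  rewrite val_cn by auto. split.
  - intros (t & _ & (p & Gp & _ & Hp) & ->) y Hy.
    apply (mem_val HN) in Hy as (u & r & Hu & Gr & ->).
    destruct (G_common HG Gp Gr) as (q & Gq & X & Y).
    apply truth_mem. exists q. split; auto. eapply Hp; eauto.
  - intro Hz. destruct (val_surj z) as [t0 ->].
    set (B := fun u r => fmem r u t0 /\ fmem r u s).
    assert (HB : Rel2 B) by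
      (apply dfn_and; (apply dfn_fmem; [exact Hle | df | df | df])).
    set (t := cn P (dom s) B). exists t. split; [| split].
    + apply mem_pow. intros x Hx. unfold t, cn in Hx.
      apply mem_sep in Hx; [tauto | cls].
    + destruct HG as (_ & [p Gp] & _). exists p. split; auto.
      split; [now apply (G_in HG) |]. intros u r q Hur _ Hq.
      apply pr_cn in Hur as [_ [_ Hur]]; auto.
      apply (reg_mono (Reg_fmem le_refl le_trans u s) Hur Hq).
    + apply N_ext. intro y. unfold t. rewrite val_cn by auto. split.
      * intro Hy. pose proof (Hz y Hy) as Hy'. pose proof Hy' as Hys.
        apply (mem_val HN) in Hy' as (u & r & Hu & Gr & ->).
        exists u. split; [apply mem_dom; eauto |]. split; auto.
        apply T_and2; try apply (Reg_fmem le_refl le_trans).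
        split; now apply truth_mem.
      * intros (u & _ & Hu & ->). apply truth_mem.
        destruct Hu as (p & Gp & X & _). exists p. auto.
Qed.

Definition ck (x : V) : N := val (chk P x).

Lemma mem_ck x z : z ∈ ck x <-> exists y, y ∈ x /\ z = ck y.
Proof.
  unfold ck at 1. rewrite (mem_val HN). split.
  - intros (t & p & Ht & _ & ->). apply pr_chk in Ht as (_ & y & Hy & ->).
    exists y. auto.
  - intros (y & Hy & ->). destruct HG as (_ & [p Gp] & _).
    exists (chk P y), p. split; auto. apply pr_chk. split; eauto.
    now apply (G_in HG).
Qed.

Lemma ck_identified x : identified x (ck x).
Proof.
  induction x as [x IH] using (well_founded_ind zf_wf). constructor.
  - intros y Hy. exists (ck y). split; auto. apply mem_ck. eauto.
  - intros b Hb. apply mem_ck in Hb as (y & Hy & ->). eauto.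
Qed.

Lemma ck_inj x : forall y, ck x = ck y -> x = y.
Proof.
  induction x as [x IH] using (well_founded_ind zf_wf). intros y E.
  apply zf_ext. intro z. split; intro Hz.
  - assert (K : ck z ∈ ck y) by (rewrite <- E; apply mem_ck; eauto).
    apply mem_ck in K as (w & Hw & Ew). now rewrite (IH z Hz w Ew).
  - assert (K : ck z ∈ ck x) by (rewrite E; apply mem_ck; eauto).
    apply mem_ck in K as (w & Hw & Ew). now rewrite <- (IH w Hw z (eq_sym Ew)).
Qed.

Lemma ck_mem x y : ck x ∈ ck y <-> x ∈ y.
Proof.
  rewrite mem_ck. split; [| eauto]. intros (z & Hz & E).
  apply ck_inj in E. now subst.
Qed.

Lemma N_infinity : exists w : N,
  (exists e, e ∈ w /\ forall z, ~ z ∈ e) /\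
  (forall x, x ∈ w -> exists x', x' ∈ w /\ forall z, z ∈ x' <-> z ∈ x \/ z = x).
Proof.
  exists (ck omega). split.
  - exists (ck emp). split; [apply ck_mem, (num_omega 0) |].
    intros z Hz. apply mem_ck in Hz as (y & Hy & _). destruct (mem_emp Hy).
  - intros x Hx. apply mem_ck in Hx as (y & Hy & ->). exists (ck (osucc y)).
    split; [now apply ck_mem, omega_closed |]. intro z. rewrite !mem_ck. split.
    + intros (w & Hw & ->). apply mem_osucc in Hw as [Hw | ->]; eauto.
    + intros [(w & Hw & ->) | ->]; [exists w | exists y];
        rewrite mem_osucc; auto.
Qed.

Lemma N_ZF : ZF N.
Proof.
  split; [exact N_ext | exact N_wf | exact N_pairing | exact N_union
    | exact N_powerset | exact N_infinity | exact N_separation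
    | exact N_replacement].
Qed.

End Extension.

Section ExtensionZF.
Context {V : structure} {HV : ZF V} (P : V) (le : V -> V -> Prop).
Hypothesis (PO : poset P le).
Variables (G : V -> Prop) (N : structure) (val : V -> N).
Hypothesis HG : generic (fun p => p ∈ P) le G.
Hypothesis HN : generic_extension G val.
Context {ZN : ZF N}.
Implicit Types p q r s t : V.
Local Notation ck := (ck P val).

Lemma val_opn s t : val (opn P s t) = pr (val s) (val t).
Proof.
  assert (U : forall s t, val (upn P s t) = upair (val s) (val t)).
  { intros s' t'. apply zf_ext. intro z. rewrite mem_upair.
    apply (val_upn HG HN). }
  unfold opn, pr. now rewrite !U.
Qed.

Lemma ck_ordinal x : ordinal x -> ordinal (ck x).
Proof.
  intros [H1 H2]. split.
  - intros y Hy z Hz. apply (mem_ck HG HN) in Hy as (y' & Hy' & ->).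
    apply (mem_ck HG HN) in Hz as (z' & Hz' & ->).
    apply (ck_mem HG HN). eapply H1; eauto.
  - intros y Hy z Hz w Hw. apply (mem_ck HG HN) in Hy as (y' & Hy' & ->).
    apply (mem_ck HG HN) in Hz as (z' & Hz' & ->).
    apply (mem_ck HG HN) in Hw as (w' & Hw' & ->).
    apply (ck_mem HG HN). eapply (H2 y'); eauto.
Qed.

Lemma ck_upair x y : ck (upair x y) = upair (ck x) (ck y).
Proof.
  apply zf_ext. intro z. rewrite (mem_ck HG HN), mem_upair. split.
  - intros (w & Hw & ->). apply mem_upair in Hw as [-> | ->]; auto.
  - intros [-> | ->]; [exists x | exists y]; rewrite mem_upair; auto.
Qed.

Lemma ck_pr x y : ck (pr x y) = pr (ck x) (ck y).
Proof. unfold pr. now rewrite !ck_upair. Qed.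

Lemma ck_emp : ck emp = emp.
Proof.
  apply zf_ext. intro z. rewrite (mem_ck HG HN). split.
  - intros (w & Hw & ->). destruct (mem_emp Hw).
  - intro H. destruct (mem_emp H).
Qed.

Lemma val_Vs a s : ordinal a -> s ∈ Vs a -> val s ∈ Vs (ck a).
Proof.
  revert s. induction a as [a IH] using (well_founded_ind zf_wf).
  intros s Oa Hs. apply mem_Vs in Hs as (b & Hb & Hs).
  assert (Ob : ordinal b) by (eapply ord_mem; eauto).
  apply mem_Vs. exists (ck b). split; [now apply (ck_mem HG HN) |].
  intros z Hz. apply (mem_val HN) in Hz as (t & p & Ht & _ & ->).
  apply IH; auto. apply Hs in Ht. now apply Vs_pr_inv in Ht.
Qed.

(** The rank of a value is at most the check of the rank of its name, and the elements of a check
    are checks. *)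
Lemma N_ordinal (a : N) : ordinal a -> exists b, ordinal b /\ a = ck b.
Proof.
  intro Oa. destruct (val_surj HN a) as [s E].
  assert (K : a ∈ Vs (ck (osucc (rk s)))).
  { rewrite E. apply val_Vs; [apply ord_osucc, ord_rk | apply in_Vs_osucc_rk]. }
  rewrite ord_Vs in K; auto; [| apply ck_ordinal, ord_osucc, ord_rk].
  apply (mem_ck HG HN) in K as (b & Hb & ->). exists b. split; auto.
  eapply ord_mem; [apply ord_osucc, ord_rk | eauto].
Qed.

(** The pairs of a check of an index and the value of the name with that index enumerate a set
    containing [val s]. Different indices have different checks, which makes this a function. *)
Lemma N_WO : WO (M := V) -> WO (M := N).
Proof.
  intros WV x. destruct (val_surj HN x) as [s ->].
  destruct (WV (dom s)) as (o & h & Oo & Hh & Hs).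
  set (f := prod (img (sep h (fun p => fstp p ∈ o))
    (fun p => opn P (chk P (fstp p)) (sndp p))) P).
  assert (HF : Fun1 (fun p => opn P (chk P (fstp p)) (sndp p))).
  { pose proof (Fun1_chk P). unfold opn, upn. cls. }
  assert (Hf : forall z, z ∈ val f <-> exists b t, b ∈ o /\ pr b t ∈ h /\
    z = pr (ck b) (val t)).
  { intro z. rewrite (mem_val HN). unfold f. split.
    - intros (u & p & Hu & _ & ->). apply pr_prod in Hu as [Hu _].
      apply mem_img in Hu as (q & Hq & ->); auto.
      apply mem_sep in Hq as [Hq Ho]; [| cls].
      destruct (proj1 Hh q Hq) as (b & t & ->).
      rewrite fstp_pr, sndp_pr in *. exists b, t. rewrite val_opn. auto.
    - intros (b & t & Hb & Hbt & ->). destruct HG as (Gin & [p Gp] & _).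
      exists (opn P (chk P b) t), p. rewrite val_opn. split; auto.
      apply pr_prod. split; auto. apply mem_img; auto. exists (pr b t).
      rewrite mem_sep by cls. rewrite fstp_pr, sndp_pr. auto. }
  exists (ck o), (val f). split; [now apply ck_ordinal |]. split; [split |].
  - intros p Hp. apply Hf in Hp as (b & t & _ & _ & ->). eauto.
  - intros a y y' Hy Hy'. apply Hf in Hy as (b & t & _ & Hbt & E),
      Hy' as (b' & t' & _ & Hbt' & E').
    apply pr_inj in E as [-> ->], E' as [E' ->].
    apply (ck_inj HG HN) in E'. subst b'. now rewrite (proj2 Hh _ _ _ Hbt Hbt').
  - intros y Hy. apply (mem_val HN) in Hy as (t & p & Ht & _ & ->).
    destruct (Hs t) as (b & Hb & Hbt); [apply mem_dom; eauto |].
    exists (ck b). split; [now apply (ck_mem HG HN) |]. apply Hf. eauto 6.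
Qed.

End ExtensionZF.

(** * Two filters with the same generic extension *)

Section Translation.
Context {V : structure} {HV : ZF V} (P : V).
Implicit Types p q r s t : V.

(** A name for the value of [s] with respect to the filter of the conditions
    [q] such that [R p q] for some [p] in the generic filter. *)
Definition tr (R : V -> V -> Prop) s : V :=
  rec dom (fun s g => sep (prod (ran g) P) (fun x => exists t q,
    pr t q ∈ s /\ fstp x = app g t /\ R (sndp x) q)) s.

Lemma pr_tr (R : V -> V -> Prop) s u p : Rel2 R ->
  pr u p ∈ tr R s <-> p ∈ P /\ exists t q, pr t q ∈ s /\ u = tr R t /\ R p q.
Proof.
  intro HR. assert (H1 : Fun1 (dom (M := V))) by cls.
  assert (H2 : Fun2 (fun s g : V => sep (prod (ran g) P) (fun x => exists t q,
    pr t q ∈ s /\ fstp x = app g t /\ R (sndp x) q))) by cls.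
  assert (HF : Fun1 (tr R)) by (apply Fun1_rec; auto; apply dom_wf).
  unfold tr at 1. rewrite rec_eq; auto; [| apply dom_wf]. fold (tr R).
  rewrite mem_sep by cls. rewrite pr_prod, fstp_pr, sndp_pr, mem_ran. split.
  - intros [[_ Hp] (t & q & Ht & -> & Hr)]. split; auto. exists t, q.
    rewrite app_lam; auto. apply mem_dom. eauto.
  - intros (Hp & t & q & Ht & -> & Hr).
    assert (Hd : t ∈ dom s) by (apply mem_dom; eauto).
    split; [split; auto |].
    + exists t. apply pr_lam; auto.
    + exists t, q. rewrite app_lam; auto.
Qed.

(** [G] and [G'] are definable from each other through [R] and [R']. Hence [tr R] turns names for
    [G'] into names for [G], and [tr R'] shows that every element of [N] is reached from [G']. *)
Lemma generic_extension_translate (G G' : V -> Prop) (N : structure)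
    (val : V -> N) (R R' : V -> V -> Prop) : Rel2 R -> Rel2 R' ->
  (forall p, G p -> p ∈ P) -> (forall p, G' p -> p ∈ P) ->
  (forall q, G' q <-> exists p, G p /\ R p q) ->
  (forall p, G p <-> exists q, G' q /\ R' q p) ->
  generic_extension G val -> exists val' : V -> N, generic_extension G' val'.
Proof.
  intros HR HR' GP GP' GG' G'G (He & Hs & Hv).
  assert (mv : forall s z, z ∈ val s <->
    exists t p, pr t p ∈ s /\ G p /\ z = val t).
  { intros s z. rewrite Hv. split; intros (t & p & X & Y); exists t, p;
      now rewrite pair_inE in *. }
  set (val' := fun s => val (tr R s)).
  assert (mv' : forall s z, z ∈ val' s <->
    exists t p, pr t p ∈ s /\ G' p /\ z = val' t).
  { intros s z. unfold val' at 1. rewrite mv. split.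
    - intros (u & p & Hu & Gp & ->). apply pr_tr in Hu as
        (_ & t & q & Ht & -> & Hr); auto. exists t, q. repeat split; auto.
      apply GG'. eauto.
    - intros (t & q & Ht & Gq & ->). apply GG' in Gq as (p & Gp & Hr).
      exists (tr R t), p. split; [| split; auto]. apply pr_tr; auto.
      split; eauto. }
  exists val'. split; [auto | split].
  - intro a. destruct (Hs a) as [s ->]. exists (tr R' s).
    induction s as [s IH] using (well_founded_ind dom_wf).
    apply He. intro z. rewrite mv, mv'. split.
    + intros (t & p & Ht & Gp & ->). apply G'G in Gp as (q & Gq & Hr).
      exists (tr R' t), q. split; [| split; auto].
      * apply pr_tr; auto. split; eauto.
      * apply IH. apply mem_dom. eauto.
    + intros (u & q & Hu & Gq & ->). apply pr_tr in Hu as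
        (_ & t & p & Ht & -> & Hr); auto. exists t, p. split; auto. split.
      * apply G'G. eauto.
      * symmetry. apply IH, mem_dom. eauto.
  - intros s z. rewrite mv'. split; intros (t & p & X & Y); exists t, p;
      now rewrite pair_inE in *.
Qed.

End Translation.

(** * Prikry forcing *)

Section FiniteSets.
Context {M : structure} {HM : ZF M}.
Implicit Types x y z a b c s t u k : M.

(** For sets of ordinals this is finiteness: no infinite ascending sequence. *)
Definition finset s : Prop :=
  forall u, subset u s -> (exists x, x ∈ u) ->
    exists m, m ∈ u /\ forall x, x ∈ u -> x ∈ m \/ x = m.

Lemma dfn_finset {Par : M -> Prop} {E : Type} {HE : Env M E} (a : E -> M) :
  FW Par a -> DW Par (fun e => finset (a e)).
Proof. intro. unfold finset. dfn. Qed.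

Lemma finset_sub s t : finset t -> subset s t -> finset s.
Proof. intros H K u Hu. apply H. intros x Hx. auto. Qed.

Lemma list_max (l : list M) : forall u,
  (forall x, x ∈ u -> In x l /\ ordinal x) -> (exists x, x ∈ u) ->
  exists m, m ∈ u /\ forall x, x ∈ u -> x ∈ m \/ x = m.
Proof.
  induction l as [| a l IH]; intros u Hu [x0 Hx0].
  { destruct (Hu x0 Hx0) as [[] _]. }
  destruct (classic (exists x, x ∈ u /\ x <> a)) as [(x & Hx & Nx) | K].
  - destruct (IH (sep u (fun x => x <> a))) as (m & Hm & Hmax).
    + intros z Hz. apply mem_sep in Hz as [Hz Nz]; [| cls].
      destruct (Hu z Hz) as [[-> | H] O]; [congruence | auto].
    + exists x. apply mem_sep; [cls | auto].
    + apply mem_sep in Hm as [Hm Nm]; [| cls].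
      assert (Hm' : forall z, z ∈ u -> z <> a -> z ∈ m \/ z = m).
      { intros z Hz Nz. apply Hmax. apply mem_sep; [cls | auto]. }
      destruct (classic (a ∈ u)) as [Ha | Ha].
      * destruct (ord_total (proj2 (Hu a Ha)) (proj2 (Hu m Hm)))
          as [L | [L | L]].
        -- exists m. split; auto. intros z Hz.
           destruct (classic (z = a)) as [-> |]; auto.
        -- congruence.
        -- exists a. split; auto. intros z Hz.
           destruct (classic (z = a)) as [-> | Nz]; auto. left.
           destruct (Hm' z Hz Nz) as [X | ->]; auto.
           eapply ord_trans; eauto. apply (proj2 (Hu a Ha)).
      * exists m. split; auto. intros z Hz. apply Hm'; auto. congruence.
  - exists a. assert (a ∈ u).
    { destruct (classic (x0 = a)) as [<- |]; auto. destruct K. eauto. }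
    split; auto. intros z Hz. right. apply NNPP. intro. apply K. eauto.
Qed.

(** Taking away the largest element repeatedly is a descent in the ordinals, so it stops after
    externally finitely many steps. *)
Lemma finset_list k s : ordinal k -> subset s k ->
  finset s <-> exists l, forall x, x ∈ s <-> In x l.
Proof.
  intros Ok Hs. split.
  - intro Hf. assert (K : forall a, ordinal a ->
      exists l, forall x, (x ∈ s /\ x ∈ a) <-> In x l).
    { induction a as [a IH] using (well_founded_ind zf_wf). intro Oa.
      destruct (classic (exists x, x ∈ s /\ x ∈ a)) as [(x & Hx & Hxa) | N].
      - destruct (Hf (sep s (fun x => x ∈ a))) as (m & Hm & Hmax).
        + intros z Hz. apply mem_sep in Hz; [tauto | cls].
        + exists x. apply mem_sep; [cls | auto].
        + apply mem_sep in Hm as [Hms Hma]; [| cls].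
          destruct (IH m Hma (ord_mem Oa Hma)) as [l Hl].
          exists (m :: l). intro z. simpl. rewrite <- Hl. split.
          * intros [Hz Hza]. destruct (Hmax z) as [X | ->]; auto.
            apply mem_sep; [cls | auto].
          * intros [<- | [X Y]]; auto. split; auto. eapply ord_trans; eauto.
      - exists nil. intro z. simpl. split; [| tauto]. intros [X Y]. eauto. }
    destruct (K k Ok) as [l Hl]. exists l. intro x. rewrite <- Hl.
    split; [auto | tauto].
  - intros [l Hl] u Hu He. apply (list_max (l := l)); auto.
    intros x Hx. split; [now apply Hl, Hu |]. eapply ord_mem; eauto.
Qed.

Lemma finset_emp : finset emp.
Proof. intros u Hu [x Hx]. destruct (mem_emp (Hu x Hx)). Qed.

Definition add s x : M := cup s (upair x x).
Definition rmv s x : M := sep s (fun y => y <> x).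

Lemma mem_add s x y : y ∈ add s x <-> y ∈ s \/ y = x.
Proof. unfold add. rewrite mem_cup, mem_upair. tauto. Qed.

Lemma mem_rmv s x y : y ∈ rmv s x <-> y ∈ s /\ y <> x.
Proof. unfold rmv. now rewrite mem_sep by cls. Qed.

Lemma df_add {Par : M -> Prop} {E : Type} {HE : Env M E} (a b : E -> M) :
  FW Par a -> FW Par b -> FW Par (fun e => add (a e) (b e)).
Proof. intros. unfold add. df. Qed.

Lemma df_rmv {Par : M -> Prop} {E : Type} {HE : Env M E} (a b : E -> M) :
  FW Par a -> FW Par b -> FW Par (fun e => rmv (a e) (b e)).
Proof. intros. unfold rmv. df. Qed.

Lemma finset_add k s x : ordinal k -> subset s k -> x ∈ k -> finset s ->
  finset (add s x).
Proof.
  intros Ok Hs Hx Hf. apply (finset_list Ok Hs) in Hf as [l Hl].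
  apply (finset_list (k := k)); auto.
  - intros y Hy. apply mem_add in Hy as [Hy | ->]; auto.
  - exists (x :: l). intro y. rewrite mem_add, Hl. simpl.
    split; intros [|]; auto.
Qed.

Lemma finset_bounded k s : limit_ordinal k -> subset s k -> finset s ->
  exists b, b ∈ k /\ subset s b.
Proof.
  intros Lk Hs Hf. destruct (classic (exists x, x ∈ s)) as [He | N].
  - destruct (Hf s (@subset_refl M s) He) as (m & Hm & Hmax).
    exists (osucc m). split; [apply limit_osucc; auto |].
    intros x Hx. apply mem_osucc. auto.
  - destruct Lk as (_ & [b Hb] & _). exists b. split; auto.
    intros x Hx. destruct N. eauto.
Qed.

Lemma finset_Vs k s : limit_ordinal k -> subset s k -> finset s -> s ∈ Vs k.
Proof.
  intros Lk Hs Hf. destruct (finset_bounded Lk Hs Hf) as (b & Hb & Hsb).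
  assert (Ob : ordinal b) by (eapply ord_mem; eauto; apply Lk).
  apply (Vs_bounded (b := b)); auto. intros x Hx. apply ord_Vs; auto.
  eapply ord_mem; eauto.
Qed.

End FiniteSets.

Ltac df_more4 := df_fun.
Ltac dfn_more4 := dfn_rel.
Ltac df_more3 ::=
  lazymatch goal with
  | |- DF _ _ (fun e => add _ _) => apply df_add; df
  | |- DF _ _ (fun e => rmv _ _) => apply df_rmv; df
  | |- DF _ _ (fun e => least _ _ _) => apply df_least; df
  | |- _ => df_more4
  end.
Ltac dfn_more3 ::=
  lazymatch goal with
  | |- Dfn _ _ (fun e => finset _) => apply dfn_finset; df
  | |- Dfn _ _ (fun e => surj _ _ _) => apply dfn_surj; df
  | |- _ => dfn_more4
  end.

(** In [nu_diag] the diagonal intersection is indexed by the sets in [Vs k] and not only by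
    ordinals, because stems, tree nodes and pairs of them occur as indices. [nu_tail] supplies limit
    points beyond any bound. *)
Record normal_uf {V : structure} {HV : ZF V} (k U : V) : Prop := {
  nu_lim : limit_ordinal k;
  nu_sub : forall A, A ∈ U -> subset A k;
  nu_ultra : forall A, subset A k -> ~ A ∈ U -> sep k (fun x => ~ x ∈ A) ∈ U;
  nu_up : forall A B, A ∈ U -> subset A B -> subset B k -> B ∈ U;
  nu_and : forall A B, A ∈ U -> B ∈ U -> sep A (fun x => x ∈ B) ∈ U;
  nu_emp : ~ emp ∈ U;
  nu_diag : forall B : V -> V, Fun1 B -> (forall x, x ∈ Vs k -> B x ∈ U) ->
    sep k (fun g => forall x, x ∈ Vs g -> g ∈ B x) ∈ U;
  nu_tail : forall a, a ∈ k ->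
    sep k (fun g => a ∈ g /\ omega ∈ g /\ limit_ordinal g) ∈ U }.

Section Prikry.
Context {V : structure} {HV : ZF V} (k U : V).
Hypothesis (NU : normal_uf k U).
Hypothesis (VWO : WO (M := V)).
Implicit Types p q r s t u x y z A B C : V.

Let Lk : limit_ordinal k := nu_lim NU.
Let Ok : ordinal k := proj1 Lk.

Definition PP : V := prod (sep (pow k) finset) U.

Lemma pr_PP s A : pr s A ∈ PP <-> (subset s k /\ finset s) /\ A ∈ U.
Proof.
  unfold PP. rewrite pr_prod, mem_sep by cls. rewrite mem_pow. tauto.
Qed.

Lemma mem_PP p : p ∈ PP <->
  exists s A, p = pr s A /\ (subset s k /\ finset s) /\ A ∈ U.
Proof.
  split.
  - intro H. pose proof H as K. unfold PP in H.
    apply mem_prod in H as (s & A & _ & _ & ->). exists s, A.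
    rewrite pr_PP in K. auto.
  - intros (s & A & -> & H). now apply pr_PP.
Qed.

Lemma PP_prikry p : prikry_condition k U p <-> p ∈ PP.
Proof.
  rewrite mem_PP. split.
  - intros (s & A & Hp & Hs & Hl & HA). apply is_pairE in Hp. exists s, A.
    repeat split; auto. now apply (finset_list Ok Hs).
  - intros (s & A & -> & [Hs Hf] & HA). exists s, A. rewrite is_pairE.
    repeat split; auto. now apply (finset_list Ok Hs).
Qed.

Definition end_ext t s : Prop :=
  subset s t /\ forall x y, x ∈ t -> y ∈ s -> x ∈ y -> x ∈ s.

Lemma prikry_leE t B s A : subset t k ->
  prikry_le k (pr t B) (pr s A) <->
  end_ext t s /\ (forall x, x ∈ t -> ~ x ∈ s -> x ∈ A) /\ subset B A.
Proof.
  intro Ht. split.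
  - intros (t' & B' & s' & A' & E1 & E2 & (a & Ha & Hs) & H1 & H2).
    apply is_pairE in E1, E2. apply pr_inj in E1 as [<- <-], E2 as [<- <-].
    split; auto. split.
    + intros x Hx. apply Hs in Hx. tauto.
    + intros x y Hx Hy Hxy. apply Hs. split; auto. apply Hs in Hy as [_ Hy].
      destruct Ha as [Ha | ->]; eapply ord_trans; eauto. eapply ord_mem; eauto.
  - intros ([H1 H2] & H3 & H4). exists t, B, s, A. rewrite !is_pairE.
    split; auto. split; auto. split; auto.
    (* The cut demanded by [prikry_le] is the set of the ordinals that are at most some element of
       [s]. *)
    set (a := sep k (fun x => exists y, y ∈ s /\ (x ∈ y \/ x = y))).
    assert (Ma : forall x, x ∈ a <-> x ∈ k /\ exists y, y ∈ s /\
      (x ∈ y \/ x = y)) by (intro; unfold a; now rewrite mem_sep by cls).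
    exists a. split.
    + apply ord_subset; auto.
      * apply ord_set.
        -- intros b Hb. apply Ma in Hb as [Hb _]. eapply ord_mem; eauto.
        -- intros b c Hb Hc. apply Ma in Hb as (Hb & y & Hy & Hby). apply Ma.
           split; [eapply ord_trans; eauto |]. exists y. split; auto. left.
           destruct Hby as [Hby | ->]; auto. eapply ord_trans; eauto.
           eapply ord_mem; eauto.
      * intros x Hx. apply Ma in Hx. tauto.
    + intro x. split.
      * intro Hx. split; auto. apply Ma. split; auto. eauto.
      * intros [Hx Hxa]. apply Ma in Hxa as (_ & y & Hy & [K | ->]); eauto.
Qed.

Lemma PP_poset : poset PP (prikry_le k).
Proof.
  split.
  - unfold prikry_le. cls.
  - intros p Hp. apply mem_PP in Hp as (s & A & -> & [Hs _] & _).
    apply prikry_leE; auto. repeat split; auto. intros x y. auto.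
    intros ? ? ?; tauto. apply subset_refl.
  - intros p q r Hp Hq Hr. apply mem_PP in Hp as (s & A & -> & [Hs _] & _),
      Hq as (t & B & -> & [Ht _] & _), Hr as (u & C & -> & [Hu _] & _).
    rewrite !prikry_leE by auto.
    intros ([X1 X2] & X3 & X4) ([Y1 Y2] & Y3 & Y4). split; [split |].
    + intros x Hx; auto.
    + intros x y Hx Hy Hxy. eauto.
    + split; [| intros x Hx; auto].
      intros x Hx N. destruct (classic (x ∈ t)); auto.
Qed.

Local Notation ext := (ext PP (prikry_le k)).

Lemma ext_pr t B s A : ext (pr t B) (pr s A) <->
  pr t B ∈ PP /\ pr s A ∈ PP /\ end_ext t s /\
  (forall x, x ∈ t -> ~ x ∈ s -> x ∈ A) /\ subset B A.
Proof.
  split; intros (H1 & H2 & H3); split; auto; split; auto;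
    pose proof H1 as K; apply pr_PP in K as [[K _] _];
    now apply prikry_leE in H3 || apply prikry_leE.
Qed.

Lemma ext_inv q p : ext q p -> exists t B s A, q = pr t B /\ p = pr s A.
Proof.
  intros (H1 & H2 & _). apply mem_PP in H1 as (t & B & -> & _),
    H2 as (s & A & -> & _). eauto 6.
Qed.

Lemma nu_k : k ∈ U.
Proof.
  destruct (classic (k ∈ U)) as [|N]; auto. exfalso.
  apply (nu_emp NU). replace emp with (sep k (fun x => ~ x ∈ k)).
  - apply (nu_ultra NU); auto. apply subset_refl.
  - apply zf_ext. intro z. rewrite mem_sep by cls. split; [tauto |].
    intro H. destruct (mem_emp H).
Qed.

Lemma nu_nonempty A : A ∈ U -> exists x, x ∈ A.
Proof.
  intro H. apply NNPP. intro N. apply (nu_emp NU).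
  replace emp with A; auto. apply zf_ext. intro z. split; intro Hz.
  - destruct N. eauto.
  - destruct (mem_emp Hz).
Qed.

Lemma nu_inter A B : A ∈ U -> B ∈ U ->
  exists C, C ∈ U /\ forall x, x ∈ C <-> x ∈ A /\ x ∈ B.
Proof.
  intros HA HB. exists (sep A (fun x => x ∈ B)).
  split; [now apply (nu_and NU) |]. intro x. now rewrite mem_sep by cls.
Qed.

Lemma nu_above s : subset s k -> finset s ->
  exists C, C ∈ U /\ forall x, x ∈ C ->
    (subset s x /\ s ∈ Vs x) /\ omega ∈ x /\ limit_ordinal x.
Proof.
  intros Hs Hf. destruct (finset_bounded Lk Hs Hf) as (b & Hb & Hsb).
  exists (sep k (fun g => b ∈ g /\ omega ∈ g /\ limit_ordinal g)).
  split; [now apply (nu_tail NU) |]. intros x Hx.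
  apply mem_sep in Hx as (Hx & Hbx & Hox & Lx);
    [| unfold limit_ordinal; cls].
  assert (Hsx : subset s x).
  { intros y Hy. eapply ord_trans; [apply Lx | apply Hsb, Hy | exact Hbx]. }
  split; auto. split; auto. now apply finset_Vs.
Qed.

Lemma PP_add s A x : pr s A ∈ PP -> x ∈ A -> subset s x ->
  ext (pr (add s x) A) (pr s A).
Proof.
  intros Hp Hx Hsx. pose proof Hp as K. apply pr_PP in K as [[Hs Hf] HA].
  assert (Hxk : x ∈ k) by (eapply (nu_sub NU); eauto).
  apply ext_pr. split; [| split; auto; split; [split |]].
  - apply pr_PP. split; auto. split.
    + intros y Hy. apply mem_add in Hy as [Hy | ->]; auto.
    + apply (finset_add Ok); auto.
  - intros y Hy. apply mem_add; auto.
  - intros y z Hy Hz Hyz. apply mem_add in Hy as [Hy | ->]; auto.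
    destruct (mem_asym Hyz). auto.
  - split; [| apply subset_refl].
    intros y Hy N. apply mem_add in Hy as [Hy | ->]; tauto.
Qed.

Lemma PP_shrink s A B : pr s A ∈ PP -> B ∈ U -> subset B A ->
  ext (pr s B) (pr s A).
Proof.
  intros Hp HB HBA. pose proof Hp as K. apply pr_PP in K as [Hs HA].
  apply ext_pr. split; [now apply pr_PP | split; auto].
  split; [split; [apply subset_refl | auto] |]. split; auto. tauto.
Qed.

Section PrikryProperty.
Variable (Q : V -> Prop).
Hypotheses (RQ : Reg PP (prikry_le k) Q) (CQ : Cls Q).

Definition pos t : Prop := exists C, C ∈ U /\ Q (pr t C).

Lemma Cls_pos : Cls pos.
Proof. unfold pos. cls. Qed.

(* A one-step diagonalisation: if almost all one-point extensions of [t] have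
   a direct extension in [Q], then so has [t]. *)
Lemma pos_of_almost_all t D : subset t k -> finset t -> D ∈ U ->
  (forall g, g ∈ D -> subset t g /\ pos (add t g)) -> pos t.
Proof.
  intros Ht Hf HD H. destruct (VWO U) as (o & h & Oo & Hh).
  pose proof Cls_pos as CP.
  set (C := fun g => least h o (sep U (fun C => g ∈ D /\ Q (pr (add t g) C)))).
  assert (HC : forall g, g ∈ D -> C g ∈ U /\ Q (pr (add t g) (C g))).
  { intros g Hg. assert (K : C g ∈ sep U (fun C => g ∈ D /\ Q (pr (add t g) C))).
    { unfold C. eapply least_mem; eauto.
      - intros x Hx. apply mem_sep in Hx; [tauto | cls].
      - destruct (H g Hg) as (_ & C0 & X & Y). exists C0.
        apply mem_sep; [cls | auto]. }
    apply mem_sep in K; [tauto | cls]. }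
  (* A definable case distinction: outside [D] the default [k] is taken, so that the diagonal
     intersection is over members of [U] everywhere. *)
  set (Cb := fun g => bigU (sep (upair (C g) k)
    (fun z => (g ∈ D /\ z = C g) \/ (~ g ∈ D /\ z = k)))).
  assert (HCb : Fun1 Cb) by (unfold Cb, C; cls).
  assert (ECb : forall g, g ∈ D -> Cb g = C g).
  { intros g Hg. unfold Cb. apply bigU_sep_unique; auto.
    - assert (Fun1 C) by (unfold C; cls). cls.
    - apply mem_upair; auto.
    - intros y [[_ E] | [N _]]; [auto | tauto]. }
  assert (ECb' : forall g, ~ g ∈ D -> Cb g = k).
  { intros g Hg. unfold Cb. apply bigU_sep_unique; auto.
    - assert (Fun1 C) by (unfold C; cls). cls.
    - apply mem_upair; auto.
    - intros y [[N _] | [_ E]]; [tauto | auto]. }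
  assert (HB : sep k (fun g => forall x, x ∈ Vs g -> g ∈ Cb x) ∈ U).
  { apply (nu_diag NU); auto. intros x _.
    destruct (classic (x ∈ D)) as [Hx | Hx].
    - rewrite ECb by auto. now apply HC.
    - rewrite ECb' by auto. apply nu_k. }
  destruct (nu_inter HD HB) as (B & HBU & MB).
  exists B. split; auto.
  assert (Hp : pr t B ∈ PP) by (apply pr_PP; auto).
  apply (reg_dense RQ); auto.
  (* The first new point [g] of [u] lies in [D]. All later points belong to the diagonal
     intersection and hence to [C g], so [u] extends the stem [add t g] within the condition chosen
     for [g]. *)
  assert (Step : forall u E, ext (pr u E) (pr t B) -> (exists x, x ∈ u /\ ~ x ∈ t) ->
    exists r, ext r (pr u E) /\ Q r).
  { intros u E Hu (x0 & Hx0 & Nx0).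
    pose proof Hu as K. apply ext_pr in K as (K1 & _ & [K2 K3] & K4 & K5).
    pose proof K1 as K6. apply pr_PP in K6 as [[Huk Huf] HE].
    destruct (@ord_least V HV (fun x => x ∈ u /\ ~ x ∈ t) x0) as
      (g & Og & [Hgu Ngt] & Hmin); [exact (ord_mem Ok (Huk _ Hx0)) | auto |].
    assert (HgB : g ∈ B) by auto. apply MB in HgB as [HgD Hgd].
    destruct (HC g HgD) as [HCg HQ].
    destruct (nu_inter HE HCg) as (E' & HE' & ME').
    exists (pr u E').
    assert (R1 : ext (pr u E') (pr u E)).
    { apply PP_shrink; auto. intros z Hz. apply ME' in Hz. tauto. }
    split; auto. apply (reg_mono RQ HQ). apply ext_pr.
    split; [apply R1 |]. split; [now apply (reg_in RQ) in HQ |].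
    split; [split |].
    - intros z Hz. apply mem_add in Hz as [Hz | ->]; auto.
    - intros x y Hx Hy Hxy. apply mem_add.
      apply mem_add in Hy as [Hy | ->]; [left; eauto |].
      left. apply NNPP. intro N. exact (Hmin x Hxy (conj Hx N)).
    - split; [| intros z Hz; apply ME' in Hz; tauto].
      intros x Hx N. rewrite mem_add in N.
      assert (HxB : x ∈ B) by (apply K4; tauto). apply MB in HxB as [_ HxB].
      apply mem_sep in HxB as [Hxk HxB]; [| cls].
      assert (Hgx : g ∈ x).
      { assert (Ox : ordinal x) by exact (ord_mem Ok Hxk).
        destruct (ord_total Og Ox) as [L | [L | L]]; auto.
        - subst. tauto.
        - exfalso. apply (Hmin x L). tauto. }
      assert (Ox : ordinal x) by exact (ord_mem Ok Hxk).
      rewrite <- ECb by auto. apply HxB. apply ord_Vs; auto. }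
  intros q Hq. destruct (ext_inv Hq) as (u & E & _ & _ & -> & _).
  destruct (classic (exists x, x ∈ u /\ ~ x ∈ t)) as [He | N].
  { apply Step; auto. }
  pose proof Hq as K. apply ext_pr in K as (K1 & _ & [K2 K3] & K4 & K5).
  pose proof K1 as K6. apply pr_PP in K6 as [[Huk Huf] HE].
  (* No point has been added to the stem yet; adding one leads back to the previous case. *)
  destruct (nu_above Huk Huf) as (C' & HC' & HC'').
  destruct (nu_inter HE HC') as (E' & HE' & ME').
  destruct (nu_nonempty HE') as [g Hg]. apply ME' in Hg as [Hg1 Hg2].
  apply HC'' in Hg2 as [[Hug _] _].
  assert (R1 : ext (pr (add u g) E) (pr u E)) by (now apply PP_add).
  destruct (Step (add u g) E) as (r & Hr & HQ).
  - apply (ext_trans (po_refl PP_poset) (po_trans PP_poset) R1 Hq).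
  - exists g. split; [apply mem_add; auto |]. intro X. apply K2 in X.
    exact (mem_irrefl (Hug g X)).
  - exists r. split; auto. apply (ext_trans (po_refl PP_poset) (po_trans PP_poset) Hr R1).
Qed.

End PrikryProperty.

(** If neither [Q] nor its negation holds at a condition with stem [s], then by [pos_of_almost_all]
    the same is true of U-many one-point extensions of [s]. A diagonal intersection keeps all finite
    extensions undecided, so no extension is in [Q]; but then the negation is forced after all. *)
Lemma prikry_property (Q : V -> Prop) s B :
  Reg PP (prikry_le k) Q -> Cls Q -> pr s B ∈ PP ->
  exists C, C ∈ U /\ subset C B /\
    (Q (pr s C) \/ fneg PP (prikry_le k) Q (pr s C)).
Proof.
  intros RQ CQ Hp.
  set (Q' := fneg PP (prikry_le k) Q).
  assert (RQ' : Reg PP (prikry_le k) Q').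
  { apply (Reg_fneg (po_refl PP_poset) (po_trans PP_poset)). apply RQ. }
  assert (CQ' : Cls Q').
  { pose proof (Rel2_ext PP (po_rel PP_poset)). unfold Q', fneg. cls. }
  assert (Fin : forall t (Q : V -> Prop), Reg PP (prikry_le k) Q -> pos Q t ->
    forall B, pr t B ∈ PP -> exists C, C ∈ U /\ subset C B /\ Q (pr t C)).
  { intros t R HR (C & HC & HQC) B' HB'.
    pose proof HB' as K. apply pr_PP in K as [Ht HBU].
    destruct (nu_inter HC HBU) as (C' & HC' & MC).
    exists C'. split; auto. split; [intros x Hx; apply MC in Hx; tauto |].
    apply (reg_mono HR HQC). apply PP_shrink; auto.
    - now apply pr_PP.
    - intros x Hx. apply MC in Hx. tauto. }
  destruct (classic (pos Q s)) as [X | X].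
  { destruct (Fin s Q RQ X B Hp) as (C & ? & ? & ?). eauto. }
  destruct (classic (pos Q' s)) as [Y | Y].
  { destruct (Fin s Q' RQ' Y B Hp) as (C & ? & ? & ?). eauto. }
  exfalso.
  pose proof (Cls_pos CQ) as CP. pose proof (Cls_pos CQ') as CP'.
  set (und := fun t => ~ pos Q t /\ ~ pos Q' t).
  set (T0 := fun t => sep k (fun g => und (add t g))).
  assert (CU : Cls und) by (unfold und; cls).
  assert (FT : Fun1 T0) by (unfold T0; cls).
  assert (HT0 : forall t, subset t k -> finset t -> und t -> T0 t ∈ U).
  { intros t Ht Hf [U1 U2]. apply NNPP. intro N.
    apply (nu_ultra NU) in N; [| intros x Hx; apply mem_sep in Hx; [tauto | cls]].
    destruct (nu_above Ht Hf) as (C & HC & HC').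
    destruct (nu_inter N HC) as (D & HD & MD).
    assert (HDp : forall g, g ∈ D -> subset t g /\
      (pos Q (add t g) \/ pos Q' (add t g))).
    { intros g Hg. apply MD in Hg as [Hg Hgc]. split; [exact (proj1 (proj1 (HC' g Hgc))) |].
      apply mem_sep in Hg as [Hgk Hg]; [| cls]. apply NNPP. intro K.
      apply Hg. apply mem_sep; [cls |]. split; auto. unfold und. tauto. }
    set (D1 := sep D (fun g => pos Q (add t g))).
    assert (MD1 : forall g, g ∈ D1 <-> g ∈ D /\ pos Q (add t g)).
    { intro g. unfold D1. now rewrite mem_sep by cls. }
    destruct (classic (D1 ∈ U)) as [Z | Z].
    - apply U1. apply (pos_of_almost_all RQ CQ (D := D1)); auto.
      intros g Hg. apply MD1 in Hg as [Hg Hg']. split; auto. exact (proj1 (HDp g Hg)).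
    - apply (nu_ultra NU) in Z.
      2:{ intros x Hx. apply MD1 in Hx as [Hx _]. eapply (nu_sub NU); eauto. }
      destruct (nu_inter Z HD) as (D2 & HD2 & MD2).
      apply U2. apply (pos_of_almost_all RQ' CQ' (D := D2)); auto.
      intros g Hg. apply MD2 in Hg as [Hg Hg'].
      apply mem_sep in Hg as [_ Hg]; [| cls].
      destruct (HDp g Hg') as [Hs [Z1 | Z1]]; auto. destruct Hg. apply MD1. auto. }
  set (Bf := fun t => bigU (sep (upair (T0 t) k)
    (fun z => (T0 t ∈ U /\ z = T0 t) \/ (~ T0 t ∈ U /\ z = k)))).
  assert (FB : Fun1 Bf) by (unfold Bf; cls).
  assert (EB1 : forall t, T0 t ∈ U -> Bf t = T0 t).
  { intros t Ht. unfold Bf. apply bigU_sep_unique; [cls | | auto |].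
    - apply mem_upair; auto.
    - intros y [[_ E] | [N _]]; tauto. }
  assert (EB2 : forall t, ~ T0 t ∈ U -> Bf t = k).
  { intros t Ht. unfold Bf. apply bigU_sep_unique; [cls | | auto |].
    - apply mem_upair; auto.
    - intros y [[N _] | [_ E]]; tauto. }
  assert (HD : sep k (fun g => forall x, x ∈ Vs g -> g ∈ Bf x) ∈ U).
  { apply (nu_diag NU); auto. intros x _.
    destruct (classic (T0 x ∈ U)) as [K | K].
    - now rewrite EB1.
    - rewrite EB2 by auto. apply nu_k. }
  pose proof Hp as K. apply pr_PP in K as [[Hsk Hsf] HBU].
  destruct (nu_above Hsk Hsf) as (C0 & HC0 & HC0').
  destruct (nu_inter HD HC0) as (C1 & HC1 & MC1).
  assert (Hq : pr s C1 ∈ PP) by (apply pr_PP; auto).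
  (* Induction on a bound for [u]: without its largest element [m], the stem lies inside [m], and
     [m] is in the diagonal intersection. *)
  assert (Ind : forall g u, subset u k -> finset u -> end_ext u s ->
    (forall x, x ∈ u -> ~ x ∈ s -> x ∈ C1) -> subset u g -> und u).
  { induction g as [g IH] using (well_founded_ind zf_wf).
    intros u Huk Huf [He1 He2] HuC Hug.
    destruct (classic (exists x, x ∈ u /\ ~ x ∈ s)) as [(x & Hx & Nx) | N].
    - destruct (Huf u (subset_refl (a := u))) as (m & Hm & Hmax); [eauto |].
      assert (Nms : ~ m ∈ s).
      { intro Hms. apply Nx. destruct (Hmax x Hx) as [Z | ->]; eauto. }
      set (u' := rmv u m).
      assert (Hu'm : subset u' m).
      { intros z Hz. apply mem_rmv in Hz as [Hz Nz].
        destruct (Hmax z Hz); tauto. }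
      assert (Hu'u : subset u' u).
      { intros z Hz. apply mem_rmv in Hz. tauto. }
      assert (HmC : m ∈ C1) by auto. apply MC1 in HmC as [HmD HmC].
      apply HC0' in HmC as (_ & _ & Lm).
      apply mem_sep in HmD as [Hmk HmD]; [| cls].
      assert (Hu'f : finset u') by (eapply finset_sub; eauto).
      assert (Hu'k : subset u' k) by (intros z Hz; auto).
      assert (Uu' : und u').
      { apply (IH m); auto.
        - split.
          + intros z Hz. apply mem_rmv. split; auto. intros ->. tauto.
          + intros z y Hz Hy Hzy. eauto. }
      assert (Em : u = add u' m).
      { apply zf_ext. intro z. rewrite mem_add. unfold u'. rewrite mem_rmv.
        split; [intro; destruct (classic (z = m)); auto |].
        intros [[] | ->]; auto. }
      assert (Hmm : m ∈ Bf u') by (apply HmD, finset_Vs; auto).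
      rewrite EB1 in Hmm by auto. apply mem_sep in Hmm as [_ Hmm]; [| cls].
      now rewrite Em.
    - replace u with s; [split; auto |]. apply zf_ext. intro z.
      split; auto. intro Hz. apply NNPP. intro. apply N. eauto. }
  assert (Dec : forall q, ext q (pr s C1) -> ~ Q q /\ ~ Q' q).
  { intros q Hqe. destruct (ext_inv Hqe) as (u & E & _ & _ & -> & _).
    pose proof Hqe as K. apply ext_pr in K as (K1 & _ & K2 & K4 & K5).
    pose proof K1 as K6. apply pr_PP in K6 as [[Huk Huf] HE].
    destruct (Ind k u) as [Z1 Z2]; auto.
    split; intro Z; [apply Z1 | apply Z2]; exists E; auto. }
  destruct (Dec (pr s C1)) as [_ Z].
  { apply (ext_refl (po_refl PP_poset)); auto. }
  apply Z. split; auto. intros q Hqe. now apply Dec.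
Qed.

End Prikry.

(** * Prikry sequences, and the removal of a point *)

Section PrikryGeneric.
Context {V : structure} {HV : ZF V} (k U : V).
Hypothesis (NU : normal_uf k U).
Hypothesis (VWO : WO (M := V)).
Implicit Types p q r s t u x y z A B C : V.

Let Lk : limit_ordinal k := nu_lim NU.
Let Ok : ordinal k := proj1 Lk.
Local Notation PP := (PP k U).
Local Notation ext := (ext PP (prikry_le k)).
Let PO := PP_poset NU.

Definition init (c : V -> Prop) s : Prop :=
  (forall x, x ∈ s -> c x) /\
  (forall x y, c x -> y ∈ s -> x ∈ y -> x ∈ s).

(** The filter of the conditions compatible with the sequence [c]. *)
Definition Gof (c : V -> Prop) p : Prop :=
  exists s A, p = pr s A /\ p ∈ PP /\ init c s /\
    forall x, c x -> ~ x ∈ s -> x ∈ A.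

Lemma Gof_pr (c : V -> Prop) s A : Gof c (pr s A) <->
  pr s A ∈ PP /\ init c s /\ forall x, c x -> ~ x ∈ s -> x ∈ A.
Proof.
  split; [| intro H; exists s, A; tauto].
  intros (s' & A' & E & H). apply pr_inj in E as [<- <-]. auto.
Qed.

Lemma init_total (c : V -> Prop) s t : (forall x, c x -> ordinal x) ->
  init c s -> init c t -> subset s t \/ subset t s.
Proof.
  intros Oc [S1 S2] [T1 T2].
  destruct (classic (subset s t)) as [|N]; auto. right.
  apply not_all_ex_not in N as [x N]. apply imply_to_and in N as [Hx N].
  intros y Hy. destruct (ord_total (Oc x (S1 x Hx)) (Oc y (T1 y Hy)))
    as [L | [L | L]].
  - destruct N. eauto.
  - subst. tauto.
  - eauto.
Qed.

Lemma end_ext_init (c : V -> Prop) s t : subset s t -> init c s -> init c t ->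
  end_ext t s.
Proof. intros H [S1 S2] [T1 T2]. split; auto. eauto. Qed.

Variables (G : V -> Prop) (N : structure) (val : V -> N).
Hypothesis HG : generic (fun p => p ∈ PP) (prikry_le k) G.

Definition cs x : Prop := exists s A, G (pr s A) /\ x ∈ s.

Lemma G_PP p : G p -> p ∈ PP.
Proof. apply (G_in HG). Qed.

Lemma G_stem s A : G (pr s A) -> subset s k /\ finset s /\ A ∈ U.
Proof. intro H. apply G_PP in H. apply pr_PP in H. tauto. Qed.

Lemma cs_k x : cs x -> x ∈ k.
Proof. intros (s & A & Gs & Hx). now apply (G_stem Gs). Qed.

Lemma G_common_pr s A t B : G (pr s A) -> G (pr t B) ->
  exists u C, G (pr u C) /\ ext (pr u C) (pr s A) /\ ext (pr u C) (pr t B).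
Proof.
  intros Gs Gt. destruct (G_common HG Gs Gt) as (r & Gr & X & Y).
  pose proof (G_PP Gr) as K. apply mem_PP in K as (u & C & -> & _). eauto 6.
Qed.

Lemma G_Gof p : G p -> Gof cs p.
Proof.
  intro Gp. pose proof (G_PP Gp) as K. apply mem_PP in K as (s & A & -> & _).
  apply Gof_pr. split; [now apply G_PP |].
  assert (L : forall x, cs x -> exists u C, G (pr u C) /\ x ∈ u /\
    ext (pr u C) (pr s A)).
  { intros x (t & B & Gt & Hx). destruct (G_common_pr Gp Gt)
      as (u & C & Gu & X & Y). exists u, C. repeat split; auto; try apply X.
    apply (ext_pr NU) in Y as (_ & _ & [Y _] & _). auto. }
  split; [split |].
  - intros x Hx. exists s, A. auto.
  - intros x y Hx Hy Hxy. destruct (L x Hx) as (u & C & _ & Hxu & X).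
    apply (ext_pr NU) in X as (_ & _ & [X1 X2] & _). eauto.
  - intros x Hx Nx. destruct (L x Hx) as (u & C & _ & Hxu & X).
    apply (ext_pr NU) in X as (_ & _ & _ & X & _). auto.
Qed.

Lemma stem_above s : init cs s -> finset s -> subset s k ->
  forall p, G p -> exists u C, G (pr u C) /\ subset s u /\ ext (pr u C) p.
Proof.
  intros [S1 S2] Hf Hs p Gp.
  pose proof (G_PP Gp) as K. apply mem_PP in K as (t & B & -> & _).
  destruct (classic (exists x, x ∈ s)) as [He | E].
  - destruct (Hf s (subset_refl (a := s)) He) as (m & Hm & Hmax).
    destruct (S1 m Hm) as (u & C & Gu & Hmu).
    destruct (G_common_pr Gu Gp) as (u' & C' & Gu' & X & Y).
    exists u', C'. split; auto. split; auto. intros x Hx.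
    apply G_Gof, Gof_pr in Gu' as (_ & [_ I2] & _).
    apply (ext_pr NU) in X as (_ & _ & [X _] & _).
    destruct (Hmax x Hx) as [L | ->]; eauto.
  - exists t, B. split; auto. split.
    + intros x Hx. destruct E. eauto.
    + apply (ext_refl (po_refl PO)). now apply G_PP.
Qed.

(** A condition that agrees with the sequence is compatible with every element of [G], because a
    stem of [G] can be taken to extend the given one; genericity then puts it in [G]. *)
Lemma G_iff p : G p <-> Gof cs p.
Proof.
  split; [apply G_Gof |]. intros (s & A & -> & Hp & Hi & HA).
  pose proof Hp as K. apply pr_PP in K as [[Hs Hf] HAU].
  pose proof (Rel2_ext PP (po_rel PO)) as HR.
  destruct HG as (_ & [p0 Gp0] & _).
  destruct (@G_dense _ _ _ _ (po_rel PO) (po_refl PO) (po_trans PO) _ HG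
    (fun q => ext q (pr s A) \/ ~ exists r, ext r q /\ ext r (pr s A)) p0 Gp0)
    as (q & Gq & _ & [X | X]).
  - cls.
  - intros q [Hq _]. destruct (classic (exists r, ext r q /\ ext r (pr s A)))
      as [(r & X & Y) | Z].
    + eauto.
    + exists q. split; auto. now apply (ext_refl (po_refl PO)).
  - eapply (G_up HG); eauto.
  - exfalso. apply X. destruct (stem_above Hi Hf Hs Gq) as (u & C & Gu & Hsu & Y).
    destruct (G_stem Gu) as (Hu & Huf & HC).
    destruct (nu_inter NU HC HAU) as (D & HD & MD).
    exists (pr u D). split.
    + apply (ext_trans (po_refl PO) (po_trans PO) (q := pr u C)); auto.
      apply (PP_shrink NU); auto; [now apply G_PP |].
      intros x Hx. apply MD in Hx. tauto.
    + pose proof (G_Gof Gu) as Gu'. apply Gof_pr in Gu' as (_ & Iu & _).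
      apply (ext_pr NU). split; [apply pr_PP; auto |]. split; auto.
      split; [now apply (end_ext_init (c := cs)) |]. split.
      * intros x Hx Nx. apply HA; auto. now apply Iu.
      * intros x Hx. apply MD in Hx. tauto.
Qed.

Lemma cs_unbounded a : a ∈ k -> exists x, cs x /\ a ∈ x.
Proof.
  intro Ha. destruct HG as (_ & [p0 Gp0] & _).
  destruct (@G_dense _ _ _ _ (po_rel PO) (po_refl PO) (po_trans PO) _ HG
    (fun q => exists x, x ∈ fstp q /\ a ∈ x) p0 Gp0) as (q & Gq & _ & x & X & Y).
  - cls.
  - intros q [Hq _]. apply mem_PP in Hq as (s & A & -> & [Hs Hf] & HA).
    destruct (nu_above NU Hs Hf) as (C & HC & HC').
    destruct (nu_inter NU HA HC) as (D & HD & MD).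
    destruct (nu_inter NU HD (nu_tail NU Ha)) as (D' & HD' & MD').
    destruct (nu_nonempty NU HD') as [g Hg]. apply MD' in Hg as [Hg1 Hg2].
    apply MD in Hg1 as [Hg1 Hg3]. apply HC' in Hg3 as [[Hsg _] _].
    apply mem_sep in Hg2 as (_ & Hag & _); [| unfold limit_ordinal; cls].
    exists (pr (add s g) A). split.
    + apply (PP_add NU); auto. apply pr_PP. auto.
    + exists g. rewrite fstp_pr, mem_add. auto.
  - pose proof (G_PP Gq) as K. apply mem_PP in K as (s & A & -> & _).
    rewrite fstp_pr in X. exists x. split; auto. exists s, A. auto.
Qed.

Lemma cs_ord x : cs x -> ordinal x.
Proof. intro H. exact (ord_mem Ok (cs_k H)). Qed.

Lemma below_exists g : cs g -> exists s, finset s /\ init cs s /\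
  (forall x, x ∈ s <-> cs x /\ x ∈ g).
Proof.
  intros (s & A & Gs & Hg). destruct (G_stem Gs) as (Hs & Hf & _).
  apply G_Gof, Gof_pr in Gs as (_ & [I1 I2] & _).
  exists (sep s (fun x => x ∈ g)).
  assert (Ms : forall x, x ∈ sep s (fun x => x ∈ g) <-> cs x /\ x ∈ g).
  { intro x. rewrite mem_sep by cls. split; [intros []; auto |].
    intros [Hx Hxg]. eauto. }
  split; [| split; auto].
  - eapply finset_sub; eauto. intros x Hx. apply mem_sep in Hx; [tauto | cls].
  - split.
    + intros x Hx. apply Ms in Hx. tauto.
    + intros x y Hx Hy Hxy. apply Ms. split; auto. apply Ms in Hy as [Hy Hyg].
      eapply ord_trans; eauto. exact (ord_mem Ok (Hs _ Hg)).
Qed.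

Section Remove.
Variable (g : V).
Hypothesis (Hg : cs g).

Definition cs' x : Prop := cs x /\ x <> g.

Lemma init_rmv u : init cs u -> init cs' (rmv u g).
Proof.
  intros [I1 I2]. split.
  - intros x Hx. apply mem_rmv in Hx as [Hx Nx]. split; auto.
  - intros x y [Hx Nx] Hy Hxy. apply mem_rmv. split; auto.
    apply mem_rmv in Hy as [Hy _]. eauto.
Qed.

Lemma rmv_PP u B : pr u B ∈ PP -> pr (rmv u g) B ∈ PP.
Proof.
  intro H. apply pr_PP in H as [[H1 H2] H3]. apply pr_PP. split; auto.
  assert (subset (rmv u g) u) by (intros x Hx; apply mem_rmv in Hx; tauto).
  split; [intros x Hx; auto | eapply finset_sub; eauto].
Qed.

(** Given a dense [D] and a condition whose stem contains [g], shrink its measure one set above the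
    stem, remove [g], extend into [D] and put [g] back. All new points lie above [g], so the result
    extends the original condition. *)
Lemma Gof_rmv_generic : generic (fun p => p ∈ PP) (prikry_le k) (Gof cs').
Proof.
  assert (Oc : forall x, cs' x -> ordinal x) by (intros x [Hx _]; now apply cs_ord).
  split; [| split; [| split; [| split]]].
  - intros p (s & A & -> & H & _). auto.
  - exists (pr emp k). apply Gof_pr. split; [| split; [split |]].
    + apply pr_PP. split; [split |].
      * intros x Hx. destruct (mem_emp Hx).
      * apply finset_emp.
      * apply (nu_k NU).
    + intros x Hx. destruct (mem_emp Hx).
    + intros x y _ Hy. destruct (mem_emp Hy).
    + intros x [Hx _] _. now apply cs_k.
  - intros p q (t & B & -> & Hp & It & HB) Hq Hle.
    pose proof Hq as K. apply mem_PP in K as (s & A & -> & _).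
    pose proof Hp as K'. apply pr_PP in K' as [[Ht _] _].
    apply (prikry_leE NU) in Hle as ([H1 H2] & H3 & H4); auto.
    destruct It as [I1 I2].
    apply Gof_pr. split; auto. split; [split |].
    + intros x Hx. auto.
    + intros x y Hx Hy Hxy. apply (H2 x y); auto. eapply I2; eauto.
    + intros x Hx Nx. destruct (classic (x ∈ t)); auto.
  - intros p q (s & A & -> & Hp & Is & HA) (t & B & -> & Hq & It & HB).
    pose proof Hp as K. apply pr_PP in K as [[Hs Hsf] HAU].
    pose proof Hq as K. apply pr_PP in K as [[Ht Htf] HBU].
    destruct (nu_inter NU HAU HBU) as (C & HC & MC).
    assert (L : forall s t A B, pr s A ∈ PP -> pr t B ∈ PP -> init cs' s ->
      init cs' t -> subset s t -> C ∈ U ->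
      (forall x, cs' x -> ~ x ∈ s -> x ∈ A) ->
      (forall x, cs' x -> ~ x ∈ t -> x ∈ B) ->
      (forall x, x ∈ C <-> x ∈ A /\ x ∈ B) ->
      Gof cs' (pr t C) /\ prikry_le k (pr t C) (pr s A) /\
      prikry_le k (pr t C) (pr t B)).
    { clear -NU. intros s t A B Hs Ht Is It Hst HC HA HB MC.
      pose proof Ht as K. apply pr_PP in K as [[K1 K2] K3]. split; [| split].
      - apply Gof_pr. split; [now apply pr_PP | split; auto].
        intros x Hx Nx. apply MC. split; auto.
      - apply (prikry_leE NU); auto.
        split; [now apply (end_ext_init (c := cs')) |]. split.
        + intros x Hx Nx. apply HA; auto. now apply It.
        + intros x Hx. apply MC in Hx. tauto.
      - apply (prikry_leE NU); auto.
        split; [split; [apply subset_refl | auto] |]. split; [tauto |].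
        intros x Hx. apply MC in Hx. tauto. }
    destruct (init_total Oc Is It) as [X | X].
    + exists (pr t C). apply (L s t A B); auto.
    + exists (pr s C). destruct (L t s B A) as (X1 & X2 & X3); auto.
      intro x. rewrite MC. tauto.
  - intros D HD1 HD2.
    pose proof (Rel2_ext PP (po_rel PO)) as HR.
    destruct HG as (_ & [p0 Gp0] & _).
    destruct (@G_dense _ _ _ _ (po_rel PO) (po_refl PO) (po_trans PO) _ HG
      (fun q => (g ∈ fstp q /\ pr (rmv (fstp q) g) (sndp q) ∈ D) \/
         (~ g ∈ fstp q /\ exists x, x ∈ fstp q /\ g ∈ x)) p0 Gp0)
      as (q & Gq & _ & X).
    + cls.
    + intros q [Hq _]. pose proof Hq as K.
      apply mem_PP in K as (s & A & -> & [Hs Hf] & HA).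
      destruct (classic (g ∈ s)) as [Hgs | Ngs].
      * destruct (nu_above NU Hs Hf) as (C & HC & HC').
        destruct (nu_inter NU HA HC) as (A' & HA' & MA').
        assert (Hr : pr (rmv s g) A' ∈ PP).
        { apply rmv_PP. apply pr_PP. auto. }
        destruct (HD2 _ Hr) as (d & Hd & Hle).
        pose proof (HD1 d Hd) as Kd.
        apply mem_PP in Kd as (t & B & -> & [Ht Htf] & HB).
        apply (prikry_leE NU) in Hle as ([H1 H2] & H3 & H4); auto.
        assert (Habove : forall x, x ∈ t -> ~ x ∈ s -> subset s x).
        { intros x Hx Nx. assert (X : x ∈ A').
          { apply H3; auto. rewrite mem_rmv. tauto. }
          apply MA' in X as [_ X]. exact (proj1 (proj1 (HC' x X))). }
        assert (Ngt : ~ g ∈ t).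
        { intro X. destruct (classic (g ∈ rmv s g)) as [Y | Y].
          - apply mem_rmv in Y. tauto.
          - pose proof (H3 g X Y) as Z. apply MA' in Z as [_ Z].
            apply HC' in Z as [[Z _] _]. exact (mem_irrefl (Z g Hgs)). }
        exists (pr (add t g) B). split.
        -- apply (ext_pr NU). split; [| split; auto; split; [split |]].
           ++ apply pr_PP. split; auto. split.
              ** intros x Hx. apply mem_add in Hx as [Hx | ->]; auto.
              ** apply (finset_add Ok); auto.
           ++ intros x Hx. apply mem_add.
              destruct (classic (x = g)); auto. left. apply H1, mem_rmv. auto.
           ++ intros x y Hx Hy Hxy. apply mem_add in Hx as [Hx | ->]; auto.
              apply NNPP. intro Nx. pose proof (Habove x Hx Nx y Hy) as Z.
              exact (mem_asym Hxy Z).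
           ++ split.
              ** intros x Hx Nx. apply mem_add in Hx as [Hx | ->]; [| tauto].
                 assert (X : x ∈ A') by (apply H3; auto; rewrite mem_rmv; tauto).
                 apply MA' in X. tauto.
              ** intros x Hx. apply H4, MA' in Hx. tauto.
        -- left. rewrite fstp_pr, sndp_pr. split; [apply mem_add; auto |].
           replace (rmv (add t g) g) with t; auto.
           apply zf_ext. intro x. rewrite mem_rmv, mem_add. split.
           ++ intro Hx. split; auto. intros ->. tauto.
           ++ tauto.
      (* If [g] is not in the stem, the stem is extended beyond [g] without it. No such condition is
         in [G], since its stem would be an initial segment of the sequence that skips [g]. *)
      * destruct (nu_above NU Hs Hf) as (C & HC & HC').
        destruct (nu_inter NU HA HC) as (A' & HA' & MA').
        destruct (nu_inter NU HA' (nu_tail NU (cs_k Hg))) as (A2 & HA2 & MA2).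
        destruct (nu_nonempty NU HA2) as [x Hx]. apply MA2 in Hx as [Hx1 Hx2].
        apply MA' in Hx1 as [Hx1 Hx3]. apply HC' in Hx3 as [[Hx3 _] _].
        apply mem_sep in Hx2 as (_ & Hx2 & _); [| unfold limit_ordinal; cls].
        exists (pr (add s x) A). split; [now apply (PP_add NU) |].
        right. rewrite fstp_pr. split.
        -- intro Z. apply mem_add in Z as [Z | ->]; [tauto |].
           exact (mem_irrefl Hx2).
        -- exists x. rewrite mem_add. auto.
    + pose proof (G_PP Gq) as K. apply mem_PP in K as (u & B & -> & _).
      rewrite fstp_pr, sndp_pr in X. apply G_Gof, Gof_pr in Gq as (K1 & K2 & K3).
      destruct X as [[Hgu HD] | [Ngu (x & Hx & Hgx)]].
      * exists (pr (rmv u g) B). split; auto. apply Gof_pr.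
        split; [now apply rmv_PP |]. split; [now apply init_rmv |].
        intros x [Hx Nx] Nxu. apply K3; auto. rewrite mem_rmv in Nxu. tauto.
      * destruct Ngu. destruct K2 as [_ K2]. eauto.
Qed.

(** The relations required by [generic_extension_translate]: [rel1] compares conditions after
    removing [g], [rel2] after putting it back. In [rel2] the stem must have a point above [g],
    which ensures that it contains all points of the sequence below [g]. *)
Definition rel1 p q : Prop :=
  p ∈ PP /\ q ∈ PP /\ g ∈ fstp p /\ end_ext (rmv (fstp p) g) (fstp q) /\
  (forall x, x ∈ rmv (fstp p) g -> ~ x ∈ fstp q -> x ∈ sndp q) /\
  subset (sndp p) (sndp q).

Definition rel2 q p : Prop :=
  p ∈ PP /\ q ∈ PP /\ (exists x, x ∈ fstp q /\ g ∈ x) /\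
  end_ext (add (fstp q) g) (fstp p) /\
  (forall x, x ∈ add (fstp q) g -> ~ x ∈ fstp p -> x ∈ sndp p) /\
  subset (sndp q) (sndp p).

Lemma big_stem s : init cs s -> finset s -> subset s k ->
  exists u C, G (pr u C) /\ subset s u /\ g ∈ u /\ exists x, x ∈ u /\ g ∈ x.
Proof.
  intros Is Hf Hs. destruct (cs_unbounded (cs_k Hg)) as (x & (t & B & Gt & Hx) & Hgx).
  destruct (stem_above Is Hf Hs Gt) as (u & C & Gu & Hsu & X).
  apply (ext_pr NU) in X as (_ & _ & [X _] & _). exists u, C.
  split; auto. split; auto. split; eauto.
  apply G_Gof, Gof_pr in Gu as (_ & [_ I2] & _). eauto.
Qed.

Lemma cs'_init_cs s : init cs' s -> subset s k -> finset s ->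
  exists s', subset s s' /\ init cs s' /\ finset s' /\ subset s' k.
Proof.
  intros [I1 I2] Hs Hf.
  destruct (classic (exists x, x ∈ s)) as [He | E].
  - destruct (Hf s (subset_refl (a := s)) He) as (m & Hm & Hmax).
    destruct (proj1 (I1 m Hm)) as (u & C & Gu & Hmu).
    destruct (G_stem Gu) as (X1 & X2 & X3). exists u.
    apply G_Gof, Gof_pr in Gu as (_ & [J1 J2] & _). split; [| split; [split |]; auto].
    intros x Hx. destruct (Hmax x Hx) as [L | ->]; auto.
    apply (J2 x m); auto. now apply I1.
  - exists emp. split; [intros x Hx; destruct E; eauto |].
    split; [split; [intros x Hx | intros x y _ Hx]; destruct (mem_emp Hx) |].
    split; [apply finset_emp | intros x Hx; destruct (mem_emp Hx)].
Qed.

Lemma Gof_rel1 q : Gof cs' q <-> exists p, G p /\ rel1 p q.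
Proof.
  split.
  - intros (t & B & -> & Hq & It & HB).
    pose proof Hq as K. apply pr_PP in K as [[Ht Hf] HBU].
    destruct (cs'_init_cs It Ht Hf) as (s' & X1 & X2 & X3 & X4).
    destruct (big_stem X2 X3 X4) as (u & C & Gu & Hsu & Hgu & _).
    destruct (G_stem Gu) as (Y1 & Y2 & Y3).
    destruct (nu_inter NU Y3 HBU) as (D & HD & MD).
    pose proof (G_Gof Gu) as K. apply Gof_pr in K as (K1 & K2 & K3).
    assert (Hp : pr u D ∈ PP) by (apply pr_PP; auto).
    exists (pr u D). split.
    + apply G_iff, Gof_pr. split; auto. split; auto. intros x Hx Nx.
      apply MD. split; auto. apply HB.
      * split; auto. intros ->. tauto.
      * intro Z. apply Nx. auto.
    + unfold rel1. rewrite !fstp_pr, !sndp_pr. split; auto. split; auto.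
      split; auto. pose proof (init_rmv K2) as Iu. split; [| split].
      * apply (end_ext_init (c := cs')); auto. intros x Hx. apply mem_rmv.
        split; auto. now apply It.
      * intros x Hx Nx. apply HB; auto. now apply Iu.
      * intros x Hx. apply MD in Hx. tauto.
  - intros (p & Gp & Hp & Hq & Hgp & He & Hc & Hs).
    apply mem_PP in Hp as (u & C & -> & _).
    pose proof Hq as K. apply mem_PP in K as (t & B & -> & _).
    rewrite !fstp_pr, !sndp_pr in *.
    apply G_Gof, Gof_pr in Gp as (K1 & K2 & K3).
    pose proof (init_rmv K2) as [I1 I2]. destruct He as [E1 E2].
    apply Gof_pr. split; auto. split; [split |].
    + intros x Hx. auto.
    + intros x y Hx Hy Hxy. apply (E2 x y); auto. eapply I2; eauto.
    + intros x Hx Nx. destruct (classic (x ∈ u)) as [Z | Z].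
      * apply Hc; auto. apply mem_rmv. split; auto. apply Hx.
      * apply Hs, K3; auto. apply Hx.
Qed.

Lemma G_rel2 p : G p <-> exists q, Gof cs' q /\ rel2 q p.
Proof.
  split.
  - intro Gp. pose proof (G_PP Gp) as Hp.
    pose proof Hp as K. apply mem_PP in K as (u & C & -> & [Hu Hf] & HC).
    pose proof (G_Gof Gp) as K. apply Gof_pr in K as (_ & Iu & HuC).
    destruct (big_stem Iu Hf Hu) as (u1 & C1 & Gu1 & Hsu & Hgu & x0 & Hx0 & Hgx0).
    destruct (G_stem Gu1) as (Y1 & Y2 & Y3).
    destruct (nu_inter NU Y3 HC) as (D & HD & MD).
    pose proof (G_Gof Gu1) as K. apply Gof_pr in K as (K1 & K2 & K3).
    assert (Hq : pr (rmv u1 g) D ∈ PP) by (apply rmv_PP, pr_PP; auto).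
    assert (Ea : add (rmv u1 g) g = u1).
    { apply zf_ext. intro x. rewrite mem_add, mem_rmv. split.
      - intros [[] | ->]; auto.
      - intro. destruct (classic (x = g)); auto. }
    exists (pr (rmv u1 g) D). split.
    + apply Gof_pr. split; auto. split; [now apply init_rmv |].
      intros x [Hx Nx] Nxu. rewrite mem_rmv in Nxu. apply MD.
      split; [apply K3; tauto | apply HuC; auto].
    + unfold rel2. rewrite !fstp_pr, !sndp_pr, Ea. split; auto. split; auto.
      split; [| split; [| split]].
      * exists x0. split; auto. apply mem_rmv. split; auto. intros ->.
        exact (mem_irrefl Hgx0).
      * now apply (end_ext_init (c := cs)).
      * intros x Hx Nx. apply HuC; auto. now apply K2.
      * intros x Hx. apply MD in Hx. tauto.
  - intros (q & Gq & Hp & Hq & (x0 & Hx0 & Hgx0) & He & Hc & Hs).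
    apply mem_PP in Hq as (t & B & -> & _).
    pose proof Hp as K. apply mem_PP in K as (u & C & -> & _).
    rewrite !fstp_pr, !sndp_pr in *.
    apply Gof_pr in Gq as (K1 & [I1 I2] & K3).
    destruct He as [E1 E2]. apply G_iff, Gof_pr. split; auto. split; [split |].
    + intros x Hx. apply E1, mem_add in Hx as [Hx | ->]; auto. now apply I1.
    + intros x y Hx Hy Hxy. apply (E2 x y); auto. apply mem_add.
      destruct (classic (x = g)) as [| Nx]; auto. left.
      apply E1, mem_add in Hy as [Hy | ->].
      * apply (I2 x y); auto. split; auto.
      * apply (I2 x x0); auto; [split; auto |].
        apply (ord_trans (b := g)); auto. apply cs_ord. now apply I1.
    + intros x Hx Nx. destruct (classic (x ∈ add t g)) as [Z | Z]; auto.
      rewrite mem_add in Z. apply Hs, K3; [split; auto | tauto].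
Qed.

Lemma rmv_extension : generic_extension G val ->
  exists val' : V -> N, generic_extension (Gof cs') val'.
Proof.
  assert (F1 : Rel2 rel1) by (unfold rel1, end_ext; cls).
  assert (F2 : Rel2 rel2) by (unfold rel2, end_ext; cls).
  apply (generic_extension_translate (P := PP) F1 F2).
  - apply G_PP.
  - intros p (s & A & -> & H & _). auto.
  - apply Gof_rel1.
  - apply G_rel2.
Qed.

End Remove.

Hypothesis HN : generic_extension G val.
Context {ZN : ZF N}.
Local Notation ck := (ck PP val).

Lemma ck_Vs a x : ordinal a -> x ∈ Vs a -> ck x ∈ Vs (ck a).
Proof.
  revert x. induction a as [a IH] using (well_founded_ind zf_wf).
  intros x Oa Hx. apply mem_Vs in Hx as (b & Hb & Hx). apply mem_Vs.
  exists (ck b). split; [now apply (ck_mem HG HN) |]. intros z Hz.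
  apply (mem_ck HG HN) in Hz as (y & Hy & ->). apply IH; auto.
  exact (ord_mem Oa Hb).
Qed.

Definition decides p s x : Prop :=
  fmem PP (prikry_le k) p x s \/
  fneg PP (prikry_le k) (fun p => fmem PP (prikry_le k) p x s) p.

Lemma dfn_decides {E : Type} {HE : Env V E} (a b c : E -> V) :
  FW (@whole V) a -> FW (@whole V) b -> FW (@whole V) c ->
  DW (@whole V) (fun e => decides (a e) (b e) (c e)).
Proof.
  intros. unfold decides. apply dfn_or.
  - apply dfn_fmem; auto. apply (po_rel PO).
  - apply (dfn_fneg PP (po_rel PO) (A := fun e p =>
      fmem PP (prikry_le k) p (c e) (b e))); auto.
    apply dfn_fmem; [apply (po_rel PO) | df | df | df].
Qed.

Lemma decides_mono p q s x : decides p s x -> ext q p -> decides q s x.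
Proof.
  intros [H | H] Hq; [left | right].
  - apply (reg_mono (Reg_fmem (po_refl PO) (po_trans PO) x s) H Hq).
  - refine (reg_mono (Reg_fneg (po_refl PO) (po_trans PO) _) H Hq).
    apply (Reg_fmem (po_refl PO) (po_trans PO) x s).
Qed.

(** Direct extensions deciding all of [ck x ∈ val sg] with [x ∈ Vs g] at every
    stem bounded by [g], for all later [g] at once. *)
Lemma decide_diag (sg : V) : exists B, B ∈ U /\
  forall g u x C, g ∈ B -> u ∈ Vs g -> x ∈ Vs g -> pr u C ∈ PP ->
    (forall y, y ∈ C -> y ∈ B /\ (g ∈ y \/ g = y)) ->
    decides (pr u C) sg (chk PP x).
Proof.
  destruct (VWO U) as (o & h & Oo & Hh).
  pose proof (Fun1_chk PP) as FC.
  assert (D3 : Rel2 (fun z C => decides (pr (fstp z) C) sg (chk PP (sndp z)))).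
  { apply dfn_decides; df. }
  set (S := fun z => sep U (fun C => decides (pr (fstp z) C) sg (chk PP (sndp z)))).
  (* Where no direct extension decides, the default [k] keeps the value of [Bf] in [U]. *)
  set (Bf := fun z => least h o (cup (S z) (sep (upair k k)
    (fun y => ~ exists C, C ∈ S z)))).
  assert (FS : Fun1 S) by (unfold S; cls).
  assert (FB : Fun1 Bf) by (unfold Bf; cls).
  assert (HB : forall z, Bf z ∈ U /\ ((exists C, C ∈ S z) -> Bf z ∈ S z)).
  { intro z. assert (K : Bf z ∈ cup (S z) (sep (upair k k)
      (fun y => ~ exists C, C ∈ S z))).
    { unfold Bf. eapply least_mem; eauto.
      - intros y Hy. apply mem_cup in Hy as [Hy | Hy].
        + unfold S in Hy. apply mem_sep in Hy; [tauto | cls].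
        + apply mem_sep in Hy as [Hy _]; [| cls].
          apply mem_upair in Hy as [-> | ->]; apply (nu_k NU).
      - destruct (classic (exists C, C ∈ S z)) as [[C HC] | K].
        + exists C. apply mem_cup; auto.
        + exists k. apply mem_cup. right. apply mem_sep; [cls |].
          rewrite mem_upair. auto. }
    apply mem_cup in K as [K | K].
    - split; auto. unfold S in K. apply mem_sep in K; [tauto | cls].
    - apply mem_sep in K as [K K']; [| cls].
      split; [apply mem_upair in K as [-> | ->]; apply (nu_k NU) | tauto]. }
  assert (HD : sep k (fun g => forall x, x ∈ Vs g -> g ∈ Bf x) ∈ U).
  { apply (nu_diag NU); auto. intros x _. apply HB. }
  assert (Hl : exists a, a ∈ k) by apply Lk. destruct Hl as [a Ha].
  destruct (nu_inter NU HD (nu_tail NU Ha)) as (B & HBU & MB).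
  assert (MB' : forall g, g ∈ B -> limit_ordinal g /\
    forall x, x ∈ Vs g -> g ∈ Bf x).
  { intros g Hg. apply MB in Hg as [Hg1 Hg2].
    apply mem_sep in Hg1 as [_ Hg1]; [| cls].
    apply mem_sep in Hg2 as (_ & _ & _ & Hg2); [| unfold limit_ordinal; cls].
    auto. }
  exists B. split; auto. intros g u x C Hg Hu Hx HP HC.
  set (z := pr u x).
  pose proof HP as K. apply pr_PP in K as [Huf HCU].
  assert (He : exists C, C ∈ S z).
  { destruct (@prikry_property V HV k U NU VWO
      (fun p => fmem PP (prikry_le k) p (chk PP x) sg) u C)
      as (C' & HC' & _ & Hd); auto.
    - apply (Reg_fmem (po_refl PO) (po_trans PO)).
    - apply dfn_fmem; [apply (po_rel PO) | df | df | df].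
    - exists C'. unfold S. apply mem_sep; [cls |]. split; auto.
      unfold z. now rewrite fstp_pr, sndp_pr. }
  apply HB in He. unfold S in He. apply mem_sep in He as [He1 He2]; [| cls].
  unfold z in He2 at 1 3. rewrite fstp_pr, sndp_pr in He2.
  apply (decides_mono He2). apply (PP_shrink NU); auto; [now apply pr_PP |].
  intros y Hy. destruct (HC y Hy) as [HyB Hgy].
  destruct (MB' g Hg) as [Lg _]. destruct (MB' y HyB) as [Ly Hyy].
  apply Hyy. unfold z. apply (Vs_pr Ly).
  - destruct Hgy as [Hgy | ->]; auto. revert Hu. apply Vs_mono. apply (proj1 (proj1 Ly)); auto.
  - destruct Hgy as [Hgy | ->]; auto. revert Hx. apply Vs_mono. apply (proj1 (proj1 Ly)); auto.
Qed.

Lemma decides_truth p sg x : G p -> decides p sg (chk PP x) ->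
  (ck x ∈ val sg <-> fmem PP (prikry_le k) p (chk PP x) sg).
Proof.
  intros Gp Hd. split.
  - intro H. apply (truth_mem PO HG HN) in H as (q & Gq & Hq).
    destruct Hd as [Hd | Hd]; auto. exfalso.
    destruct (G_common HG Gp Gq) as (r & _ & X & Y).
    apply (proj2 Hd r X).
    apply (reg_mono (Reg_fmem (po_refl PO) (po_trans PO) _ _) Hq Y).
  - intro H. apply (truth_mem PO HG HN). exists p. auto.
Qed.

(** By induction the elements of [x] are checks of members of [Vs b]. One condition of [G] decides
    all of these memberships at once, so [x] is the check of the set of those it forces. *)
Lemma Vs_preserved a (x : N) : ordinal a -> subset a k -> x ∈ Vs (ck a) ->
  exists y, y ∈ Vs a /\ x = ck y.
Proof.
  revert x. induction a as [a IH] using (well_founded_ind zf_wf).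
  intros x Oa Hak Hx. apply mem_Vs in Hx as (b' & Hb' & Hx).
  apply (mem_ck HG HN) in Hb' as (b & Hb & ->).
  assert (Ob : ordinal b) by exact (ord_mem Oa Hb).
  assert (Hbk : b ∈ k) by auto.
  destruct (val_surj HN x) as [sg ->].
  destruct (decide_diag sg) as (B & HB & HBd).
  pose proof (Fun1_chk PP) as FC.
  destruct HG as (_ & [p0 Gp0] & _).
  destruct (@G_dense _ _ _ _ (po_rel PO) (po_refl PO) (po_trans PO) _ HG
    (fun q => forall y, y ∈ Vs b -> decides q sg (chk PP y)) p0 Gp0)
    as (p & Gp & _ & Hp).
  - apply dfn_all. apply dfn_imp; [dfn |]. apply dfn_decides; df.
  - intros q [Hq _]. pose proof Hq as K.
    apply mem_PP in K as (s & A & -> & [Hs Hf] & HA).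
    destruct (nu_above NU Hs Hf) as (C & HC & HC').
    destruct (nu_inter NU HB HC) as (B1 & HB1 & MB1).
    destruct (nu_inter NU HB1 (nu_tail NU Hbk)) as (B2 & HB2 & MB2).
    destruct (nu_inter NU HB2 HA) as (B3 & HB3 & MB3).
    exists (pr s B3). split.
    + apply (PP_shrink NU); auto. intros y Hy. apply MB3 in Hy. tauto.
    + assert (H3 : forall g, g ∈ B3 -> g ∈ B /\ s ∈ Vs g /\ b ∈ g /\ ordinal g).
      { intros g Hg. apply MB3 in Hg as [Hg _]. apply MB2 in Hg as [Hg Hg'].
        apply MB1 in Hg as [Hg Hg''].
        apply mem_sep in Hg' as (_ & Hg' & _ & Lg); [| unfold limit_ordinal; cls].
        apply HC' in Hg'' as [[_ Hg''] _].
        exact (conj Hg (conj Hg'' (conj Hg' (proj1 Lg)))). }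
      destruct (nu_nonempty NU HB3) as [g1 Hg1].
      (* The least element of the measure one set serves as the bound [g] in [decide_diag]; the stem
         and all of [Vs b] lie below it. *)
      destruct (@ord_least V HV (fun g => g ∈ B3) g1) as (g & Og & Hg & Hmin);
        [exact (proj2 (proj2 (proj2 (H3 g1 Hg1)))) | auto |].
      destruct (H3 g Hg) as (X1 & X2 & X3 & X4).
      intros y Hy. apply (HBd g s y B3); auto.
      * revert Hy. apply Vs_mono. apply (proj1 X4); auto.
      * apply pr_PP. auto.
      * intros y' Hy'. destruct (H3 y' Hy') as (Z1 & Z2 & Z3 & Z4). split; auto.
        destruct (ord_total X4 Z4) as [L | [L | L]]; auto.
        destruct (Hmin y' L Hy').
  - assert (D3 : Cls (fun y => fmem PP (prikry_le k) p (chk PP y) sg)).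
    { apply dfn_fmem; [apply (po_rel PO) | df | df | df]. }
    exists (sep (Vs b) (fun y => fmem PP (prikry_le k) p (chk PP y) sg)). split.
    + apply mem_Vs. exists b. split; auto. intros y Hy.
      apply mem_sep in Hy; [tauto | cls].
    + apply zf_ext. intro z. rewrite (mem_ck HG HN). split.
      * intro Hz. destruct (IH b Hb z Ob) as (y & Hy & ->); auto.
        { intros w Hw. apply Hak. exact (ord_trans Oa Hw Hb). }
        exists y. split; auto. apply mem_sep; [cls |]. split; auto.
        apply (decides_truth Gp (Hp y Hy)). auto.
      * intros (y & Hy & ->). apply mem_sep in Hy as [Hy Hf]; [| cls].
        now apply (decides_truth Gp (Hp y Hy)).
Qed.

End PrikryGeneric.

(** * Elementary embeddings of [V_lam] *)

(** [preserves] compares valuations that are related at every variable, including those that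
    represent no component. So valuations for both environments have to be chosen together. *)
Class EnvR (M : structure) (E : Type) (HE : Env M E) := {
  envR : (M -> M -> Prop) -> E -> E -> Prop;
  envR_rep : forall (R : M -> M -> Prop) e e' (v w : nat -> M),
    envR R e e' -> (forall n, R (v n) (w n)) ->
    exists v' w', (forall n, R (v' n) (w' n)) /\ rep e v' /\ rep e' w' }.

#[global, refine] Instance EnvR_unit (M : structure) : EnvR (Env_unit M) := {
  envR := fun _ _ _ => True }.
Proof. intros R e e' v w _ H. exists v, w. repeat split; auto. Defined.

#[global, refine] Instance EnvR_prod (M : structure) (E : Type) (HE : Env M E)
  (HR : EnvR HE) : EnvR (Env_prod HE) := {
  envR := fun R e e' => envR R (fst e) (fst e') /\ R (snd e) (snd e') }.
Proof.
  intros R [e x] [e' x'] v w [H1 H2] H; cbn [fst snd] in *.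
  destruct (envR_rep H1 H) as (v' & w' & X & Y & Z).
  exists (upd v' (2 * depth) x), (upd w' (2 * depth) x'). split; [| split].
  - intro n. unfold upd. destruct (Nat.eqb n (2 * depth)); auto.
  - split; [now apply rep_upd | apply upd_same].
  - split; [now apply rep_upd | apply upd_same].
Defined.

Section Elementary.
Context {V : structure} {HV : ZF V} (la : V).
Hypothesis (Ll : limit_ordinal la).
Implicit Types x y z a b c f g i p s t u w : V.

Definition inL x : Prop := in_V la x.
Definition NoPar : V -> Prop := fun _ => False.
Let Ol : ordinal la := proj1 Ll.

Lemma inL_Vs x : inL x <-> x ∈ Vs la.
Proof. apply in_V_iff. Qed.

Lemma inL_trans x y : inL x -> y ∈ x -> inL y.
Proof. rewrite !inL_Vs. now apply Vs_trans. Qed.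

Lemma inL_pr x y : inL x -> inL y -> inL (pr x y).
Proof. rewrite !inL_Vs. now apply Vs_pr. Qed.

Lemma inL_pr_inv x y : inL (pr x y) -> inL x /\ inL y.
Proof. rewrite !inL_Vs. now apply Vs_pr_inv. Qed.

Lemma inL_sub x y : subset x y -> inL y -> inL x.
Proof. rewrite !inL_Vs. apply Vs_subset. Qed.

Lemma pr_Vs2 a x y : x ∈ Vs a -> y ∈ Vs a -> pr x y ∈ Vs (osucc (osucc a)).
Proof.
  intros Hx Hy.
  assert (K : forall u w, u ∈ Vs a -> w ∈ Vs a -> upair u w ∈ Vs (osucc a)).
  { intros u w Hu Hw. apply (Vs_bounded (b := a)).
    - apply mem_osucc; auto.
    - intros z Hz. apply mem_upair in Hz as [-> | ->]; auto. }
  apply (Vs_bounded (b := osucc a)).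
  - apply mem_osucc; auto.
  - intros z Hz. unfold pr in Hz. apply mem_upair in Hz as [-> | ->]; auto.
Qed.

Lemma inL_rel a f : a ∈ la ->
  (forall p, p ∈ f -> exists x y, p = pr x y /\ x ∈ Vs a /\ y ∈ Vs a) -> inL f.
Proof.
  intros Ha H. apply inL_Vs. apply (Vs_bounded (b := osucc (osucc a))).
  - auto using limit_osucc.
  - intros p Hp. destruct (H p Hp) as (x & y & -> & Hx & Hy).
    now apply pr_Vs2.
Qed.

Lemma inL_ord a : ordinal a -> inL a <-> a ∈ la.
Proof. intro Oa. rewrite inL_Vs. now apply ord_Vs. Qed.

Lemma inL_bounded a x : a ∈ la -> subset x (Vs a) -> inL x.
Proof. intros Ha H. apply inL_Vs. now apply (Vs_bounded (b := a)). Qed.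

Section Rules.
Context {E : Type} {HE : Env V E}.
Local Notation DL := (Dfn inL NoPar).
Local Notation FL := (DF inL NoPar).

Lemma ldfn_exB (t : E -> V) (P : E -> V -> Prop) : FL t ->
  DL (fun e : E * V => P (fst e) (snd e)) ->
  DL (fun e => exists x, x ∈ t e /\ P e x).
Proof.
  intros Ht HP. apply dfn_iff with
    (Q := fun e => exists x, inL x /\ (x ∈ t e /\ P e x)).
  - apply (dfn_exD (P := fun e x => x ∈ t e /\ P e x)). apply dfn_and; auto.
    apply dfn_mem; [apply df_snd | apply (df_weak Ht)].
  - intros e He. split.
    + intros (x & Hx & Hp). exists x. split; auto.
      eapply inL_trans; [apply Ht, He | exact Hx].
    + intros (x & _ & H). eauto.
Qed.

Lemma ldfn_allB (t : E -> V) (P : E -> V -> Prop) : FL t ->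
  DL (fun e : E * V => P (fst e) (snd e)) ->
  DL (fun e => forall x, x ∈ t e -> P e x).
Proof.
  intros Ht HP. apply dfn_iff with
    (Q := fun e => forall x, inL x -> (x ∈ t e -> P e x)).
  - apply (dfn_allD (P := fun e x => x ∈ t e -> P e x)). apply dfn_imp; auto.
    apply dfn_mem; [apply df_snd | apply (df_weak Ht)].
  - intros e He. split; auto. intros H x Hx. apply H; auto.
    eapply inL_trans; [apply Ht, He | exact Hx].
Qed.

End Rules.

(** The Kuratowski pair is described with quantifiers bounded by the pair and its elements, which
    mean the same in V_la as in the whole model. *)
Lemma ldfn_pr {E : Type} {HE : Env V E} (p s t : E -> V) :
  DF inL NoPar p -> DF inL NoPar s -> DF inL NoPar t ->
  Dfn inL NoPar (fun e => p e = pr (s e) (t e)).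
Proof.
  intros Hp Hs Ht. apply dfn_iff with (Q := fun e =>
    (forall w, w ∈ p e ->
       (s e ∈ w /\ forall z, z ∈ w -> z = s e) \/
       (s e ∈ w /\ t e ∈ w /\ forall z, z ∈ w -> z = s e \/ z = t e)) /\
    (exists w, w ∈ p e /\ (s e ∈ w /\ forall z, z ∈ w -> z = s e)) /\
    (exists w, w ∈ p e /\
       (s e ∈ w /\ t e ∈ w /\ forall z, z ∈ w -> z = s e \/ z = t e))).
  - repeat first
      [ apply dfn_and | apply dfn_or | apply ldfn_exB | apply ldfn_allB
      | apply dfn_mem | apply dfn_eq | df_var | df_hyp ].
  - intros e _. assert (K1 : forall w, (s e ∈ w /\ forall z, z ∈ w -> z = s e)
      <-> w = upair (s e) (s e)).
    { intro w. split.
      - intros [H1 H2]. apply zf_ext. intro z. rewrite mem_upair.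
        split; [auto |]. intros [-> | ->]; auto.
      - intros ->. rewrite mem_upair. split; auto. intros z Hz.
        apply mem_upair in Hz. tauto. }
    assert (K2 : forall w, (s e ∈ w /\ t e ∈ w /\
      forall z, z ∈ w -> z = s e \/ z = t e) <-> w = upair (s e) (t e)).
    { intro w. split.
      - intros (H1 & H2 & H3). apply zf_ext. intro z. rewrite mem_upair.
        split; [auto |]. intros [-> | ->]; auto.
      - intros ->. rewrite !mem_upair. split; auto. split; auto. intros z Hz.
        now apply mem_upair in Hz. }
    split.
    + intros ->. split; [| split].
      * intros w Hw. rewrite K1, K2. unfold pr in Hw. now apply mem_upair in Hw.
      * exists (upair (s e) (s e)). rewrite K1. unfold pr.
        rewrite mem_upair. auto.
      * exists (upair (s e) (t e)). rewrite K2. unfold pr.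
        rewrite mem_upair. auto.
    + intros (H1 & (w1 & H2 & H3) & (w2 & H4 & H5)).
      apply K1 in H3. apply K2 in H5. subst w1 w2.
      apply zf_ext. intro w. unfold pr. rewrite mem_upair. split.
      * intro Hw. destruct (H1 w Hw) as [H | H];
          [apply K1 in H | apply K2 in H]; auto.
      * intros [-> | ->]; auto.
Qed.

Lemma ldfn_prin {E : Type} {HE : Env V E} (p s t : E -> V) :
  DF inL NoPar p -> DF inL NoPar s -> DF inL NoPar t ->
  Dfn inL NoPar (fun e => pr (s e) (t e) ∈ p e).
Proof.
  intros Hp Hs Ht. apply dfn_iff with
    (Q := fun e => exists w, w ∈ p e /\ w = pr (s e) (t e)).
  - apply ldfn_exB; auto. apply ldfn_pr; [df_var | df_hyp | df_hyp].
  - intros e _. split; [eauto |]. intros (w & H & ->). exact H.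
Qed.

Ltac ldfn0 :=
  cbv beta;
  lazymatch goal with
  | |- DF _ _ _ => first [ df_var | df_hyp ]
  | |- Dfn _ _ (fun e => _ /\ _) => apply dfn_and; ldfn0
  | |- Dfn _ _ (fun e => _ \/ _) => apply dfn_or; ldfn0
  | |- Dfn _ _ (fun e => ~ _) => apply dfn_not; ldfn0
  | |- Dfn _ _ (fun e => _ <-> _) => apply dfn_equiv; ldfn0
  | |- Dfn _ _ (fun e => exists x, inL _ /\ _) => apply dfn_exD; ldfn0
  | |- Dfn _ _ (fun e => exists x, _ ∈ _ /\ _) => apply ldfn_exB; ldfn0
  | |- Dfn _ _ (fun e => forall x, inL _ -> _) => apply dfn_allD; ldfn0
  | |- Dfn _ _ (fun e => forall x, x ∈ _ -> _) => apply ldfn_allB; ldfn0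
  | |- Dfn _ _ (fun e => subset _ _) => unfold subset; ldfn0
  | |- Dfn _ _ (fun e => _ = pr _ _) => apply ldfn_pr; ldfn0
  | |- Dfn _ _ (fun e => _ = _) => apply dfn_eq; ldfn0
  | |- Dfn _ _ (fun e => pr _ _ ∈ _) => apply ldfn_prin; ldfn0
  | |- Dfn _ _ (fun e => _ ∈ _) => apply dfn_mem; ldfn0
  | |- Dfn _ _ (fun e => _ -> _) => apply dfn_imp; ldfn0
  | |- _ => idtac
  end.

Lemma ldfn_ordinal {E : Type} {HE : Env V E} (s : E -> V) :
  DF inL NoPar s -> Dfn inL NoPar (fun e => ordinal (s e)).
Proof. intro. unfold ordinal, transitive_set. ldfn0. Qed.

Lemma ldfn_limit_ordinal {E : Type} {HE : Env V E} (s : E -> V) :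
  DF inL NoPar s -> Dfn inL NoPar (fun e => limit_ordinal (s e)).
Proof.
  intro. unfold limit_ordinal. apply dfn_and; [now apply ldfn_ordinal |].
  apply dfn_and; [| ldfn0].
  apply dfn_iff with (Q := fun e => exists a, a ∈ s e /\ a = a); [ldfn0 |].
  intros e _. split; [intros [x Hx]; exists x; auto | intros (x & Hx & _); eauto].
Qed.

Definition inVo a x : Prop := ordinal a /\ x ∈ Vs a.

(** The formula asserts a function [f] that computes the hierarchy below [a]. As [la] is a limit,
    such a function is an element of V_la, and by induction it takes the true values. *)
Lemma ldfn_inVo {E : Type} {HE : Env V E} (s t : E -> V) :
  DF inL NoPar s -> DF inL NoPar t ->
  Dfn inL NoPar (fun e => inVo (s e) (t e)).
Proof.
  intros Hs Ht. apply dfn_iff with (Q := fun e => ordinal (s e) /\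
    exists f, inL f /\
      ((forall b, b ∈ s e -> exists w, inL w /\ pr b w ∈ f) /\
       (forall b, b ∈ s e -> forall w, inL w -> pr b w ∈ f ->
          forall y, inL y -> (y ∈ w <->
            exists c, c ∈ b /\ exists u, inL u /\ (pr c u ∈ f /\ subset y u))) /\
       (exists b, b ∈ s e /\ exists w, inL w /\
          (pr b w ∈ f /\ subset (t e) w)))).
  - apply dfn_and; [now apply ldfn_ordinal |]. ldfn0.
  - intros e He. destruct Ht as [_ Ht], Hs as [_ Hs].
    specialize (Hs e He). specialize (Ht e He).
    set (a := s e) in *. set (x := t e) in *. clearbody a x.
    unfold inVo. split.
    + intros [Oa Hx]. split; auto. apply inL_ord in Hs; auto.
      pose proof (Fun1_Vs (M := V)) as FV.
      assert (HLV : forall b, b ∈ a -> inL (Vs b)).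
      { intros b Hb. apply (inL_bounded (a := b)); [| apply subset_refl].
        exact (ord_trans Ol Hb Hs). }
      exists (lam a Vs). split; [| split; [| split]].
      * apply (inL_rel Hs). intros p Hp. apply mem_lam in Hp as (b & Hb & ->);
          auto. exists b, (Vs b). split; auto. split.
        -- apply ord_Vs; auto. exact (ord_mem Oa Hb).
        -- apply mem_Vs. exists b. split; auto. apply subset_refl.
      * intros b Hb. exists (Vs b). split; auto. apply pr_lam; auto.
      * intros b Hb w Hw Hbw y Hy. apply pr_lam in Hbw as [_ ->]; auto.
        rewrite mem_Vs. split.
        -- intros (c & Hc & Hyc). exists c. split; auto. exists (Vs c).
           assert (Hca : c ∈ a) by exact (ord_trans Oa Hc Hb).
           split; auto. split; auto. apply pr_lam; auto.
        -- intros (c & Hc & u & Hu & Hcu & Hyu).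
           apply pr_lam in Hcu as [_ ->]; auto. eauto.
      * apply mem_Vs in Hx as (b & Hb & Hxb). exists b. split; auto.
        exists (Vs b). split; auto. split; auto. apply pr_lam; auto.
    + intros (Oa & f & Hf & H1 & H2 & b & Hb & w & Hw & Hbw & Hxw).
      split; auto. assert (Hal : a ∈ la) by (apply inL_ord; auto).
      assert (K : forall b, b ∈ a -> forall w, inL w -> pr b w ∈ f -> w = Vs b).
      { induction b0 as [b0 IH] using (well_founded_ind zf_wf).
        intros Hb0 w0 Hw0 Hbw0. apply zf_ext. intro y. rewrite mem_Vs. split.
        - intro Hy. apply (H2 b0 Hb0 w0 Hw0 Hbw0) in Hy
            as (c & Hc & u & Hu & Hcu & Hyu); [| eapply inL_trans; eauto].
          exists c. split; auto. rewrite <- (IH c Hc) with (w := u); auto.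
          exact (ord_trans Oa Hc Hb0).
        - intros (c & Hc & Hyc).
          assert (Hca : c ∈ a) by exact (ord_trans Oa Hc Hb0).
          destruct (H1 c Hca) as (u & Hu & Hcu).
          rewrite <- (IH c Hc Hca u Hu Hcu) in Hyc.
          apply (H2 b0 Hb0 w0 Hw0 Hbw0); [eapply inL_sub; eauto |]. eauto 6. }
      apply mem_Vs. exists b. split; auto. now rewrite <- (K b Hb w).
Qed.

End Elementary.

Ltac ldfn :=
  cbv beta;
  lazymatch goal with
  | |- DF _ _ _ => first [ df_var | df_hyp ]
  | |- Dfn _ _ (fun e => _ /\ _) => apply dfn_and; ldfn
  | |- Dfn _ _ (fun e => _ \/ _) => apply dfn_or; ldfn
  | |- Dfn _ _ (fun e => ~ _) => apply dfn_not; ldfn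
  | |- Dfn _ _ (fun e => _ <-> _) => apply dfn_equiv; ldfn
  | |- Dfn _ _ (fun e => exists x, inL _ _ /\ _) => apply dfn_exD; ldfn
  | |- Dfn _ _ (fun e => exists x, _ ∈ _ /\ _) => apply ldfn_exB; [auto | |]; ldfn
  | |- Dfn _ _ (fun e => forall x, inL _ _ -> _) => apply dfn_allD; ldfn
  | |- Dfn _ _ (fun e => forall x, x ∈ _ -> _) => apply ldfn_allB; [auto | |]; ldfn
  | |- Dfn _ _ (fun e => subset _ _) => unfold subset; ldfn
  | |- Dfn _ _ (fun e => ordinal _) => apply ldfn_ordinal; [auto |]; ldfn
  | |- Dfn _ _ (fun e => limit_ordinal _) =>
    apply ldfn_limit_ordinal; [auto |]; ldfn
  | |- Dfn _ _ (fun e => inVo _ _) => apply ldfn_inVo; [auto | |]; ldfn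
  | |- Dfn _ _ (fun e => _ = pr _ _) => apply ldfn_pr; [auto | | |]; ldfn
  | |- Dfn _ _ (fun e => _ = _) => apply dfn_eq; ldfn
  | |- Dfn _ _ (fun e => pr _ _ ∈ _) => apply ldfn_prin; [auto | | |]; ldfn
  | |- Dfn _ _ (fun e => _ ∈ _) => apply dfn_mem; ldfn
  | |- Dfn _ _ (fun e => _ -> _) => apply dfn_imp; ldfn
  | |- _ => idtac
  end.

(** * Transfer along an elementary embedding of V_la into itself *)

Section Embedding.
Context {V : structure} {HV : ZF V} (la : V).
Hypothesis (Ll : limit_ordinal la).
Implicit Types x y z a b c f g p s t u w : V.
Variable (i : V).
Hypothesis (Hi : elementary_embedding i (in_V la) (in_V la)).
Local Notation inL := (inL la).

Lemma emb_isfun : isfun i.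
Proof.
  destruct Hi as [[H1 H2] _]. split.
  - intros p Hp. destruct (H1 p Hp) as (x & y & E & _). apply is_pairE in E. eauto.
  - intros x y y' Hy Hy'. assert (Hx : in_V la x).
    { destruct (H1 _ Hy) as (x' & z & E & Hx & _). apply is_pairE in E.
      apply pr_inj in E as [-> _]. auto. }
    destruct (H2 x Hx) as (z & _ & U).
    rewrite <- (U y), <- (U y'); auto; now apply pair_inE.
Qed.

Lemma emb_pr x : inL x -> pr x (app i x) ∈ i.
Proof.
  intro Hx. destruct Hi as [[_ H] _]. destruct (H x Hx) as (y & Hy & _).
  apply pair_inE in Hy. now rewrite (app_eq emb_isfun Hy).
Qed.

Lemma emb_inL x : inL x -> inL (app i x).
Proof.
  intro Hx. destruct Hi as [[H _] _].
  destruct (H _ (emb_pr Hx)) as (x' & y & E & _ & Hy). apply is_pairE in E.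
  apply pr_inj in E as [_ ->]. exact Hy.
Qed.

(** With [NoPar] the parameter list is empty, so that moving the components of the environment moves
    everything the formula speaks of. *)
Lemma emb_el {E : Type} {HE : Env V E} {HR : EnvR HE} (P : E -> Prop) e e' :
  Dfn inL (@NoPar V) P -> envD inL e -> envD inL e' ->
  envR (fun x y => inL x /\ y = app i x) e e' -> P e <-> P e'.
Proof.
  intros (f & l & Hl & Hf) He He' Hr.
  assert (l = nil) by (destruct l; auto; inversion Hl; now destruct H1). subst l.
  assert (H0 : inL emp).
  { destruct Ll as (_ & [a Ha] & _). apply (inL_bounded (a := a)); auto.
    intros z Hz. destruct (mem_emp Hz). }
  destruct (envR_rep (v := fun _ => emp) (w := fun _ => app i emp) Hr)
    as (v & w & Hvw & Hv & Hw); [auto |].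
  assert (Dv : forall n, inL (v n)) by (intro n; apply Hvw).
  assert (Dw : forall n, inL (w n)).
  { intro n. destruct (Hvw n) as [X ->]. now apply emb_inL. }
  rewrite (Hf e v), (Hf e' w); auto; try (intros [|k] a Ha; discriminate).
  destruct Hi as [_ Hp]. apply Hp; auto.
  intro n. destruct (Hvw n) as [X ->]. apply pair_inE. now apply emb_pr.
Qed.

End Embedding.

Section EmbeddingFacts.
Context {V : structure} {HV : ZF V} (la : V).
Hypothesis (Ll : limit_ordinal la).
Variable (i : V).
Hypothesis (Hi : elementary_embedding i (in_V la) (in_V la)).
Local Notation inL := (inL la).
Local Notation im := (app i).

Lemma el1 (P : V -> Prop) :
  Dfn inL (@NoPar V) (fun e : unit * V =>
    P (snd e)) ->
  forall x1, inL x1 -> (P x1 <-> P (im x1)).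
Proof.
  intros H x1; intros.
  apply (emb_el Ll Hi H (e := (tt, x1)) (e' := (tt, im x1)));
  repeat split; cbn [fst snd]; auto; apply (emb_inL Hi); auto.
Qed.

Lemma el2 (P : V -> V -> Prop) :
  Dfn inL (@NoPar V) (fun e : unit * V * V =>
    P (snd (fst e)) (snd e)) ->
  forall x1 x2, inL x1 -> inL x2 -> (P x1 x2 <-> P (im x1) (im x2)).
Proof.
  intros H x1 x2; intros.
  apply (emb_el Ll Hi H (e := (tt, x1, x2)) (e' := (tt, im x1, im x2)));
  repeat split; cbn [fst snd]; auto; apply (emb_inL Hi); auto.
Qed.

Lemma el3 (P : V -> V -> V -> Prop) :
  Dfn inL (@NoPar V) (fun e : unit * V * V * V =>
    P (snd (fst (fst e))) (snd (fst e)) (snd e)) ->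
  forall x1 x2 x3, inL x1 -> inL x2 -> inL x3 -> (P x1 x2 x3 <-> P (im x1) (im x2) (im x3)).
Proof.
  intros H x1 x2 x3; intros.
  apply (emb_el Ll Hi H (e := (tt, x1, x2, x3)) (e' := (tt, im x1, im x2, im x3)));
  repeat split; cbn [fst snd]; auto; apply (emb_inL Hi); auto.
Qed.

Lemma el4 (P : V -> V -> V -> V -> Prop) :
  Dfn inL (@NoPar V) (fun e : unit * V * V * V * V =>
    P (snd (fst (fst (fst e)))) (snd (fst (fst e))) (snd (fst e)) (snd e)) ->
  forall x1 x2 x3 x4, inL x1 -> inL x2 -> inL x3 -> inL x4 -> (P x1 x2 x3 x4 <-> P (im x1) (im x2) (im x3) (im x4)).
Proof.
  intros H x1 x2 x3 x4; intros.
  apply (emb_el Ll Hi H (e := (tt, x1, x2, x3, x4)) (e' := (tt, im x1, im x2, im x3, im x4)));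
  repeat split; cbn [fst snd]; auto; apply (emb_inL Hi); auto.
Qed.

Lemma el5 (P : V -> V -> V -> V -> V -> Prop) :
  Dfn inL (@NoPar V) (fun e : unit * V * V * V * V * V =>
    P (snd (fst (fst (fst (fst e))))) (snd (fst (fst (fst e)))) (snd (fst (fst e))) (snd (fst e)) (snd e)) ->
  forall x1 x2 x3 x4 x5, inL x1 -> inL x2 -> inL x3 -> inL x4 -> inL x5 -> (P x1 x2 x3 x4 x5 <-> P (im x1) (im x2) (im x3) (im x4) (im x5)).
Proof.
  intros H x1 x2 x3 x4 x5; intros.
  apply (emb_el Ll Hi H (e := (tt, x1, x2, x3, x4, x5)) (e' := (tt, im x1, im x2, im x3, im x4, im x5)));
  repeat split; cbn [fst snd]; auto; apply (emb_inL Hi); auto.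
Qed.

Lemma el7 (P : V -> V -> V -> V -> V -> V -> V -> Prop) :
  Dfn inL (@NoPar V) (fun e : unit * V * V * V * V * V * V * V =>
    P (snd (fst (fst (fst (fst (fst (fst e))))))) (snd (fst (fst (fst (fst (fst e)))))) (snd (fst (fst (fst (fst e))))) (snd (fst (fst (fst e)))) (snd (fst (fst e))) (snd (fst e)) (snd e)) ->
  forall x1 x2 x3 x4 x5 x6 x7, inL x1 -> inL x2 -> inL x3 -> inL x4 -> inL x5 -> inL x6 -> inL x7 -> (P x1 x2 x3 x4 x5 x6 x7 <-> P (im x1) (im x2) (im x3) (im x4) (im x5) (im x6) (im x7)).
Proof.
  intros H x1 x2 x3 x4 x5 x6 x7; intros.
  apply (emb_el Ll Hi H (e := (tt, x1, x2, x3, x4, x5, x6, x7)) (e' := (tt, im x1, im x2, im x3, im x4, im x5, im x6, im x7)));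
  repeat split; cbn [fst snd]; auto; apply (emb_inL Hi); auto.
Qed.

Lemma im_mem x y : inL x -> inL y -> (x ∈ y <-> im x ∈ im y).
Proof. apply (el2 (P := fun x y => x ∈ y)). ldfn. Qed.

Lemma im_pr x y : inL x -> inL y -> im (pr x y) = pr (im x) (im y).
Proof.
  intros Hx Hy. assert (Hp := inL_pr Ll Hx Hy).
  refine (proj1 (el3 (P := fun x y z => z = pr x y) _ Hx Hy Hp) eq_refl).
  ldfn.
Qed.

Lemma im_subset x y : inL x -> inL y -> (subset x y <-> subset (im x) (im y)).
Proof. apply (el2 (P := fun x y => subset x y)). ldfn. Qed.

Lemma im_ordinal x : inL x -> (ordinal x <-> ordinal (im x)).
Proof. apply (el1 (P := fun x => ordinal x)). ldfn. Qed.

Lemma im_limit x : inL x -> (limit_ordinal x <-> limit_ordinal (im x)).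
Proof. apply (el1 (P := fun x => limit_ordinal x)). ldfn. Qed.

Lemma im_isfun f : inL f -> isfun f -> isfun (im f).
Proof.
  intros Hf [H1 H2].
  assert (K1 : forall p, p ∈ f -> exists x, inL x /\ exists y, inL y /\
    p = pr x y).
  { intros p Hp. destruct (H1 p Hp) as (x & y & ->).
    destruct (inL_pr_inv Ll (inL_trans Ll Hf Hp)). eauto. }
  assert (K2 : forall x, inL x -> forall y, inL y -> forall z, inL z ->
    pr x y ∈ f -> pr x z ∈ f -> y = z) by eauto.
  pose proof (proj1 (el1 (P := fun f => forall p, p ∈ f -> exists x, inL x /\
    exists y, inL y /\ p = pr x y) ltac:(ldfn) Hf) K1) as LK1.
  pose proof (proj1 (el1 (P := fun f => forall x, inL x -> forall y, inL y ->
    forall z, inL z -> pr x y ∈ f -> pr x z ∈ f -> y = z) ltac:(ldfn) Hf) K2) as LK2.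
  assert (Hf' := emb_inL Hi Hf).
  split.
  - intros p Hp. destruct (LK1 p Hp) as (x & _ & y & _ & ->). eauto.
  - intros x y z Hy Hz. destruct (inL_pr_inv Ll (inL_trans Ll Hf' Hy)).
    destruct (inL_pr_inv Ll (inL_trans Ll Hf' Hz)). eauto.
Qed.

Lemma im_pr_mem x y f : inL f -> pr x y ∈ f -> pr (im x) (im y) ∈ im f.
Proof.
  intros Hf H. assert (Hp := inL_trans Ll Hf H).
  destruct (inL_pr_inv Ll Hp) as [Hx Hy].
  rewrite <- im_pr by auto. exact (proj1 (im_mem Hp Hf) H).
Qed.

Lemma inL_Vs_ord a : a ∈ la -> inL (Vs a).
Proof. intro Ha. apply (inL_bounded Ha). apply subset_refl. Qed.

Lemma im_Vs a : a ∈ la -> im (Vs a) = Vs (im a).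
Proof.
  intro Ha. assert (Oa : ordinal a) by exact (ord_mem (proj1 Ll) Ha).
  assert (Hi' : inL a) by (apply inL_ord; auto).
  assert (HV' := inL_Vs_ord Ha).
  assert (Oa' : ordinal (im a)) by exact (proj1 (im_ordinal Hi') Oa).
  assert (K : forall x, inL x -> (x ∈ Vs a <-> inVo a x)).
  { intros x _. unfold inVo. tauto. }
  pose proof (proj1 (el2 (P := fun v a => forall x, inL x -> (x ∈ v <-> inVo a x))
    ltac:(ldfn) HV' Hi') K) as LK.
  apply zf_ext. intro x. split.
  - intro H. apply (LK x (inL_trans Ll (emb_inL Hi HV') H)) in H. apply H.
  - intro H. apply LK; [| split; auto].
    apply (inL_trans Ll (x := Vs (im a))); auto. apply inL_Vs_ord.
    apply inL_ord; auto. now apply (emb_inL Hi).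
Qed.

End EmbeddingFacts.

(** * The critical point: fixed sets, large cardinal properties and the induced ultrafilter *)

Section CriticalPoint.
Context {V : structure} {HV : ZF V} (la : V).
Hypothesis (Ll : limit_ordinal la).
Implicit Types x y z a b c f g p s t u w A B : V.
Variable (j k : V).
Hypothesis (Hj : elementary_embedding j (in_V la) (in_V la)).
Hypothesis (Hk : is_critical_point j k).
Local Notation inL := (inL la).
Local Notation jj := (app j).
Local Notation Ol := (proj1 Ll).
Local Notation Jf := (emb_isfun Hj).

Lemma crit_ord : ordinal k.
Proof. apply Hk. Qed.
Local Notation Ok := crit_ord.
Local Hint Resolve crit_ord : core.

Lemma crit_inL : inL k.
Proof.
  pose proof Hk as (_ & (k' & H & _) & _). pose proof Hj as [[H1 _] _].
  apply pair_inE in H. destruct (H1 _ H) as (x & y & E & Hx & _).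
  apply is_pairE in E. apply pr_inj in E as [-> _]. exact Hx.
Qed.

Lemma crit_la : k ∈ la.
Proof. apply (inL_ord Ll Ok). apply crit_inL. Qed.
Local Notation Lk := crit_inL.
Local Hint Resolve crit_inL crit_la : core.

Lemma crit_fix a : a ∈ k -> jj a = a.
Proof.
  intro Ha. pose proof Hk as (_ & _ & H). apply (app_eq Jf), pair_inE, H, Ha.
Qed.

Lemma crit_moved : k ∈ jj k.
Proof.
  assert (O' : ordinal (jj k)) by exact (proj1 (im_ordinal Ll Hj Lk) Ok).
  assert (S : subset k (jj k)).
  { intros a Ha. rewrite <- (crit_fix Ha).
    exact (proj1 (im_mem Ll Hj (inL_trans Ll Lk Ha) Lk) Ha). }
  destruct (ord_subset Ok O' S) as [|E]; auto. exfalso.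
  pose proof Hk as (_ & (k' & H & N) & _). apply N.
  apply pair_inE in H. rewrite <- (app_eq Jf H). auto.
Qed.

(** A set bounded by some [b] below [k] has an image with the same bound, and by induction the sets
    below the bound are fixed; hence no element is gained or lost. *)
Lemma im_fix_Vs x : x ∈ Vs k -> jj x = x.
Proof.
  assert (K : forall b, b ∈ k -> forall x, subset x (Vs b) -> jj x = x).
  { induction b as [b IH] using (well_founded_ind zf_wf). intros Hb y Hy.
    assert (Ob : ordinal b) by exact (ord_mem Ok Hb).
    assert (Hbl : b ∈ la) by exact (ord_trans Ol Hb crit_la).
    assert (Lb : inL b) by (apply (inL_ord Ll Ob); auto).
    assert (Ly : inL y) by (apply (inL_bounded Hbl); auto).
    assert (Fx : forall z, z ∈ Vs b -> jj z = z).
    { intros z Hz. apply mem_Vs in Hz as (c & Hc & Hz). apply (IH c); auto.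
      exact (ord_trans Ok Hc Hb). }
    assert (K : forall z, z ∈ y -> inVo b z) by (intros z Hz; split; auto).
    pose proof (proj1 (el2 Ll Hj (P := fun y b => forall z, z ∈ y -> inVo b z)
      ltac:(ldfn) Ly Lb) K) as LK. cbv beta in LK.
    rewrite (crit_fix Hb) in LK.
    apply zf_ext. intro z. split; intro Hz.
    - pose proof (proj2 (LK z Hz)) as Hzb. rewrite <- (Fx z Hzb) in Hz.
      exact (proj2 (im_mem Ll Hj (inL_trans Ll (inL_Vs_ord Hbl) Hzb) Ly) Hz).
    - rewrite <- (Fx z (Hy z Hz)). 
      exact (proj1 (im_mem Ll Hj (inL_trans Ll Ly Hz) Ly) Hz). }
  intro Hx. apply mem_Vs in Hx as (b & Hb & Hx). eauto.
Qed.

Lemma crit_limit : limit_ordinal k.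
Proof.
  split; [exact Ok | split].
  - apply NNPP. intro N.
    assert (K : forall x, x ∈ k -> x <> x) by (intros x Hx; destruct N; eauto).
    pose proof (proj1 (el1 Ll Hj (P := fun k => forall x, x ∈ k -> x <> x)
      ltac:(ldfn) Lk) K) as LK. exact (LK k crit_moved eq_refl).
  - intros b Hb. apply NNPP. intro N.
    assert (Lb : inL b) by exact (inL_trans Ll Lk Hb).
    assert (K : forall x, x ∈ k -> x ∈ b \/ x = b).
    { intros x Hx. destruct (ord_total (ord_mem Ok Hx) (ord_mem Ok Hb))
        as [L | [L | L]]; auto. destruct N. eauto. }
    pose proof (proj1 (el2 Ll Hj (P := fun k b => forall x, x ∈ k -> x ∈ b \/ x = b)
      ltac:(ldfn) Lk Lb) K) as LK. cbv beta in LK. rewrite (crit_fix Hb) in LK.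
    destruct (LK k crit_moved) as [X | ->].
    + exact (mem_asym Hb X).
    + exact (mem_irrefl Hb).
Qed.
Local Notation Limk := crit_limit.
Local Hint Resolve crit_limit : core.

Lemma num_limit a n : limit_ordinal a -> num n ∈ a.
Proof.
  intro La. induction n; simpl; [| now apply limit_osucc].
  destruct La as (Oa & [b Hb] & _).
  destruct (ord_total ord_emp (ord_mem Oa Hb)) as [L | [L | L]].
  - exact (ord_trans Oa L Hb).
  - now subst.
  - destruct (mem_emp L).
Qed.

(** If [k] were [omega], each of its elements would be empty or have a largest element. By
    elementarity so would each element of the image of [k], in particular the limit ordinal [k]. *)
Lemma omega_crit : omega ∈ k.
Proof.
  assert (S : subset omega k).
  { intros x Hx. apply mem_omega in Hx as [n ->]. now apply num_limit. }
  destruct (ord_subset ord_omega Ok S) as [|E]; auto. exfalso.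
  assert (K : forall x, x ∈ k -> (forall z, z ∈ x -> z <> z) \/
    exists y, y ∈ x /\ forall z, z ∈ x -> z ∈ y \/ z = y).
  { intros x Hx. rewrite <- E in Hx. apply mem_omega in Hx as [[|n] ->].
    - left. intros z Hz. destruct (mem_emp Hz).
    - right. exists (num n). simpl. rewrite mem_osucc. split; auto.
      intros z Hz. now apply mem_osucc in Hz. }
  pose proof (proj1 (el1 Ll Hj (P := fun k => forall x, x ∈ k ->
    (forall z, z ∈ x -> z <> z) \/ exists y, y ∈ x /\ forall z, z ∈ x ->
    z ∈ y \/ z = y) ltac:(ldfn) Lk) K) as LK. cbv beta in LK.
  destruct (LK k crit_moved) as [X | (y & Hy & X)].
  - pose proof Limk as (_ & [a Ha] & _). exact (X a Ha eq_refl).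
  - pose proof Limk as (_ & _ & Z). destruct (Z y Hy) as (b & Hb & Hyb).
    destruct (X b Hb) as [Y | ->].
    + exact (mem_asym Hyb Y).
    + exact (mem_irrefl Hyb).
Qed.

(** If [f] were cofinal on [x], the image of [f] would reach [k] at some point of the fixed set [x];
    but there its value is the value of [f], which is below [k]. *)
Lemma crit_regular f x : x ∈ Vs k -> inL f -> isfun f ->
  (forall y z, pr y z ∈ f -> z ∈ k) ->
  ~ forall a, a ∈ k -> exists y, y ∈ x /\ exists z, inL z /\
      (pr y z ∈ f /\ (a ∈ z \/ a = z)).
Proof.
  intros Hx Lf If Hr Hc.
  assert (Lx : inL x) by exact (inL_trans Ll (inL_Vs_ord crit_la) Hx).
  pose proof (proj1 (el3 Ll Hj (P := fun k x f => forall a, a ∈ k ->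
    exists y, y ∈ x /\ exists z, inL z /\ (pr y z ∈ f /\ (a ∈ z \/ a = z)))
    ltac:(ldfn) Lk Lx Lf) Hc) as LK. cbv beta in LK.
  rewrite (im_fix_Vs Hx) in LK.
  destruct (LK k crit_moved) as (y & Hy & z & Lz & Hyz & Hkz).
  assert (HyV : y ∈ Vs k) by exact (Vs_trans Ok Hx Hy).
  assert (Ly : inL y) by exact (inL_trans Ll Lx Hy).
  assert (K : exists w, inL w /\ pr y w ∈ f).
  { apply (proj2 (el2 Ll Hj (P := fun y f => exists w, inL w /\ pr y w ∈ f)
      ltac:(ldfn) Ly Lf)). rewrite (im_fix_Vs HyV). eauto. }
  destruct K as (w & Lw & Hw). pose proof (Hr y w Hw) as Hwk.
  pose proof (im_pr_mem Ll Hj Lf Hw) as Hw'.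
  rewrite (im_fix_Vs HyV), (crit_fix Hwk) in Hw'.
  pose proof (proj2 (im_isfun Ll Hj Lf If) _ _ _ Hyz Hw') as E. subst z.
  destruct Hkz as [X | X].
  - exact (mem_asym Hwk X).
  - subst. exact (mem_irrefl Hwk).
Qed.

Lemma no_surj_crit f x : x ∈ Vs k -> isfun f ->
  (forall y z, pr y z ∈ f -> y ∈ x) ->
  ~ forall z, z ∈ k -> exists y, y ∈ x /\ pr y z ∈ f.
Proof.
  intros Hx If Hd Hs.
  set (f' := sep f (fun p => sndp p ∈ k)).
  assert (Mf : forall y z, pr y z ∈ f' <-> pr y z ∈ f /\ z ∈ k).
  { intros y z. unfold f'. rewrite mem_sep by cls. now rewrite sndp_pr. }
  assert (If' : isfun f').
  { eapply isfun_sub; eauto. intros p Hp. apply mem_sep in Hp; [tauto | cls]. }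
  assert (Lf' : inL f').
  { apply (inL_rel Ll crit_la). intros p Hp.
    destruct (proj1 If' p Hp) as (y & z & ->). exists y, z. split; auto.
    apply Mf in Hp as [Hp Hz]. split.
    - exact (Vs_trans Ok Hx (Hd y z Hp)).
    - apply ord_Vs; auto. exact (ord_mem Ok Hz). }
  apply (crit_regular Hx Lf' If').
  - intros y z H. apply Mf in H. tauto.
  - intros a Ha. destruct (Hs a Ha) as (y & Hy & Hya). exists y.
    split; auto. exists a. split; [exact (inL_trans Ll Lk Ha) |].
    split; auto. apply Mf. auto.
Qed.

(** The bounded form is the one that can be carried along [j], for instance to show that images of
    cardinals are cardinals. *)
Lemma bijE f a b : is_bijection f a b <->
  ((forall p, p ∈ f -> exists x, x ∈ a /\ exists y, y ∈ b /\ p = pr x y) /\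
   (forall x, x ∈ a -> exists y, y ∈ b /\ (pr x y ∈ f /\
      forall y', y' ∈ b -> pr x y' ∈ f -> y' = y)) /\
   (forall y, y ∈ b -> exists x, x ∈ a /\ (pr x y ∈ f /\
      forall x', x' ∈ a -> pr x' y ∈ f -> x' = x))).
Proof.
  split.
  - intros [[H1 H2] H3].
    assert (H1' : forall p, p ∈ f -> exists x, x ∈ a /\ exists y, y ∈ b /\
      p = pr x y).
    { intros p Hp. destruct (H1 p Hp) as (x & y & E & Hx & Hy).
      apply is_pairE in E. eauto 6. }
    assert (H1'' : forall x y, pr x y ∈ f -> x ∈ a /\ y ∈ b).
    { intros x y Hp. destruct (H1' _ Hp) as (x' & Hx & y' & Hy & E).
      apply pr_inj in E as [-> ->]. auto. }
    split; auto. split.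
    + intros x Hx. destruct (H2 x Hx) as (y & Hy & U). apply pair_inE in Hy.
      exists y. split; [apply (H1'' _ _ Hy) |]. split; auto.
      intros y' _ Hy'. symmetry. now apply U, pair_inE.
    + intros y Hy. destruct (H3 y Hy) as (x & Hx & U). apply pair_inE in Hx.
      exists x. split; [apply (H1'' _ _ Hx) |]. split; auto.
      intros x' _ Hx'. symmetry. now apply U, pair_inE.
  - intros (H1 & H2 & H3).
    assert (H1'' : forall x y, pr x y ∈ f -> x ∈ a /\ y ∈ b).
    { intros x y Hp. destruct (H1 _ Hp) as (x' & Hx & y' & Hy & E).
      apply pr_inj in E as [-> ->]. auto. }
    split; [split |].
    + intros p Hp. destruct (H1 p Hp) as (x & Hx & y & Hy & ->).
      exists x, y. rewrite is_pairE. auto.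
    + intros x Hx. destruct (H2 x Hx) as (y & Hy & Hxy & U). exists y.
      split; [now apply pair_inE |]. intros y' Hy'. apply pair_inE in Hy'.
      symmetry. apply U; auto. apply (H1'' _ _ Hy').
    + intros y Hy. destruct (H3 y Hy) as (x & Hx & Hxy & U). exists x.
      split; [now apply pair_inE |]. intros x' Hx'. apply pair_inE in Hx'.
      symmetry. apply U; auto. apply (H1'' _ _ Hx').
Qed.

Lemma crit_no_bijection a f : a ∈ k -> ~ is_bijection f a k.
Proof.
  intros Ha Hf. pose proof (is_bijection_fun Hf) as If. apply bijE in Hf
    as (H1 & _ & H3).
  apply (@no_surj_crit f a); auto.
  - apply ord_Vs; auto. exact (ord_mem Ok Ha).
  - intros y z Hp. destruct (H1 _ Hp) as (x' & Hx & y' & Hy & E).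
    apply pr_inj in E as [-> ->]. auto.
  - intros z Hz. destruct (H3 z Hz) as (x & Hx & Hxz & _). eauto.
Qed.

Definition cardL b : Prop := ordinal b /\ forall a, a ∈ b ->
  ~ exists f, inL f /\
  ((forall p, p ∈ f -> exists x, x ∈ a /\ exists y, y ∈ b /\ p = pr x y) /\
   (forall x, x ∈ a -> exists y, y ∈ b /\ (pr x y ∈ f /\
      forall y', y' ∈ b -> pr x y' ∈ f -> y' = y)) /\
   (forall y, y ∈ b -> exists x, x ∈ a /\ (pr x y ∈ f /\
      forall x', x' ∈ a -> pr x' y ∈ f -> x' = x))).

Lemma cardL_cardinal b : inL b -> cardL b <-> cardinal b.
Proof.
  intro Lb. split.
  - intros [Ob H]. split; auto. intros a Ha [f Hf]. apply (H a Ha).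
    exists f. apply bijE in Hf. split; auto.
    assert (Hbl : b ∈ la) by (apply (inL_ord Ll Ob); auto).
    apply (inL_rel Ll Hbl). intros p Hp.
    destruct (proj1 Hf p Hp) as (x & Hx & y & Hy & ->). exists x, y.
    split; auto. assert (Oy : ordinal y) by exact (ord_mem Ob Hy).
    assert (Oa : ordinal a) by exact (ord_mem Ob Ha).
    assert (Ox : ordinal x) by exact (ord_mem Oa Hx).
    rewrite !ord_Vs by auto. split; auto. exact (ord_trans Ob Hx Ha).
  - intros [Ob H]. split; auto. intros a Ha (f & _ & Hf). apply (H a Ha).
    exists f. now apply bijE.
Qed.

Lemma im_cardinal b : inL b -> cardinal b -> cardinal (jj b).
Proof.
  intros Lb Hb. apply cardL_cardinal in Hb; auto.
  apply cardL_cardinal; [now apply (emb_inL Hj) |].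
  refine (proj1 (el1 Ll Hj (P := fun b => cardL b) _ Lb) Hb).
  unfold cardL. ldfn.
Qed.

Lemma crit_cardinal : cardinal k.
Proof. split; auto. intros a Ha [f Hf]. exact (crit_no_bijection Ha Hf). Qed.

(** The enumeration given by choice may be long. Ordering [x] by first indices and collapsing gives
    an order type [o]; if [o] reached [k], a set in [Vs k] would map onto [k]. *)
Lemma crit_wellorder (VWO : WO (M := V)) x : x ∈ Vs k ->
  exists o h, o ∈ k /\ surj h o x.
Proof.
  intro Hx. destruct (VWO x) as (q & h & Oq & Hh & Hs).
  set (idx := fun y a => a ∈ q /\ pr a y ∈ h /\
    forall b, b ∈ a -> ~ pr b y ∈ h).
  assert (Hidx : forall y, y ∈ x -> exists a, idx y a).
  { intros y Hy. destruct (Hs y Hy) as (a & Ha & Hay).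
    destruct (@ord_least V HV (fun a => a ∈ q /\ pr a y ∈ h) a)
      as (b & Ob & [Hb Hby] & Hm); [exact (ord_mem Oq Ha) | auto |].
    exists b. split; auto. split; auto. intros c Hc Hcy.
    apply (Hm c Hc). split; auto. exact (ord_trans Oq Hc Hb). }
  assert (Uidx : forall y a b, idx y a -> idx y b -> a = b).
  { intros y a b (A1 & A2 & A3) (B1 & B2 & B3).
    destruct (ord_total (ord_mem Oq A1) (ord_mem Oq B1)) as [L | [L | L]]; auto.
    - destruct (B3 a L A2).
    - destruct (A3 b L B2). }
  set (lt := fun y z => exists a b, idx y a /\ idx z b /\ a ∈ b).
  destruct (@collapse_exists V HV x lt) as (o & f & Oo & If & Df & F1 & F2 & F3 & F4).
  - unfold lt, idx. cls.
  - intros y z w Hy Hz Hw (a & b & A1 & A2 & A3) (b' & c & B1 & B2 & B3).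
    rewrite (Uidx _ _ _ B1 A2) in B3. exists a, c. split; auto. split; auto.
    assert (Hc : c ∈ q) by apply B2. exact (ord_trans (ord_mem Oq Hc) A3 B3).
  - intros y z Hy Hz. destruct (Hidx y Hy) as [a Ia], (Hidx z Hz) as [b Ib].
    destruct (ord_total (ord_mem Oq (proj1 Ia)) (ord_mem Oq (proj1 Ib)))
      as [L | [L | L]].
    + left. exists a, b. auto.
    + right; left. subst b. exact (proj2 Hh _ _ _ (proj1 (proj2 Ia))
        (proj1 (proj2 Ib))).
    + right; right. exists b, a. auto.
  - apply wf_measure_ord with (m := fun y => the (idx y)).
    intros y z Hy Hz (a & b & A1 & A2 & A3).
    rewrite (Uidx _ _ _ (the_spec (Hidx y Hy)) A1).
    now rewrite (Uidx _ _ _ (the_spec (Hidx z Hz)) A2).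
  - assert (Hok : o ∈ k).
    { destruct (ord_total Oo Ok) as [L | [L | L]]; auto; exfalso;
      apply (@no_surj_crit f x); auto.
      - intros y z Hp. rewrite <- Df. apply mem_dom. eauto.
      - intros z Hz. rewrite <- L in Hz. destruct (F2 z Hz) as (y & Hy & <-).
        exists y. split; auto. apply app_mem; congruence.
      - intros y z Hp. rewrite <- Df. apply mem_dom. eauto.
      - intros z Hz. destruct (F2 z (ord_trans Oo Hz L)) as (y & Hy & <-).
        exists y. split; auto. apply app_mem; congruence. }
    destruct (bijection_inverse If Df F1 F2 F3) as [g Hg].
    exists o, g. split; auto. split; [exact (is_bijection_fun Hg) |].
    intros y Hy. apply bijE in Hg as (_ & _ & Hg).
    destruct (Hg y Hy) as (b & Hb & Hby & _). eauto.
Qed.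

(** Order [d] by the level of the first preimage and then by size. The predecessors of a point of
    level [a] have preimages in [Vs a], so the order type is at most [k]; thus [d] would be in
    bijection with an ordinal below it. *)
Lemma crit_no_surj_succ d g : cardinal d -> k ∈ d -> isfun g ->
  ~ forall b, b ∈ d -> exists x, x ∈ Vs k /\ pr x b ∈ g.
Proof.
  intros [Od Hd] Hkd Ig Hg.
  set (lvl := fun b a => a ∈ k /\ (exists x, x ∈ Vs a /\ pr x b ∈ g) /\
    forall c, c ∈ a -> ~ exists x, x ∈ Vs c /\ pr x b ∈ g).
  assert (Hl : forall b, b ∈ d -> exists a, lvl b a).
  { intros b Hb. destruct (Hg b Hb) as (x & Hx & Hxb).
    assert (Hr : osucc (rk x) ∈ k).
    { apply limit_osucc; auto. now apply mem_Vs_rk. }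
    destruct (@ord_least V HV (fun a => a ∈ k /\ exists x, x ∈ Vs a /\ pr x b ∈ g)
      (osucc (rk x))) as (a & Oa & [Ha Hax] & Hm).
    - apply ord_osucc, ord_rk.
    - split; auto. exists x. split; auto. apply in_Vs_osucc_rk.
    - exists a. split; auto. split; auto. intros c Hc He.
      apply (Hm c Hc). split; auto. exact (ord_trans Ok Hc Ha). }
  assert (Ul : forall b a a', lvl b a -> lvl b a' -> a = a').
  { intros b a a' (A1 & A2 & A3) (B1 & B2 & B3).
    destruct (ord_total (ord_mem Ok A1) (ord_mem Ok B1)) as [L | [L | L]]; auto.
    - destruct (B3 a L A2).
    - destruct (A3 a' L B2). }
  set (lt := fun b b' => exists a a', lvl b a /\ lvl b' a' /\
    (a ∈ a' \/ (a = a' /\ b ∈ b'))).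
  destruct (@collapse_exists V HV d lt) as (o & f & Oo & If & Df & F1 & F2 & F3 & F4).
  - unfold lt, lvl. cls.
  - intros x y z Hx Hy Hz (a & b & A1 & A2 & A3) (b' & c & B1 & B2 & B3).
    rewrite (Ul _ _ _ B1 A2) in B3. exists a, c. split; auto. split; auto.
    assert (Oc : ordinal c) by exact (ord_mem Ok (proj1 B2)).
    destruct A3 as [A3 | [-> A3]], B3 as [B3 | [-> B3]]; auto.
    + left. exact (ord_trans Oc A3 B3).
    + right. split; auto. exact (ord_trans (ord_mem Od Hz) A3 B3).
  - intros x y Hx Hy. destruct (Hl x Hx) as [a Ia], (Hl y Hy) as [b Ib].
    destruct (ord_total (ord_mem Ok (proj1 Ia)) (ord_mem Ok (proj1 Ib)))
      as [L | [L | L]].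
    + left. exists a, b. auto.
    + subst b. destruct (ord_total (ord_mem Od Hx) (ord_mem Od Hy))
        as [L | [L | L]]; auto.
      * left. exists a, a. auto 6.
      * right; right. exists a, a. auto 6.
    + right; right. exists b, a. auto.
  - assert (K : forall a b, lvl b a ->
      Acc (fun x y => x ∈ d /\ y ∈ d /\ lt x y) b).
    { induction a as [a IHa] using (well_founded_ind zf_wf).
      induction b as [b IHb] using (well_founded_ind zf_wf). intro Hb.
      constructor. intros y (Hy & Hbd & a1 & a2 & Y1 & Y2 & Y3).
      rewrite (Ul _ _ _ Y2 Hb) in Y3. destruct Y3 as [Y3 | [-> Y3]].
      - apply (IHa a1); auto.
      - apply IHb; auto. }
    intro b. destruct (classic (b ∈ d)) as [Hb | Nb].
    + destruct (Hl b Hb) as [a Ha]. eauto.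
    + constructor. intros y (_ & Hb & _). tauto.
  - assert (Hok : ~ k ∈ o).
    { intro Hko. destruct (F2 k Hko) as (b & Hb & Eb).
      destruct (Hl b Hb) as [a Ha].
      set (h := sep (prod (Vs a) k) (fun p => exists b', pr (fstp p) b' ∈ g /\
        b' ∈ d /\ pr b' (sndp p) ∈ f)).
      assert (Mh : forall x z, pr x z ∈ h <-> (x ∈ Vs a /\ z ∈ k) /\
        exists b', pr x b' ∈ g /\ b' ∈ d /\ pr b' z ∈ f).
      { intros x z. unfold h. rewrite mem_sep by cls.
        now rewrite pr_prod, fstp_pr, sndp_pr. }
      assert (Oa : ordinal a) by exact (ord_mem Ok (proj1 Ha)).
      apply (@no_surj_crit h (Vs a)).
      - apply mem_Vs. exists a. split; [apply Ha | apply subset_refl].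
      - split.
        + intros p Hp. apply mem_sep in Hp as [Hp _]; [| cls].
          apply mem_prod in Hp as (x & z & _ & _ & ->). eauto.
        + intros x z z' Hz Hz'. apply Mh in Hz as (_ & b1 & X1 & _ & X2),
            Hz' as (_ & b2 & Y1 & _ & Y2).
          rewrite (proj2 Ig _ _ _ Y1 X1) in Y2. exact (proj2 If _ _ _ X2 Y2).
      - intros y z Hp. apply Mh in Hp. tauto.
      - intros z Hz. rewrite <- Eb in Hz.
        destruct (F4 b z Hb Hz) as (b' & Hb' & (a1 & a2 & Y1 & Y2 & Y3) & ->).
        rewrite (Ul _ _ _ Y2 Ha) in Y3. rewrite Eb in Hz.
        destruct Y1 as (Y0 & (x & Hx & Hxb) & _).
        assert (Hxa : x ∈ Vs a).
        { destruct Y3 as [Y3 | [-> _]]; auto. revert Hx. apply Vs_mono.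
          apply (proj1 Oa); auto. }
        exists x. split; auto. apply Mh. split; auto. exists b'.
        split; auto. split; auto. apply app_mem; congruence. }
    assert (Hod : o ∈ d).
    { destruct (ord_total Oo Ok) as [L | [L | L]]; [| now subst | tauto].
      exact (ord_trans Od L Hkd). }
    destruct (bijection_inverse If Df F1 F2 F3) as [q Hq].
    apply (Hd o Hod). eauto.
Qed.

Variable (U : V).
Hypothesis (HU : is_induced_ultrafilter j k U).

Lemma sub_k_inL A : subset A k -> inL A.
Proof. intro H. exact (inL_sub H Lk). Qed.

Lemma mem_U A : A ∈ U <-> subset A k /\ k ∈ jj A.
Proof.
  rewrite (HU A). split.
  - intros [HA (B & HB & HkB)]. apply pair_inE in HB.
    now rewrite (app_eq Jf HB).
  - intros [HA Hka]. split; auto. exists (jj A). split; auto.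
    apply pair_inE, (emb_pr Hj). now apply sub_k_inL.
Qed.

Lemma crit_normal : normal_uf k U.
Proof.
  split.
  - exact Limk.
  - intros A HA. now apply mem_U.
  - intros A HA N. set (B := sep k (fun x => ~ x ∈ A)).
    assert (MB : forall x, x ∈ B <-> x ∈ k /\ ~ x ∈ A) by
      (intro; unfold B; now rewrite mem_sep by cls).
    assert (HB : subset B k) by (intros x Hx; apply MB in Hx; tauto).
    apply mem_U. split; auto.
    assert (K : forall x, x ∈ k -> x ∈ A \/ x ∈ B).
    { intros x Hx. rewrite MB. destruct (classic (x ∈ A)); auto. }
    pose proof (proj1 (el3 Ll Hj (P := fun k A B => forall x, x ∈ k ->
      x ∈ A \/ x ∈ B) ltac:(ldfn) Lk (sub_k_inL HA) (sub_k_inL HB)) K) as LK.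
    destruct (LK k crit_moved) as [X | X]; auto. destruct N. apply mem_U. auto.
  - intros A B HA HAB HB. apply mem_U in HA as [HA Hka]. apply mem_U.
    split; auto. exact (proj1 (im_subset Ll Hj (sub_k_inL HA) (sub_k_inL HB))
      HAB k Hka).
  - intros A B HA HB. apply mem_U in HA as [HA Hka], HB as [HB Hkb].
    set (C := sep A (fun x => x ∈ B)).
    assert (MC : forall x, x ∈ C <-> x ∈ A /\ x ∈ B) by
      (intro; unfold C; now rewrite mem_sep by cls).
    assert (HC : subset C k) by (intros x Hx; apply MC in Hx as [Hx _]; auto).
    apply mem_U. split; auto.
    assert (K : forall x, x ∈ A -> x ∈ B -> x ∈ C) by (intros; apply MC; auto).
    exact (proj1 (el3 Ll Hj (P := fun A B C => forall x, x ∈ A -> x ∈ B -> x ∈ C)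
      ltac:(ldfn) (sub_k_inL HA) (sub_k_inL HB) (sub_k_inL HC)) K k Hka Hkb).
  - intro H. apply mem_U in H as [H0 H].
    assert (K : forall x : V, x ∈ emp -> x <> x) by
      (intros x Hx; destruct (mem_emp Hx)).
    exact (proj1 (el1 Ll Hj (P := fun A => forall x, x ∈ A -> x <> x)
      ltac:(ldfn) (sub_k_inL H0)) K k H eq_refl).
  - intros B FB HB. pose proof (Fun1_Vs (M := V)) as FV.
    set (S := sep k (fun g => forall x, x ∈ Vs g -> g ∈ B x)).
    assert (MS : forall g, g ∈ S <-> g ∈ k /\ forall x, x ∈ Vs g -> g ∈ B x) by
      (intro; unfold S; now rewrite mem_sep by cls).
    assert (HS : subset S k) by (intros x Hx; apply MS in Hx; tauto).
    apply mem_U. split; auto.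
    (* [F] represents [B] inside V_la. Since [j] fixes each [x] in [Vs k], the image of [F] sends
       [x] to the image of [B x], which contains [k]. *)
    set (F := lam (Vs k) B).
    assert (HBk : forall x, x ∈ Vs k -> subset (B x) k).
    { intros x Hx. apply HB, mem_U in Hx. tauto. }
    assert (LF : inL F).
    { apply (inL_rel Ll (a := osucc k)); [apply limit_osucc; auto; apply crit_la |].
      intros p Hp. apply mem_lam in Hp as (x & Hx & ->); auto.
      exists x, (B x). split; auto. split.
      - revert Hx. apply Vs_mono. intros z Hz. apply mem_osucc. auto.
      - apply (Vs_bounded (b := k)); [apply mem_osucc; auto |].
        intros z Hz. apply HBk in Hz; auto. apply ord_Vs; auto.
        exact (ord_mem Ok Hz). }
    assert (LV : inL (Vs k)) by exact (inL_Vs_ord crit_la).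
    assert (K : forall g, g ∈ k -> (forall x, x ∈ Vs k -> inVo g x ->
      exists b, inL b /\ (pr x b ∈ F /\ g ∈ b)) -> g ∈ S).
    { intros g Hg H. apply MS. split; auto. intros x Hx.
      assert (Og : ordinal g) by exact (ord_mem Ok Hg).
      destruct (H x) as (b & _ & Hb & Hgb).
      - revert Hx. apply Vs_mono. now apply (proj1 Ok).
      - split; auto.
      - apply pr_lam in Hb as [_ ->]; auto. }
    apply (proj1 (el4 Ll Hj (P := fun k v F S => forall g, g ∈ k ->
      (forall x, x ∈ v -> inVo g x -> exists b, inL b /\ (pr x b ∈ F /\ g ∈ b)) ->
      g ∈ S) ltac:(ldfn) Lk LV LF (sub_k_inL HS)) K k crit_moved).
    intros x _ [_ Hx]. exists (jj (B x)).
    split; [apply (emb_inL Hj), sub_k_inL; auto |]. split.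
    + rewrite <- (im_fix_Vs Hx) at 1. apply (im_pr_mem Ll Hj LF).
      apply pr_lam; auto.
    + apply mem_U. auto.
  - intros a Ha. set (S := sep k (fun g => a ∈ g /\ omega ∈ g /\ limit_ordinal g)).
    assert (MS : forall g, g ∈ S <-> g ∈ k /\ a ∈ g /\ omega ∈ g /\ limit_ordinal g)
      by (intro; unfold S; rewrite mem_sep; [reflexivity | unfold limit_ordinal; cls]).
    assert (HS : subset S k) by (intros x Hx; apply MS in Hx; tauto).
    apply mem_U. split; auto.
    assert (K : forall g, g ∈ k -> a ∈ g -> omega ∈ g -> limit_ordinal g -> g ∈ S).
    { intros. apply MS. auto. }
    pose proof (proj1 (el4 Ll Hj (P := fun k a o S => forall g, g ∈ k -> a ∈ g ->
      o ∈ g -> limit_ordinal g -> g ∈ S) ltac:(ldfn) Lk (inL_trans Ll Lk Ha)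
      (inL_trans Ll Lk omega_crit) (sub_k_inL HS)) K) as LK. cbv beta in LK.
    rewrite (crit_fix Ha), (crit_fix omega_crit) in LK.
    exact (LK k crit_moved Ha omega_crit Limk).
Qed.

End CriticalPoint.

(** * The iterates of [j], and the tree of approximations along them *)

Section Iteration.
Context {V : structure} {HV : ZF V} (la : V).
Hypothesis (Ll : limit_ordinal la).
Variables (j : V) (kap : nat -> V) (J : nat -> nat -> V) (U : V).
Hypothesis (Hj : elementary_embedding j (in_V la) (in_V la)).
Hypothesis (Hkap : is_critical_sequence j kap).
Hypothesis (HJ : is_iteration la j J).
Hypothesis (HU : is_induced_ultrafilter j (kap 0) U).
Implicit Types x y z a b c f g p s t u w A B : V.
Local Notation inL := (inL la).
Local Notation jj := (app j).
Local Notation jn n := (app (J n (S n))).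
Local Notation J0 n := (app (J 0 n)).
Local Notation k := (kap 0).

Lemma kap_crit : is_critical_point j k.
Proof. apply Hkap. Qed.
Local Notation Hk := kap_crit.

Lemma J_el m n : m <= n -> elementary_embedding (J m n) (in_V la) (in_V la).
Proof. apply HJ. Qed.

Lemma jn_el n : elementary_embedding (J n (S n)) (in_V la) (in_V la).
Proof. apply J_el. lia. Qed.

Lemma J0_el n : elementary_embedding (J 0 n) (in_V la) (in_V la).
Proof. apply J_el. lia. Qed.

Lemma J0_0 x : inL x -> J0 0 x = x.
Proof.
  intro Hx. apply (app_eq (emb_isfun (J0_el 0))), pair_inE.
  destruct HJ as (_ & _ & _ & H & _). apply H. auto.
Qed.

Lemma J0_S n x : inL x -> J0 (S n) x = jn n (J0 n x).
Proof.
  intro Hx. apply (app_eq (emb_isfun (J0_el (S n)))), pair_inE.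
  destruct HJ as (_ & H & _).
  apply (H 0 n (S n)); [lia | lia |]. exists (J0 n x).
  split; apply pair_inE.
  - now apply (emb_pr (J0_el n)).
  - apply (emb_pr (jn_el n)). now apply (emb_inL (J0_el n)).
Qed.

Lemma jn_0 : J 0 1 = j.
Proof. apply HJ. Qed.

(** How the definition of the next embedding is used: the image under [j] of a bounded piece of one
    graph is a piece of the next graph. *)
Lemma plus_sub n a c : a ∈ la -> subset c (J n (S n)) -> subset c (Vs a) ->
  subset (jj c) (J (S n) (S (S n))).
Proof.
  intros Ha Hc HcV z Hz. destruct HJ as (_ & _ & _ & _ & H). apply (H n z).
  set (c' := sep (J n (S n)) (fun x => x ∈ Vs a)).
  assert (Mc : forall x, x ∈ c' <-> x ∈ J n (S n) /\ x ∈ Vs a) by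
    (intro; unfold c'; now rewrite mem_sep by cls).
  assert (Lc' : inL c').
  { apply (inL_bounded Ha). intros x Hx. apply Mc in Hx. tauto. }
  assert (Lc : inL c) by exact (inL_bounded Ha HcV).
  exists a, c', (jj c'). split; auto. split; [| split].
  - intro x. rewrite Mc, <- in_V_iff. reflexivity.
  - apply pair_inE. now apply (emb_pr Hj).
  - apply (proj1 (im_subset Ll Hj Lc Lc')); auto.
    intros x Hx. apply Mc. auto.
Qed.

Lemma inL_rk x : inL x -> exists a, a ∈ la /\ x ∈ Vs a.
Proof.
  intro Hx. apply inL_Vs in Hx. apply mem_Vs_rk in Hx; [| apply Ll].
  exists (osucc (rk x)). split; [now apply limit_osucc | apply in_Vs_osucc_rk].
Qed.

Lemma jj_jn n y : inL y -> jj (jn n y) = jn (S n) (jj y).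
Proof.
  intro Hy. symmetry. apply (app_eq (emb_isfun (jn_el (S n)))).
  assert (Lq := emb_inL (jn_el n) Hy).
  assert (Lp := inL_pr Ll Hy Lq).
  destruct (inL_rk Lp) as (a & Ha & Hp).
  apply (@plus_sub n a (upair (pr y (jn n y)) (pr y (jn n y)))); auto.
  - intros x Hx. apply mem_upair in Hx as [-> | ->]; now apply (emb_pr (jn_el n)).
  - intros x Hx. apply mem_upair in Hx as [-> | ->]; auto.
  - rewrite <- (im_pr Ll Hj) by auto.
    refine (proj1 (im_mem Ll Hj Lp _) _).
    + apply inL_Vs. apply Vs_upair; auto; now apply inL_Vs.
    + apply mem_upair; auto.
Qed.

(** By [jj_jn], applying [j] carries each factor of the composition to the next one. So [j] itself,
    and not only the maps of the system, relates consecutive stages of the iteration. *)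
Lemma jj_J0 n x : inL x -> jj (J0 n x) = J0 (S n) x.
Proof.
  intro Hx. induction n.
  - rewrite J0_0 by auto. now rewrite jn_0.
  - rewrite (J0_S n) by auto.
    rewrite jj_jn by (now apply (emb_inL (J0_el n))).
    rewrite IHn. now rewrite <- J0_S.
Qed.

Lemma kap_S n : kap (S n) = jj (kap n).
Proof.
  symmetry. apply (app_eq (emb_isfun Hj)), pair_inE. apply Hkap.
Qed.

Lemma kap_inL n : inL (kap n).
Proof.
  induction n; [exact (crit_inL Hj Hk) |]. rewrite kap_S.
  now apply (emb_inL Hj).
Qed.

Lemma kap_J0 n : kap n = J0 n k.
Proof.
  induction n; [now rewrite J0_0 by apply kap_inL |].
  rewrite kap_S, IHn. apply jj_J0, kap_inL.
Qed.

Lemma jn_kap n : jn n (kap n) = kap (S n).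
Proof.
  induction n; [now rewrite jn_0, kap_S |].
  rewrite (kap_S n), <- jj_jn, IHn, <- kap_S by apply kap_inL. reflexivity.
Qed.

Lemma kap_limit n : limit_ordinal (kap n).
Proof.
  induction n; [exact (crit_limit Ll Hj Hk) |]. rewrite kap_S.
  exact (proj1 (im_limit Ll Hj (kap_inL n)) IHn).
Qed.

Lemma kap_ord n : ordinal (kap n).
Proof. apply kap_limit. Qed.

Lemma kap_la n : kap n ∈ la.
Proof. apply (inL_ord Ll (kap_ord n)), kap_inL. Qed.

Lemma kap_lt n : kap n ∈ kap (S n).
Proof.
  induction n.
  - rewrite kap_S. exact (crit_moved Ll Hj Hk).
  - rewrite (kap_S n), (kap_S (S n)).
    exact (proj1 (im_mem Ll Hj (kap_inL n) (kap_inL (S n))) IHn).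
Qed.

Lemma kap_mono m n : m < n -> kap m ∈ kap n.
Proof.
  induction 1; [apply kap_lt |].
  exact (ord_trans (kap_ord (S m0)) IHle (kap_lt m0)).
Qed.

Lemma kap_inj m n : kap m = kap n -> m = n.
Proof.
  intro E. destruct (Nat.lt_trichotomy m n) as [L | [L | L]]; auto;
    apply kap_mono in L; rewrite E in L; destruct (mem_irrefl L).
Qed.

Lemma Vs_kap_mono m n : m <= n -> subset (Vs (kap m)) (Vs (kap n)).
Proof.
  intro H. apply Vs_mono. destruct (Nat.eq_dec m n) as [-> | N];
    [apply subset_refl |].
  apply (proj1 (kap_ord n)), kap_mono. lia.
Qed.

(** The identity on [Vs (kap n)] is a bounded piece of the graph of [jn n] by induction, and [j]
    sends it to the identity on [Vs (kap (S n))]. *)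
Lemma jn_fix n x : x ∈ Vs (kap n) -> jn n x = x.
Proof.
  revert x. induction n; intros x Hx.
  - rewrite jn_0. exact (im_fix_Vs Ll Hj Hk Hx).
  - set (c := lam (Vs (kap n)) (fun x => x)).
    assert (Hc : forall z, z ∈ Vs (kap n) -> pr z z ∈ c).
    { intros z Hz. apply pr_lam; [cls | auto]. }
    assert (Lv : inL (Vs (kap n))) by exact (inL_Vs_ord (kap_la n)).
    assert (HcV : subset c (Vs (osucc (osucc (kap n))))).
    { intros p Hp. apply mem_lam in Hp as (z & Hz & ->); [| cls].
      now apply pr_Vs2. }
    assert (Ha : osucc (osucc (kap n)) ∈ la).
    { apply limit_osucc, limit_osucc, kap_la; auto. }
    assert (Lc : inL c) by exact (inL_bounded Ha HcV).
    pose proof (proj1 (el2 Ll Hj (P := fun v c => forall z, z ∈ v -> pr z z ∈ c)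
      ltac:(ldfn) Lv Lc) Hc) as LK. cbv beta in LK.
    rewrite (im_Vs Ll Hj (kap_la n)), <- kap_S in LK.
    apply (app_eq (emb_isfun (jn_el (S n)))).
    apply (plus_sub Ha (c := c)); auto.
    intros p Hp. apply mem_lam in Hp as (z & Hz & ->); [| cls].
    rewrite <- (IHn z Hz) at 2. apply (emb_pr (jn_el n)).
    exact (inL_trans Ll Lv Hz).
Qed.

Lemma J0_Vs n : J0 n (Vs k) = Vs (kap n).
Proof. rewrite (im_Vs Ll (J0_el n) (kap_la 0)). now rewrite <- kap_J0. Qed.

Lemma U_inL : inL U.
Proof.
  apply (inL_bounded (a := osucc k)); [apply limit_osucc, kap_la; auto |].
  intros A HA. apply (mem_U Hj Hk HU) in HA as [HA _].
  apply (Vs_bounded (b := k)); [apply mem_osucc; auto |].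
  intros x Hx. apply ord_Vs; auto using kap_ord.
  exact (ord_mem (kap_ord 0) (HA x Hx)).
Qed.

(** The members of [J0 n U] belong to the ultrafilter that [jn n] induces on [kap n]. The claim at
    stage [n] concerns only a bounded piece [c] of the graph of [jn n], so [j] carries it to the
    next stage. *)
Lemma Un n A : A ∈ J0 n U -> subset A (kap n) /\ kap n ∈ jn n A.
Proof.
  revert A. induction n; intros A HA.
  - rewrite J0_0 in HA by apply U_inL. rewrite jn_0.
    now apply (mem_U Hj Hk HU).
  (* Subsets of [kap (S n)] appear one level above it, and pairs of them two levels later. *)
  - set (a := osucc (osucc (osucc (kap (S n))))).
    assert (Ha : a ∈ la) by
      (repeat apply limit_osucc; auto using kap_la).
    set (c := sep (J n (S n)) (fun x => x ∈ Vs a)).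
    assert (Mc : forall x, x ∈ c <-> x ∈ J n (S n) /\ x ∈ Vs a) by
      (intro; unfold c; now rewrite mem_sep by cls).
    assert (Hc1 : subset c (J n (S n))) by (intros x Hx; apply Mc in Hx; tauto).
    assert (Hc2 : subset c (Vs a)) by (intros x Hx; apply Mc in Hx; tauto).
    assert (Lc : inL c) by exact (inL_bounded Ha Hc2).
    assert (LU : inL (J0 n U)) by (apply (emb_inL (J0_el n)), U_inL).
    assert (K : forall A, A ∈ J0 n U -> subset A (kap n) /\
      exists B, inL B /\ (pr A B ∈ c /\ kap n ∈ B)).
    { intros A' HA'. destruct (IHn A' HA') as [X Y]. split; auto.
      assert (LA : inL A') by exact (inL_trans Ll LU HA').
      exists (jn n A'). split; [now apply (emb_inL (jn_el n)) |]. split; auto.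
      apply Mc. split; [now apply (emb_pr (jn_el n)) |].
      apply pr_Vs2; apply (Vs_bounded (b := kap (S n))); try (apply mem_osucc; auto).
      - intros x Hx. apply X in Hx. apply ord_Vs; auto using kap_ord.
        + exact (ord_mem (kap_ord n) Hx).
        + exact (ord_trans (kap_ord (S n)) Hx (kap_lt n)).
      - intros x Hx.
        pose proof (proj1 (im_subset Ll (jn_el n) LA (kap_inL n)) X) as X'.
        rewrite jn_kap in X'. apply X' in Hx. apply ord_Vs; auto using kap_ord.
        exact (ord_mem (kap_ord (S n)) Hx). }
    pose proof (proj1 (el3 Ll Hj (P := fun u q c => forall A, A ∈ u ->
      subset A q /\ exists B, inL B /\ (pr A B ∈ c /\ q ∈ B))
      ltac:(ldfn) LU (kap_inL n) Lc) K) as LK. cbv beta in LK.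
    rewrite jj_J0, <- kap_S in LK by apply U_inL.
    destruct (LK A HA) as (X & B & _ & HB & HkB). split; auto.
    apply (plus_sub Ha Hc1 Hc2) in HB.
    now rewrite (app_eq (emb_isfun (jn_el (S n))) HB).
Qed.

(** The demands on an approximation [e] defined on the levels [Vs b] for [b] in [t]. With [m] the
    first point of [t], they say that [e] carries a coded type (f, r) at the stem [t] to (f', r) at
    [t'] without [m], is the identity on [Vs m], moves (o, m), which will be the name of [m], and
    respects the entries of tuples. All quantifiers range over V_la, and [emp] enters through the
    variable [o], so that no parameter occurs. *)
Definition OK (F o t t' e : V) : Prop :=
  (forall p, p ∈ e -> exists x, inL x /\ exists y, inL y /\ (p = pr x y /\
     exists b, b ∈ t /\ inVo b x)) /\
  (forall x, inL x -> forall y, inL y -> forall z, inL z ->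
     pr x y ∈ e -> pr x z ∈ e -> y = z) /\
  (forall b, b ∈ t -> forall x, inL x -> inVo b x ->
     exists y, inL y /\ pr x y ∈ e) /\
  (forall m, m ∈ t -> (forall b, b ∈ t -> m = b \/ m ∈ b) ->
     (forall t'', inL t'' -> (forall z, inL z -> (z ∈ t'' <-> z ∈ t' /\ ~ z = m)) ->
        forall u, inL u -> pr t u ∈ F -> forall u', inL u' -> pr t'' u' ∈ F ->
        forall f, inL f -> forall f', inL f' -> forall r, inL r ->
        pr f f' ∈ e -> inVo m r -> pr f r ∈ u -> pr f' r ∈ u') /\
     (forall x, inL x -> forall y, inL y -> pr x y ∈ e -> inVo m x -> y = x) /\
     (forall x, inL x -> forall y, inL y -> pr x y ∈ e -> x = pr o m ->
        exists b, inL b /\ (~ b = m /\ y = pr o b)) /\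
     (forall f, inL f -> forall f', inL f' -> pr f f' ∈ e ->
        forall i, inL i -> inVo m i -> forall x, inL x -> forall x', inL x' ->
        pr i x ∈ f -> pr x x' ∈ e -> pr i x' ∈ f')).

(** The node [y = (t + g, e')] extends the node [x = (t, e)]. *)
Definition SUC (F o x g y : V) : Prop :=
  exists t, inL t /\ exists e, inL e /\ exists t', inL t' /\ exists e', inL e' /\
    (x = pr t e /\ y = pr t' e' /\
     (forall z, inL z -> (z ∈ t' <-> z ∈ t \/ z = g)) /\
     subset t g /\ subset e e' /\ OK F o t t' e').

Lemma ldfn_OK {E : Type} {HE : Env V E} (F o t t' e : E -> V) :
  DF inL (@NoPar V) F -> DF inL (@NoPar V) o -> DF inL (@NoPar V) t ->
  DF inL (@NoPar V) t' -> DF inL (@NoPar V) e ->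
  Dfn inL (@NoPar V) (fun q => OK (F q) (o q) (t q) (t' q) (e q)).
Proof. intros. unfold OK. ldfn. Qed.

Lemma ldfn_SUC {E : Type} {HE : Env V E} (F o x g y : E -> V) :
  DF inL (@NoPar V) F -> DF inL (@NoPar V) o -> DF inL (@NoPar V) x ->
  DF inL (@NoPar V) g -> DF inL (@NoPar V) y ->
  Dfn inL (@NoPar V) (fun q => SUC (F q) (o q) (x q) (g q) (y q)).
Proof. intros. unfold SUC. ldfn. apply ldfn_OK; ldfn. Qed.

Lemma dfn_inL {Par : V -> Prop} {E : Type} {HE : Env V E} (t : E -> V) :
  Par la -> FW Par t -> DW Par (fun e => inL (t e)).
Proof.
  intros Hl Ht. apply dfn_iff with (Q := fun e => t e ∈ Vs la).
  - dfn.
  - intros e _. apply inL_Vs.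
Qed.

(** The levels on which [en n] is defined stop before the last critical point of [tn n]. This lag
    places the images under [j], and with them the whole node, in [Vs (kap n)], where [jn n] is the
    identity. *)
Fixpoint tn (n : nat) : V :=
  match n with 0 => emp | S n => add (tn n) (kap n) end.
Definition en (n : nat) : V :=
  match n with 0 => emp | S n => lam (bigU (img (tn n) Vs)) (app j) end.

Lemma mem_tn n x : x ∈ tn n <-> exists m, m < n /\ x = kap m.
Proof.
  induction n; simpl.
  - split; [intro H; destruct (mem_emp H) | intros (m & Hm & _); lia].
  - rewrite mem_add, IHn. split.
    + intros [(m & Hm & ->) | ->]; [exists m | exists n]; split; auto.
    + intros (m & Hm & ->). destruct (Nat.eq_dec m n) as [-> |]; auto.
      left. exists m. split; auto. lia.
Qed.

Lemma tn_sub n : subset (tn n) (kap n).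
Proof. intros x Hx. apply mem_tn in Hx as (m & Hm & ->). now apply kap_mono. Qed.

Lemma tn_inL n : inL (tn n).
Proof. apply (inL_sub (tn_sub (n := n))), kap_inL. Qed.

Lemma mem_en n p : p ∈ en (S n) <->
  exists m x, m < n /\ x ∈ Vs (kap m) /\ p = pr x (jj x).
Proof.
  pose proof (Fun1_Vs (M := V)) as FV.
  simpl. rewrite mem_lam by cls. split.
  - intros (x & Hx & ->). apply mem_bigU in Hx as (v & Hv & Hx).
    apply mem_img in Hv as (b & Hb & ->); auto.
    apply mem_tn in Hb as (m & Hm & ->). eauto.
  - intros (m & x & Hm & Hx & ->). exists x. split; auto.
    apply mem_bigU. exists (Vs (kap m)). split; auto. apply mem_img; auto.
    exists (kap m). split; auto. apply mem_tn. eauto.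
Qed.

Lemma pr_en n x y : pr x y ∈ en (S n) <->
  (exists m, m < n /\ x ∈ Vs (kap m)) /\ y = jj x.
Proof.
  rewrite mem_en. split.
  - intros (m & z & Hm & Hz & E). apply pr_inj in E as [-> ->]. eauto.
  - intros [(m & Hm & Hx) ->]. eauto.
Qed.

Lemma jj_Vs_kap m x : x ∈ Vs (kap m) -> jj x ∈ Vs (kap (S m)).
Proof.
  intro Hx. rewrite kap_S, <- (im_Vs Ll Hj (kap_la m)).
  assert (Lv := inL_Vs_ord (kap_la m)).
  exact (proj1 (im_mem Ll Hj (inL_trans Ll Lv Hx) Lv) Hx).
Qed.

Lemma emp_inL : inL emp.
Proof.
  apply (inL_bounded (kap_la 0)). intros x Hx. destruct (mem_emp Hx).
Qed.

Lemma emp_Vs n : emp ∈ Vs (kap n).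
Proof.
  apply (Vs_bounded (b := emp)); [exact (num_limit 0 (kap_limit n)) |].
  intros x Hx. destruct (mem_emp Hx).
Qed.

Lemma en_Vs n : en n ∈ Vs (kap n).
Proof.
  destruct n; [apply emp_Vs |].
  apply (Vs_bounded (b := osucc (osucc (kap n)))).
  - apply limit_osucc, limit_osucc, kap_lt; apply kap_limit.
  - intros p Hp. apply mem_en in Hp as (m & x & Hm & Hx & ->). apply pr_Vs2.
    + apply (Vs_kap_mono (m := m)); auto. lia.
    + apply (Vs_kap_mono (m := S m)); [lia | now apply jj_Vs_kap].
Qed.

Lemma tn_Vs n : tn n ∈ Vs (kap n).
Proof.
  destruct n; [apply emp_Vs |].
  apply (Vs_bounded (b := osucc (kap n))).
  - apply limit_osucc, kap_lt; apply kap_limit.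
  - intros x Hx. apply mem_tn in Hx as (m & Hm & ->).
    apply ord_Vs; [apply kap_ord | apply ord_osucc, kap_ord |].
    apply mem_osucc. destruct (Nat.eq_dec m n) as [-> |]; auto.
    left. apply kap_mono. lia.
Qed.

Lemma Vs_kap_inL n x : x ∈ Vs (kap n) -> inL x.
Proof. exact (inL_trans Ll (inL_Vs_ord (kap_la n))). Qed.

Lemma jj_add t a t' : inL t -> inL a -> inL t' ->
  (forall z, inL z -> (z ∈ t' <-> z ∈ t \/ z = a)) ->
  forall z, z ∈ jj t' <-> z ∈ jj t \/ z = jj a.
Proof.
  intros Lt La Lt' K.
  pose proof (proj1 (el3 Ll Hj (P := fun t a t' => forall z, inL z ->
    (z ∈ t' <-> z ∈ t \/ z = a)) ltac:(ldfn) Lt La Lt') K) as LK. cbv beta in LK.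
  intro z. split.
  - intro Hz. apply LK; auto. exact (inL_trans Ll (emb_inL Hj Lt') Hz).
  - intro Hz. apply LK; auto. destruct Hz as [Hz | ->].
    + exact (inL_trans Ll (emb_inL Hj Lt) Hz).
    + now apply (emb_inL Hj).
Qed.

Lemma mem_jj_tn n x : x ∈ jj (tn n) <-> exists m, m < n /\ x = kap (S m).
Proof.
  induction n.
  - simpl. rewrite (im_fix_Vs Ll Hj Hk (emp_Vs 0)).
    split; [intro H; destruct (mem_emp H) | intros (m & Hm & _); lia].
  - rewrite (jj_add (t := tn n) (a := kap n) (t' := tn (S n)));
      auto using tn_inL, kap_inL.
    + rewrite IHn, <- kap_S. split.
      * intros [(m & Hm & ->) | ->]; [exists m | exists n]; split; auto.
      * intros (m & Hm & ->). destruct (Nat.eq_dec m n) as [-> |]; auto.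
        left. exists m. split; auto. lia.
    + intros z _. simpl. apply mem_add.
Qed.

Section Branch.
Variable (F : V).
Hypotheses (LF : inL F) (IF : isfun F)
  (HF1 : forall t u, pr t u ∈ F -> subset u (Vs k))
  (HF2 : forall t, t ∈ Vs k -> exists u, pr t u ∈ F).

Definition xn (n : nat) : V := pr (tn n) (en n).

Lemma xn_Vs n : xn n ∈ Vs (kap n).
Proof. apply Vs_pr; [apply kap_limit | apply tn_Vs | apply en_Vs]. Qed.

Lemma Fn_inL n : inL (J0 n F).
Proof. now apply (emb_inL (J0_el n)). Qed.

Lemma Fn_total n t : t ∈ Vs (kap n) -> exists u, inL u /\ pr t u ∈ J0 n F.
Proof.
  assert (K : forall t, t ∈ Vs k -> exists u, inL u /\ pr t u ∈ F).
  { intros t' Ht. destruct (HF2 Ht) as [u Hu]. exists u. split; auto.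
    exact (proj2 (inL_pr_inv Ll (inL_trans Ll LF Hu))). }
  pose proof (proj1 (el2 Ll (J0_el n) (P := fun v F => forall t, t ∈ v ->
    exists u, inL u /\ pr t u ∈ F) ltac:(ldfn) (inL_Vs_ord (kap_la 0)) LF) K)
    as LK. cbv beta in LK. rewrite J0_Vs in LK. apply LK.
Qed.

(* The branch of the tree given by the restrictions of [j]. *)
Lemma SUC_branch n : SUC (J0 (S n) F) emp (xn n) (kap n) (xn (S n)).
Proof.
  exists (tn n). split; [apply tn_inL |]. exists (en n).
  split; [exact (Vs_kap_inL (en_Vs n)) |]. exists (tn (S n)).
  split; [apply tn_inL |]. exists (en (S n)).
  split; [exact (Vs_kap_inL (en_Vs (S n))) |].
  split; [reflexivity | split; [reflexivity | split; [| split; [| split]]]].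
  - intros z _. simpl. apply mem_add.
  - apply tn_sub.
  - destruct n; [intros x Hx; destruct (mem_emp Hx) |].
    intros p Hp. apply mem_en in Hp as (m & x & Hm & Hx & ->).
    apply mem_en. exists m, x. split; auto.
  - assert (Lx : forall m x, x ∈ Vs (kap m) -> inL x) by
      (intros m x; apply Vs_kap_inL).
    split; [| split; [| split]].
    + intros p Hp. apply mem_en in Hp as (m & x & Hm & Hx & ->).
      exists x. split; [eauto |]. exists (jj x).
      split; [apply (emb_inL Hj); eauto |]. split; auto.
      exists (kap m). split; [apply mem_tn; eauto |]. split; auto using kap_ord.
    + intros x _ y _ z _ Hy Hz. apply pr_en in Hy as [_ ->], Hz as [_ ->]. auto.
    + intros b Hb x Hx [_ Hxb]. apply mem_tn in Hb as (m & Hm & ->).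
      exists (jj x). split; [now apply (emb_inL Hj) |]. apply pr_en. eauto.
    + intros m' Hm' Hmin. apply mem_tn in Hm' as (m0 & Hm0 & Em).
      assert (m0 = 0).
      { destruct m0; auto. exfalso.
        assert (K : k ∈ tn n) by (apply mem_tn; exists 0; split; [lia | auto]).
        destruct (Hmin k K) as [E | E]; rewrite Em in E.
        - apply kap_inj in E. lia.
        - apply (mem_asym E). apply kap_mono. lia. }
      subst m0. subst m'.
      assert (Fx : forall x, inVo k x -> jj x = x).
      { intros x [_ Hx]. exact (im_fix_Vs Ll Hj Hk Hx). }
      split; [| split; [| split]].
      * intros t'' Lt'' Ht'' u Lu Hu u' Lu' Hu' f Lf f' Lf' r Lr Hff Hr Hfr.
        apply pr_en in Hff as [(m & Hm & Hf) ->].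
        (* Dropping the first of the n+1 initial critical points amounts to applying [j] to the
           first n of them. *)
        assert (E'' : t'' = jj (tn n)).
        { apply zf_ext. intro z. rewrite mem_jj_tn. split.
          - intro Hz. apply Ht'' in Hz as [Hz Nz]; [| exact (inL_trans Ll Lt'' Hz)].
            apply mem_tn in Hz as ([| m1] & Hm1 & ->); [tauto |].
            exists m1. split; auto. lia.
          - intros (m1 & Hm1 & ->). apply Ht''; [apply kap_inL |]. split.
            + apply mem_tn. exists (S m1). split; auto. lia.
            + intro E. apply kap_inj in E. lia. }
        destruct (Fn_total (tn_Vs n)) as (u0 & Lu0 & Hu0).
        assert (I' : isfun (J0 (S n) F)) by exact (im_isfun Ll (J0_el (S n)) LF IF).
        (* Both values of the next tree function come from [u0], its value at the present stage: at
           [tn n] it is the image of [u0] under [jn n], which fixes (f, r), and at [t''] it is the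
           image under [j], which sends (f, r) to (f', r). *)
        assert (Eu : u = jn n u0).
        { pose proof (im_pr_mem Ll (jn_el n) (Fn_inL n) Hu0) as K.
          rewrite (jn_fix (tn_Vs n)), <- J0_S in K by auto.
          exact (proj2 I' _ _ _ Hu K). }
        assert (Hfn : f ∈ Vs (kap n)) by (apply (Vs_kap_mono (m := m)); auto; lia).
        assert (Hrn : r ∈ Vs (kap n)).
        { apply (Vs_kap_mono (m := 0)); [lia | apply Hr]. }
        assert (Hp : pr f r ∈ Vs (kap n)) by (apply Vs_pr; auto using kap_limit).
        assert (H0 : pr f r ∈ u0).
        { apply (im_mem Ll (jn_el n) (Lx n _ Hp) Lu0).
          rewrite (jn_fix Hp). now rewrite <- Eu. }
        assert (Eu' : u' = jj u0).
        { pose proof (im_pr_mem Ll Hj (Fn_inL n) Hu0) as K.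
          rewrite jj_J0, <- E'' in K by auto. exact (proj2 I' _ _ _ Hu' K). }
        rewrite Eu', <- (Fx r Hr). exact (im_pr_mem Ll Hj Lu0 H0).
      * intros x _ y _ Hxy Hx. apply pr_en in Hxy as [_ ->]. auto.
      * intros x _ y _ Hxy ->. apply pr_en in Hxy as [_ ->].
        exists (kap 1). split; [apply kap_inL |]. split.
        -- intro E. apply kap_inj in E. lia.
        -- rewrite (im_pr Ll Hj emp_inL (kap_inL 0)), <- kap_S.
           now rewrite (im_fix_Vs Ll Hj Hk (emp_Vs 0)).
      * intros f Lf f' _ Hff i _ Hi x _ x' _ Hix Hxx.
        apply pr_en in Hff as [_ ->], Hxx as [_ ->].
        rewrite <- (Fx i Hi). exact (im_pr_mem Ll Hj Lf Hix).
Qed.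

(** A partial ranking of the tree: at a ranked node, almost all points lead only to successors of
    smaller rank. [v], [W] and [o] are variables because the property is transported along the
    iteration. *)
Definition good v W o r : Prop :=
  forall x, x ∈ v -> forall a, inL a -> pr x a ∈ r ->
    exists B, B ∈ W /\ forall g, g ∈ B -> forall y, y ∈ v -> SUC F o x g y ->
      exists b, b ∈ a /\ pr y b ∈ r.

(* Along the branch the ranks form a descending sequence of the direct limit. *)
Lemma no_rank r a : inL r -> good (Vs k) U emp r -> inL a ->
  pr (pr emp emp) a ∈ r -> Acc (limit_mem J) (0, a) -> False.
Proof.
  intros Lr Hg La Ha HA.
  assert (K : forall q, Acc (limit_mem J) q -> forall n a, q = (n, a) -> inL a ->
    pr (xn n) a ∈ J0 n r -> False).
  { induction 1 as [q _ IH]. intros n b -> Lb Hb.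
    pose proof (proj1 (el5 Ll (J0_el n) (P := fun F v W o r =>
      forall x, x ∈ v -> forall a, inL a -> pr x a ∈ r ->
      exists B, B ∈ W /\ forall g, g ∈ B -> forall y, y ∈ v -> SUC F o x g y ->
      exists b, b ∈ a /\ pr y b ∈ r) ltac:(ldfn; apply ldfn_SUC; ldfn)
      LF (inL_Vs_ord (kap_la 0)) U_inL emp_inL Lr) Hg) as Gn.
    cbv beta in Gn. rewrite J0_Vs in Gn.
    destruct (Gn (xn n) (xn_Vs n) b Lb Hb) as (B & HB & HBg).
    assert (LUn : inL (J0 n U)) by (apply (emb_inL (J0_el n)), U_inL).
    assert (LB : inL B) by exact (inL_trans Ll LUn HB).
    destruct (Un HB) as [_ HkB].
    (* The image of [B] under [jn n] contains [kap n], the point by which the branch continues,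
       while [xn n] is fixed. So in the next ranking the next node has a rank inside the image of
       [b], which is a descent in the direct limit. *)
    pose proof (proj1 (el7 Ll (jn_el n) (P := fun F v B o r x a =>
      forall g, g ∈ B -> forall y, y ∈ v -> SUC F o x g y ->
      exists b, b ∈ a /\ pr y b ∈ r) ltac:(ldfn; apply ldfn_SUC; ldfn)
      (Fn_inL n) (inL_Vs_ord (kap_la n)) LB (emb_inL (J0_el n) emp_inL)
      (emb_inL (J0_el n) Lr) (Vs_kap_inL (xn_Vs n)) Lb) HBg) as Hn.
    cbv beta in Hn.
    rewrite <- !J0_S, (im_Vs Ll (jn_el n) (kap_la n)), jn_kap,
      (jn_fix (xn_Vs n)) in Hn by auto using emp_inL.
    assert (E0 : J0 (S n) emp = emp).
    { assert (Z : forall x : V, x ∈ emp -> x <> x) by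
        (intros x Hx; destruct (mem_emp Hx)).
      pose proof (proj1 (el1 Ll (J0_el (S n)) (P := fun A => forall x, x ∈ A ->
        x <> x) ltac:(ldfn) emp_inL) Z) as Z'. apply zf_ext. intro x.
      split; intro Hx; [destruct (Z' x Hx eq_refl) | destruct (mem_emp Hx)]. }
    rewrite E0 in Hn.
    destruct (Hn (kap n) HkB (xn (S n)) (xn_Vs (S n)) (SUC_branch n))
      as (b' & Hb' & Hr').
    assert (Ljb : inL (jn n b)) by (now apply (emb_inL (jn_el n))).
    assert (Lb' : inL b') by exact (inL_trans Ll Ljb Hb').
    apply (IH (S n, b')) with (n := S n) (a := b'); auto.
    exists (S n), b', (jn n b). simpl. split; [lia |]. split; [lia |].
    split; [| split; auto].
    - destruct HJ as (_ & _ & _ & H & _). apply H. auto.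
    - apply pair_inE. now apply (emb_pr (jn_el n)). }
  apply (K (0, a) HA 0 a); auto. rewrite J0_0 by auto. exact Ha.
Qed.

End Branch.
End Iteration.

Ltac df_more5 := df_fun.
Ltac dfn_more5 := dfn_rel.
Ltac dfn_more4 ::=
  lazymatch goal with
  | |- Dfn _ _ (fun e => inL _ _) => apply dfn_inL; [exact I | df]
  | |- Dfn _ _ (fun e => inVo _ _) => unfold inVo; dfn
  | |- _ => dfn_more5
  end.
Ltac df_more4 ::= df_more5.

(** * The minimal ranking and the unranked part of the tree *)

Section KeyLemma.
Context {V : structure} {HV : ZF V} (la : V).
Hypothesis (Ll : limit_ordinal la).
Variables (j : V) (kap : nat -> V) (J : nat -> nat -> V) (U d : V).
Hypothesis (Hj : elementary_embedding j (in_V la) (in_V la)).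
Hypothesis (Hkap : is_critical_sequence j kap).
Hypothesis (HJ : is_iteration la j J).
Hypothesis (HU : is_induced_ultrafilter j (kap 0) U).
Hypothesis (Hd : is_successor_cardinal (kap 0) d).
Hypothesis (Hwf : forall a, a ∈ d -> Acc (limit_mem J) (0, a)).
Implicit Types x y z a b c f g p r s t u w A B : V.
Local Notation inL := (inL la).
Local Notation k := (kap 0).
Local Notation Hk := (kap_crit Hkap).
Local Notation NU := (crit_normal Ll Hj Hk HU).

Lemma dfn_SUC {E : Type} {HE : Env V E} (F o x g y : E -> V) :
  FW (@whole V) F -> FW (@whole V) o -> FW (@whole V) x ->
  FW (@whole V) g -> FW (@whole V) y ->
  DW (@whole V) (fun q => SUC la (F q) (o q) (x q) (g q) (y q)).
Proof. intros. unfold SUC, OK. dfn. Qed.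

Variable (F : V).
Hypotheses (LF : inL F) (IF : isfun F)
  (HF1 : forall t u, pr t u ∈ F -> subset u (Vs k))
  (HF2 : forall t, t ∈ Vs k -> exists u, pr t u ∈ F).

Definition goodf r : Prop :=
  isfun r /\ (forall p, p ∈ r -> exists x a, p = pr x a /\ x ∈ Vs k /\ a ∈ d) /\
  good la F (Vs k) U emp r.

Lemma Cls_goodf : Cls goodf.
Proof.
  unfold goodf, good. unfold Cls.
  apply dfn_and; [dfn |]. apply dfn_and; [dfn |].
  apply dfn_all. apply dfn_imp; [dfn |]. apply dfn_all.
  apply dfn_imp; [dfn |]. apply dfn_imp; [dfn |]. apply dfn_ex.
  apply dfn_and; [dfn |]. apply dfn_all. apply dfn_imp; [dfn |].
  apply dfn_all. apply dfn_imp; [dfn |]. apply dfn_imp; [| dfn].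
  apply dfn_SUC; df.
Qed.

Lemma d_ord : ordinal d.
Proof. apply Hd. Qed.

Lemma d_kap1 : subset d (kap 1).
Proof.
  apply Hd.
  - rewrite (kap_S Hj Hkap). apply (im_cardinal Ll Hj).
    + exact (crit_inL Hj Hk).
    + exact (crit_cardinal Ll Hj Hk).
  - exact (kap_lt Ll Hj Hkap 0).
Qed.

Lemma inL_d a : a ∈ d -> inL a.
Proof.
  intro Ha. exact (inL_trans Ll (kap_inL Hj Hkap 1) (d_kap1 Ha)).
Qed.

Lemma goodf_inL r : goodf r -> inL r.
Proof.
  intros (_ & H & _). apply (inL_rel Ll (kap_la Ll Hj Hkap 1)).
  intros p Hp. destruct (H p Hp) as (x & a & -> & Hx & Ha). exists x, a.
  split; auto. split.
  - revert Hx. apply (Vs_kap_mono Ll Hj Hkap (m := 0)). lia.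
  - apply ord_Vs; [exact (ord_mem d_ord Ha) | exact (kap_ord Ll Hj Hkap 1) |].
    now apply d_kap1.
Qed.

Lemma goodf_d r x a : goodf r -> pr x a ∈ r -> x ∈ Vs k /\ a ∈ d.
Proof.
  intros (_ & H & _) Hr. destruct (H _ Hr) as (x' & a' & E & H').
  apply pr_inj in E as [-> ->]. auto.
Qed.

(** Minimising over all good rankings leaves as unranked exactly those nodes that no good ranking
    reaches. *)
Definition isR x a : Prop :=
  (exists r, goodf r /\ pr x a ∈ r) /\
  forall r a', goodf r -> pr x a' ∈ r -> a ∈ a' \/ a = a'.

Definition RR : V := sep (prod (Vs k) d) (fun p => isR (fstp p) (sndp p)).

Lemma pr_RR x a : pr x a ∈ RR <-> isR x a.
Proof.
  pose proof Cls_goodf as CG. unfold RR.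
  rewrite mem_sep by (unfold isR; cls).
  rewrite fstp_pr, sndp_pr, pr_prod. split; [tauto |]. intro H. split; auto.
  destruct H as ((r & Hr & Hx) & _). exact (goodf_d Hr Hx).
Qed.

Lemma RR_le r x a : goodf r -> pr x a ∈ r ->
  exists b, pr x b ∈ RR /\ (b ∈ a \/ b = a).
Proof.
  intros Hr Hx.
  destruct (@ord_least V HV (fun a => exists r, goodf r /\ pr x a ∈ r) a)
    as (b & Ob & Hb & Hm); [exact (ord_mem d_ord (proj2 (goodf_d Hr Hx))) | eauto |].
  assert (K : forall r a', goodf r -> pr x a' ∈ r -> b ∈ a' \/ b = a').
  { intros r' a' Hr' Hx'.
    destruct (ord_total Ob (ord_mem d_ord (proj2 (goodf_d Hr' Hx'))))
      as [L | [L | L]]; auto. destruct (Hm a' L). eauto. }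
  exists b. split; [apply pr_RR; split; auto | eauto].
Qed.

Lemma RR_unique x a b : pr x a ∈ RR -> pr x b ∈ RR -> a = b.
Proof.
  rewrite !pr_RR. intros [(r & Hr & Ha) La] [(r' & Hr' & Hb) Lb].
  destruct (La _ _ Hr' Hb) as [L |]; auto.
  destruct (Lb _ _ Hr Ha) as [L' |]; auto. destruct (mem_asym L L').
Qed.

(** A measure one set for a ranking that attains the minimum at [x] also works for [RR], since
    passing to minima only lowers the ranks of the successors. *)
Lemma RR_good : goodf RR.
Proof.
  split; [split |].
  - intros p Hp. unfold RR in Hp. apply mem_sep in Hp as [Hp _].
    + apply mem_prod in Hp as (x & a & _ & _ & ->). eauto.
    + pose proof Cls_goodf as CG. unfold isR. cls.
  - intros x y y'. apply RR_unique.
  - split.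
    + intros p Hp. unfold RR in Hp. apply mem_sep in Hp as [Hp _].
      * apply mem_prod in Hp as (x & a & Hx & Ha & ->). eauto 6.
      * pose proof Cls_goodf as CG. unfold isR. cls.
    + intros x Hx a La Ha. apply pr_RR in Ha as ((r & Hr & Hxa) & _).
      destruct (proj2 (proj2 Hr) x Hx a La Hxa) as (B & HB & H).
      exists B. split; auto. intros g Hg y Hy HS.
      destruct (H g Hg y Hy HS) as (b & Hb & Hyb).
      destruct (RR_le Hr Hyb) as (b' & Hb' & L). exists b'. split; auto.
      destruct L as [L | ->]; auto.
      exact (ord_trans (ord_mem d_ord (proj2 (goodf_d Hr Hxa))) L Hb).
Qed.

Definition SS : V := sep d (fun a => exists x, pr x a ∈ RR).

Lemma mem_SS a : a ∈ SS <-> exists x, pr x a ∈ RR.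
Proof.
  unfold SS. rewrite mem_sep by cls. split; [tauto |]. intros [x Hx].
  split; eauto. exact (proj2 (goodf_d RR_good Hx)).
Qed.

(* A gap [b] in the range of the minimal rank function could be filled by
   lowering the next value [a0] to [b]. *)
Lemma SS_down a b : a ∈ SS -> b ∈ a -> b ∈ SS.
Proof.
  intros Ha Hb. apply NNPP. intro N.
  assert (Hdd : forall c, c ∈ SS -> c ∈ d).
  { intros c Hc. apply mem_SS in Hc as [x Hx]. exact (proj2 (goodf_d RR_good Hx)). }
  destruct (@ord_least V HV (fun c => c ∈ SS /\ b ∈ c) a)
    as (a0 & O0 & [H0 Hb0] & Hm); [exact (ord_mem d_ord (Hdd a Ha)) | auto |].
  set (r := sep (prod (Vs k) d) (fun p => (p ∈ RR /\ sndp p <> a0) \/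
    (pr (fstp p) a0 ∈ RR /\ sndp p = b))).
  assert (Hbd : b ∈ d) by exact (ord_trans d_ord Hb0 (Hdd a0 H0)).
  assert (Mr : forall x c, pr x c ∈ r <-> (pr x c ∈ RR /\ c <> a0) \/
    (pr x a0 ∈ RR /\ c = b)).
  { intros x c. unfold r. rewrite mem_sep by cls.
    rewrite fstp_pr, sndp_pr, pr_prod. split; [tauto |]. intros H. split; auto.
    destruct H as [[H _] | [H ->]].
    - exact (goodf_d RR_good H).
    - split; auto. exact (proj1 (goodf_d RR_good H)). }
  assert (Gr : goodf r).
  { split; [split | split].
    - intros p Hp. unfold r in Hp. apply mem_sep in Hp as [Hp _]; [| cls].
      apply mem_prod in Hp as (x & c & _ & _ & ->). eauto.
    - intros x c c' Hc Hc'. apply Mr in Hc, Hc'.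
      destruct Hc as [[X Y] | [X ->]], Hc' as [[X' Y'] | [X' ->]]; auto.
      + exact (RR_unique X X').
      + destruct Y. exact (RR_unique X X').
      + destruct Y'. exact (RR_unique X' X).
    - intros p Hp. unfold r in Hp. apply mem_sep in Hp as [Hp _]; [| cls].
      apply mem_prod in Hp as (x & c & Hx & Hc & ->). eauto 6.
    - intros x Hx c Lc Hc. apply Mr in Hc as [[X Y] | [X ->]].
      + destruct (proj2 (proj2 RR_good) x Hx c Lc X) as (B & HB & H).
        exists B. split; auto. intros g Hg y Hy HS.
        destruct (H g Hg y Hy HS) as (b1 & Hb1 & Hyb).
        destruct (classic (b1 = a0)) as [-> | Nb].
        * exists b. split; [| apply Mr; auto].
          exact (ord_trans (ord_mem d_ord (proj2 (goodf_d RR_good X))) Hb0 Hb1).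
        * exists b1. split; auto. apply Mr. auto.
      + destruct (proj2 (proj2 RR_good) x Hx a0 (inL_d (Hdd a0 H0)) X)
          as (B & HB & H).
        exists B. split; auto. intros g Hg y Hy HS.
        destruct (H g Hg y Hy HS) as (b1 & Hb1 & Hyb).
        assert (H1 : b1 ∈ SS) by (apply mem_SS; eauto).
        exists b1. split.
        * destruct (ord_total (ord_mem d_ord (Hdd b1 H1)) (ord_mem d_ord Hbd))
            as [L | [L | L]]; auto.
          -- subst. tauto.
          -- destruct (Hm b1 Hb1). auto.
        * apply Mr. left. split; auto. intros ->. exact (mem_irrefl Hb1). }
  apply mem_SS in H0 as [x Hx].
  assert (K : pr x b ∈ r) by (apply Mr; auto).
  apply pr_RR in Hx as [_ Hl]. destruct (Hl r b Gr K) as [L | L].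
  - exact (mem_asym L Hb0).
  - subst. exact (mem_irrefl Hb0).
Qed.

(** The ranks in use form an initial segment of [d]. They cannot exhaust [d], as [RR] would then map
    a part of [Vs k] onto the successor cardinal of [k]. *)
Lemma SS_d : SS ∈ d.
Proof.
  assert (Hs : subset SS d).
  { intros a Ha. unfold SS in Ha. apply mem_sep in Ha; [tauto | cls]. }
  assert (Os : ordinal SS).
  { apply ord_set.
    - intros b Hb. exact (ord_mem d_ord (Hs b Hb)).
    - intros b c. apply SS_down. }
  destruct (ord_subset Os d_ord Hs) as [|E]; auto. exfalso.
  apply (@crit_no_surj_succ V HV la Ll j k Hj Hk d RR).
  all: try exact (proj1 Hd); try exact (proj1 (proj2 Hd)); try exact (proj1 RR_good).
  intros b Hb. rewrite <- E in Hb. apply mem_SS in Hb as [x Hx].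
    exists x. split; auto. exact (proj1 (goodf_d RR_good Hx)).
Qed.

(** [W] is the set of the unranked nodes. If almost all points led from [x] in [W] only to ranked
    successors, giving [x] the rank [SS], which exceeds every rank in use, would be a good ranking
    of [x]. The root is unranked by [no_rank]. *)
Theorem key_lemma : exists W, subset W (Vs k) /\ pr emp emp ∈ W /\
  forall x, x ∈ W -> exists B, B ∈ U /\
    forall g, g ∈ B -> exists y, y ∈ W /\ SUC la F emp x g y.
Proof.
  set (W := sep (Vs k) (fun x => ~ exists a, pr x a ∈ RR)).
  assert (MW : forall x, x ∈ W <-> x ∈ Vs k /\ ~ exists a, pr x a ∈ RR).
  { intro x. unfold W. now rewrite mem_sep by cls. }
  exists W. split; [intros x Hx; apply MW in Hx; tauto |]. split.
  - apply MW. split.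
    + apply Vs_pr; [exact (crit_limit Ll Hj Hk) | | ];
        exact (emp_Vs Ll Hj Hkap 0).
    + intros [a Ha]. destruct (goodf_d RR_good Ha) as [_ Had].
      apply (no_rank Ll Hj Hkap HJ HU LF IF HF2 (r := RR) (a := a)); auto.
      * exact (goodf_inL RR_good).
      * exact (proj2 (proj2 RR_good)).
      * now apply inL_d.
  - intros x Hx. apply MW in Hx as [HxV Nx].
    assert (CS : Cls (fun g => exists y, y ∈ W /\ SUC la F emp x g y)).
    { apply dfn_ex. apply dfn_and; [dfn |]. apply dfn_SUC; df. }
    set (B := sep k (fun g => exists y, y ∈ W /\ SUC la F emp x g y)).
    assert (MB : forall g, g ∈ B <-> g ∈ k /\ exists y, y ∈ W /\ SUC la F emp x g y).
    { intro g. exact (mem_sep k g CS). }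
    destruct (classic (B ∈ U)) as [HB | NB].
    { exists B. split; auto. intros g Hg. apply MB in Hg. tauto. }
    exfalso. apply (nu_ultra NU) in NB.
    2:{ intros g Hg. apply MB in Hg. tauto. }
    apply Nx.
    set (r := add RR (pr x SS)).
    assert (Gr : goodf r).
    { split; [split | split].
      - intros p Hp. apply mem_add in Hp as [Hp | ->]; [| eauto].
        exact (proj1 (proj1 RR_good) p Hp).
      - intros z c c' Hc Hc'. apply mem_add in Hc, Hc'.
        destruct Hc as [Hc | Hc], Hc' as [Hc' | Hc'].
        + exact (RR_unique Hc Hc').
        + apply pr_inj in Hc' as [-> _]. destruct Nx. eauto.
        + apply pr_inj in Hc as [-> _]. destruct Nx. eauto.
        + apply pr_inj in Hc as [_ ->], Hc' as [_ ->]. auto.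
      - intros p Hp. apply mem_add in Hp as [Hp | ->].
        + exact (proj1 (proj2 RR_good) p Hp).
        + exists x, SS. split; auto. split; auto. apply SS_d.
      - intros z Hz c Lc Hc. apply mem_add in Hc as [Hc | Hc].
        + destruct (proj2 (proj2 RR_good) z Hz c Lc Hc) as (B' & HB' & H).
          exists B'. split; auto. intros g Hg y Hy HS.
          destruct (H g Hg y Hy HS) as (b & Hb & Hyb). exists b.
          split; auto. apply mem_add; auto.
        + apply pr_inj in Hc as [-> ->].
          exists (sep k (fun x => ~ x ∈ B)). split; auto.
          intros g Hg y Hy HS. apply mem_sep in Hg as [Hg Ng]; [| cls].
          assert (Ny : ~ y ∈ W) by (intro Y; apply Ng, MB; eauto).
          rewrite MW in Ny. apply NNPP. intro K. apply Ny. split; auto.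
          intros [b Hb]. apply K. exists b. split; [apply mem_SS; eauto |].
          apply mem_add; auto. }
    destruct (RR_le (x := x) (a := SS) Gr) as (b & Hb & _); [apply mem_add; auto |].
    eauto.
Qed.

End KeyLemma.

(** * Types of finite tuples *)

Section Types.
Context {M : structure} {HM : ZF M}.
Implicit Types x y z a b c p q : M.

Definition updt a i y : M := add (sep a (fun p => fstp p <> i)) (pr i y).

(** The atomic diagram of a tuple: label 0 stands for membership and label 1 for equality. *)
Definition at_ a : M :=
  sep (prod (num 2) (prod (dom a) (dom a))) (fun q => exists i j x y,
    pr i x ∈ a /\ pr j y ∈ a /\
    ((q = pr (num 0) (pr i j) /\ x ∈ y) \/ (q = pr (num 1) (pr i j) /\ x = y))).

(** The labelled variations [(i, j), a'] of the tuple [a] at [i] by an element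
    of its [j]-th entry. *)
Definition vs a : M :=
  bigU (img a (fun q => img (prod (dom a) (sndp q)) (fun w =>
    pr (pr (fstp w) (fstp q)) (updt a (fstp w) (sndp w))))).

Definition tprd x : M :=
  img (prod (fstp x) (vs (sndp x))) (fun w => pr (fstp w) (sndp (sndp w))).
Definition tstep x g : M :=
  pr (at_ (sndp x)) (img (prod (fstp x) (vs (sndp x))) (fun w =>
    pr (pr (fstp w) (fstp (sndp w))) (app g (pr (fstp w) (sndp (sndp w)))))).

(** The bounded type of depth [k]: it determines the truth of the Delta_0
    formulas of quantifier depth at most [k]. *)
Definition tb k a : M := rec tprd tstep (pr k a).

Lemma df_vs {Par : M -> Prop} {E : Type} {HE : Env M E} (s : E -> M) :
  FW Par s -> FW Par (fun e => vs (s e)).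
Proof. intros. unfold vs, updt. df. Qed.

Lemma df_at {Par : M -> Prop} {E : Type} {HE : Env M E} (s : E -> M) :
  FW Par s -> FW Par (fun e => at_ (s e)).
Proof. intros. unfold at_. df. Qed.

Lemma Fun1_tprd : Fun1 tprd.
Proof.
  unfold Fun1, tprd. apply df_img; [| df]. apply df_prod; [df |].
  apply df_vs. df.
Qed.

Lemma df_tstep {Par : M -> Prop} {E : Type} {HE : Env M E} (s t : E -> M) :
  FW Par s -> FW Par t -> FW Par (fun e => tstep (s e) (t e)).
Proof.
  intros. unfold tstep. apply df_pr; [apply df_at; df |].
  apply df_img; [| df]. apply df_prod; [df |]. apply df_vs. df.
Qed.

Lemma tprd_wf : well_founded (fun z x => z ∈ tprd x).
Proof.
  assert (K : forall m x, fstp x = m -> Acc (fun z x => z ∈ tprd x) x).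
  { intro m. induction m as [m IH] using (well_founded_ind zf_wf).
    intros x <-. constructor. intros z Hz. unfold tprd in Hz.
    apply mem_img in Hz as (w & Hw & ->).
    2:{ unfold Fun1. df. }
    apply mem_prod in Hw as (m & v & Hm & _ & ->).
    apply (IH m Hm). now rewrite !fstp_pr. }
  intro x. exact (K _ x eq_refl).
Qed.

Lemma df_tb {Par : M -> Prop} {E : Type} {HE : Env M E} (s t : E -> M) :
  FW Par s -> FW Par t -> FW Par (fun e => tb (s e) (t e)).
Proof.
  intros. unfold tb. apply df_rec.
  - intros _. exact tprd_wf.
  - unfold tprd. apply df_img; [| df]. apply df_prod; [df |]. apply df_vs. df.
  - apply df_tstep; df.
  - df.
Qed.

Lemma tb_eq k a : tb k a = pr (at_ a) (img (prod k (vs a)) (fun w =>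
    pr (pr (fstp w) (fstp (sndp w))) (tb (fstp w) (sndp (sndp w))))).
Proof.
  unfold tb at 1.
  assert (HS : Fun2 tstep) by (apply df_tstep; df).
  pose proof (Fun1_rec Fun1_tprd HS tprd_wf) as HR.
  rewrite (rec_eq Fun1_tprd HS tprd_wf). unfold tstep at 1.
  rewrite fstp_pr, sndp_pr. f_equal. apply img_ext. intros w Hw. f_equal.
  unfold tb. apply (app_lam (t := rec tprd tstep)); auto.
  unfold tprd. rewrite fstp_pr, sndp_pr.
  apply mem_img; [cls |]. eauto.
Qed.

(** The labels of depth and indices allow the types of the variations to be read off from the type,
    which gives the back-and-forth property. *)
Lemma tb_step k a b : tb k a = tb k b -> at_ a = at_ b /\
  forall m l a', m ∈ k -> pr l a' ∈ vs a ->
    exists b', pr l b' ∈ vs b /\ tb m a' = tb m b'.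
Proof.
  rewrite !tb_eq. intro H. apply pr_inj in H as [H1 H2]. split; auto.
  assert (CF : Fun1 (fun w : M => pr (pr (fstp w) (fstp (sndp w)))
    (tb (fstp w) (sndp (sndp w))))).
  { unfold Fun1. apply df_pr; [df |]. apply df_tb; df. }
  intros m l a' Hm Ha.
  assert (K : pr (pr m l) (tb m a') ∈ img (prod k (vs a)) (fun w =>
    pr (pr (fstp w) (fstp (sndp w))) (tb (fstp w) (sndp (sndp w))))).
  { apply mem_img; auto. exists (pr m (pr l a')). rewrite pr_prod.
    rewrite !fstp_pr, !sndp_pr, !fstp_pr. auto. }
  rewrite H2 in K. apply mem_img in K as (w & Hw & E); auto.
  apply mem_prod in Hw as (m' & v & Hm' & Hv & ->).
  pose proof Hv as Hv'. unfold vs in Hv'. apply mem_bigU in Hv' as (s & Hs & Hv').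
  apply mem_img in Hs as (q & _ & ->); [| unfold updt; cls].
  apply mem_img in Hv' as (w & _ & ->); [| unfold updt; cls].
  rewrite !fstp_pr, !sndp_pr, !fstp_pr, ?sndp_pr in E.
  apply pr_inj in E as [E1 E2]. apply pr_inj in E1 as [-> ->]. eauto.
Qed.

Fixpoint tup (n : nat) (v : nat -> M) : M :=
  match n with 0 => emp | S n => add (tup n v) (pr (num n) (v n)) end.

Lemma mem_tup n v p : p ∈ tup n v <-> exists i, i < n /\ p = pr (num i) (v i).
Proof.
  induction n; simpl.
  - split; [intro H; destruct (mem_emp H) | intros (i & Hi & _); lia].
  - rewrite mem_add, IHn. split.
    + intros [(i & Hi & ->) | ->]; eauto.
    + intros (i & Hi & ->). destruct (Nat.eq_dec i n) as [-> |]; auto.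
      left. exists i. split; auto. lia.
Qed.

Lemma pr_tup n v i x : pr (num i) x ∈ tup n v <-> i < n /\ x = v i.
Proof.
  rewrite mem_tup. split.
  - intros (i' & Hi & E). apply pr_inj in E as [E ->]. apply num_inj in E.
    subst. auto.
  - intros [Hi ->]. eauto.
Qed.

Lemma isfun_tup n v : isfun (tup n v).
Proof.
  split.
  - intros p Hp. apply mem_tup in Hp as (i & _ & ->). eauto.
  - intros x y y' Hy Hy'. apply mem_tup in Hy as (i & _ & E).
    apply pr_inj in E as [-> ->]. apply pr_tup in Hy'. now symmetry.
Qed.

Lemma mem_dom_tup n v x : x ∈ dom (tup n v) <-> x ∈ num n.
Proof.
  rewrite mem_dom, mem_num. split.
  - intros [y Hy]. apply mem_tup in Hy as (i & Hi & E).
    apply pr_inj in E as [-> _]. eauto.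
  - intros (i & Hi & ->). exists (v i). now apply pr_tup.
Qed.

Lemma dom_tup n v : dom (tup n v) = num n.
Proof. apply zf_ext. intro. apply mem_dom_tup. Qed.

Lemma app_tup n v i : i < n -> app (tup n v) (num i) = v i.
Proof. intro. apply app_eq; [apply isfun_tup | now apply pr_tup]. Qed.

Lemma tup_ext n v w : (forall i, i < n -> v i = w i) -> tup n v = tup n w.
Proof.
  intro H. apply zf_ext. intro p. rewrite !mem_tup.
  split; intros (i & Hi & ->); exists i; rewrite H; auto.
Qed.

Lemma tup_of n a : isfun a -> dom a = num n ->
  a = tup n (fun i => app a (num i)).
Proof.
  intros Ia Da. apply fun_ext; auto; [apply isfun_tup | now rewrite dom_tup |].
  intros x Hx. rewrite Da in Hx. apply mem_num in Hx as (i & Hi & ->).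
  now rewrite app_tup.
Qed.

Lemma tup_Vs b n v : limit_ordinal b -> (forall i, i < n -> v i ∈ Vs b) ->
  omega ∈ b -> tup n v ∈ Vs b.
Proof.
  intros Lb Hv Ho. pose proof (proj1 Lb) as Ob.
  assert (HN : forall i, num i ∈ Vs b).
  { intro i. apply ord_Vs; auto; [apply ord_num |].
    exact (ord_trans Ob (num_omega i) Ho). }
  induction n; simpl; [apply (HN 0) |].
  assert (X : tup n v ∈ Vs b) by (apply IHn; auto).
  assert (Y : pr (num n) (v n) ∈ Vs b) by (apply Vs_pr; auto).
  apply mem_Vs_rk in X; auto. apply mem_Vs_rk in Y; auto.
  assert (O1 := ord_rk (tup n v)). assert (O2 := ord_rk (pr (num n) (v n))).
  assert (exists d, d ∈ b /\ (rk (tup n v) ∈ d \/ rk (tup n v) = d) /\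
    (rk (pr (num n) (v n)) ∈ d \/ rk (pr (num n) (v n)) = d))
    as (d & Hd & D1 & D2).
  { destruct (ord_total O1 O2) as [H | [H | H]];
      [exists (rk (pr (num n) (v n))) | exists (rk (tup n v)) | exists (rk (tup n v))];
      split; auto; split; auto. }
  apply (Vs_bounded (limit_osucc Lb Hd)). intros p Hp.
  assert (Od := ord_osucc (ord_mem Ob Hd)).
  apply mem_add in Hp as [Hp | ->]; apply mem_Vs_rk; auto.
  - apply (ord_trans Od (mem_rk_mem Hp)). apply mem_osucc. destruct D1; auto.
  - apply mem_osucc. destruct D2; auto.
Qed.

Lemma updt_tup n v i y : i < n -> updt (tup n v) (num i) y = tup n (upd v i y).
Proof.
  intro Hi. apply zf_ext. intro p. unfold updt. rewrite mem_add.
  rewrite mem_sep by cls. rewrite !mem_tup. split.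
  - intros [[(j & Hj & ->) H] | ->].
    + rewrite fstp_pr in H. exists j. split; auto. rewrite upd_other; auto.
    + exists i. rewrite upd_same. auto.
  - intros (j & Hj & ->). destruct (Nat.eq_dec j i) as [-> | Nj].
    + rewrite upd_same. auto.
    + left. rewrite upd_other by auto. split; [eauto |].
      rewrite fstp_pr. intro E. apply num_inj in E. auto.
Qed.

Lemma pr_vs n v l a : pr l a ∈ vs (tup n v) <-> exists i j y, i < n /\ j < n /\
  y ∈ v j /\ l = pr (num i) (num j) /\ a = tup n (upd v i y).
Proof.
  unfold vs. rewrite mem_bigU. split.
  - intros (s & Hs & H). apply mem_img in Hs as (q & Hq & ->); [| unfold updt; cls].
    apply mem_img in H as (w & Hw & E); [| unfold updt; cls].
    apply mem_tup in Hq as (j & Hj & ->).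
    apply mem_prod in Hw as (x & y & Hx & Hy & ->).
    rewrite mem_dom_tup in Hx. apply mem_num in Hx as (i & Hi & ->).
    rewrite !fstp_pr, !sndp_pr in *. rewrite updt_tup in E by auto.
    apply pr_inj in E as [-> ->]. eauto 9.
  - intros (i & j & y & Hi & Hj & Hy & -> & ->).
    eexists. split.
    + apply mem_img; [unfold updt; cls |]. exists (pr (num j) (v j)).
      split; [now apply pr_tup | reflexivity].
    + apply mem_img; [unfold updt; cls |]. exists (pr (num i) y).
      rewrite pr_prod, !fstp_pr, !sndp_pr, updt_tup by auto.
      split; auto. split; auto. rewrite dom_tup. apply mem_num. eauto.
Qed.

Lemma at_spec n v (b i j : nat) : i < n -> j < n ->
  (pr (num b) (pr (num i) (num j)) ∈ at_ (tup n v) <->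
   (b = 0 /\ v i ∈ v j) \/ (b = 1 /\ v i = v j)).
Proof.
  intros Hi Hj. unfold at_. rewrite mem_sep by cls. split.
  - intros [_ (i' & j' & x & y & Hx & Hy & H)].
    assert (H' : (b = 0 /\ i' = num i /\ j' = num j /\ x ∈ y) \/
      (b = 1 /\ i' = num i /\ j' = num j /\ x = y)).
    { destruct H as [[E H] | [E H]]; apply pr_inj in E as [E1 E2];
        apply pr_inj in E2 as [-> ->];
        [apply (num_inj (m := b) (n := 0)) in E1 |
         apply (num_inj (m := b) (n := 1)) in E1]; auto. }
    destruct H' as [(-> & -> & -> & H') | (-> & -> & -> & H')];
      apply pr_tup in Hx as [_ ->]; apply pr_tup in Hy as [_ ->]; auto.
  - intro H. split.
    + rewrite !pr_prod, !dom_tup. repeat split; apply mem_num; eauto.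
      exists b. split; auto. destruct H as [[-> _] | [-> _]]; lia.
    + exists (num i), (num j), (v i), (v j). rewrite !pr_tup.
      destruct H as [[-> H] | [-> H]]; auto 8.
Qed.

Fixpoint mv (f : form) : nat :=
  match f with
  | Mem x y | Eq x y => S (max x y)
  | Neg f => mv f
  | And f g | Or f g | Imp f g => max (mv f) (mv g)
  | All x f | Ex x f => max (S x) (mv f)
  end.

Fixpoint dp (f : form) : nat :=
  match f with
  | Mem _ _ | Eq _ _ => 0
  | Neg f => dp f
  | And f g | Or f g | Imp f g => max (dp f) (dp g)
  | All _ f | Ex _ f => S (dp f)
  end.

Lemma tb_atom n k (v w : nat -> M) : tb (num k) (tup n v) = tb (num k) (tup n w) ->
  forall i j, i < n -> j < n ->
    (v i ∈ v j <-> w i ∈ w j) /\ (v i = v j <-> w i = w j).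
Proof.
  intros H i j Hi Hj. apply tb_step in H as [H _].
  pose proof (at_spec v 0 Hi Hj) as A1. pose proof (at_spec v 1 Hi Hj) as A2.
  pose proof (at_spec w 0 Hi Hj) as B1. pose proof (at_spec w 1 Hi Hj) as B2.
  rewrite H in A1, A2.
  assert (N1 : 0 <> 1) by lia. assert (N2 : 1 <> 0) by lia. tauto.
Qed.

Lemma tb_forth n k (v w : nat -> M) i j y :
  tb (num (S k)) (tup n v) = tb (num (S k)) (tup n w) -> i < n -> j < n ->
  y ∈ v j -> exists y', y' ∈ w j /\
    tb (num k) (tup n (upd v i y)) = tb (num k) (tup n (upd w i y')).
Proof.
  intros H Hi Hj Hy. apply tb_step in H as [_ H].
  destruct (H (num k) (pr (num i) (num j)) (tup n (upd v i y))) as (b & Hb & E).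
  - apply mem_num. exists k. auto.
  - apply pr_vs. eauto 9.
  - apply pr_vs in Hb as (i' & j' & y' & Hi' & Hj' & Hy' & E' & ->).
    apply pr_inj in E' as [E1 E2]. apply num_inj in E1, E2. subst. eauto.
Qed.

(** An Ehrenfeucht-Fraisse argument: a quantifier on [x] bounded by [y] replaces the entry [x] of
    the tuple by an element of the entry [y], so it is met by a variation. *)
Theorem tb_sat f : delta0 f -> forall n k (v w : nat -> M), mv f <= n -> dp f <= k ->
  tb (num k) (tup n v) = tb (num k) (tup n w) ->
  (sat (@whole M) v f <-> sat (@whole M) w f).
Proof.
  induction 1; intros n k v w Hn Hk Hv; cbn [mv dp sat] in *.
  - apply (tb_atom Hv); lia.
  - apply (tb_atom Hv); lia.
  - rewrite (IHdelta0 n k v w); auto; reflexivity.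
  - rewrite (IHdelta0_1 n k v w), (IHdelta0_2 n k v w); try lia; auto; reflexivity.
  - rewrite (IHdelta0_1 n k v w), (IHdelta0_2 n k v w); try lia; auto; reflexivity.
  - rewrite (IHdelta0_1 n k v w), (IHdelta0_2 n k v w); try lia; auto; reflexivity.
  - destruct k as [|k]; [lia |].
    assert (Q : forall v w : nat -> M,
      tb (num (S k)) (tup n v) = tb (num (S k)) (tup n w) ->
      (forall a, whole a -> upd v x a x ∈ upd v x a y -> sat (@whole M) (upd v x a) f) ->
      (forall a, whole a -> upd w x a x ∈ upd w x a y -> sat (@whole M) (upd w x a) f)).
    { intros v' w' E Hs a _. rewrite upd_same, upd_other by auto. intro Ha.
      destruct (@tb_forth n k w' v' x y a (eq_sym E)) as (b & Hb & E'); [lia | lia | auto |].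
      apply (IHdelta0 n k (upd w' x a) (upd v' x b)); [lia | lia | exact E' |].
      apply Hs; [exact I |].
      now rewrite upd_same, upd_other by auto. }
    split; apply Q; auto.
  - destruct k as [|k]; [lia |].
    assert (Q : forall v w : nat -> M,
      tb (num (S k)) (tup n v) = tb (num (S k)) (tup n w) ->
      (exists a, whole a /\ (upd v x a x ∈ upd v x a y /\ sat (@whole M) (upd v x a) f)) ->
      (exists a, whole a /\ (upd w x a x ∈ upd w x a y /\ sat (@whole M) (upd w x a) f))).
    { intros v' w' E (a & _ & Ha & Hs). rewrite upd_same, upd_other in Ha by auto.
      destruct (@tb_forth n k v' w' x y a E) as (b & Hb & E'); [lia | lia | auto |].
      exists b. split; [exact I |]. rewrite upd_same, upd_other by auto.
      split; auto.
      apply (IHdelta0 n k (upd v' x a) (upd w' x b)); [lia | lia | exact E' | auto]. }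
    split; apply Q; auto.
Qed.

Lemma num_Vs b n : ordinal b -> omega ∈ b \/ omega = b -> num n ∈ Vs b.
Proof.
  intros Ob H. apply ord_Vs; auto; [apply ord_num |].
  destruct H as [H | <-]; [| apply num_omega].
  exact (ord_trans Ob (num_omega n) H).
Qed.

Lemma limit_omega : limit_ordinal (omega (M := M)).
Proof.
  split; [apply ord_omega |]. split; [exists emp; apply (num_omega 0) |].
  intros a Ha. exists (osucc a). split; [now apply omega_closed |].
  apply mem_osucc. auto.
Qed.

(** The rank of a type exceeds omega by a finite amount that depends on the depth and not on the
    entries. This is what puts types below all points of the sequence that matter. *)
Lemma tb_bound b n k : limit_ordinal b -> omega ∈ b -> exists d, d ∈ b /\
  omega ∈ d /\ forall m v, m < k -> tb (num m) (tup n v) ∈ Vs d.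
Proof.
  intros Lb Ho. induction k.
  - exists (osucc omega). split; [now apply limit_osucc |].
    split; [apply mem_osucc; auto |]. intros; lia.
  - destruct IHk as (d & Hd & Hod & IH).
    assert (Od := ord_mem (proj1 Lb) Hd).
    assert (L2 : forall c, c ∈ b -> osucc c ∈ b) by (intro; now apply limit_osucc).
    (* Labelled types of smaller depth lie two levels above [d], their set one level higher, and its
       pair with the atomic diagram another two. *)
    pose (d' := osucc (osucc (osucc (osucc (osucc d))))).
    assert (Od1 := ord_osucc (ord_osucc Od)).
    assert (Sub : subset (Vs d) (Vs (osucc (osucc d)))).
    { apply Vs_mono. intros z Hz. apply mem_osucc. left. apply mem_osucc. auto. }
    assert (Hnum : forall i, num i ∈ Vs d) by (intro; apply num_Vs; auto).
    exists d'. split; [unfold d'; auto 6 |]. split.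
    { unfold d'. apply mem_osucc; left. apply mem_osucc; left. apply mem_osucc; left.
      apply mem_osucc; left. apply mem_osucc; auto. }
    intros m v Hm. destruct (Nat.eq_dec m k) as [-> | Nm].
    2:{ apply (Vs_mono (a := d)); [| apply IH; lia]. unfold d'.
        intros z Hz. do 5 (apply mem_osucc; left). auto. }
    rewrite tb_eq. unfold d'. apply pr_Vs2.
    + apply Vs_bounded with (b := osucc (osucc d)); [apply mem_osucc; auto |].
      intros q Hq. unfold at_ in Hq. apply mem_sep in Hq as [Hq _]; [| cls].
      apply mem_prod in Hq as (x & y & Hx & Hy & ->).
      apply mem_prod in Hy as (y1 & y2 & Hy1 & Hy2 & ->).
      rewrite dom_tup in Hy1, Hy2. apply mem_num in Hx as (x1 & _ & ->).
      apply mem_num in Hy1 as (i1 & _ & ->). apply mem_num in Hy2 as (i2 & _ & ->).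
      assert (K : pr (num x1) (pr (num i1) (num i2)) ∈ Vs (omega (M := M))).
      { assert (On := ord_omega (M := M)). pose proof limit_omega as Lo.
        repeat apply Vs_pr; auto; apply num_Vs; auto. }
      revert K. apply Vs_mono. intros z Hz. do 2 (apply mem_osucc; left).
      exact (ord_trans Od Hz Hod).
    + apply Vs_bounded with (b := osucc (osucc d)); [apply mem_osucc; auto |].
      intros q Hq. apply mem_img in Hq as (w & Hw & ->).
      2:{ unfold Fun1. apply df_pr; [df |]. apply df_tb; df. }
      apply mem_prod in Hw as (m & u & Hm' & Hu & ->).
      apply mem_num in Hm' as (m' & Hm' & ->).
      pose proof Hu as Hu'. unfold vs in Hu'. apply mem_bigU in Hu' as (s & Hs & Hu').
      apply mem_img in Hs as (q & _ & ->); [| unfold updt; cls].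
      apply mem_img in Hu' as (w & _ & ->); [| unfold updt; cls].
      rewrite !fstp_pr, !sndp_pr, !fstp_pr, ?sndp_pr.
      apply pr_vs in Hu as (i & j & y & _ & _ & _ & -> & ->).
      apply pr_Vs2; [| now apply IH].
      assert (K : pr (num m') (pr (num i) (num j)) ∈ Vs (omega (M := M))).
      { assert (On := ord_omega (M := M)). pose proof limit_omega as Lo.
        repeat apply Vs_pr; auto; apply num_Vs; auto. }
      revert K. apply Vs_mono. intros z Hz. exact (ord_trans Od Hz Hod).
Qed.

Lemma tb_Vs b n k v : limit_ordinal b -> omega ∈ b ->
  tb (num k) (tup n v) ∈ Vs b.
Proof.
  intros Lb Ho. destruct (tb_bound n (S k) Lb Ho) as (d & Hd & _ & H).
  assert (K := H k v (Nat.lt_succ_diag_r k)). revert K. apply Vs_mono.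
  intros z Hz. exact (ord_trans (proj1 Lb) Hz Hd).
Qed.

End Types.

Ltac df_more6 := df_fun.
Ltac df_more5 ::=
  lazymatch goal with
  | |- DF _ _ (fun e => tb _ _) => apply df_tb; df
  | |- DF _ _ (fun e => updt _ _ _) => unfold updt; df
  | |- _ => df_more6
  end.

(** * Reflection of Sigma_2 formulas *)

Section Reflection.
Context {M : structure} {HM : ZF M}.
Variable (be : M).
Hypotheses (Lbe : limit_ordinal be) (Obe : omega ∈ be).
Implicit Types x y z a b c p q s J r : M.

Definition var_of J a b : Prop := isfun b /\ dom b = dom a /\
  forall i z, ~ i ∈ J -> (pr i z ∈ a <-> pr i z ∈ b).

(** The types realised by the variations of [b] at the indices in [J]; it
    determines the truth of Pi_1 formulas at [b]. *)
Definition S1 k J b : M :=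
  sep (Vs be) (fun r => exists c, var_of J b c /\ r = tb k c).

(** [Ra] asks for a variation of a tuple at the indices [I] that has prescribed types for the
    variations at [J]; reflecting it yields correctness for Sigma_2. [Rb] asks for the length of an
    enumeration; reflecting it makes the resulting ordinal a cardinal. *)
Definition Ra x y : Prop := exists k J I a s,
  x = pr (pr k J) (pr I (pr a s)) /\ var_of I a y /\ S1 k J y = s.
Definition Rb x y : Prop := ordinal y /\ exists h, surj h y x.

Lemma Rel2_Ra : Rel2 Ra.
Proof. unfold Ra, S1, var_of. cls. Qed.

Lemma Rel2_Rb : Rel2 Rb.
Proof. unfold Rb. cls. Qed.

Definition refl_at (R : M -> M -> Prop) a b : Prop :=
  forall x, x ∈ Vs a -> (exists y, R x y) -> exists y, y ∈ Vs b /\ R x y.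
Definition Cl a b : Prop :=
  ordinal b /\ rk a ∈ b /\ refl_at Ra a b /\ refl_at Rb a b.

Lemma Rel2_Cl : Rel2 Cl.
Proof.
  pose proof Rel2_Ra. pose proof Rel2_Rb. unfold Cl, refl_at. cls.
Qed.

Lemma Cl_exists a : exists b, Cl a b.
Proof.
  destruct (collection (Vs a) Rel2_Ra) as (b1 & O1 & H1).
  destruct (collection (Vs a) Rel2_Rb) as (b2 & O2 & H2).
  set (u := bigU (cup (upair b1 b2) (upair (rk a) (rk a)))).
  assert (Hu : forall c, c = b1 \/ c = b2 \/ c = rk a -> subset c u).
  { intros c Hc z Hz. apply mem_bigU. exists c. split; auto. apply mem_cup.
    rewrite !mem_upair. tauto. }
  assert (Ou : ordinal u).
  { apply ord_bigU. intros c Hc. apply mem_cup in Hc. rewrite !mem_upair in Hc.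
    destruct Hc as [[-> | ->] | [-> | ->]]; auto; apply ord_rk. }
  assert (Su : subset u (osucc u)) by (intros z Hz; apply mem_osucc; auto).
  exists (osucc u). split; [now apply ord_osucc |]. split.
  - apply mem_osucc. apply ord_subset; auto. apply ord_rk.
  - split.
    + intros x Hx Hy. destruct (H1 x Hx Hy) as (y & Hy1 & Hxy). exists y.
      split; auto. revert Hy1. apply Vs_mono. intros z Hz. apply Su, (Hu b1); auto.
    + intros x Hx Hy. destruct (H2 x Hx Hy) as (y & Hy1 & Hxy). exists y.
      split; auto. revert Hy1. apply Vs_mono. intros z Hz. apply Su, (Hu b2); auto.
Qed.

Definition isLL a b : Prop := Cl a b /\ forall c, c ∈ b -> ~ Cl a c.
Definition LL a : M := the (isLL a).

Lemma LL_spec a : isLL a (LL a).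
Proof.
  unfold LL. apply (the_spec (P := isLL a)). destruct (Cl_exists a) as [b Hb].
  destruct (@ord_least M HM (Cl a) b) as (c & _ & Hc & Hm); auto.
  - apply Hb.
  - exists c. split; auto.
Qed.

Lemma LL_unique a b : isLL a b -> b = LL a.
Proof.
  intros [Hb Mb]. destruct (LL_spec a) as [Hc Mc].
  destruct (ord_total (proj1 Hb) (proj1 Hc)) as [H | [H | H]]; auto.
  - destruct (Mc _ H Hb).
  - destruct (Mb _ H Hc).
Qed.

Lemma Fun1_LL : Fun1 LL.
Proof.
  unfold Fun1. apply df_char with (Q := fun e y => isLL (snd e) y).
  - pose proof Rel2_Cl. unfold isLL. dfn.
  - intros e. apply LL_spec.
  - intros e y. apply LL_unique.
Qed.

Variable (a0 : M).
Hypothesis (Oa0 : ordinal a0).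

Definition sup0 g : M := bigU (cup (upair a0 a0) (ran g)).
Definition gg (n : M) : M := rec (fun n => n) (fun _ g => LL (sup0 g)) n.

Lemma Fun1_gg : Fun1 gg.
Proof.
  pose proof Fun1_LL. apply Fun1_rec; [cls | unfold sup0; cls | apply zf_wf].
Qed.

Lemma gg_eq n : gg n = LL (sup0 (lam n gg)).
Proof.
  pose proof Fun1_LL. unfold gg at 1. rewrite rec_eq; auto.
  - cls.
  - unfold sup0; cls.
  - apply zf_wf.
Qed.

Definition al n : M := sup0 (lam n gg).

Lemma gg_Cl n : Cl (al n) (gg n).
Proof. rewrite gg_eq. apply LL_spec. Qed.

Lemma mem_al n c x : (c = a0 \/ exists m, m ∈ n /\ c = gg m) ->
  x ∈ c -> x ∈ al n.
Proof.
  intros Hc Hx. apply mem_bigU. exists c. split; auto. apply mem_cup.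
  destruct Hc as [-> | (m & Hm & ->)]; [left; apply mem_upair; auto |].
  right. apply mem_ran. exists m. apply pr_lam; auto. apply Fun1_gg.
Qed.

Lemma ord_al n : ordinal (al n).
Proof.
  apply ord_bigU. intros c Hc. apply mem_cup in Hc as [Hc | Hc].
  - apply mem_upair in Hc as [-> | ->]; auto.
  - apply mem_ran in Hc as [m Hm]. apply pr_lam in Hm as [_ ->]; [| apply Fun1_gg].
    apply gg_Cl.
Qed.

Lemma al_gg n : al n ∈ gg n.
Proof.
  destruct (gg_Cl n) as (_ & H & _). now rewrite (rk_ord (ord_al n)) in H.
Qed.

Lemma gg_lt n c : (c = a0 \/ exists m, m ∈ n /\ c = gg m) -> c ∈ gg n.
Proof.
  intro Hc. assert (Oc : ordinal c).
  { destruct Hc as [-> | (m & _ & ->)]; auto. apply gg_Cl. }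
  assert (S : subset c (al n)) by (intros x; now apply mem_al).
  destruct (ord_subset Oc (ord_al n) S) as [H | ->]; [| apply al_gg].
  exact (ord_trans (proj1 (gg_Cl n)) H (al_gg n)).
Qed.

(** Omega many steps of [LL] are taken, each of which reflects both relations from everything below
    the earlier steps. A set below the supremum is already below one of the steps. *)
Theorem reflection : exists z, limit_ordinal z /\ a0 ∈ z /\
  refl_at Ra z z /\ refl_at Rb z z.
Proof.
  set (z := bigU (img omega gg)).
  assert (Mz : forall x, x ∈ z <-> exists n, n ∈ omega /\ x ∈ gg n).
  { intro x. unfold z. rewrite mem_bigU. split.
    - intros (y & Hy & Hx). apply mem_img in Hy as (n & Hn & ->); [eauto | apply Fun1_gg].
    - intros (n & Hn & Hx). exists (gg n). split; auto.
      apply mem_img; [apply Fun1_gg | eauto]. }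
  assert (Oz : ordinal z).
  { apply ord_bigU. intros c Hc. apply mem_img in Hc as (n & _ & ->); [| apply Fun1_gg].
    apply gg_Cl. }
  assert (Hsub : forall n, n ∈ omega -> subset (gg n) z).
  { intros n Hn x Hx. apply Mz. eauto. }
  assert (Hnext : forall n, n ∈ omega -> gg n ∈ gg (osucc n)).
  { intros n Hn. apply gg_lt. right. exists n. split; auto. apply mem_osucc; auto. }
  assert (HV : forall x, x ∈ Vs z -> exists n, n ∈ omega /\ x ∈ Vs (gg n)).
  { intros x Hx. apply mem_Vs_rk in Hx; auto. apply Mz in Hx as (n & Hn & Hx).
    exists n. split; auto. apply mem_Vs_rk; auto. apply gg_Cl. }
  assert (HR : forall R, (forall n, refl_at R (al n) (gg n)) -> refl_at R z z).
  { intros R HR x Hx Hy. destruct (HV x Hx) as (n & Hn & Hxn).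
    destruct (HR (osucc n) x) as (y & Hy1 & Hxy); auto.
    - revert Hxn. apply Vs_mono. intros w Hw. apply mem_al with (c := gg n); auto.
      right. exists n. split; auto. apply mem_osucc; auto.
    - exists y. split; auto. revert Hy1. apply Vs_mono. apply Hsub.
      now apply omega_closed. }
  exists z. split; [| split; [| split]].
  - split; auto. split.
    + exists a0. apply Mz. exists emp. split; [apply (num_omega 0) |].
      apply gg_lt; auto.
    + intros a Ha. apply Mz in Ha as (n & Hn & Ha). exists (gg n). split; auto.
      apply Mz. exists (osucc n). split; [now apply omega_closed | auto].
  - apply Mz. exists emp. split; [apply (num_omega 0) |]. apply gg_lt; auto.
  - apply HR. intro. apply gg_Cl.
  - apply HR. intro. apply gg_Cl.
Qed.

End Reflection.

Definition agree {T : Type} (l : list nat) (v w : nat -> T) : Prop :=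
  forall i, ~ In i l -> w i = v i.

(** A block of quantifiers becomes one quantifier over the valuations that differ on a finite list,
    in place of a contraction of the block by pairing. *)
Lemma pi_1_nf {M : structure} m f : pi m f -> m = 1 ->
  exists l g, delta0 g /\ forall (D : M -> Prop) v, (forall i, D (v i)) ->
    (sat D v f <-> forall u, (forall i, D (u i)) -> agree l v u -> sat D u g).
Proof.
  induction 1 as [| m f Hf | m x f Hf IH]; intro E; [discriminate | |].
  - injection E as ->. inversion Hf; subst. exists nil, f. split; auto.
    intros D v Hv. split.
    + intros Hs u _ Hu. replace u with v; auto.
      apply functional_extensionality. intro i. symmetry. now apply Hu.
    + intro Hs. apply Hs; auto. intros i _. reflexivity.
  - destruct (IH E) as (l & g & Hg & Hs). exists (x :: l), g. split; auto.
    intros D v Hv. simpl.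
    assert (HD : forall a, D a -> forall i, D (upd v x a i)).
    { intros a Ha i. unfold upd. destruct (Nat.eqb i x); auto. }
    split.
    + intros H u Hu Ha. apply (proj1 (Hs D _ (HD _ (Hu x))) (H _ (Hu x)) u Hu).
      intros i Hi. unfold upd. destruct (Nat.eqb_spec i x) as [-> |]; auto.
      apply Ha. simpl. intuition.
    + intros H a Ha. apply (Hs D _ (HD a Ha)). intros u Hu Ha'. apply H; auto.
      intros i Hi. simpl in Hi. rewrite Ha' by tauto. apply upd_other. intuition.
Qed.

Lemma sigma_2_nf {M : structure} m f : sigma m f -> m = 2 ->
  exists l l' g, delta0 g /\ forall (D : M -> Prop) v, (forall i, D (v i)) ->
    (sat D v f <-> exists w, (forall i, D (w i)) /\ agree l v w /\
       forall u, (forall i, D (u i)) -> agree l' w u -> sat D u g).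
Proof.
  induction 1 as [| m f Hf | m x f Hf IH]; intro E; [discriminate | |].
  - destruct (@pi_1_nf M m f Hf) as (l' & g & Hg & Hs); [congruence |].
    exists nil, l', g. split; auto. intros D v Hv. rewrite Hs by auto. split.
    + intro H. exists v. split; auto. split; auto. intros i _. reflexivity.
    + intros (w & Hw & Ha & H). replace v with w; auto.
      apply functional_extensionality. intro i. now apply Ha.
  - destruct (IH E) as (l & l' & g & Hg & Hs). exists (x :: l), l', g. split; auto.
    intros D v Hv. simpl.
    assert (HD : forall a, D a -> forall i, D (upd v x a i)).
    { intros a Ha i. unfold upd. destruct (Nat.eqb i x); auto. }
    split.
    + intros (a & Ha & H). apply (Hs D _ (HD a Ha)) in H as (w & Hw & Ag & H).
      exists w. split; auto. split; auto. intros i Hi. simpl in Hi.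
      rewrite Ag by tauto. apply upd_other. intuition.
    + intros (w & Hw & Ag & H). exists (w x). split; auto.
      apply (Hs D _ (HD _ (Hw x))). exists w. split; auto. split; auto.
      intros i Hi. unfold upd. destruct (Nat.eqb_spec i x) as [-> |]; auto.
      apply Ag. simpl. intuition.
Qed.

Lemma sigma_1_2 m f : sigma m f -> m = 1 -> sigma 2 f.
Proof.
  induction 1 as [| m f Hf | m x f Hf IH]; intro E; [discriminate | |].
  - apply sigma_pi, pi_sigma. injection E as ->. inversion Hf; subst.
    now constructor.
  - apply sigma_Ex. auto.
Qed.

Lemma delta0_abs {M : structure} (D : M -> Prop) f :
  (forall x y, D x -> y ∈ x -> D y) -> delta0 f ->
  forall v, (forall i, D (v i)) -> (sat D v f <-> sat (@whole M) v f).
Proof.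
  intros HD. assert (HU : forall v x a, (forall i, D (v i)) -> D a ->
    forall i, D (upd v x a i)).
  { intros v x a Hv Ha i. unfold upd. destruct (Nat.eqb i x); auto. }
  induction 1; simpl; intros v Hv.
  - reflexivity.
  - reflexivity.
  - rewrite IHdelta0 by auto. reflexivity.
  - rewrite IHdelta0_1, IHdelta0_2 by auto. reflexivity.
  - rewrite IHdelta0_1, IHdelta0_2 by auto. reflexivity.
  - rewrite IHdelta0_1, IHdelta0_2 by auto. reflexivity.
  - split.
    + intros Hs a _ Ha. assert (Da : D a).
      { rewrite upd_same, upd_other in Ha by auto. exact (HD _ _ (Hv y) Ha). }
      apply IHdelta0; auto.
    + intros Hs a Da Ha. apply IHdelta0; auto. apply Hs; auto. exact I.
  - split.
    + intros (a & Da & Ha & Hs). exists a. split; [exact I |]. split; auto.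
      apply IHdelta0; auto.
    + intros (a & _ & Ha & Hs). assert (Da : D a).
      { rewrite upd_same, upd_other in Ha by auto. exact (HD _ _ (Hv y) Ha). }
      exists a. split; auto. split; auto. apply IHdelta0; auto.
Qed.

Section Correct.
Context {M : structure} {HM : ZF M}.
Variables (be z : M).
Hypotheses (Lbe : limit_ordinal be) (Obe : omega ∈ be) (Lz : limit_ordinal z)
  (Hbz : be ∈ z) (Hra : refl_at (Ra be) z z) (Hrb : refl_at Rb z z).
Hypothesis (MWO : WO (M := M)).

Let Oz : ordinal z := proj1 Lz.
Let Hoz : omega ∈ z := ord_trans Oz Obe Hbz.

(** By reflection of [Rb], the power set of any [a] below [z] is enumerated by an ordinal below [z];
    a bijection from [a] to [z] would therefore contradict Cantor's theorem. *)
Lemma refl_cardinal : cardinal z.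
Proof.
  split; auto. intros a Ha [f Hf].
  assert (Hp : pow a ∈ Vs z).
  { assert (Oa := ord_mem Oz Ha).
    apply (Vs_bounded (limit_osucc Lz Ha)). intros x Hx. apply mem_pow in Hx.
    apply Vs_bounded with (b := a); [apply mem_osucc; auto |].
    intros y Hy. apply ord_Vs; auto. exact (ord_mem Oa (Hx y Hy)). }
  destruct (Hrb Hp) as (o & Ho & Oo & h & Hh).
  - destruct (MWO (pow a)) as (o & h & Oo & Hh). exists o. split; eauto.
  - apply (proj1 (ord_Vs Oo Oz)) in Ho.
    apply (no_bijection_power Hf (a := o) (h := h)); auto.
    intros x Hx. exact (ord_trans Oz Hx Ho).
Qed.

Fixpoint lset (l : list nat) : M :=
  match l with nil => emp | i :: l => add (lset l) (num i) end.

Lemma mem_lset l x : x ∈ lset l <-> exists i, In i l /\ x = num i.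
Proof.
  induction l as [|i l IH]; simpl.
  - split; [intro H; destruct (mem_emp H) | intros (i & [] & _)].
  - rewrite mem_add, IH. split.
    + intros [(k & Hk & ->) | ->]; eauto.
    + intros (k & [-> | Hk] & ->); eauto.
Qed.

Lemma lset_Vs l : lset l ∈ Vs z.
Proof.
  apply (Vs_bounded Hoz). intros x Hx. apply mem_lset in Hx as (i & _ & ->).
  apply num_Vs; auto. apply ord_omega.
Qed.

Lemma var_of_tup n l (w : nat -> M) c : (forall i, In i l -> i < n) ->
  (var_of (lset l) (tup n w) c <-> exists u, agree l w u /\ c = tup n u).
Proof.
  intro Hl. split.
  - intros (Ic & Dc & Hc). rewrite dom_tup in Dc.
    exists (fun i => if Nat.ltb i n then app c (num i) else w i). split.
    + intros i Hi. destruct (Nat.ltb_spec i n) as [Hn |]; auto.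
      apply (app_eq Ic). apply Hc.
      * intro H. apply mem_lset in H as (i' & Hi' & E). apply num_inj in E. now subst.
      * now apply pr_tup.
    + rewrite (tup_of Ic Dc) at 1. apply tup_ext. intros i Hi.
      destruct (Nat.ltb_spec i n); auto. lia.
  - intros (u & Ha & ->). split; [apply isfun_tup |].
    split; [now rewrite !dom_tup |]. intros x y Hx. rewrite !mem_tup.
    split; intros (i & Hi & E); exists i; split; auto;
      assert (K : ~ In i l) by (intro K; apply Hx, mem_lset; exists i;
        split; auto; apply pr_inj in E; tauto);
      rewrite ?(Ha i K) in *; auto; now rewrite (Ha i K).
Qed.

Lemma mem_S1 n k l (w : nat -> M) r : (forall i, In i l -> i < n) ->
  (r ∈ S1 be (num k) (lset l) (tup n w) <->
   exists u, agree l w u /\ r = tb (num k) (tup n u)).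
Proof.
  intro Hl. unfold S1. rewrite mem_sep by (unfold var_of; cls). split.
  - intros (_ & c & Hc & ->). apply (var_of_tup _ _ Hl) in Hc as (u & Hu & ->). eauto.
  - intros (u & Hu & ->). split; [now apply tb_Vs |].
    exists (tup n u). split; auto. apply var_of_tup; eauto.
Qed.

Lemma refl_tup n k l l' (v w : nat -> M) : (forall i, v i ∈ Vs z) ->
  (forall i, In i l -> i < n) -> agree l v w ->
  exists w', (forall i, w' i ∈ Vs z) /\ agree l v w' /\
    S1 be (num k) (lset l') (tup n w') = S1 be (num k) (lset l') (tup n w).
Proof.
  intros Hv Hl Hw.
  set (s := S1 be (num k) (lset l') (tup n w)).
  destruct (Hra (x := pr (pr (num k) (lset l')) (pr (lset l) (pr (tup n v) s))))
    as (y & Hy & k' & J & I' & a & s' & E & H1 & H2).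
  - repeat apply Vs_pr; auto using lset_Vs.
    + apply num_Vs; auto.
    + apply tup_Vs; auto.
    + apply (Vs_bounded Hbz). intros r Hr. unfold s, S1 in Hr.
      apply mem_sep in Hr; [tauto | unfold var_of; cls].
  - exists (tup n w). unfold Ra. do 5 eexists. split; [reflexivity |].
    split; [apply var_of_tup; eauto | reflexivity].
  - apply pr_inj in E as [E1 E2]. apply pr_inj in E1 as [<- <-].
    apply pr_inj in E2 as [<- E2]. apply pr_inj in E2 as [<- <-].
    apply (var_of_tup _ _ Hl) in H1 as (u & Hu & ->). exists u.
    split; [| split; auto]. intro i. destruct (le_lt_dec n i) as [L | L].
    + rewrite Hu; auto. intro K. apply Hl in K. lia.
    + assert (K : pr (num i) (u i) ∈ tup n u) by (now apply pr_tup).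
      apply (Vs_trans Oz Hy) in K. now apply (Vs_pr_inv Oz) in K.
Qed.

(** The inner Pi_1 part at [w] depends only on the set [S1] of types of the variations of [w].
    [refl_tup] moves a witness into V_z with this set unchanged, and in the other direction, with an
    empty list of further variables, it moves a counterexample into V_z. *)
Lemma refl_C2 : C_class 2 z.
Proof.
  split; auto. split; [exists be; auto |]. split; [intros; exact I |].
  intros f Hf v w Hv _ Hvw.
  replace w with v by (apply functional_extensionality; auto). clear w Hvw.
  destruct (@sigma_2_nf M 2 f Hf eq_refl) as (l & l' & g & Hg & Hs).
  rewrite (Hs (in_V z) v Hv), (Hs (@whole M) v (fun _ => I)). clear Hs.
  assert (HT : forall x y : M, in_V z x -> y ∈ x -> in_V z y).
  { intros x y. rewrite !in_V_iff. apply Vs_trans. auto. }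
  assert (exists n, mv g <= n /\ (forall i, In i l -> i < n) /\
    (forall i, In i l' -> i < n)) as (n & Hn & Hl & Hl').
  { exists (mv g + S (List.list_max l) + S (List.list_max l')). split; [lia |].
    assert (K : forall l i, In i l -> i <= List.list_max l).
    { clear. intros l i Hi. assert (L := proj1 (List.list_max_le l _) (le_n _)).
      rewrite Forall_forall in L. auto. }
    split; intros i Hi; apply K in Hi; lia. }
  assert (HD : forall v : nat -> M, (forall i, in_V z (v i)) -> forall i, v i ∈ Vs z).
  { intros u Hu i. now apply in_V_iff. }
  split.
  - intros (w & Hw & Ha & H). exists w. split; [intro; exact I |]. split; auto.
    intros u _ Hu. apply NNPP. intro Nu.
    destruct (@refl_tup n (dp g) l' nil w u (HD w Hw) Hl' Hu) as (u' & Hu' & Ha' & E).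
    assert (K : tb (num (dp g)) (tup n u) ∈ S1 be (num (dp g)) (lset nil) (tup n u)).
    { apply mem_S1; [intros i [] |]. exists u. split; auto. intros i _. reflexivity. }
    rewrite <- E in K. apply mem_S1 in K as (u2 & Hu2 & E2); [| intros i []].
    assert (u2 = u') by (apply functional_extensionality; intro i; apply Hu2; intros []).
    subst u2. apply Nu. apply (tb_sat Hg Hn (le_n _) E2).
    apply (delta0_abs HT Hg); [intro i; now apply in_V_iff |].
    apply H; auto. intro i. now apply in_V_iff.
  - intros (w & _ & Ha & H).
    destruct (@refl_tup n (dp g) l l' v w (HD v Hv) Hl Ha) as (w' & Hw' & Ha' & E).
    exists w'. split; [intro i; now apply in_V_iff |]. split; auto.
    intros u Hu Hu'. apply (delta0_abs HT Hg Hu).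
    assert (K : tb (num (dp g)) (tup n u) ∈ S1 be (num (dp g)) (lset l') (tup n w')).
    { apply mem_S1; eauto. }
    rewrite E in K. apply mem_S1 in K as (u2 & Hu2 & E2); auto.
    apply (tb_sat Hg Hn (le_n _) E2). apply H; auto. intro; exact I.
Qed.

Lemma refl_C1 : C_class 1 z.
Proof.
  destruct refl_C2 as (H1 & H2 & H3 & H4). split; auto. split; auto. split; auto.
  intros f Hf. apply H4. exact (sigma_1_2 Hf eq_refl).
Qed.

End Correct.

(** * Coded elementary submodels *)

(** Relativisation to the set held by variable 0. It makes every formula Delta_0, so the bounded
    types of tuples headed by V_zeta determine full truth in V_zeta. *)
Fixpoint rl (f : form) : form :=
  match f with
  | Mem x y => Mem (S x) (S y)
  | Eq x y => Eq (S x) (S y)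
  | Neg f => Neg (rl f)
  | And f g => And (rl f) (rl g)
  | Or f g => Or (rl f) (rl g)
  | Imp f g => Imp (rl f) (rl g)
  | All x f => All (S x) (Imp (Mem (S x) 0) (rl f))
  | Ex x f => Ex (S x) (And (Mem (S x) 0) (rl f))
  end.

Lemma delta0_rl f : delta0 (rl f).
Proof. induction f; simpl; constructor; auto. Qed.

Definition scons {T : Type} (d : T) (v : nat -> T) (i : nat) : T :=
  match i with 0 => d | S i => v i end.

Lemma upd_scons {T : Type} (d : T) v x a :
  upd (scons d v) (S x) a = scons d (upd v x a).
Proof. apply functional_extensionality. intros [|i]; reflexivity. Qed.

Lemma sat_rl {M : structure} (d : M) f : forall v,
  sat (fun x => x ∈ d) v f <-> sat (@whole M) (scons d v) (rl f).
Proof.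
  induction f; intro v; simpl; try reflexivity.
  - now rewrite IHf.
  - now rewrite IHf1, IHf2.
  - now rewrite IHf1, IHf2.
  - now rewrite IHf1, IHf2.
  - split.
    + intros H a _ Ha. rewrite upd_scons in *. apply IHf, H.
      simpl in Ha. now rewrite upd_same in Ha.
    + intros H a Ha. apply IHf. rewrite <- upd_scons. apply H; [exact I |].
      rewrite upd_scons. simpl. now rewrite upd_same.
  - split.
    + intros (a & Ha & H). exists a. split; [exact I |]. rewrite upd_scons.
      split; [| now apply IHf]. simpl. now rewrite upd_same.
    + intros (a & _ & Ha & H). rewrite upd_scons in *. exists a.
      split; [| now apply IHf]. simpl in Ha. now rewrite upd_same in Ha.
Qed.

Section Codes.
Context {M : structure} {HM : ZF M}.
Variables (k z : M).
Implicit Types x y a b f g p q : M.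
Local Notation D := (Vs z).

(** The tuple named by [f] with the structure [D] itself put in front; this is why the indices of
    the entries are shifted by one. *)
Definition cz pi f : M :=
  add (img f (fun q => pr (osucc (fstp q)) (app pi (sndp q)))) (pr emp D).

Definition code pi : M := sep (Vs k) (fun q => exists f n m,
  m ∈ omega /\ n ∈ omega /\ isfun f /\ dom f = n /\
  q = pr f (pr n (pr m (tb m (cz pi f))))).

(** A system of names: (0, x) denotes x, (1, emp) denotes [k], and the last clause is the
    Tarski-Vaught criterion, phrased through equality of types. *)
Definition coding pi : Prop :=
  isfun pi /\ dom pi = Vs k /\
  (forall x, x ∈ Vs k -> app pi x ∈ D) /\
  (forall x, x ∈ Vs k -> app pi (pr (num 0) x) = x) /\
  app pi (pr (num 1) emp) = k /\
  (forall f, f ∈ Vs k -> isfun f -> dom f ∈ omega ->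
     forall i m y, i ∈ osucc (dom f) -> m ∈ omega -> y ∈ D ->
     exists x, x ∈ Vs k /\
       tb m (updt (cz pi f) i y) = tb m (updt (cz pi f) i (app pi x))).

Definition coded A : Prop := exists pi, coding pi /\ A = code pi.

Lemma dfn_coded {Par : M -> Prop} {E : Type} {HE : Env M E} (s : E -> M) :
  Par k -> Par z -> FW Par s -> DW Par (fun e => coded (s e)).
Proof. intros. unfold coded, coding, code, cz. dfn. Qed.

Lemma cz_tup pi n xs :
  cz pi (tup n xs) = tup (S n) (scons D (fun i => app pi (xs i))).
Proof.
  apply zf_ext. intro p. unfold cz. rewrite mem_add, mem_img by cls.
  rewrite mem_tup. split.
  - intros [(q & Hq & ->) | ->].
    + apply mem_tup in Hq as (i & Hi & ->). exists (S i).
      rewrite fstp_pr, sndp_pr. split; [lia | reflexivity].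
    + exists 0. split; [lia | reflexivity].
  - intros ([|i] & Hi & ->); [right; reflexivity |]. left.
    exists (pr (num i) (xs i)). rewrite fstp_pr, sndp_pr.
    split; [apply pr_tup; split; [lia | auto] | reflexivity].
Qed.

Hypotheses (Lk : limit_ordinal k) (Hok : omega ∈ k) (Lz : limit_ordinal z)
  (Hkz : k ∈ z).
Let Ok : ordinal k := proj1 Lk.
Let Oz : ordinal z := proj1 Lz.

Lemma kD x : x ∈ Vs k -> x ∈ D.
Proof. apply Vs_mono. intros y Hy. exact (ord_trans Oz Hy Hkz). Qed.

Lemma numk n : num n ∈ Vs k.
Proof. apply num_Vs; auto. Qed.

Section Existence.
Hypothesis (MWO : WO (M := M)).
Variables (o h : M).
Hypotheses (Oo : ordinal o) (Hh : surj h o D).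

(** The name (2, (f, (i, (m, r)))) denotes the first element of [D] that gives the tuple named by
    [f] the type [r] of depth [m] when put in place [i]. *)
Definition wit g f i m r : M :=
  least h o (sep D (fun y => tb m (updt (cz g f) i y) = r)).
Definition isval g x y : Prop :=
  x = pr (num 0) y \/ (x = pr (num 1) emp /\ y = k) \/
  (exists f i m r, x = pr (num 2) (pr f (pr i (pr m r))) /\ y = wit g f i m r).
Definition pst x g : M := bigU (sep D (isval g x)).
Definition pirec x : M := rec (fun x => Vs (rk x)) pst x.

Lemma Cls_isval g x : Cls (isval g x).
Proof. unfold isval, wit, cz. cls. Qed.

Lemma isval_unique g x y y' : isval g x y -> isval g x y' -> y' = y.
Proof.
  assert (N01 : num (M := M) 0 <> num 1) by (intro E; apply num_inj in E; lia).
  assert (N02 : num (M := M) 0 <> num 2) by (intro E; apply num_inj in E; lia).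
  assert (N12 : num (M := M) 1 <> num 2) by (intro E; apply num_inj in E; lia).
  intros [E | [[E ->] | (f & i & m & r & E & ->)]]
    [E' | [[E' ->] | (f' & i' & m' & r' & E' & ->)]]; rewrite E in E';
    apply pr_inj in E' as [E1 E2]; try congruence.
  apply pr_inj in E2 as [-> E2]. apply pr_inj in E2 as [-> E2].
  now apply pr_inj in E2 as [-> ->].
Qed.

Lemma pst_val g x y : y ∈ D -> isval g x y -> pst x g = y.
Proof.
  intros Hy Hv. apply bigU_sep_unique; auto; [apply Cls_isval |].
  intros y' Hy'. exact (isval_unique Hv Hy').
Qed.

Lemma emp_D : emp ∈ D.
Proof. apply kD, (numk 0). Qed.

Lemma pst_D g x : pst x g ∈ D.
Proof.
  destruct (classic (exists y, y ∈ D /\ isval g x y)) as [(y & Hy & Hv) | H].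
  - now rewrite (pst_val Hy Hv).
  - replace (pst x g) with (emp (M := M)); [apply emp_D |].
    apply zf_ext. intro w. split; [intro Hw; destruct (mem_emp Hw) |].
    intro Hw. apply mem_bigU in Hw as (y & Hy & _).
    apply mem_sep in Hy as [Hy Hv]; [| apply Cls_isval]. destruct H. eauto.
Qed.

Lemma pi_prd : Fun1 (fun x : M => Vs (rk x)).
Proof. cls. Qed.

Lemma Fun2_pst : Fun2 pst.
Proof. unfold pst, isval, wit, cz. cls. Qed.

Lemma pi_wf : well_founded (fun w x : M => w ∈ Vs (rk x)).
Proof.
  assert (K : forall a x, rk x = a -> Acc (fun w x : M => w ∈ Vs (rk x)) x).
  { intro a. induction a as [a IH] using (well_founded_ind zf_wf).
    intros x <-. constructor. intros w Hw. apply mem_Vs_rk in Hw; [| apply ord_rk].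
    exact (IH _ Hw w eq_refl). }
  intro x. exact (K _ x eq_refl).
Qed.

Lemma Fun1_pirec : Fun1 pirec.
Proof. exact (Fun1_rec pi_prd Fun2_pst pi_wf). Qed.

Lemma pirec_eq x : pirec x = pst x (lam (Vs (rk x)) pirec).
Proof. exact (rec_eq pi_prd Fun2_pst pi_wf x). Qed.

Definition pi0 : M := lam (Vs k) pirec.

Lemma app_pi0 x : x ∈ Vs k -> app pi0 x = pirec x.
Proof. apply app_lam, Fun1_pirec. Qed.

Lemma rk_pr_l a b : rk a ∈ rk (pr a b).
Proof.
  apply (ord_trans (b := rk (upair a a)) (ord_rk _)); apply mem_rk_mem; apply mem_upair; auto.
Qed.

Lemma rk_pr_r a b : rk b ∈ rk (pr a b).
Proof.
  apply (ord_trans (b := rk (upair a b)) (ord_rk _)); apply mem_rk_mem; apply mem_upair; auto.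
Qed.

Lemma coding_exists : exists pi, coding pi.
Proof.
  exists pi0. assert (HF := Fun1_pirec).
  split; [apply isfun_lam; auto |]. split; [apply dom_lam; auto |].
  assert (Hp : forall m x, x ∈ Vs k -> pr (num m) x ∈ Vs k).
  { intros m x Hx. apply Vs_pr; auto. apply numk. }
  split; [| split; [| split]].
  - intros x Hx. rewrite app_pi0, pirec_eq by auto. apply pst_D.
  - intros x Hx. rewrite app_pi0, pirec_eq by auto.
    apply pst_val; [now apply kD | left; auto].
  - rewrite app_pi0, pirec_eq by (apply Hp, (numk 0)).
    apply pst_val; [| right; left; auto]. apply ord_Vs; auto.
  - intros f Hf If Df i m y Hi Hm Hy.
    set (r := tb m (updt (cz pi0 f) i y)).
    assert (exists n, dom f = num n) as [n Hn] by (now apply mem_omega).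
    apply mem_omega in Hm as [m' ->]. rewrite Hn in Hi.
    apply (mem_num (S n)) in Hi as (i' & Hi & ->).
    (* The type has to lie in [Vs k] in order to be part of a name; it does because types are
       small. *)
    assert (Hr : r ∈ Vs k).
    { unfold r. rewrite (tup_of If Hn), cz_tup, updt_tup by auto. now apply tb_Vs. }
    set (x := pr (num 2) (pr f (pr (num i') (pr (num m') r)))).
    assert (Hx : x ∈ Vs k).
    { unfold x. repeat apply Vs_pr; auto using numk. }
    exists x. split; auto. rewrite (app_pi0 Hx), pirec_eq.
    (* The entries of [f] have smaller rank than the name [x], so the recursion already has their
       values. *)
    assert (Ecz : cz (lam (Vs (rk x)) pirec) f = cz pi0 f).
    { unfold cz. f_equal. apply img_ext. intros q Hq. f_equal.
      destruct (proj1 If q Hq) as (a & b & ->). rewrite sndp_pr.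
      assert (Hb : b ∈ Vs k).
      { apply (Vs_trans Ok Hf) in Hq. now apply (Vs_pr_inv Ok) in Hq. }
      rewrite app_pi0, app_lam; auto. apply mem_Vs_rk; [apply ord_rk |].
      apply (ord_trans (ord_rk x) (rk_pr_r a b)).
      apply (ord_trans (ord_rk x) (mem_rk_mem Hq)). unfold x.
      exact (ord_trans (ord_rk _) (rk_pr_l _ _) (rk_pr_r _ _)). }
    assert (CS : Cls (fun y => tb (num m') (updt (cz pi0 f) (num i') y) = r)).
    { unfold cz. cls. }
    assert (HW : wit (lam (Vs (rk x)) pirec) f (num i') (num m') r ∈
      sep D (fun y => tb (num m') (updt (cz pi0 f) (num i') y) = r)).
    { unfold wit. rewrite Ecz. apply (least_mem Oo Hh).
      - intros w Hw. apply mem_sep in Hw; tauto.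
      - exists y. apply mem_sep; auto. }
    apply mem_sep in HW as [HW1 HW2]; auto.
    rewrite (pst_val (y := wit (lam (Vs (rk x)) pirec) f (num i') (num m') r)); auto.
    right; right. exists f, (num i'), (num m'), r. auto.
Qed.

End Existence.

Section Submodel.
Variable (pi : M).
Hypothesis (HP : coding pi).

Lemma coding_D x : x ∈ Vs k -> app pi x ∈ D.
Proof. apply HP. Qed.

Definition hull : M := img (Vs k) (app pi).

Lemma mem_hull y : y ∈ hull <-> exists x, x ∈ Vs k /\ y = app pi x.
Proof. apply mem_img. cls. Qed.

Lemma hull_choice (v : nat -> M) : (forall i, v i ∈ hull) ->
  exists xs : nat -> M, forall i, xs i ∈ Vs k /\ v i = app pi (xs i).
Proof.
  intro H. exists (fun i => proj1_sig (constructive_indefinite_description _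
    (proj1 (mem_hull (v i)) (H i)))).
  intro i. now destruct (constructive_indefinite_description _ _).
Qed.

Lemma ft_sat (f : form) n (v w : nat -> M) : mv (rl f) <= S n ->
  tb (num (dp (rl f))) (tup (S n) (scons D v)) =
  tb (num (dp (rl f))) (tup (S n) (scons D w)) ->
  (sat (fun x => x ∈ D) v f <-> sat (fun x => x ∈ D) w f).
Proof.
  intros Hn H. rewrite !sat_rl.
  exact (tb_sat (delta0_rl f) Hn (le_n _) H).
Qed.

Lemma hull_witness (f : form) (x : nat) (v : nat -> M) a : (forall i, v i ∈ hull) -> a ∈ D ->
  sat (fun x => x ∈ D) (upd v x a) f ->
  exists a', a' ∈ hull /\ sat (fun x => x ∈ D) (upd v x a') f.
Proof.
  intros Hv Ha Hs. destruct (hull_choice Hv) as [xs Hxs].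
  pose (n := mv (rl f) + S x).
  assert (Hf : tup n xs ∈ Vs k).
  { apply tup_Vs; auto. intros i _. apply Hxs. }
  destruct HP as (_ & _ & _ & _ & _ & H).
  destruct (H _ Hf (isfun_tup n xs)) with (i := num (M := M) (S x))
    (m := num (M := M) (dp (rl f))) (y := a) as (x' & Hx' & E); auto.
  - rewrite dom_tup. apply num_omega.
  - rewrite dom_tup. apply (mem_num (S n)). exists (S x). split; auto. unfold n; lia.
  - apply num_omega.
  - exists (app pi x'). split; [apply mem_hull; eauto |].
    rewrite cz_tup, !updt_tup, !upd_scons in E by (unfold n; lia).
    assert (Ev : (fun i => app pi (xs i)) = v).
    { apply functional_extensionality. intro i. symmetry. apply Hxs. }
    rewrite Ev in E. apply (ft_sat (n := n)) in E; [| unfold n; lia].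
    now apply E.
Qed.

Lemma hull_D y : y ∈ hull -> y ∈ D.
Proof. intro H. apply mem_hull in H as (x & Hx & ->). now apply coding_D. Qed.

Lemma upd_in (P : M -> Prop) v (x : nat) a : (forall i, P (v i)) -> P a ->
  forall i : nat, P (upd v x a i).
Proof. intros Hv Ha i. unfold upd. destruct (Nat.eqb i x); auto. Qed.

(** The Tarski-Vaught test: [hull_witness] replaces a witness from [D] by one in the hull that has
    the same type together with the parameters. *)
Lemma hull_sat (f : form) : forall v, (forall i, v i ∈ hull) ->
  (sat (fun x => x ∈ hull) v f <-> sat (fun x => x ∈ D) v f).
Proof.
  induction f; intros v Hv; simpl; try reflexivity.
  - now rewrite IHf.
  - now rewrite IHf1, IHf2.
  - now rewrite IHf1, IHf2.
  - now rewrite IHf1, IHf2.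
  - split.
    + intros H a Ha. apply NNPP. intro N.
      destruct (@hull_witness (Neg f) x v a Hv Ha N) as (a' & Ha' & N').
      apply N'. apply IHf; [| now apply H].
      now apply (upd_in (P := fun y => y ∈ hull)).
    + intros H a Ha. apply IHf; [| apply H; now apply hull_D].
      now apply (upd_in (P := fun y => y ∈ hull)).
  - split.
    + intros (a & Ha & H). exists a. split; [now apply hull_D |].
      apply IHf; auto. now apply (upd_in (P := fun y => y ∈ hull)).
    + intros (a & Ha & H).
      destruct (hull_witness Hv Ha H) as (a' & Ha' & H'). exists a'. split; auto.
      apply IHf; auto. now apply (upd_in (P := fun y => y ∈ hull)).
Qed.

End Submodel.

Lemma in_V_D : in_V z = (fun x => x ∈ D).
Proof.
  apply functional_extensionality. intro x. apply propositional_extensionality.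
  apply in_V_iff.
Qed.

Section Embedding.
Variables (pi pi2 e : M).
Hypotheses (HP : coding pi) (HP2 : coding pi2).
Hypothesis (He : forall x, x ∈ Vs k -> app e x ∈ Vs k).
Hypothesis (Het : forall n m (xs : nat -> M), (forall i, xs i ∈ Vs k) ->
  tb (num m) (tup (S n) (scons D (fun i => app pi (xs i)))) =
  tb (num m) (tup (S n) (scons D (fun i => app pi2 (app e (xs i)))))).

Definition emb : M := img (Vs k) (fun x => pr (app pi x) (app pi2 (app e x))).

Lemma pr_emb x y : pr x y ∈ emb <->
  exists w, w ∈ Vs k /\ x = app pi w /\ y = app pi2 (app e w).
Proof.
  unfold emb. rewrite mem_img by cls. split.
  - intros (w & Hw & E). apply pr_inj in E as [-> ->]. eauto.
  - intros (w & Hw & -> & ->). eauto.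
Qed.

Lemma emb_elementary : elementary_embedding emb (fun x => x ∈ hull pi) (in_V z).
Proof.
  rewrite in_V_D. split; [split |].
  - intros p Hp. unfold emb in Hp. apply mem_img in Hp as (w & Hw & ->); [| cls].
    exists (app pi w), (app pi2 (app e w)). split; [now apply is_pairE |].
    split; [apply mem_hull; eauto |]. apply (coding_D HP2). auto.
  - intros x Hx. apply mem_hull in Hx as (w & Hw & ->).
    exists (app pi2 (app e w)). split; [apply pair_inE, pr_emb; eauto |].
    intros y Hy. apply pair_inE, pr_emb in Hy as (w' & Hw' & E & ->).
    (* The map is well defined because the equality of two entries is part of the type of the pair
       of their names. *)
    assert (K := @Het 2 0 (fun i => match i with 0 => w | _ => w' end)).
    assert (K' := tb_atom (K ltac:(intros [|i]; auto)) (i := 1) (j := 2)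
      ltac:(lia) ltac:(lia)). simpl in K'. now apply K'.
  - intros f _ v w Hv Hw Hr.
    assert (exists xs : nat -> M, forall i, xs i ∈ Vs k /\ v i = app pi (xs i) /\
      w i = app pi2 (app e (xs i))) as [xs Hxs].
    { assert (H : forall i, exists x, x ∈ Vs k /\ v i = app pi x /\
        w i = app pi2 (app e x)).
      { intro i. apply pr_emb, pair_inE, Hr. }
      exists (fun i => proj1_sig (constructive_indefinite_description _ (H i))).
      intro i. now destruct (constructive_indefinite_description _ _). }
    rewrite (hull_sat HP) by auto.
    assert (K := @Het (mv (rl f)) (dp (rl f)) xs (fun i => proj1 (Hxs i))).
    replace (fun i => app pi (xs i)) with v in K
      by (apply functional_extensionality; intro; apply Hxs).
    replace (fun i => app pi2 (app e (xs i))) with w in K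
      by (apply functional_extensionality; intro; apply Hxs).
    apply (ft_sat (n := mv (rl f))); [lia | exact K].
Qed.

(** The definition is met with m = 1 and the one ordinal [z] as both eta and zeta, since [z] is in
    C^(1) and in C^(2). The submodel is the hull of [pi], embedded by sending the object named by x
    in [pi] to the one named by e(x) in [pi2]. *)
Theorem exacting_of_codes : limit_cardinal k -> WO (M := M) ->
  refl_at (Ra k) z z -> refl_at Rb z z ->
  app e (pr (num 1) emp) = pr (num 1) emp ->
  (exists a b, a ∈ k /\ b ∈ Vs k /\ app e (pr (num 0) a) = pr (num 0) b /\ b <> a) ->
  exacting k.
Proof.
  intros LC MWO HRa HRb H1 (a & b & Ha & Hb & Hab & Nab).
  assert (Vp : forall m x, x ∈ Vs k -> pr (num m) x ∈ Vs k).
  { intros m x Hx. apply Vs_pr; auto. apply numk. }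
  assert (P0 : forall x, x ∈ Vs k -> app pi (pr (num 0) x) = x) by apply HP.
  assert (P0' : forall x, x ∈ Vs k -> app pi2 (pr (num 0) x) = x) by apply HP2.
  assert (P1 : app pi (pr (num 1) emp) = k) by apply HP.
  assert (P1' : app pi2 (pr (num 1) emp) = k) by apply HP2.
  assert (Ez : emp ∈ Vs k) by apply (numk 0).
  assert (HaV : a ∈ Vs k) by (apply ord_Vs; auto; exact (ord_mem Ok Ha)).
  assert (Cz := refl_cardinal Lz HRb MWO).
  split; auto. exists 1, z, (hull pi), z, emb. split; [lia |]. split; auto.
  split; [exact (refl_C1 Lk Hok Lz Hkz HRa) |]. split; auto. split.
  { rewrite in_V_D. split; [apply hull_D; auto |].
    intros f _ v w Hv Hw Hvw.
    replace w with v by (apply functional_extensionality; auto).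
    now apply hull_sat. }
  split.
  { intros x Hx. apply in_V_iff in Hx. apply mem_hull.
    exists (pr (num 0) x). split; auto. now rewrite P0. }
  split; [apply mem_hull; exists (pr (num 1) emp); auto |].
  split; auto. split; [exact (refl_C2 Lk Hok Lz Hkz HRa) |]. split; auto.
  split; [apply emb_elementary |]. split.
  - apply pair_inE, pr_emb. exists (pr (num 1) emp). rewrite H1, P1, P1'. auto.
  - exists a, b. split; auto. split; auto. apply pair_inE, pr_emb.
    exists (pr (num 0) a). rewrite Hab, P0, P0'; auto.
Qed.

End Embedding.
End Codes.

(** * Strong limits are limit cardinals *)

Section StrongLimit.
Context {M : structure} {HM : ZF M}.
Implicit Types x y z a b c f g h o p q : M.

Lemma surj_comp h h' a b c : surj h a b -> surj h' b c -> exists g, surj g a c.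
Proof.
  intros [I1 H1] [I2 H2].
  set (g := sep (prod a c) (fun p => exists y, pr (fstp p) y ∈ h /\ pr y (sndp p) ∈ h')).
  assert (Mg : forall x z, pr x z ∈ g <-> (x ∈ a /\ z ∈ c) /\
    exists y, pr x y ∈ h /\ pr y z ∈ h').
  { intros x z. unfold g. rewrite mem_sep by cls.
    now rewrite pr_prod, fstp_pr, sndp_pr. }
  exists g. split; [split |].
  - intros p Hp. unfold g in Hp. apply mem_sep in Hp as [Hp _]; [| cls].
    apply mem_prod in Hp as (x & z & _ & _ & ->). eauto.
  - intros x z z' Hz Hz'. apply Mg in Hz as (_ & y & Hy & Hz).
    apply Mg in Hz' as (_ & y' & Hy' & Hz').
    rewrite (proj2 I1 _ _ _ Hy Hy') in Hz. exact (proj2 I2 _ _ _ Hz Hz').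
  - intros z Hz. destruct (H2 z Hz) as (y & Hy & Hyz).
    destruct (H1 y Hy) as (x & Hx & Hxy). exists x. split; auto. apply Mg. eauto.
Qed.

(** The cardinal above [a] is the least ordinal [b] that is not an image of [a]. It is below [k]
    because some [o] below [k] maps onto the power set of [a], and so is not an image of [a]
    itself. *)
Lemma strong_limit_cardinal k : limit_ordinal k ->
  (forall a, a ∈ k -> exists o h, o ∈ k /\ surj h o (pow a)) -> limit_cardinal k.
Proof.
  intros (Ok & Nk & Lk) H. split; [| split; auto].
  - split; auto. intros a Ha [f Hf]. destruct (H a Ha) as (o & h & Ho & Hh).
    apply (no_bijection_power Hf (a := o) (h := h)); auto.
    intros x Hx. exact (ord_trans Ok Hx Ho).
  - intros a Ha. destruct (H a Ha) as (o & h & Ho & Hh).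
    assert (Oa := ord_mem Ok Ha).
    destruct (@ord_least M HM (fun b => ~ exists g, surj g a b) o)
      as (b & Ob & Nb & Mb); [exact (ord_mem Ok Ho) | |].
    { intros [g Hg]. destruct (surj_comp Hg Hh) as [g' Hg']. exact (cantor Hg'). }
    assert (Hid : forall c, subset c a -> exists g, surj g a c).
    { intros c Hc. exists (lam a (fun x => x)). split; [apply isfun_lam; cls |].
      intros y Hy. exists y. split; auto. apply pr_lam; [cls | auto]. }
    exists b. split; [| split].
    + destruct (ord_total Ob (ord_mem Ok Ho)) as [L | [-> | L]]; auto.
      * exact (ord_trans Ok L Ho).
      * exfalso. apply (Mb o L). intros [g Hg].
        destruct (surj_comp Hg Hh) as [g' Hg']. exact (cantor Hg').
    + destruct (ord_total Oa Ob) as [L | [-> | L]]; auto; destruct Nb; apply Hid.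
      * apply subset_refl.
      * intros x Hx. exact (ord_trans Oa Hx L).
    + split; auto. intros c Hc [f Hf]. apply (Mb c Hc). intros [g Hg].
      assert (Hs : surj f c b).
      { split; [exact (is_bijection_fun Hf) |]. intros y Hy.
        destruct Hf as [[Hf1 _] Hf2]. destruct (Hf2 y Hy) as (x & Hx & _).
        destruct Hx as (p & Hp & Hpf). destruct (Hf1 p Hpf) as (x' & y' & Hp' & Hx' & _).
        apply is_pairE in Hp, Hp'. subst p. apply pr_inj in Hp' as [-> ->]. eauto. }
      apply Nb. exact (surj_comp Hg Hs).
Qed.

End StrongLimit.

(** * Absoluteness of check values *)

Section Checks.
Context {V : structure} {HV : ZF V} (P : V) (le : V -> V -> Prop).
Variables (G : V -> Prop) (N : structure) (val : V -> N).
Hypothesis HG : generic (fun p => p ∈ P) le G.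
Hypothesis HN : generic_extension G val.
Context {ZN : ZF N}.
Local Notation ck := (ck P val).
Implicit Types x y z a b : V.

Lemma ck_osucc x : ck (osucc x) = osucc (ck x).
Proof.
  apply zf_ext. intro w. rewrite (mem_ck HG HN), mem_osucc, (mem_ck HG HN). split.
  - intros (y & Hy & ->). apply mem_osucc in Hy as [Hy | ->]; eauto.
  - intros [(y & Hy & ->) | ->]; eexists; (split; [apply mem_osucc | reflexivity]); auto.
Qed.

Lemma ck_num n : ck (num n) = num n.
Proof.
  induction n; simpl; [apply (ck_emp HG HN) |]. now rewrite ck_osucc, IHn.
Qed.

Lemma ck_omega : ck omega = omega.
Proof.
  apply zf_ext. intro w. rewrite (mem_ck HG HN), mem_omega. split.
  - intros (y & Hy & ->). apply mem_omega in Hy as [n ->]. exists n. apply ck_num.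
  - intros [n ->]. exists (num n). split; [apply num_omega | now rewrite ck_num].
Qed.

Lemma ck_limit a : limit_ordinal a -> limit_ordinal (ck a).
Proof.
  intros (Oa & (b & Hb) & H). split; [now apply (ck_ordinal HG HN) |]. split.
  - exists (ck b). now apply (ck_mem HG HN).
  - intros w Hw. apply (mem_ck HG HN) in Hw as (y & Hy & ->).
    destruct (H y Hy) as (c & Hc & Hyc). exists (ck c).
    split; now apply (ck_mem HG HN).
Qed.

Lemma ck_isfun f : isfun f -> isfun (ck f).
Proof.
  intros [H1 H2].
  assert (K : forall w, w ∈ ck f -> exists x y, pr x y ∈ f /\ w = pr (ck x) (ck y)).
  { intros w Hw. apply (mem_ck HG HN) in Hw as (p & Hp & ->).
    destruct (H1 p Hp) as (x & y & ->). rewrite (ck_pr HG HN). eauto. }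
  split.
  - intros w Hw. destruct (K w Hw) as (x & y & _ & ->). eauto.
  - intros x y y' Hy Hy'. destruct (K _ Hy) as (a & b & Hab & E).
    destruct (K _ Hy') as (a' & b' & Hab' & E').
    apply pr_inj in E as [-> ->]. apply pr_inj in E' as [E ->].
    apply (ck_inj HG HN) in E. subst a'. now rewrite (H2 _ _ _ Hab Hab').
Qed.

Lemma ck_tup n (v : nat -> V) : ck (tup n v) = tup n (fun i => ck (v i)).
Proof.
  apply zf_ext. intro w. rewrite (mem_ck HG HN), mem_tup. split.
  - intros (p & Hp & ->). apply mem_tup in Hp as (i & Hi & ->). exists i.
    split; auto. now rewrite (ck_pr HG HN), ck_num.
  - intros (i & Hi & ->). exists (pr (num i) (v i)).
    rewrite (ck_pr HG HN), ck_num. split; auto. now apply pr_tup.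
Qed.

(** A definition with parameters from the ground model is a formula with check
    names, and so is forced when it holds. *)
Lemma dfn_names (Q : N -> Prop) (sg : V) :
  DW (fun a : N => exists y, a = ck y) (fun e : unit * N => Q (snd e)) ->
  exists f nv, forall val' : V -> N, (forall y, val' (chk P y) = ck y) ->
    (Q (val' sg) <-> sat (@whole N) (fun n => val' (nv n)) f).
Proof.
  intros (f & l & Hl & H).
  assert (exists ys, l = map ck ys) as [ys ->].
  { clear H. induction l as [|a l IH]; [exists nil; reflexivity |].
    apply Forall_cons_iff in Hl as [[[y ->] _] Hl]. destruct (IH Hl) as [ys ->].
    exists (y :: ys). reflexivity. }
  exists f, (fun n => if Nat.odd n then chk P (nth (Nat.div2 n) ys emp) else sg).
  intros val' Hv. apply (H (tt, val' sg)); [apply envD_all; intro; exact I | intro; exact I | |].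
  - split; [exact I |]. reflexivity.
  - intros i a Ha. rewrite nth_error_map in Ha.
    destruct (nth_error ys i) as [y |] eqn:E; [| discriminate]. simpl in Ha.
    injection Ha as <-.
    assert (O : Nat.odd (2 * i + 1) = true) by (apply Nat.odd_spec; exists i; lia).
    rewrite O. replace (Nat.div2 (2 * i + 1)) with i
      by (rewrite Nat.add_1_r; symmetry; apply Nat.div2_succ_double).
    rewrite (nth_error_nth _ _ emp E). apply Hv.
Qed.

End Checks.

(** * Branches through the tree of approximations *)

Section Branch.
Context {V : structure} {HV : ZF V} (k U la : V).
Hypothesis (NU : normal_uf k U).
Hypothesis (VWO : WO (M := V)).
Hypotheses (Ll : limit_ordinal la) (Hkl : k ∈ la).
Hypothesis (KL : forall F : V, isfun F ->
  (forall p, p ∈ F -> exists t u, p = pr t u /\ t ∈ Vs k /\ subset u (Vs k)) ->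
  (forall t, t ∈ Vs k -> exists u, pr t u ∈ F) ->
  exists W, subset W (Vs k) /\ pr emp emp ∈ W /\
    forall x, x ∈ W -> exists B, B ∈ U /\
      forall g, g ∈ B -> exists y, y ∈ W /\ SUC la F emp x g y).
Variable (sg : V).
Implicit Types p q r s t u x y z A B C g h : V.
Local Notation Lk := (nu_lim NU).
Local Notation Ok := (proj1 (nu_lim NU)).
Local Notation PP := (PP k U).
Local Notation le := (prikry_le k).
Local Notation Hle := (po_rel (PP_poset NU)).

(** Conditions with the same stem are compatible, so the decisions made at a stem are consistent.
    For sets below the next point they are complete, by [decide_diag], once the measure one sets lie
    in the set provided there. *)
Definition forced t x : Prop := exists B, fmem PP le (pr t B) (chk PP x) sg.
Definition Fs s : V :=
  lam (Vs k) (fun t => sep (Vs k) (fun x => forced (cup s t) x)).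

Lemma dfn_forced {E : Type} {HE : Env V E} (a b : E -> V) :
  FW (@whole V) a -> FW (@whole V) b -> DW (@whole V) (fun e => forced (a e) (b e)).
Proof.
  intros Ha Hb. unfold forced. apply dfn_ex. apply (dfn_fmem PP Hle); [df | | df].
  pose proof (Fun1_chk PP). df.
Qed.

Lemma Rel2_forced : Rel2 forced.
Proof. unfold Rel2. apply dfn_forced; df. Qed.

Lemma df_Fs {E : Type} {HE : Env V E} (a : E -> V) :
  FW (@whole V) a -> FW (@whole V) (fun e => Fs (a e)).
Proof. intro. pose proof Rel2_forced. unfold Fs. df. Qed.

Lemma pr_Fs s t u : pr t u ∈ Fs s <->
  t ∈ Vs k /\ u = sep (Vs k) (fun x => forced (cup s t) x).
Proof. pose proof Rel2_forced. unfold Fs.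
  apply (@pr_lam V HV (Vs k) (fun t => sep (Vs k) (fun x => forced (cup s t) x)) t u).
  cls.
Qed.

Lemma mem_Fs s t x : t ∈ Vs k -> x ∈ Vs k ->
  (x ∈ app (Fs s) t <-> forced (cup s t) x).
Proof.
  intros Ht Hx. pose proof Rel2_forced. unfold Fs. rewrite app_lam by (auto; cls).
  rewrite mem_sep by cls. tauto.
Qed.

(** [h] chooses a successor for each node and point uniformly, and the points of [B] are closed
    under [h]. So a node reached by way of earlier points always lies below the next point, where
    [h] can be applied again. *)
Definition good_set s B : Prop := exists W h, subset W (Vs k) /\ pr emp emp ∈ W /\
  forall g, g ∈ B ->
    (forall x, x ∈ W -> x ∈ Vs g ->
       app h (pr g x) ∈ W /\ SUC la (Fs s) emp x g (app h (pr g x))) /\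
    (forall q, q ∈ Vs g -> app h q ∈ W -> app h q ∈ Vs g) /\
    (subset s g /\ s ∈ Vs g) /\ omega ∈ g /\ limit_ordinal g.

Lemma dfn_good {E : Type} {HE : Env V E} (a b : E -> V) :
  FW (@whole V) a -> FW (@whole V) b -> DW (@whole V) (fun e => good_set (a e) (b e)).
Proof.
  intros Ha Hb. unfold good_set, limit_ordinal.
  apply dfn_ex, dfn_ex, dfn_and; [dfn |]. apply dfn_and; [dfn |].
  apply dfn_all, dfn_imp; [dfn |]. apply dfn_and; [| dfn].
  apply dfn_all, dfn_imp; [dfn |]. apply dfn_imp; [dfn |].
  apply dfn_and; [dfn |]. apply dfn_SUC; try df. apply df_Fs. df.
Qed.

Lemma good_dense s B0 : pr s B0 ∈ PP -> exists B, B ∈ U /\ subset B B0 /\ good_set s B.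
Proof.
  intro Hs. apply (pr_PP) in Hs as [[Hsk Hsf] HB0].
  pose proof Rel2_forced as RF.
  destruct (KL (F := Fs s)) as (W & HW & HW0 & HWs).
  { apply isfun_lam. cls. }
  { intros p Hp. unfold Fs in Hp. apply mem_lam in Hp as (t & Ht & ->); [| cls].
    do 2 eexists. split; [reflexivity |]. split; auto.
    intros x Hx. apply mem_sep in Hx; [tauto | cls]. }
  { intros t Ht. eexists. apply pr_Fs. eauto. }
  destruct (VWO (Vs k)) as (o & w & Oo & Hw).
  assert (DS : forall q, Cls (fun y => SUC la (Fs s) emp (sndp q) (fstp q) y)).
  { intro q. unfold Cls. apply dfn_SUC; try df. }
  assert (FL : Fun1 (fun q => least w o (sep W
    (fun y => SUC la (Fs s) emp (sndp q) (fstp q) y)))).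
  { unfold Fun1. apply df_least; [df | df |]. apply df_sep; [df |].
    apply dfn_SUC; try df. }
  set (h := lam (prod k (Vs k)) (fun q => least w o (sep W
    (fun y => SUC la (Fs s) emp (sndp q) (fstp q) y)))).
  assert (exists RR : V -> V -> Prop, Rel2 RR /\ forall x g, RR x g <-> (x ∈ W ->
    app h (pr g x) ∈ W /\ SUC la (Fs s) emp x g (app h (pr g x))))
    as (RR & CC & HRR).
  { exists (fun x g => x ∈ W ->
      app h (pr g x) ∈ W /\ SUC la (Fs s) emp x g (app h (pr g x))).
    split; [| intros; reflexivity].
    unfold Rel2. apply dfn_imp; [dfn |]. apply dfn_and; [dfn |].
    apply dfn_SUC; try df. }
  (* First diagonal intersection, over nodes: from every node of [W] below it, the point [g] leads
     to a successor in [W], namely the one chosen by [h]. *)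
  assert (H1 : sep k (fun g => forall x, x ∈ Vs g -> g ∈ sep k (RR x)) ∈ U).
  { apply (nu_diag NU (B := fun x => sep k (RR x))); [cls |].
    intros x Hx. destruct (classic (x ∈ W)) as [Hxw | Nx].
    - destruct (HWs x Hxw) as (B & HB & H). apply (nu_up NU HB).
      + intros g Hg. assert (Hgk := nu_sub NU HB Hg). apply mem_sep; [cls |].
        split; auto. apply HRR. intros _.
        assert (Eh : app h (pr g x) = least w o (sep W
          (fun y => SUC la (Fs s) emp x g y))).
        { unfold h. rewrite app_lam; auto; [| now apply pr_prod].
          now rewrite fstp_pr, sndp_pr. }
        assert (DS' := DS (pr g x)). rewrite fstp_pr, sndp_pr in DS'.
        assert (K : app h (pr g x) ∈ sep W (fun y => SUC la (Fs s) emp x g y)).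
        { rewrite Eh. apply (least_mem Oo Hw).
          - intros y Hy. apply mem_sep in Hy as [Hy _]; auto.
          - destruct (H g Hg) as (y & Hy & HS). exists y. apply mem_sep; auto. }
        apply mem_sep in K; auto.
      + intros g Hg. apply mem_sep in Hg; [tauto | cls].
    - apply (nu_up NU (nu_k NU)).
      + intros g Hg. apply mem_sep; [cls |]. rewrite HRR. tauto.
      + intros g Hg. apply mem_sep in Hg; [tauto | cls]. }
  (* Second diagonal intersection, over the arguments of [h]: a value in [W] at an argument below
     [g] is itself below [g]. *)
  assert (H2 : sep k (fun g => forall q, q ∈ Vs g -> g ∈ sep k (fun g =>
    app h q ∈ W -> app h q ∈ Vs g)) ∈ U).
  { apply (nu_diag NU (B := fun q => sep k (fun g => app h q ∈ W -> app h q ∈ Vs g)));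
      [cls |].
    intros q Hq. destruct (classic (app h q ∈ W)) as [Hxw | Nx].
    - assert (Hr : rk (app h q) ∈ k) by (apply mem_Vs_rk; [exact Ok | now apply HW]).
      apply (nu_up NU (nu_tail NU Hr)).
      + intros g Hg. apply mem_sep in Hg as (Hg & Hg1 & _ & Hg2); [| unfold limit_ordinal; cls].
        apply mem_sep; [cls |]. split; auto. intros _.
        apply mem_Vs_rk; auto. apply Hg2.
      + intros g Hg. apply mem_sep in Hg; [tauto | cls].
    - apply (nu_up NU (nu_k NU)).
      + intros g Hg. apply mem_sep; [cls | tauto].
      + intros g Hg. apply mem_sep in Hg; [tauto | cls]. }
  destruct (nu_above NU Hsk Hsf) as (B3 & HB3 & H3).
  destruct (nu_inter NU H1 H2) as (B4 & HB4 & M4).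
  destruct (nu_inter NU HB3 HB4) as (B5 & HB5 & M5).
  destruct (nu_inter NU HB0 HB5) as (B & HB & MB).
  exists B. split; auto. split; [intros x Hx; apply MB in Hx; tauto |].
  exists W, h. split; auto. split; auto. intros g Hg.
  apply MB in Hg as [_ Hg]. apply M5 in Hg as [Hg3 Hg].
  apply M4 in Hg as [Hg1 Hg2].
  apply mem_sep in Hg1 as [_ Hg1]; [| cls]. apply mem_sep in Hg2 as [_ Hg2]; [| cls].
  split; [| split].
  - intros x HxW Hx. specialize (Hg1 x Hx). apply mem_sep in Hg1 as [_ Hg1]; [| cls].
    rewrite HRR in Hg1. auto.
  - intros q Hq. specialize (Hg2 q Hq). apply mem_sep in Hg2; [tauto | cls].
  - now apply H3.
Qed.

(** All sets involved are in [Vs k], hence in V_la, so the quantifiers that [SUC] relativises to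
    V_la become unrestricted ones. *)
Lemma SUC_use s x g y : x ∈ Vs k -> y ∈ Vs k -> g ∈ Vs k -> SUC la (Fs s) emp x g y ->
  exists t e t' e', x = pr t e /\ y = pr t' e' /\ (forall z, z ∈ t' <-> z ∈ t \/ z = g) /\
    subset e e' /\
    (forall x y z, pr x y ∈ e' -> pr x z ∈ e' -> y = z) /\
    (forall b x, ordinal b -> b ∈ t -> x ∈ Vs b -> exists y, pr x y ∈ e') /\
    (forall m, m ∈ t -> (forall b, b ∈ t -> m = b \/ m ∈ b) -> ordinal m ->
      (forall t'' f f' r, (forall z, z ∈ t'' <-> z ∈ t' /\ z <> m) -> pr f f' ∈ e' ->
         r ∈ Vs m -> pr f r ∈ app (Fs s) t -> pr f' r ∈ app (Fs s) t'') /\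
      (forall x y, pr x y ∈ e' -> x ∈ Vs m -> y = x) /\
      (forall y, pr (pr emp m) y ∈ e' -> exists b, b <> m /\ y = pr emp b) /\
      (forall f f' i x x', pr f f' ∈ e' -> i ∈ Vs m -> pr i x ∈ f -> pr x x' ∈ e' ->
         pr i x' ∈ f')).
Proof.
  intros Hx Hy Hgk (t & _ & e & _ & t' & _ & e' & _ & -> & -> & Ht' & Hsub & He & HOK).
  assert (LV : forall x, x ∈ Vs k -> inL la x).
  { intros z Hz. apply (inL_bounded Hkl). intros w Hw. exact (Vs_trans Ok Hz Hw). }
  apply (Vs_pr_inv Ok) in Hx as [Ht _]. apply (Vs_pr_inv Ok) in Hy as [Ht'V He'].
  assert (Le : forall a b, pr a b ∈ e' -> (a ∈ Vs k /\ b ∈ Vs k) /\ inL la a /\ inL la b).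
  { intros a b Hab. apply (Vs_trans Ok He') in Hab. apply (Vs_pr_inv Ok) in Hab.
    split; [tauto | split; apply LV; tauto]. }
  destruct HOK as (_ & O2 & O3 & O4).
  exists t, e, t', e'. split; auto. split; auto. split.
  { intro z. split; intro Hz.
    - apply (Ht' z); auto. apply LV. exact (Vs_trans Ok Ht'V Hz).
    - apply (Ht' z); auto. destruct Hz as [Hz | ->].
      + apply LV. exact (Vs_trans Ok Ht Hz).
      + now apply LV. }
  split; auto. split; [| split].
  - intros a b c Hb Hc. destruct (Le _ _ Hb) as (_ & L1 & L2).
    destruct (Le _ _ Hc) as (_ & _ & L3). eauto.
  - intros b a Ob Hb Ha. destruct (O3 b Hb a) as (c & _ & Hc); eauto.
    + apply LV. apply (Vs_mono (a := b)); auto. apply ord_le_subset; [exact Ok |].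
      left. apply (ord_Vs Ob Ok). exact (Vs_trans Ok Ht Hb).
    + split; auto.
  - intros m Hm Hmin Om. destruct (O4 m Hm Hmin) as (P1 & P2 & P3 & P4).
    assert (HmL : forall r, r ∈ Vs m -> r ∈ Vs k).
    { intro r. apply Vs_mono. apply ord_le_subset; [exact Ok |].
      left. apply (ord_Vs Om Ok). exact (Vs_trans Ok Ht Hm). }
    pose proof Rel2_forced as RF.
    assert (Happ : forall t, t ∈ Vs k -> pr t (app (Fs s) t) ∈ Fs s).
    { intros q Hq. apply app_mem; [apply isfun_lam; cls |].
      unfold Fs. rewrite dom_lam; auto. cls. }
    assert (Lapp : forall t, t ∈ Vs k -> inL la (app (Fs s) t)).
    { intros q Hq. apply (inL_bounded Hkl). intros w Hw. unfold Fs in Hw.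
      rewrite app_lam in Hw; auto; [| cls]. apply mem_sep in Hw; [tauto | cls]. }
    split; [| split; [| split]].
    + intros t'' f f' r Ht'' Hf Hr H.
      destruct (Le _ _ Hf) as (_ & L1 & L2).
      assert (HtV : t'' ∈ Vs k).
      { apply (Vs_subset (y := t')); auto. intros z Hz. now apply Ht''. }
      apply (P1 t'' (LV _ HtV)) with (u := app (Fs s) t) (f := f); auto.
      split; auto.
    + intros a b Hab Ha. destruct (Le _ _ Hab) as (_ & L1 & L2).
      apply (P2 a L1 b L2 Hab). split; auto.
    + intros b Hb. destruct (Le _ _ Hb) as (_ & L1 & L2).
      destruct (P3 _ L1 _ L2 Hb eq_refl) as (c & _ & Nc & ->). eauto.
    + intros f f' i a a' Hf Hi Ha Ha'.
      destruct (Le _ _ Hf) as ((_ & _) & L1 & L2).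
      destruct (Le _ _ Ha') as (_ & L3 & L4).
      apply (P4 f L1 f' L2 Hf i (LV _ (HmL _ Hi)) (conj Om Hi) a L3 a' L4 Ha Ha').
Qed.

Section Nodes.
Variables (s B W h : V).
Hypotheses (HBk : subset B k) (HW : subset W (Vs k)) (HW0 : pr emp emp ∈ W).
Hypothesis (HB : forall g, g ∈ B ->
    (forall x, x ∈ W -> x ∈ Vs g ->
       app h (pr g x) ∈ W /\ SUC la (Fs s) emp x g (app h (pr g x))) /\
    (forall q, q ∈ Vs g -> app h q ∈ W -> app h q ∈ Vs g) /\
    (subset s g /\ s ∈ Vs g) /\ omega ∈ g /\ limit_ordinal g).

(** Empty or a singleton. Writing the maximum as a set makes recursion on its removal total and
    definable. *)
Definition maxs t : V := sep t (fun m => forall b, b ∈ t -> b ∈ m \/ b = m).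
Definition eprd t : V := img (maxs t) (rmv t).
Definition estep t g : V :=
  bigU (cup (sep (upair (pr emp emp) (pr emp emp)) (fun _ => t = emp))
    (img (maxs t) (fun m => app h (pr m (app g (rmv t m)))))).

(** The node reached from the root by applying [h] to the points of [t] in increasing order. It is
    defined in [V] for every [t], so it can be used inside a name. *)
Definition Ev t : V := rec eprd estep t.

Lemma mem_maxs t m : m ∈ maxs t <-> m ∈ t /\ forall b, b ∈ t -> b ∈ m \/ b = m.
Proof. unfold maxs. now rewrite mem_sep by cls. Qed.

Lemma maxs_unique t m m' : m ∈ maxs t -> m' ∈ maxs t -> m' = m.
Proof.
  rewrite !mem_maxs. intros [H1 H2] [H3 H4].
  destruct (H2 m' H3) as [L |]; auto. destruct (H4 m H1) as [L' |]; auto.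
  destruct (mem_asym L L').
Qed.

Lemma mem_eprd t z : z ∈ eprd t <-> exists m, m ∈ maxs t /\ z = rmv t m.
Proof. unfold eprd. apply mem_img. cls. Qed.

Lemma eprd_wf : well_founded (fun z t => z ∈ eprd t).
Proof.
  assert (K : forall m t, m ∈ maxs t -> Acc (fun z t => z ∈ eprd t) t).
  { intro m. induction m as [m IH] using (well_founded_ind zf_wf).
    intros t Hm. constructor. intros z Hz. apply mem_eprd in Hz as (m' & Hm' & ->).
    rewrite (maxs_unique Hm Hm'). constructor. intros z Hz.
    pose proof Hz as Hz'. apply mem_eprd in Hz' as (m2 & Hm2 & _).
    assert (L : m2 ∈ m).
    { apply mem_maxs in Hm2 as [Hm2 _]. apply mem_rmv in Hm2 as [Hm2 N].
      apply mem_maxs in Hm as [_ Hm]. destruct (Hm m2 Hm2); tauto. }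
    exact (Acc_inv (IH m2 L _ Hm2) Hz). }
  intro t. constructor. intros z Hz. apply mem_eprd in Hz as (m & Hm & ->).
  apply (Acc_inv (K m t Hm)). apply mem_eprd. eauto.
Qed.

Lemma Fun1_eprd : Fun1 eprd.
Proof. unfold eprd, maxs. cls. Qed.

Lemma Fun2_estep : Fun2 estep.
Proof. unfold estep, maxs. cls. Qed.

Lemma Fun1_Ev : Fun1 Ev.
Proof. exact (Fun1_rec Fun1_eprd Fun2_estep eprd_wf). Qed.

Lemma bigU_single a y : (forall x, x ∈ a <-> x = y) -> bigU a = y.
Proof.
  intro H. apply zf_ext. intro z. rewrite mem_bigU. split.
  - intros (x & Hx & Hz). apply H in Hx. now subst.
  - intro Hz. exists y. split; auto. now apply H.
Qed.

Lemma Ev_emp : Ev emp = pr emp emp.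
Proof.
  unfold Ev. rewrite (rec_eq Fun1_eprd Fun2_estep eprd_wf). unfold estep at 1.
  apply bigU_single. intro x. rewrite mem_cup, mem_sep, mem_upair by cls. split.
  - intros [H | H]; [tauto |]. apply mem_img in H as (m & Hm & _); [| cls].
    apply mem_maxs in Hm as [Hm _]. destruct (mem_emp Hm).
  - intros ->. auto.
Qed.

Lemma Ev_max t m : m ∈ maxs t -> Ev t = app h (pr m (Ev (rmv t m))).
Proof.
  intro Hm. unfold Ev at 1. pose proof Fun1_Ev as HE.
  rewrite (rec_eq Fun1_eprd Fun2_estep eprd_wf). fold Ev. unfold estep at 1.
  assert (A1 : app (lam (eprd t) (rec eprd estep)) (rmv t m) = Ev (rmv t m)).
  { apply (app_lam (t := Ev)); [exact HE |]. apply mem_eprd. eauto. }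
  apply bigU_single. intro x. rewrite mem_cup, mem_sep by cls. split.
  - intros [[_ ->] | H].
    + apply mem_maxs in Hm as [Hm _]. destruct (mem_emp Hm).
    + apply mem_img in H as (m' & Hm' & ->); [| cls].
      rewrite (maxs_unique Hm Hm'). now rewrite A1.
  - intros ->. right. apply mem_img; [cls |]. exists m. split; auto. now rewrite A1.
Qed.

Variable (cc : V -> Prop).
Hypotheses (cB : forall g, cc g -> g ∈ B)
  (cU : forall a, a ∈ k -> exists g, cc g /\ a ∈ g)
  (cF : forall g, cc g -> exists t, finset t /\ forall x, x ∈ t <-> cc x /\ x ∈ g).

Definition tg g : V := the (fun t => forall x, x ∈ t <-> cc x /\ x ∈ g).

Lemma mem_tg g : cc g -> forall x, x ∈ tg g <-> cc x /\ x ∈ g.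
Proof.
  intro Hg. apply the_set_spec. destruct (cF Hg) as (t & _ & Ht). eauto.
Qed.

Lemma tg_eq g t : cc g -> (forall x, x ∈ t <-> cc x /\ x ∈ g) -> t = tg g.
Proof. intros Hg H. apply zf_ext. intro x. now rewrite H, mem_tg. Qed.

Lemma cc_k g : cc g -> g ∈ k.
Proof. intro H. apply HBk, cB, H. Qed.

Lemma cc_ord g : cc g -> ordinal g.
Proof. intro H. exact (ord_mem Ok (cc_k H)). Qed.

Lemma cc_lim g : cc g -> limit_ordinal g.
Proof. intro H. apply (HB (cB H)). Qed.

Lemma tg_Vs g : cc g -> tg g ∈ Vs k.
Proof.
  intro Hg. apply (Vs_bounded (cc_k Hg)). intros x Hx.
  apply (mem_tg Hg) in Hx as [Hx Hxg].
  apply ord_Vs; auto using cc_ord.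
Qed.

Definition ipred m g : Prop :=
  cc m /\ cc g /\ m ∈ g /\ forall x, cc x -> x ∈ g -> x ∈ m \/ x = m.

Lemma ipred_cases g : cc g -> (forall x, cc x -> ~ x ∈ g) \/ exists m, ipred m g.
Proof.
  intro Hg. destruct (cF Hg) as (t & Ft & Ht).
  destruct (classic (exists x, x ∈ t)) as [Hx | N].
  - right. destruct (Ft t (fun _ H => H) Hx) as (m & Hm & Hmax).
    exists m. pose proof Hm as Hm'. apply Ht in Hm' as [H1 H2].
    split; auto. split; auto. split; auto. intros x Hcx Hxg. apply Hmax, Ht. auto.
  - left. intros x Hc Hxg. apply N. exists x. apply Ht. auto.
Qed.

Lemma ipred_max m g : ipred m g -> m ∈ maxs (tg g) /\ rmv (tg g) m = tg m.
Proof.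
  intros (Hm & Hg & Hmg & H). split.
  - apply mem_maxs. rewrite (mem_tg Hg). split; auto. intros b Hb.
    apply (mem_tg Hg) in Hb as [? ?]. auto.
  - apply tg_eq; auto. intro x. rewrite mem_rmv, (mem_tg Hg). split.
    + intros [[Hx Hxg] N]. destruct (H x Hx Hxg); tauto.
    + intros [Hx Hxm]. split; [split; auto |].
      * exact (ord_trans (cc_ord Hg) Hxm Hmg).
      * intros ->. exact (mem_irrefl Hxm).
Qed.

Lemma node_next m g : ipred m g -> Ev (tg m) ∈ W -> Ev (tg m) ∈ Vs m ->
  Ev (tg g) ∈ W /\ Ev (tg g) ∈ Vs g /\ SUC la (Fs s) emp (Ev (tg m)) m (Ev (tg g)).
Proof.
  intros Hp H1 H2. destruct (ipred_max Hp) as [Hmax Er].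
  destruct Hp as (Hm & Hg & Hmg & _).
  rewrite (Ev_max Hmax), Er.
  destruct (HB (cB Hm)) as (A1 & _). destruct (A1 _ H1 H2) as [A2 A3].
  split; auto. split; auto. destruct (HB (cB Hg)) as (_ & A4 & _).
  apply A4; auto. apply Vs_pr; auto using cc_lim.
  - apply ord_Vs; auto using cc_ord.
  - revert H2. apply Vs_mono. intros x Hx. exact (ord_trans (cc_ord Hg) Hx Hmg).
Qed.

(** Induction along the sequence: the node before a point lies below that point because the points
    of [B] are closed under [h], and this is what allows the next step. *)
Lemma node g : cc g -> Ev (tg g) ∈ W /\ Ev (tg g) ∈ Vs g /\
  exists e, Ev (tg g) = pr (tg g) e.
Proof.
  induction g as [g IH] using (well_founded_ind zf_wf). intro Hg.
  destruct (ipred_cases Hg) as [N | [m Hp]].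
  - assert (E : tg g = emp).
    { apply zf_ext. intro x. rewrite (mem_tg Hg). split.
      - intros [Hx Hxg]. destruct (N x Hx Hxg).
      - intro Hx. destruct (mem_emp Hx). }
    rewrite E, Ev_emp. split; auto. split; [| eauto].
    destruct (HB (cB Hg)) as (_ & _ & _ & Ho & Lg).
    assert (emp ∈ Vs g) by (apply (num_Vs 0); [apply Lg | auto]).
    apply Vs_pr; auto.
  - pose proof Hp as (Hm & _ & Hmg & _).
    destruct (IH m Hmg Hm) as (H1 & H2 & e & He).
    destruct (node_next Hp H1 H2) as (H3 & H4 & H5). split; auto. split; auto.
    assert (Hmk : m ∈ Vs k) by (apply ord_Vs; auto using cc_ord, cc_k; exact Ok).
    destruct (SUC_use (HW H1) (HW H3) Hmk H5)
      as (t & e1 & t' & e' & E1 & E2 & Ht & _).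
    rewrite He in E1. apply pr_inj in E1 as [<- _].
    exists e'. rewrite E2. f_equal. apply tg_eq; auto. intro x.
    rewrite Ht, (mem_tg Hm). destruct Hp as (_ & _ & _ & Hp). split.
    + intros [[Hx Hxm] | ->]; auto. split; auto.
      exact (ord_trans (cc_ord Hg) Hxm Hmg).
    + intros [Hx Hxg]. destruct (Hp x Hx Hxg); auto.
Qed.

Definition eg g : V := sndp (Ev (tg g)).

Lemma Ev_eg g : cc g -> Ev (tg g) = pr (tg g) (eg g).
Proof.
  intro Hg. destruct (node Hg) as (_ & _ & e & E). unfold eg. now rewrite E, sndp_pr.
Qed.

Lemma eg_Vs g x y : cc g -> pr x y ∈ eg g -> x ∈ Vs g /\ y ∈ Vs g.
Proof.
  intros Hg Hxy. destruct (node Hg) as (_ & H & _). rewrite (Ev_eg Hg) in H.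
  assert (Og := cc_ord Hg). apply (Vs_pr_inv Og) in H as [_ H].
  apply (Vs_trans Og H) in Hxy. now apply (Vs_pr_inv Og) in Hxy.
Qed.

Lemma ipred_use m g : ipred m g ->
    subset (eg m) (eg g) /\
    (forall x y z, pr x y ∈ eg g -> pr x z ∈ eg g -> y = z) /\
    (forall b x, cc b -> b ∈ m -> x ∈ Vs b -> exists y, pr x y ∈ eg g) /\
    (forall g0, cc g0 -> g0 ∈ m -> (forall b, cc b -> g0 = b \/ g0 ∈ b) ->
      (forall f f' r, pr f f' ∈ eg g ->
         r ∈ Vs g0 -> pr f r ∈ app (Fs s) (tg m) ->
         pr f' r ∈ app (Fs s) (rmv (tg g) g0)) /\
      (forall x y, pr x y ∈ eg g -> x ∈ Vs g0 -> y = x) /\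
      (forall y, pr (pr emp g0) y ∈ eg g -> exists b, b <> g0 /\ y = pr emp b) /\
      (forall f f' i x x', pr f f' ∈ eg g -> i ∈ Vs g0 -> pr i x ∈ f ->
         pr x x' ∈ eg g -> pr i x' ∈ f')).
Proof.
  intro Hp. pose proof Hp as (Hm & Hg & _).
  destruct (node Hm) as (H1 & H2 & _). destruct (node_next Hp H1 H2) as (H3 & _ & H5).
  assert (Hmk : m ∈ Vs k) by (apply ord_Vs; auto using cc_ord, cc_k; exact Ok).
  destruct (SUC_use (HW H1) (HW H3) Hmk H5)
    as (t & e1 & t' & e' & E1 & E2 & Ht & He & Hf & Hd & Hmin).
  rewrite (Ev_eg Hm) in E1. rewrite (Ev_eg Hg) in E2.
  apply pr_inj in E1 as [<- <-]. apply pr_inj in E2 as [<- <-].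
  split; auto. split; auto. split.
  - intros b x Hb Hbm Hx. apply (Hd b x); auto using cc_ord. apply mem_tg; auto.
  - intros g0 H0 H0m Hl. destruct (Hmin g0) as (P1 & P2 & P3 & P4).
    + apply mem_tg; auto.
    + intros b Hb. apply (mem_tg Hm) in Hb as [Hb _]. auto.
    + auto using cc_ord.
    + split; auto. intros f f' r. apply P1. intro z. apply mem_rmv.
Qed.

Lemma eg_mono g g' : cc g -> cc g' -> g ∈ g' -> subset (eg g) (eg g').
Proof.
  intros Hg. induction g' as [g' IH] using (well_founded_ind zf_wf). intros Hg' L.
  destruct (ipred_cases Hg') as [N | [m Hp]]; [destruct (N g Hg L) |].
  destruct (ipred_use Hp) as [Hs _]. destruct Hp as (Hm & _ & Hmg & Hp).
  intros x Hx. apply Hs. destruct (Hp g Hg L) as [L' | ->]; auto.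
  exact (IH m Hmg Hm L' x Hx).
Qed.

Variable (g0 : V).
Hypotheses (H0 : cc g0) (Hl0 : forall b, cc b -> g0 = b \/ g0 ∈ b).

(** Finds a step from [m] to [g] late enough for the approximations to matter at [a]. The point [b]
    between [a] and [m] is there because the approximation at [g] is total on [Vs b] for the points
    [b] before [m]. *)
Lemma big a : a ∈ k -> exists b m g, cc b /\ a ∈ b /\ b ∈ m /\ ipred m g /\ g0 ∈ m.
Proof.
  intro Ha. destruct (cU Ha) as (b0 & Hb0 & Hab).
  destruct (cU (cc_k Hb0)) as (b & Hb & Hbb). destruct (cU (cc_k Hb)) as (m' & Hm' & Hbm).
  destruct (cU (cc_k Hm')) as (g & Hg & Hmg).
  destruct (ipred_cases Hg) as [N | [m Hp]]; [destruct (N m' Hm' Hmg) |].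
  exists b, m, g. pose proof Hp as (Hm & _ & _ & Hmax).
  assert (Hbm' : b ∈ m).
  { destruct (Hmax m' Hm' Hmg) as [L | <-]; auto. exact (ord_trans (cc_ord Hm) Hbm L). }
  assert (Om := cc_ord Hm).
  split; auto. split; [exact (ord_trans (cc_ord Hb) Hab Hbb) |].
  split; auto. split; auto.
  destruct (Hl0 Hb) as [<- | L]; auto. exact (ord_trans Om L Hbm').
Qed.

(** The map e of the overview. It lives outside [V]; [ename] below gives it a name. *)
Definition EE x y : Prop := exists g, cc g /\ pr x y ∈ eg g.

Lemma EE_big x y : EE x y -> exists a, a ∈ k /\ forall g, cc g -> a ∈ g -> pr x y ∈ eg g.
Proof.
  intros (g & Hg & Hxy). exists g. split; [now apply cc_k |].
  intros g' Hg' L. exact (eg_mono Hg Hg' L Hxy).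
Qed.

Lemma k_max a b : a ∈ k -> b ∈ k -> exists c, c ∈ k /\ forall d, ordinal d -> c ∈ d ->
  a ∈ d /\ b ∈ d.
Proof.
  intros Ha Hb. assert (Oa := ord_mem Ok Ha). assert (Ob := ord_mem Ok Hb).
  destruct (ord_total Oa Ob) as [L | [-> | L]]; [exists b | exists b | exists a];
    split; auto; intros d Od Hd; split; auto.
  - exact (ord_trans Od L Hd).
  - exact (ord_trans Od L Hd).
Qed.

Lemma EE_Vs x y : EE x y -> x ∈ Vs k /\ y ∈ Vs k.
Proof.
  intros (g & Hg & Hxy). apply (eg_Vs Hg) in Hxy as [H1 H2].
  split; [revert H1 | revert H2]; apply Vs_mono; intros w Hw;
    exact (ord_trans Ok Hw (cc_k Hg)).
Qed.

Lemma EE_use x y x' y' : EE x y -> EE x' y' -> exists m g, ipred m g /\ g0 ∈ m /\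
  pr x y ∈ eg g /\ pr x' y' ∈ eg g /\ x ∈ Vs m.
Proof.
  intros H H'. destruct (EE_big H) as (a & Ha & Hb). destruct (EE_big H') as (a' & Ha' & Hb').
  destruct (k_max Ha Ha') as (c & Hc & Hm).
  assert (Hr : rk x ∈ k) by (apply mem_Vs_rk; [exact Ok | exact (proj1 (EE_Vs H))]).
  destruct (k_max Hc Hr) as (d & Hd & Hm').
  destruct (big Hd) as (b & m & g & Hcb & Hdb & Hbm & Hp & H0m).
  pose proof Hp as (Hcm & Hg & Hmg & _).
  assert (Hdm : d ∈ m) by exact (ord_trans (cc_ord Hcm) Hdb Hbm).
  assert (Hdg : d ∈ g) by exact (ord_trans (cc_ord Hg) Hdm Hmg).
  assert (Od := cc_ord Hg). destruct (Hm' g Od Hdg) as [Hcg _].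
  destruct (Hm g Od Hcg) as [Hag Hag']. exists m, g. split; auto. split; auto.
  split; auto. split; auto. apply mem_Vs_rk; [exact (cc_ord Hcm) |].
  exact (proj2 (Hm' m (cc_ord Hcm) Hdm)).
Qed.

Lemma EE_fun x y z : EE x y -> EE x z -> y = z.
Proof.
  intros H H'. destruct (EE_use H H') as (m & g & Hp & _ & H1 & H2 & _).
  destruct (ipred_use Hp) as (_ & K & _). eauto.
Qed.

Lemma EE_total x : x ∈ Vs k -> exists y, EE x y.
Proof.
  intro Hx. assert (Hr : rk x ∈ k) by (apply mem_Vs_rk; [exact Ok | auto]).
  destruct (big Hr) as (b & m & g & Hcb & Hab & Hbm & Hp & _).
  destruct (ipred_use Hp) as (_ & _ & K & _).
  destruct (K b x) as [y Hy]; auto.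
  - apply mem_Vs_rk; auto using cc_ord.
  - exists y, g. split; auto. apply Hp.
Qed.

Lemma EE_fix x y : EE x y -> x ∈ Vs g0 -> y = x.
Proof.
  intros H Hx. destruct (EE_use H H) as (m & g & Hp & Hm & H1 & _).
  destruct (ipred_use Hp) as (_ & _ & _ & K). destruct (K g0 H0 Hm Hl0) as (_ & K2 & _).
  auto.
Qed.

Lemma EE_move y : EE (pr emp g0) y -> exists b, b <> g0 /\ y = pr emp b.
Proof.
  intros H. destruct (EE_use H H) as (m & g & Hp & Hm & H1 & _).
  destruct (ipred_use Hp) as (_ & _ & _ & K).
  destruct (K g0 H0 Hm Hl0) as (_ & _ & K2 & _). auto.
Qed.

Lemma EE_tuple f f' i x x' : EE f f' -> i ∈ Vs g0 -> pr i x ∈ f -> EE x x' ->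
  pr i x' ∈ f'.
Proof.
  intros H Hi Hx H'. destruct (EE_use H H') as (m & g & Hp & Hm & H1 & H2 & _).
  destruct (ipred_use Hp) as (_ & _ & _ & K).
  destruct (K g0 H0 Hm Hl0) as (_ & _ & _ & K2). eauto.
Qed.

(** The two stems differ in the way prescribed by the tree: one ends before [m], the other before
    [g] and lacks the first point [g0]. *)
Lemma EE_code f f' r : EE f f' -> r ∈ Vs g0 -> exists m g, ipred m g /\ g0 ∈ m /\
  pr f r ∈ Vs m /\ pr f' r ∈ Vs g /\
  (pr f r ∈ app (Fs s) (tg m) -> pr f' r ∈ app (Fs s) (rmv (tg g) g0)).
Proof.
  intros H Hr. destruct (EE_use H H) as (m & g & Hp & Hm & H1 & _ & Hf).
  pose proof Hp as (Hcm & Hg & Hmg & _).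
  destruct (ipred_use Hp) as (_ & _ & _ & K).
  destruct (K g0 H0 Hm Hl0) as (K1 & _). exists m, g. split; auto. split; auto.
  assert (Hrm : r ∈ Vs m).
  { revert Hr. apply Vs_mono. intros w Hw. exact (ord_trans (cc_ord Hcm) Hw Hm). }
  split; [apply Vs_pr; auto using cc_lim |]. split; [| eauto].
  apply Vs_pr; auto using cc_lim; [exact (proj2 (eg_Vs Hg H1)) |].
  revert Hrm. apply Vs_mono. intros w Hw. exact (ord_trans (cc_ord Hg) Hw Hmg).
Qed.

End Nodes.
End Branch.

(** Applied to the original sequence and to the shortened one alike. *)
Lemma cond_Gof {V : structure} {HV : ZF V} (k U : V) (NU : normal_uf k U)
    (c : V -> Prop) (u B g : V) :
  B ∈ U -> g ∈ k -> (forall x, c x -> x ∈ k) -> (forall x, x ∈ u <-> c x /\ x ∈ g) ->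
  finset u -> (forall x, c x -> ~ x ∈ g -> x ∈ B) ->
  Gof k U c (pr u (sep B (fun y => g ∈ y \/ g = y))).
Proof.
  intros HB Hg Hck Hu Fu HcB. assert (Ok := proj1 (nu_lim NU)).
  apply Gof_pr. split; [| split; [split |]].
  - apply pr_PP. split; [split; auto; intros x Hx; apply Hck, Hu, Hx |].
    apply (nu_up NU (nu_and NU HB (nu_tail NU Hg))).
    + intros x Hx. apply mem_sep in Hx as [Hx Hx']; [| unfold limit_ordinal; cls].
      apply mem_sep in Hx' as [_ Hx']; [| unfold limit_ordinal; cls].
      apply mem_sep; [cls | tauto].
    + intros x Hx. apply mem_sep in Hx as [Hx _]; [| cls]. exact (nu_sub NU HB Hx).
  - intros x Hx. now apply Hu.
  - intros x y Hx Hy Hxy. apply Hu. split; auto. apply Hu in Hy as [_ Hy].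
    exact (ord_trans (ord_mem Ok Hg) Hxy Hy).
  - intros x Hx Nx. assert (~ x ∈ g) by (intro L; apply Nx, Hu; auto).
    apply mem_sep; [cls |]. split; auto.
    destruct (ord_total (ord_mem Ok (Hck x Hx)) (ord_mem Ok Hg)) as [L | [L | L]]; auto.
    tauto.
Qed.

(** * The embedding in the extension *)

Section Main.
Context {V : structure} {HV : ZF V} (k U la : V).
Hypothesis (NU : normal_uf k U).
Hypothesis (VWO : WO (M := V)).
Hypotheses (Ll : limit_ordinal la) (Hkl : k ∈ la) (Hok : omega ∈ k).
Hypothesis (KL : forall F : V, isfun F ->
  (forall p, p ∈ F -> exists t u, p = pr t u /\ t ∈ Vs k /\ subset u (Vs k)) ->
  (forall t, t ∈ Vs k -> exists u, pr t u ∈ F) ->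
  exists W, subset W (Vs k) /\ pr emp emp ∈ W /\
    forall x, x ∈ W -> exists B, B ∈ U /\
      forall g, g ∈ B -> exists y, y ∈ W /\ SUC la F emp x g y).
Hypothesis (SL : forall x : V, x ∈ Vs k -> exists o h, o ∈ k /\ surj h o x).
Variables (G : V -> Prop) (N : structure) (val : V -> N).
Local Notation PP := (PP k U).
Local Notation le := (prikry_le k).
Hypothesis HG : generic (fun p => p ∈ PP) le G.
Hypothesis HN : generic_extension G val.
Context {ZN : ZF N}.
Local Notation ck := (ck PP val).
Local Notation Lk := (nu_lim NU).
Local Notation Ok := (proj1 (nu_lim NU)).
Local Notation PO := (PP_poset NU).

(** Prikry forcing adds no subsets of ordinals below [k], so the enumerations of power sets from [V]
    show that [k] is still a strong limit. *)
Lemma ck_limit_cardinal : limit_cardinal (ck k).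
Proof.
  apply strong_limit_cardinal; [exact (ck_limit HG HN Lk) |].
  intros a Ha. apply (mem_ck HG HN) in Ha as (b & Hb & ->).
  assert (Ob := ord_mem Ok Hb). assert (Hsb := limit_osucc Lk Hb).
  destruct (SL (x := Vs (osucc b))) as (o & h & Ho & Ih & Hh).
  { apply (Vs_bounded Hsb). intros x Hx. exact Hx. }
  exists (ck o), (ck h). split; [now apply (ck_mem HG HN) |].
  split; [exact (ck_isfun HG HN Ih) |]. intros y Hy. apply mem_pow in Hy.
  destruct (Vs_preserved NU VWO HG HN (a := osucc b) (x := y)) as (y' & Hy' & ->).
  - now apply ord_osucc.
  - intros x Hx. exact (ord_trans Ok Hx Hsb).
  - rewrite (ck_osucc HG HN). apply Vs_bounded with (b := ck b).
    { apply mem_osucc. auto. }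
    intros w Hw. apply Hy in Hw. assert (Oc := ck_ordinal HG HN Ob).
    apply ord_Vs; auto. exact (ord_mem Oc Hw).
  - destruct (Hh y' Hy') as (b' & Hb' & Hp). exists (ck b').
    split; [now apply (ck_mem HG HN) |]. rewrite <- (ck_pr HG HN).
    now apply (ck_mem HG HN).
Qed.

Lemma good_condition (sg Bd : V) f nv : Bd ∈ U ->
  sat (@whole N) (fun n => val (nv n)) f ->
  exists s B, G (pr s B) /\ subset B Bd /\ good_set k U la sg s B /\
    forces PP le f nv (pr s B).
Proof.
  intros HBd Hs. apply (truth PO HG HN) in Hs as (p & Gp & Hp).
  destruct (G_dense (po_rel PO) (po_refl PO) (po_trans PO) HG
    (A := fun r => exists s B, r = pr s B /\ subset B Bd /\ good_set k U la sg s B) Gp)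
    as (r & Gr & Hr & s & B & -> & HB & Hg).
  - unfold Cls. apply dfn_ex, dfn_ex, dfn_and; [dfn |]. apply dfn_and; [dfn |].
    apply dfn_good; [exact NU | df | df].
  - intros q Hq. pose proof Hq as (Hq1 & _ & _). apply mem_PP in Hq1 as (s & B0 & -> & Hs & HB0).
    destruct (nu_inter NU HB0 HBd) as (B1 & HB1 & M1).
    destruct (good_dense NU VWO KL sg (s := s) (B0 := B1)) as (B & HB & HBB & Hg).
    { apply pr_PP. auto. }
    exists (pr s B). split.
    + apply (PP_shrink NU); auto; [now apply pr_PP |].
      intros x Hx. apply HBB, M1 in Hx. tauto.
    + exists s, B. split; auto. split; auto. intros x Hx. apply HBB, M1 in Hx. tauto.
  - exists s, B. split; auto. split; auto. split; auto.
    exact (reg_mono (Reg_forces (po_rel PO) (po_refl PO) (po_trans PO) f nv) Hp Hr).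
Qed.

Section Embed.
Variables (sg Bd s B W h : V).
Hypothesis (HBd : forall g u x C, g ∈ Bd -> u ∈ Vs g -> x ∈ Vs g -> pr u C ∈ PP ->
  (forall y, y ∈ C -> y ∈ Bd /\ (g ∈ y \/ g = y)) ->
  decides k U (pr u C) sg (chk PP x)).
Hypotheses (Gs : G (pr s B)) (HBB : subset B Bd) (HW : subset W (Vs k))
  (HW0 : pr emp emp ∈ W).
Hypothesis (HB : forall g, g ∈ B ->
    (forall x, x ∈ W -> x ∈ Vs g ->
       app h (pr g x) ∈ W /\ SUC la (Fs k U sg s) emp x g (app h (pr g x))) /\
    (forall q, q ∈ Vs g -> app h q ∈ W -> app h q ∈ Vs g) /\
    (subset s g /\ s ∈ Vs g) /\ omega ∈ g /\ limit_ordinal g).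

Definition cc x : Prop := cs G x /\ ~ x ∈ s.

Lemma s_props : (subset s k /\ finset s /\ B ∈ U) /\ init (cs G) s /\
  forall x, cs G x -> ~ x ∈ s -> x ∈ B.
Proof.
  split; [exact (G_stem val HG Gs) |].
  apply (G_iff NU val HG) in Gs. apply Gof_pr in Gs. tauto.
Qed.

Lemma BU : B ∈ U.
Proof. apply s_props. Qed.

Lemma BK : subset B k.
Proof. exact (nu_sub NU BU). Qed.

Lemma cB g : cc g -> g ∈ B.
Proof. intros [H1 H2]. destruct s_props as (_ & _ & H). auto. Qed.

Lemma cU a : a ∈ k -> exists g, cc g /\ a ∈ g.
Proof.
  intro Ha. destruct s_props as ((Hsk & Fs & _) & _).
  destruct (finset_bounded Lk Hsk Fs) as (b & Hb & Hsb).
  assert (Oa := ord_mem Ok Ha). assert (Ob := ord_mem Ok Hb).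
  assert (exists c, c ∈ k /\ (a ∈ c \/ a = c) /\ (b ∈ c \/ b = c)) as (c & Hc & H1 & H2).
  { destruct (ord_total Oa Ob) as [L | [-> | L]]; eauto 6. }
  destruct (cs_unbounded NU HG Hc) as (g & Hg & Hcg).
  assert (Og := cs_ord NU val HG Hg).
  assert (K : forall x, x ∈ c \/ x = c -> x ∈ g).
  { intros x [L | ->]; auto. exact (ord_trans Og L Hcg). }
  exists g. split; [| auto]. split; auto. intro L. apply Hsb in L.
  exact (mem_asym L (K b H2)).
Qed.

Lemma cF g : cc g -> exists t, finset t /\ forall x, x ∈ t <-> cc x /\ x ∈ g.
Proof.
  intros [Hg _]. destruct (below_exists NU val HG Hg) as (t & Ft & _ & Ht).
  exists (sep t (fun x => ~ x ∈ s)). split.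
  - apply (finset_sub Ft). intros x Hx. apply mem_sep in Hx; [tauto | cls].
  - intro x. rewrite mem_sep by cls. rewrite Ht. unfold cc. tauto.
Qed.

Lemma s_below g : cc g -> subset s g.
Proof. intro H. destruct (HB (cB H)) as (_ & _ & (K & _) & _). exact K. Qed.

Local Notation tg := (tg cc).
Local Notation EE := (EE h cc).
Local Notation eg := (eg h cc).
Local Notation mem_tg := (mem_tg cF).

Lemma mem_stem g x : cc g -> x ∈ cup s (tg g) <-> cs G x /\ x ∈ g.
Proof.
  intro Hg. destruct s_props as (_ & [Hi _] & _).
  rewrite mem_cup, (mem_tg Hg). unfold cc. split.
  - intros [Hx | Hx]; [| tauto]. split; auto. exact (s_below Hg Hx).
  - intros [Hx Hxg]. destruct (classic (x ∈ s)); tauto.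
Qed.

Lemma stem_finset g : cc g -> finset (cup s (tg g)).
Proof.
  intro Hg. destruct (below_exists NU val HG (proj1 Hg)) as (t & Ft & _ & Ht).
  replace (cup s (tg g)) with t; auto. apply zf_ext. intro x.
  now rewrite (mem_stem _ Hg), Ht.
Qed.

Definition dif u : V := sep u (fun x => ~ x ∈ s).
(** A condition puts (x, y) into the map when the part of its stem beyond [s] leads [Ev] to an
    approximation containing that pair. *)
Definition ename : V := cn PP (img (Vs k) (chk PP)) (fun t p =>
  exists x y, t = chk PP (pr x y) /\ pr x y ∈ sndp (Ev h (dif (fstp p)))).
Local Notation e := (val ename).

Lemma stem_tg u C : G (pr u C) -> exists g, cc g /\ dif u = tg g.
Proof.
  intro Hu. destruct (G_stem val HG Hu) as (Huk & Fu & _).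
  pose proof Hu as Hu'. apply (G_iff NU val HG) in Hu'. apply Gof_pr in Hu' as (_ & [I1 I2] & _).
  destruct (finset_bounded Lk Huk Fu) as (b & Hb & Hub).
  destruct (cU Hb) as (g1 & Hg1 & Hbg1).
  (* [g] is the first point beyond the stem [u], so [u] is the part of the sequence below [g]. *)
  destruct (@ord_least V HV (fun g => cc g /\ ~ g ∈ u) g1) as (g & Og & [Hg Ng] & Hm).
  - exact (cs_ord NU val HG (proj1 Hg1)).
  - split; auto. intro L. apply Hub in L. exact (mem_asym L Hbg1).
  - exists g. split; auto. apply (tg_eq cF Hg). intro x. unfold dif.
    rewrite mem_sep by cls. split.
    + intros [Hx Nx]. assert (Cx := I1 x Hx). split; [split; auto |].
      destruct (ord_total (cs_ord NU val HG Cx) Og) as [L | [-> | L]]; auto; [tauto |].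
      destruct Ng. exact (I2 g x (proj1 Hg) Hx L).
    + intros [Hx Hxg]. split; [| exact (proj2 Hx)]. apply NNPP. intro Nx.
      exact (Hm x Hxg (conj Hx Nx)).
Qed.

Lemma mem_e w : w ∈ e <-> exists x y, EE x y /\ w = pr (ck x) (ck y).
Proof.
  unfold ename. rewrite (val_cn HG HN).
  2:{ pose proof (Fun1_chk PP). pose proof (Fun1_Ev h). unfold Rel2, dif. dfn. }
  split.
  - intros (t & _ & (p & Gp & x & y & -> & Hxy) & ->). exists x, y.
    change (val (chk PP (pr x y))) with (ck (pr x y)). rewrite (ck_pr HG HN).
    split; auto. pose proof (G_PP HG Gp) as Hp. apply mem_PP in Hp as (u & C & -> & _).
    rewrite fstp_pr in Hxy. destruct (stem_tg Gp) as (g & Hg & E). rewrite E in Hxy.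
    exists g. auto.
  - intros (x & y & HE & ->). pose proof HE as (g & Hg & Hxy).
    exists (chk PP (pr x y)). split; [| split].
    + apply mem_img; [apply Fun1_chk |]. exists (pr x y). split; auto.
      destruct (EE_Vs NU Hkl BK HW HW0 HB cB cF HE). apply Vs_pr; auto. exact Lk.
    + exists (pr (cup s (tg g)) (sep B (fun y => g ∈ y \/ g = y))). split.
      * apply (G_iff NU val HG). apply (cond_Gof NU); auto using BU, BK, cB, stem_finset.
        -- intros z. exact (cs_k val HG (x := z)).
        -- intro z. exact (mem_stem z Hg).
        -- intros z Hz Nz. apply cB. split; auto. intro L. apply Nz. exact (s_below Hg L).
      * exists x, y. split; auto. rewrite fstp_pr.
        replace (dif (cup s (tg g))) with (tg g); auto.
        apply zf_ext. intro z. unfold dif. rewrite mem_sep by cls.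
        rewrite (mem_stem _ Hg), (mem_tg Hg). unfold cc. tauto.
    + change (val (chk PP (pr x y))) with (ck (pr x y)). now rewrite (ck_pr HG HN).
Qed.

Variable (g0 : V).
Hypotheses (H0 : cc g0) (Hl0 : forall b, cc b -> g0 = b \/ g0 ∈ b).

Lemma app_e x y : EE x y -> app e (ck x) = ck y.
Proof.
  intro H. apply app_eq; [split |].
  - intros p Hp. apply mem_e in Hp as (a & b & _ & ->). eauto.
  - intros a b c Hb Hc. apply mem_e in Hb as (a1 & b1 & H1 & E1).
    apply mem_e in Hc as (a2 & b2 & H2 & E2). apply pr_inj in E1 as [-> ->].
    apply pr_inj in E2 as [E2 ->]. apply (ck_inj HG HN) in E2. subst a2. f_equal.
    exact (EE_fun NU Hkl BK HW HW0 HB cB cU cF Hl0 H1 H2).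
  - apply mem_e. eauto.
Qed.

Lemma stem_Vs g u : cc g -> subset u (cup s (tg g)) -> u ∈ Vs g.
Proof.
  intros Hg Hu. apply finset_Vs.
  - destruct (HB (cB Hg)) as (_ & _ & _ & _ & K). exact K.
  - intros x Hx. apply Hu in Hx. now apply (mem_stem _ Hg) in Hx.
  - exact (finset_sub (stem_finset Hg) Hu).
Qed.

Lemma tg_k g : cc g -> tg g ∈ Vs k.
Proof. exact (tg_Vs NU BK cB cF (g := g)). Qed.

Lemma Vs_gk g x : cc g -> x ∈ Vs g -> x ∈ Vs k.
Proof.
  intro Hg. apply Vs_mono. intros w Hw. exact (ord_trans Ok Hw (BK (cB Hg))).
Qed.

(** The condition whose stem is the whole sequence below [m] belongs to [G] and, by the choice of
    [Bd], decides the sets below [m]. Since its decision agrees with [val sg], it is the witness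
    needed for [Fs]. *)
Lemma A_forced x m : cc m -> x ∈ Vs m -> ck x ∈ val sg ->
  x ∈ app (Fs k U sg s) (tg m).
Proof.
  intros Hm Hx HA. set (C := sep B (fun y => m ∈ y \/ m = y)).
  assert (Hc : Gof k U (cs G) (pr (cup s (tg m)) C)).
  { apply (cond_Gof NU); auto using BU, BK, cB, stem_finset.
    - intros z. exact (cs_k val HG (x := z)).
    - intro z. exact (mem_stem z Hm).
    - intros z Hz Nz. apply cB. split; auto. intro L. apply Nz. exact (s_below Hm L). }
  assert (Hd : decides k U (pr (cup s (tg m)) C) sg (chk PP x)).
  { apply HBd with (g := m); auto using cB.
    - apply (stem_Vs Hm). intros z Hz; exact Hz.
    - apply Gof_pr in Hc. tauto.
    - intros y Hy. unfold C in Hy. apply mem_sep in Hy as [Hy Hy']; [auto | cls]. }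
  apply (G_iff NU val HG) in Hc.
  apply (mem_Fs NU); [exact (tg_k Hm) | exact (Vs_gk Hm Hx) |].
  exists C. now apply (decides_truth NU HG HN Hc Hd).
Qed.

Variable (val2 : V -> N).
Hypothesis (HN2 : generic_extension (Gof k U (cs' G g0)) val2).
Local Notation HG2 := (Gof_rmv_generic NU val HG (proj1 H0)).

Lemma ck2_eq x : val2 (chk PP x) = ck x.
Proof.
  apply (identified_unique (N_ext HN) (zf_wf (M := V)) (x := x)).
  - exact (ck_identified HG2 HN2 x).
  - exact (ck_identified HG HN x).
Qed.

(** The condition whose stem is the sequence below [g] without [g0] is in the filter of the
    shortened sequence and decides [x]. A negative decision is excluded, because it is compatible
    with the condition of the same stem that witnesses membership in [Fs]. *)
Lemma forced_A2 x g : cc g -> g0 ∈ g -> x ∈ Vs g ->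
  x ∈ app (Fs k U sg s) (rmv (tg g) g0) -> ck x ∈ val2 sg.
Proof.
  intros Hg L0 Hx HF. set (C := sep B (fun y => g ∈ y \/ g = y)).
  set (u := cup s (rmv (tg g) g0)).
  assert (Hsub : subset u (cup s (tg g))).
  { intros z Hz. apply mem_cup. apply mem_cup in Hz as [Hz | Hz]; auto.
    right. apply mem_rmv in Hz. tauto. }
  assert (Hc : Gof k U (cs' G g0) (pr u C)).
  { apply (cond_Gof NU); auto using BU, BK, cB.
    - intros z [Hz _]. exact (cs_k val HG Hz).
    - intro z. unfold u. rewrite mem_cup, mem_rmv, (mem_tg Hg). unfold cs', cc.
      pose proof (s_below Hg (z := z)) as K. destruct s_props as (_ & [Hi _] & _).
      pose proof (Hi z) as K2. destruct H0 as [_ N0].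
      split; [| destruct (classic (z ∈ s)); tauto].
      intros [Hz | Hz]; [| tauto]. split; auto. split; auto. intros ->. tauto.
    - exact (finset_sub (stem_finset Hg) Hsub).
    - intros z [Hz _] Nz. apply cB. split; auto. intro L. apply Nz. exact (s_below Hg L). }
  assert (HP : pr u C ∈ PP) by (apply Gof_pr in Hc; tauto).
  assert (Hd : decides k U (pr u C) sg (chk PP x)).
  { apply HBd with (g := g); auto using cB.
    - exact (stem_Vs Hg Hsub).
    - intros y Hy. unfold C in Hy. apply mem_sep in Hy as [Hy Hy']; [auto | cls]. }
  rewrite <- ck2_eq. apply (decides_truth NU HG2 HN2 Hc Hd).
  apply (mem_Fs NU) in HF as [B' HB']; [| | exact (Vs_gk Hg Hx)].
  2:{ apply (Vs_subset (y := tg g)); [| exact (tg_k Hg)].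
      intros z Hz. apply mem_rmv in Hz. tauto. }
  destruct Hd as [Hd | [_ Hd]]; auto. exfalso.
  pose proof (Reg_fmem (po_refl PO) (po_trans PO) (chk PP x) sg) as RF.
  assert (HP' : pr u B' ∈ PP) by exact (reg_in RF HB').
  pose proof HP as [Hu HC]%pr_PP. pose proof HP' as [_ HB'U]%pr_PP.
  destruct (nu_inter NU HC HB'U) as (D & HD & MD).
  apply (Hd (pr u D)).
  - apply (PP_shrink NU); auto. intros z Hz. apply MD in Hz. tauto.
  - apply (reg_mono RF HB'). apply (PP_shrink NU); auto.
    intros z Hz. apply MD in Hz. tauto.
Qed.

Variables (z pi pi2 : N).
Hypotheses (Lz : limit_ordinal z) (Hkz : ck k ∈ z)
  (HP : coding (ck k) z pi) (HA : val sg = code (ck k) z pi)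
  (HP2 : coding (ck k) z pi2) (HA2 : val2 sg = code (ck k) z pi2)
  (HRa : refl_at (Ra (ck k)) z z) (HRb : refl_at Rb z z).

Lemma Vs_ck x : x ∈ Vs (ck k) -> exists y, y ∈ Vs k /\ x = ck y.
Proof.
  apply (Vs_preserved NU VWO HG HN); [exact Ok | intros w Hw; exact Hw].
Qed.

Lemma EEt x : x ∈ Vs k -> exists y, EE x y.
Proof. exact (EE_total NU Hkl BK HW HW0 HB cB cU cF Hl0 (x := x)). Qed.

Lemma code_type q : Cls (fun q0 => exists f n m : N, m ∈ omega /\ n ∈ omega /\
  isfun f /\ dom f = n /\ q0 = pr f (pr n (pr m (tb m (cz z q f))))).
Proof. unfold cz. cls. Qed.

(** The tuple of names [f] together with its type is an element of the first code. The tree sends it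
    to [f0] with the same type in the second code, and [f0] is the tuple of the images under the
    map. *)
Lemma embed_types n m (xs : nat -> N) : (forall i, xs i ∈ Vs (ck k)) ->
  tb (num m) (tup (S n) (scons (Vs z) (fun i => app pi (xs i)))) =
  tb (num m) (tup (S n) (scons (Vs z) (fun i => app pi2 (app e (xs i))))).
Proof.
  intro Hxs.
  assert (exists ys ys' : nat -> V, forall i, ys i ∈ Vs k /\ xs i = ck (ys i) /\
    EE (ys i) (ys' i)) as (ys & ys' & Hys).
  { assert (K : forall i, exists p : V * V, fst p ∈ Vs k /\ xs i = ck (fst p) /\
      EE (fst p) (snd p)).
    { intro i. destruct (Vs_ck (Hxs i)) as (y & Hy & E). destruct (EEt Hy) as [y' Hy'].
      exists (y, y'). auto. }
    exists (fun i => fst (proj1_sig (constructive_indefinite_description _ (K i)))),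
      (fun i => snd (proj1_sig (constructive_indefinite_description _ (K i)))).
    intro i. now destruct (constructive_indefinite_description _ _). }
  assert (Exs : (fun i => ck (ys i)) = xs).
  { apply functional_extensionality. intro i. symmetry. apply Hys. }
  destruct (HB (cB H0)) as (_ & _ & _ & Ho0 & L0).
  assert (Hk0 : g0 ∈ k) by exact (BK (cB H0)).
  set (f := tup n ys).
  assert (Hf : f ∈ Vs k).
  { apply tup_Vs; auto; [exact Lk |]. intros i _. apply Hys. }
  destruct (EEt Hf) as [f0 Hf0].
  (* Types are small: [T] lies below [g0], so it is the check of a set [t] of [V] there, and the
     data [r] built from it is left unchanged by the demand in [OK]. *)
  set (T := tb (num m) (tup (S n) (scons (Vs z) (fun i => app pi (xs i))))).
  assert (HT : T ∈ Vs (ck g0)).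
  { apply tb_Vs; [exact (ck_limit HG HN L0) |]. rewrite <- (ck_omega HG HN).
    now apply (ck_mem HG HN). }
  destruct (Vs_preserved NU VWO HG HN (a := g0) (x := T)) as (t & Ht & Et); auto.
  { exact (proj1 L0). }
  { intros w Hw. exact (ord_trans Ok Hw Hk0). }
  set (r := pr (num n) (pr (num m) t)).
  assert (Hr : r ∈ Vs g0).
  { assert (Hnum : forall i, num i ∈ Vs g0) by (intro; apply num_Vs; auto; apply L0).
    repeat apply Vs_pr; auto. }
  destruct (EE_code NU Hkl BK HW HW0 HB cB cU cF H0 Hl0 Hf0 Hr)
    as (mm & g & Hp & H0m & V1 & V2 & Hcode).
  destruct Hp as (Hmm & Hg & Hmg & _).
  assert (Eck : forall a, ck (pr a r) = pr (ck a) (pr (num n) (pr (num m) T))).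
  { intro a. unfold r. rewrite !(ck_pr HG HN), !(ck_num HG HN). now rewrite <- Et. }
  assert (InA : ck (pr f r) ∈ val sg).
  { rewrite HA. apply mem_sep; [apply code_type |]. split.
    - apply (ck_Vs HG HN); [exact Ok |]. exact (Vs_gk Hmm V1).
    - exists (ck f), (num n), (num m). rewrite Eck. unfold f.
      rewrite (ck_tup HG HN), Exs. split; [apply num_omega |].
      split; [apply num_omega |]. split; [apply isfun_tup |].
      split; [apply dom_tup |]. rewrite cz_tup. reflexivity. }
  (* Membership travels from the first code to [Fs] at the stem before [mm], through the tree to
     [Fs] at the stem without [g0], and from there to the second code. *)
  assert (InA2 : ck (pr f0 r) ∈ val2 sg).
  { apply (forced_A2 Hg); auto.
    - exact (ord_trans (proj1 (proj2 (proj2 (proj2 (proj2 (HB (cB Hg))))))) H0m Hmg).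
    - apply Hcode. now apply A_forced. }
  rewrite HA2 in InA2. apply mem_sep in InA2; [| apply code_type].
  destruct InA2 as (_ & f1 & n1 & m1 & _ & _ & If1 & Df1 & E).
  rewrite Eck in E. apply pr_inj in E as [E1 E]. apply pr_inj in E as [E2 E].
  apply pr_inj in E as [E3 E]. subst f1 n1 m1. rewrite E. f_equal.
  (* The second code says that [f0] is a function with domain [num n], and [EE_tuple] identifies its
     entries. *)
  assert (Ef : ck f0 = tup n (fun i => app e (xs i))).
  { rewrite (tup_of If1 (eq_sym E2)). apply tup_ext. intros i Hi.
    destruct (Hys i) as (Hyi & Exi & Hyy).
    rewrite Exi, (app_e Hyy). apply (app_eq If1).
    rewrite <- (ck_num HG HN), <- (ck_pr HG HN). apply (ck_mem HG HN).
    apply (EE_tuple NU Hkl BK HW HW0 HB cB cU cF H0 Hl0 Hf0 (x := ys i)); auto.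
    - apply num_Vs; auto. apply L0.
    - unfold f. now apply pr_tup. }
  rewrite Ef, cz_tup. reflexivity.
Qed.

Lemma embed_exacting : exacting (ck k).
Proof.
  assert (Hok' : omega ∈ ck k).
  { rewrite <- (ck_omega HG HN). now apply (ck_mem HG HN). }
  destruct (HB (cB H0)) as (_ & _ & _ & Ho0 & L0).
  assert (Hk0 : g0 ∈ k) by exact (BK (cB H0)).
  assert (Hnum : forall i, num i ∈ Vs g0) by (intro; apply num_Vs; auto; apply L0).
  apply (exacting_of_codes (ck_limit HG HN Lk) Hok' Lz Hkz HP HP2 (e := e)); auto.
  - intros x Hx. destruct (Vs_ck Hx) as (y & Hy & ->). destruct (EEt Hy) as [y' Hy'].
    rewrite (app_e Hy'). apply (ck_Vs HG HN); [exact Ok |].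
    exact (proj2 (EE_Vs NU Hkl BK HW HW0 HB cB cF Hy')).
  - exact embed_types.
  - exact ck_limit_cardinal.
  - exact (N_WO HG HN VWO).
  (* (1, emp), the name of [k], lies below [g0], where the map is the identity. *)
  - assert (H1 : pr (num 1) emp ∈ Vs g0).
    { apply Vs_pr; auto. apply (Hnum 0). }
    destruct (EEt (Vs_gk H0 H1)) as [y Hy].
    pose proof (EE_fix NU Hkl BK HW HW0 HB cB cU cF H0 Hl0 Hy H1) as E. subst y.
    apply app_e in Hy. rewrite (ck_pr HG HN), (ck_num HG HN), (ck_emp HG HN) in Hy.
    exact Hy.
  (* As [emp] is [num 0], the pair (emp, g0) is the name of [g0]; the map sends it to the name of a
     different set, so the embedding moves [g0]. *)
  - assert (Hg0V : g0 ∈ Vs k).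
    { apply ord_Vs; [apply L0 | exact Ok | auto]. }
    assert (H1 : pr emp g0 ∈ Vs k).
    { apply Vs_pr; [exact Lk | | auto]. exact (Vs_gk H0 (Hnum 0)). }
    destruct (EEt H1) as [y Hy].
    destruct (EE_move NU Hkl BK HW HW0 HB cB cU cF H0 Hl0 Hy) as (b & Nb & ->).
    exists (ck g0), (ck b). split; [now apply (ck_mem HG HN) |]. split; [| split].
    + apply (ck_Vs HG HN); [exact Ok |].
      pose proof (proj2 (EE_Vs NU Hkl BK HW HW0 HB cB cF Hy)) as K.
      now apply (Vs_pr_inv Ok) in K.
    + apply app_e in Hy. rewrite !(ck_pr HG HN), (ck_emp HG HN) in Hy. exact Hy.
    + intro E. apply (ck_inj HG HN) in E. auto.
Qed.

End Embed.

Theorem extension_exacting : exacting (ck k).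
Proof.
  assert (Hok' : omega ∈ ck k).
  { rewrite <- (ck_omega HG HN). now apply (ck_mem HG HN). }
  assert (LkN := ck_limit HG HN Lk).
  destruct (reflection (ck k) (proj1 LkN)) as (z & Lz & Hkz & HRa & HRb).
  destruct (N_WO HG HN VWO (Vs z)) as (o & h0 & Oo & Hh0).
  destruct (coding_exists LkN Hok' Lz Hkz Oo Hh0) as [pi HP].
  destruct (val_surj HN (code (ck k) z pi)) as [sg Hsg].
  destruct (N_ordinal HG HN (proj1 Lz)) as (zV & _ & Ez).
  (* Being a code is expressed with the parameters [k] and [z], which are checks. So it is forced by
     some condition, and it holds in every evaluation whose filter contains that condition and whose
     check names have the same values. *)
  destruct (@dfn_names V HV PP N val (coded (ck k) z) sg) as (f & nv & Hf).
  { apply dfn_coded; [exists k; reflexivity | exists zV; exact Ez | df]. }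
  destruct (decide_diag NU VWO sg) as (Bd & HBdU & HBd).
  destruct (good_condition sg (Bd := Bd) (f := f) (nv := nv))
    as (s & B & Gs & HBB & (W & h & HW & HW0 & HB) & Hfo); auto.
  { apply Hf; [reflexivity |]. exists pi. split; auto. }
  (* The point to be removed is the first one beyond the stem [s], so that (s, B) stays in the
     filter of the shortened sequence. *)
  assert (exists g0, cc s g0 /\ forall b, cc s b -> g0 = b \/ g0 ∈ b)
    as (g0 & H0 & Hl0).
  { assert (He : emp ∈ k) by exact (ord_trans Ok (num_omega 0) Hok).
    destruct (cU Gs He) as (g & Hg & _).
    assert (Hord : forall x, cc s x -> ordinal x).
    { intros x [Hx _]. exact (cs_ord NU val HG Hx). }
    destruct (@ord_least V HV (cc s) g (Hord g Hg) Hg) as (g0 & O0 & H0 & Hm).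
    exists g0. split; auto. intros b Hb.
    destruct (ord_total O0 (Hord b Hb)) as [L | [L | L]]; auto.
    destruct (Hm b L Hb). }
  destruct (rmv_extension NU HG (proj1 H0) HN) as [val2 HN2].
  assert (Gs2 : Gof k U (cs' G g0) (pr s B)).
  { apply (G_iff NU val HG) in Gs. apply Gof_pr in Gs as (P1 & [P2 P3] & P4).
    apply Gof_pr. split; auto. split; [split |].
    - intros x Hx. split; auto. intros ->. exact (proj2 H0 Hx).
    - intros x y [Hx _]. eauto.
    - intros x [Hx _]. auto. }
  assert (K : coded (ck k) z (val2 sg)).
  { apply Hf; [exact (ck2_eq H0 HN2) |].
    apply (truth PO (Gof_rmv_generic NU val HG (proj1 H0)) HN2). exists (pr s B). auto. }
  destruct K as (pi2 & HP2 & HA2).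
  exact (embed_exacting HBd Gs HBB HW HW0 HB H0 Hl0 HN2 Lz Hkz HP (eq_sym Hsg) HP2 HA2
    HRa HRb).
Qed.

End Main.

(** [I3_wf] comes with a critical sequence of its own; this identifies its first term with that of
    the given one. *)
Lemma critical_point_unique {V : structure} {HV : ZF V} (la j k k' : V) :
  elementary_embedding j (in_V la) (in_V la) ->
  is_critical_point j k -> is_critical_point j k' -> k = k'.
Proof.
  intros Hj.
  assert (K : forall k k', is_critical_point j k -> is_critical_point j k' -> ~ k ∈ k').
  { intros a b (_ & (c & Hc & Nc) & _) (_ & _ & Hb) L. apply Nc.
    apply Hb, pair_inE in L. apply pair_inE in Hc.
    exact (proj2 (emb_isfun Hj) _ _ _ Hc L). }
  intros H H'. destruct (ord_total (proj1 H) (proj1 H')) as [L | [L | L]]; auto.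
  - destruct (K k k' H H' L).
  - destruct (K k' k H' H L).
Qed.

Theorem theorem5p4
  (V : structure) (V_ZFC : ZFC V) (V_wf : well_founded (@mem V))
  (lam j : V) (kappa : nat -> V)
  (j_I3wf0 : I3_wf 0 lam j) (kappa_crit : is_critical_sequence j kappa)
  (U0 : V) (U0_def : is_induced_ultrafilter j (kappa 0) U0)
  (G : V -> Prop)
  (G_generic : generic (prikry_condition (kappa 0) U0) (prikry_le (kappa 0)) G)
  (VG : structure) (val : V -> VG) (VG_ext : generic_extension G val) :
  exists k : VG, identified (kappa 0) k /\ exacting k.
Proof.
  pose proof (ZF_of_ZFC V_ZFC V_wf) as HV.
  assert (VWO : WO (M := V)) by (apply WO_of_choice, (zfc_choice V_ZFC)).
  destruct j_I3wf0 as [(Ll & Hj & _) (kap & J & d & Hkap & HJ & Hd & Hwf)].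
  rewrite (critical_point_unique Hj (proj1 kappa_crit) (proj1 Hkap)) in *.
  set (k := kap 0) in *.
  assert (Hk : is_critical_point j k) by exact (proj1 Hkap).
  assert (NU : normal_uf k U0) by exact (crit_normal Ll Hj Hk U0_def).
  assert (HG : generic (fun p => p ∈ PP k U0) (prikry_le k) G).
  { replace (fun p => p ∈ PP k U0) with (prikry_condition k U0); auto.
    apply functional_extensionality. intro p.
    apply propositional_extensionality. apply (PP_prikry NU). }
  pose proof (N_ZF (PP_poset NU) HG VG_ext) as ZN.
  exists (ck (PP k U0) val k). split; [exact (ck_identified HG VG_ext k) |].
  assert (Hkl : k ∈ lam) by exact (kap_la Ll Hj Hkap 0).
  assert (Hok : omega ∈ k) by exact (omega_crit Ll Hj Hk).
  refine (extension_exacting NU VWO Hkl Hok _ _ HG VG_ext).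
  - intros F IF HF1 HF2.
    apply (key_lemma Ll Hj Hkap HJ U0_def Hd Hwf); auto.
    (* The tree function consists of pairs of sets of rank at most [k], so it is bounded by [kap 1]
       and belongs to V_lam. *)
    apply (inL_rel Ll (kap_la Ll Hj Hkap 1)). intros p Hp.
    destruct (HF1 p Hp) as (t & u & -> & Ht & Hu). exists t, u. split; auto. split.
    + exact (Vs_kap_mono Ll Hj Hkap (Nat.le_0_l 1) Ht).
    + exact (Vs_bounded (kap_lt Ll Hj Hkap 0) Hu).
  - exact (crit_wellorder Ll Hj Hk VWO).
Qed.
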